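(* Let $G$ be a graph and let $\Psi\subseteq\Omega(G)$ be a Borel set of ends all of which are undominated. Let $C_\Psi$ be the set of edge sets of topological cycles in the space $|G|\setminus(\Omega(G)\setminus\Psi)$, and let $D_\Psi$ be the set of bonds of $G$ that have no end of $\Psi$ in their closure. Then $C_\Psi$ and $D_\Psi$ are the set of circuits and the set of cocircuits, respectively, of a matroid on $E(G)$.
   Context: Graphs may be infinite. A ray is a one-way infinite path; two rays are equivalent if for every finite vertex set $S$ they have tails in the same component of $G-S$; equivalence classes are ends, forming $\Omega(G)$. For finite $S$ and an end $\omega$, $C(S,\omega)$ is the component of $G-S$ containing tails of rays of $\omega$ ($\omega$ lives in it). A vertex $v$ dominates $\omega$ if there are infinitely many paths from $v$ to a ray of $\omega$ pairwise meeting only in $v$; $\omega$ is undominated if no vertex dominates it. The space $|G|$ has as points the vertices, the ends, and for each edge $e$ a set $e\times(0,1)$ of interior points (edges being copies of $[0,1]$ with endpoints identified with endvertices). A basis of its topology: the sets open in the 1-complex topology of $G$, together with the sets $C_{\vec\epsilon}(S,\omega)$ ($S$ finite, $\omega$ an end, $\vec\epsilon$ a function from the edges with exactly one endvertex in $C(S,\omega)$ to $(0,1)$) consisting of all vertices of $C(S,\omega)$, all ends living in $C(S,\omega)$, all interior points of edges with both endvertices in $C(S,\omega)$, and for each edge $f$ with exactly one endvertex $t(f)$ in $C(S,\omega)$ the points of $f$ at distance less than $\vec\epsilon(f)$ from $t(f)$. Borel sets of ends refer to the subspace topology on $\Omega(G)$ (whose basic open sets are, for finite $S$ and a component $C$ of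 $G-S$, the sets of ends living in $C$). A topological cycle is a subspace homeomorphic to $S^1$; its edge set is the set of edges having an interior point on it. A cut is the set of edges between the two classes of a partition of $V(G)$; a bond is a minimal nonempty cut. An end $\omega$ is in the closure of an edge set $F$ if for every finite vertex set $S$ some edge of $F$ has an endvertex in $C(S,\omega)$. Matroids are (possibly infinite) matroids in the sense of Bruhn, Diestel, Kriesell, Pendavingh and Wollan; cocircuits are the circuits of the dual matroid. *)

(* Defs.v *)
From HB Require Import structures.
From mathcomp Require Import all_boot all_order all_algebra.
From mathcomp Require Import all_classical all_reals all_analysis.

Set Implicit Arguments.
Unset Strict Implicit.
Unset Printing Implicit Defensive.

Import Order.TTheory GRing.Theory Num.Theory.
Import numFieldNormedType.Exports.

Local Open Scope classical_set_scope.
Local Open Scope ring_scope.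

(** * Graphs and their ends *)

(* Graphs of arbitrary cardinality; loops and parallel edges are allowed.  The
   order of the two endvertices of an edge is only used to parametrize it. *)
Record graph := Graph {
  vertex : Type;
  edge : Type;
  src : edge -> vertex;
  tgt : edge -> vertex
}.

HB.instance Definition _ (G : graph) := gen_eqMixin (vertex G).
HB.instance Definition _ (G : graph) := gen_choiceMixin (vertex G).
HB.instance Definition _ (G : graph) := gen_eqMixin (edge G).
HB.instance Definition _ (G : graph) := gen_choiceMixin (edge G).

Section Ends.
Variable G : graph.
Implicit Types (u v : vertex G) (S C : set (vertex G)).

Definition adj u v : Prop :=
  exists e : edge G, (src e = u /\ tgt e = v) \/ (src e = v /\ tgt e = u).

(* linked S u v: some finite walk from u to v has all its vertices outside S *)
Inductive linked S u : vertex G -> Prop :=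
| linked0 : ~ S u -> linked S u u
| linkedS v w : linked S u v -> adj v w -> ~ S w -> linked S u w.

Definition component S C : Prop := exists2 u, ~ S u & C = linked S u.

(* Rays are given by their vertices: a choice among parallel edges affects
   neither the ends nor domination. *)
Record ray := Ray {
  ray_vertex :> nat -> vertex G;
  ray_adj : forall n, adj (ray_vertex n) (ray_vertex n.+1);
  ray_inj : injective ray_vertex
}.

Definition tail_in (r : ray) C : Prop :=
  exists N : nat, forall n, (N <= n)%N -> C (r n).

Definition ray_equiv (r r' : ray) : Prop :=
  forall S, finite_set S ->
    exists C, [/\ component S C, tail_in r C & tail_in r' C].

Record graph_end := GraphEnd {
  end_rays : set ray;
  end_raysP : exists r, end_rays = [set r' | ray_equiv r r']
}.

Definition lives_in (w : graph_end) C : Prop :=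
  forall r, end_rays w r -> tail_in r C.

(* C(S, w); for finite S there is exactly one component in this union. *)
Definition end_component S (w : graph_end) : set (vertex G) :=
  \bigcup_(C in [set C | component S C /\ lives_in w C]) C.

(* v :: p is the sequence of the vertices of a finite path. *)
Definition is_path v (p : seq (vertex G)) : Prop :=
  path (fun x y => `[< adj x y >]) v p /\ uniq (v :: p).

Definition dominates v (w : graph_end) : Prop :=
  exists2 r : ray, end_rays w r &
  exists P : set (seq (vertex G)),
    [/\ infinite_set P,
        forall p, P p -> is_path v p /\ exists n, last v p = r n &
        forall p q, P p -> P q -> p <> q ->
          forall x, x \in v :: p -> x \in v :: q -> x = v].

Definition undominated (w : graph_end) : Prop := forall v, ~ dominates v w.

Definition in_edge_closure (w : graph_end) (F : set (edge G)) : Prop :=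
  forall S, finite_set S ->
    exists2 e, F e & end_component S w (src e) \/ end_component S w (tgt e).

Definition cut (F : set (edge G)) : Prop :=
  exists A : set (vertex G),
    F = [set e | (A (src e) /\ ~ A (tgt e)) \/ (~ A (src e) /\ A (tgt e))].

Definition bond (F : set (edge G)) : Prop :=
  [/\ cut F, F !=set0 &
      forall F', cut F' -> F' !=set0 -> F' `<=` F -> F' = F].

End Ends.

(** * The space |G| *)

(* Inner e t is the interior point of e at distance t from src e and 1 - t from
   tgt e. *)
Inductive graph_point (R : realType) (G : graph) :=
| Vtx of vertex G
| End of graph_end G
| Inner of edge G & {t : R | 0 < t < 1}.

Arguments Vtx R {G}.
Arguments End R {G}.
Arguments Inner {R G}.

HB.instance Definition _ (R : realType) (G : graph) :=
  gen_eqMixin (graph_point R G).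
HB.instance Definition _ (R : realType) (G : graph) :=
  gen_choiceMixin (graph_point R G).

Section Space.
Variables (R : realType) (G : graph).
Implicit Types (S C : set (vertex G)) (w : graph_end G).

(* The canonical parametrization of e, of interest on `[0, 1] only. *)
Definition edge_map (e : edge G) (t : R) : graph_point R G :=
  if insub t is Some t' then Inner e t'
  else if t <= 0 then Vtx R (src e) else Vtx R (tgt e).

(* The open sets of the 1-complex G, i.e., of the quotient of the disjoint
   union of the discrete space V(G) and a copy of [0, 1] for each edge. *)
Definition complex_open (U : set (graph_point R G)) : Prop :=
  (forall w, ~ U (End R w)) /\
  forall e, open (edge_map e @^-1` U : set (subspace `[0 : R, 1])).

Definition exactly_one_end_in C (e : edge G) : Prop :=
  (C (src e) /\ ~ C (tgt e)) \/ (~ C (src e) /\ C (tgt e)).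

Definition thickening C (eps : edge G -> R) : set (graph_point R G) :=
  fun p => match p with
  | Vtx v => C v
  | End w => lives_in w C
  | Inner e t =>
      [\/ C (src e) /\ C (tgt e),
          [/\ C (src e), ~ C (tgt e) & val t < eps e] |
          [/\ ~ C (src e), C (tgt e) & 1 - val t < eps e]]
  end.

Definition basic_open (U : set (graph_point R G)) : Prop :=
  complex_open U \/
  exists S w (eps : edge G -> R),
    [/\ finite_set S,
        forall e, exactly_one_end_in (end_component S w) e -> 0 < eps e < 1 &
        U = thickening (end_component S w) eps].

Lemma adj_sym (u v : vertex G) : adj u v -> adj v u.
Proof. by case=> e [[? ?]|[? ?]]; exists e; [right|left]. Qed.

Lemma linked_notinl S (u v : vertex G) : linked S u v -> ~ S u.
Proof. by elim. Qed.

Lemma linked_notinr S (u v : vertex G) : linked S u v -> ~ S v.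
Proof. by case. Qed.

Lemma linked_trans S (u v w : vertex G) :
  linked S u v -> linked S v w -> linked S u w.
Proof. by move=> uv; elim=> // {}w x _ uw wx Sx; exact: linkedS uw wx Sx. Qed.

Lemma linked_sym S (u v : vertex G) : linked S u v -> linked S v u.
Proof.
elim=> [Su|{}v w uv vu vw Sw]; first exact: linked0.
apply: linked_trans vu; apply: (linkedS (linked0 Sw) (adj_sym vw)).
exact: linked_notinr uv.
Qed.

Lemma linked_sub S S' (u v : vertex G) :
  S' `<=` S -> linked S u v -> linked S' u v.
Proof.
move=> sS; elim=> [Su|{}v w _ uv vw Sw]; first by apply: linked0 => /sS.
by apply: linkedS uv vw _ => /sS.
Qed.

Lemma component_linked S C (u v : vertex G) :
  component S C -> C u -> C v -> linked S u v.
Proof.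
by case=> x Sx -> xu xv; apply: linked_trans (linked_sym xu) xv.
Qed.

Lemma component_closed S C (u v : vertex G) :
  component S C -> C u -> linked S u v -> C v.
Proof. by case=> x Sx -> xu; exact: linked_trans. Qed.

Lemma component_eq S C C' (u : vertex G) :
  component S C -> component S C' -> C u -> C' u -> C = C'.
Proof.
move=> cC cC' Cu C'u; apply/seteqP; split=> v h.
  exact: component_closed cC' C'u (component_linked cC Cu h).
exact: component_closed cC Cu (component_linked cC' C'u h).
Qed.

Lemma ray_avoids (r : ray G) S : finite_set S ->
  exists N, forall n, (N <= n)%N -> ~ S (r n).
Proof.
move=> fS; have : finite_set (r @^-1` S).
  by apply: finite_preimage => // x y _ _; exact: ray_inj.
move=> /finite_seqP[s sE]; exists (\max_(i <- s) i).+1 => n ltn Srn.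
have : n \in s by have : (r @^-1` S) n by []; rewrite sE.
by move=> /(@leq_bigmax_seq _ _ xpredT id) => /(_ isT); rewrite leqNgt ltn.
Qed.

Lemma ray_equiv_refl (r : ray G) : ray_equiv r r.
Proof.
move=> S fS; have [N rN] := ray_avoids r fS.
have tl : tail_in r (linked S (r N)).
  exists N => n; elim: n => [|n IHn]; rewrite ?leqn0.
    by move=> /eqP N0; rewrite N0 in rN *; apply: linked0; exact: rN.
  rewrite leq_eqVlt => /predU1P[<-|]; first by apply: linked0; exact: rN.
  rewrite ltnS => Nn; apply: linkedS (IHn Nn) (ray_adj r n) _.
  by apply: rN; rewrite (leq_trans Nn).
by exists (linked S (r N)); split=> //; exists (r N) => //; exact: rN.
Qed.

Lemma tail_in_meet (r : ray G) C C' :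
  tail_in r C -> tail_in r C' -> exists n, C (r n) /\ C' (r n).
Proof.
case=> N hN [N' hN']; exists (maxn N N').
by split; [apply: hN; rewrite leq_maxl|apply: hN'; rewrite leq_maxr].
Qed.

Lemma end_nonempty w : exists r, end_rays w r.
Proof.
by have [r wE] := end_raysP w; exists r; rewrite wE; exact: ray_equiv_refl.
Qed.

Lemma end_componentP S w : finite_set S ->
  exists C, [/\ component S C, lives_in w C & end_component S w = C].
Proof.
move=> fS; have [r wE] := end_raysP w.
have [C [cC rC _]] := ray_equiv_refl r fS.
have wr : end_rays w r by rewrite wE; exact: ray_equiv_refl.
have wC : lives_in w C.
  move=> r'; rewrite wE => /(_ _ fS)[C' [cC' rC' r'C']].
  have [n [Cn C'n]] := tail_in_meet rC rC'.
  by rewrite (component_eq cC cC' Cn C'n).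
exists C; split=> //; apply/seteqP; split=> [v [C' [cC' wC']]|v Cv].
  have [n [Cn C'n]] := tail_in_meet rC (wC' _ wr).
  by rewrite (component_eq cC cC' Cn C'n).
by exists C.
Qed.

Lemma edge_map0 e : edge_map e 0 = Vtx R (src e).
Proof. by rewrite /edge_map insubF ?ltxx // lexx. Qed.

Lemma edge_map1 e : edge_map e 1 = Vtx R (tgt e).
Proof. by rewrite /edge_map insubF ?ltxx ?andbF // ler10. Qed.

Lemma edge_map_in e t (h : 0 < t < 1) :
  edge_map e t = Inner e (exist (fun t => 0 < t < 1) t h).
Proof. by rewrite /edge_map insubT. Qed.

Lemma edge_cases (t : R) : t \in `[0, 1] ->
  [\/ t = 0, t = 1 | 0 < t < 1].
Proof.
rewrite in_itv /= => /andP[]; rewrite le_eqVlt => /predU1P[<-|t0].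
  by move=> _; constructor 1.
rewrite le_eqVlt => /predU1P[->|t1]; first by constructor 2.
by constructor 3; rewrite t0.
Qed.

Lemma edge_map_not_end e t w : edge_map e t <> End R w.
Proof. by rewrite /edge_map; case: insub => [?|] //; case: ifP. Qed.

Definition is_end_point (p : graph_point R G) : Prop :=
  if p is End _ then True else False.

Lemma complex_openI U U' :
  complex_open U -> complex_open U' -> complex_open (U `&` U').
Proof.
move=> [nU oU] [nU' oU']; split=> [w []|e]; first by move=> /nU.
by rewrite preimage_setI; exact: openI.
Qed.

Lemma complex_openT : complex_open (~` is_end_point).
Proof.
split=> [w|e]; first by apply.
suff -> : edge_map e @^-1` (~` is_end_point) = setT by exact: openT.
apply/seteqP; split=> // t _ /=.
by case E : (edge_map e t) => [|w|] //=; have := @edge_map_not_end e t w.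
Qed.

Lemma complex_open_thickening C eps :
  (forall e, exactly_one_end_in C e -> 0 < eps e < 1) ->
  complex_open (thickening C eps `\` is_end_point).
Proof.
move=> heps; split=> [w []|e]; first by move=> _ /=; apply.
have -> : edge_map e @^-1` (thickening C eps `\` is_end_point) =
    [set t | thickening C eps (edge_map e t)].
  apply/seteqP; split=> t /= => [[]//|h]; split=> //.
  case E : (edge_map e t) => [|w|] //=.
  by have := @edge_map_not_end e t w.
apply/open_subspaceP.
have [Cs|Cs] := pselect (C (src e)); have [Ct|Ct] := pselect (C (tgt e)).
- exists setT; first exact: openT.
  apply/seteqP; split=> t [h /= tI]; split=> //.
  have [->|->|t01] := edge_cases tI.
  + by rewrite edge_map0.
  + by rewrite edge_map1.
  + by rewrite (edge_map_in _ t01); constructor 1.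
- have /andP[e0 e1] : 0 < eps e < 1 by apply: heps; left.
  exists [set t | t < eps e]; first exact: open_lt.
  apply/seteqP; split=> t [h /= tI]; split=> //; move: h => /=;
    have [->|->|t01] := edge_cases tI.
  + by rewrite edge_map0.
  + by rewrite edge_map1 /= ltNge (ltW e1).
  + by rewrite (edge_map_in _ t01) => ?; constructor 2.
  + by rewrite edge_map0.
  + by rewrite edge_map1 => /Ct.
  + by rewrite (edge_map_in _ t01) => -[[_ /Ct]|[]|[/(_ Cs)]].
- have /andP[e0 e1] : 0 < eps e < 1 by apply: heps; right.
  exists [set t | 1 - eps e < t]; first exact: open_gt.
  apply/seteqP; split=> t [h /= tI]; split=> //; move: h => /=;
    have [->|->|t01] := edge_cases tI.
  + by rewrite edge_map0 /= subr_lt0 ltNge (ltW e1).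
  + by rewrite edge_map1.
  + by rewrite (edge_map_in _ t01) => ?; constructor 3; split; rewrite //= ltrBlDl -ltrBlDr.
  + by rewrite edge_map0 => /Cs.
  + by rewrite edge_map1 ltrBlDl ltrDr.
  + rewrite (edge_map_in _ t01) => -[[/Cs]|[/Cs]|[_ _]] //=.
    by rewrite ltrBlDl -ltrBlDr.
- exists set0; first exact: open0.
  apply/seteqP; split=> t [h /= tI] //; move: h => /=.
  have [->|->|t01] := edge_cases tI.
  + by rewrite edge_map0 => /Cs.
  + by rewrite edge_map1 => /Ct.
  + by rewrite (edge_map_in _ t01) => -[[/Cs]|[/Cs]|[_ /Ct]].
Qed.

Lemma complex_open_basic U : basic_open U -> complex_open (U `\` is_end_point).
Proof.
case=> [oU|[S [w [eps [fS heps ->]]]]]; last exact: complex_open_thickening.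
by rewrite setDE; apply: complex_openI => //; exact: complex_openT.
Qed.

Lemma basic_open_cover : \bigcup_(U in basic_open) U = setT.
Proof.
apply/seteqP; split=> // p _.
have [|np] := pselect (is_end_point p); last first.
  by exists (~` is_end_point) => //; left; exact: complex_openT.
case: p => // w _; have [C [cC wC CE]] := end_componentP w (@finite_set0 (vertex G)).
exists (thickening (end_component set0 w) (fun=> 2^-1)); last by rewrite /= CE.
right; exists set0, w, (fun=> 2^-1); split=> // e _.
by rewrite invr_gt0 ltr0n /= invf_lt1 ?ltr1n.
Qed.

Lemma basic_open_join U U' p : basic_open U -> basic_open U' -> U p -> U' p ->
  exists W, [/\ basic_open W, W p & W `<=` U `&` U'].
Proof.
move=> bU bU' Up U'p; have [ep|np] := pselect (is_end_point p); last first.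
  exists ((U `\` is_end_point) `&` (U' `\` is_end_point)); split=> //.
    by left; apply: complex_openI; exact: complex_open_basic.
  by move=> q [[? _] [? _]].
case: p ep Up U'p => // w _ Uw U'w.
case: bU => [[/(_ w)]//|[S1 [w1 [eps1 [fS1 h1 UE]]]]].
case: bU' => [[/(_ w)]//|[S2 [w2 [eps2 [fS2 h2 U'E]]]]].
have [C1 [cC1 _ C1E]] := end_componentP w1 fS1.
have [C2 [cC2 _ C2E]] := end_componentP w2 fS2.
have fS : finite_set (S1 `|` S2) by rewrite finite_setU.
have [C [cC wC CE]] := end_componentP w fS.
have [r wr] := end_nonempty w.
have sub S' C' : S' `<=` S1 `|` S2 -> component S' C' -> lives_in w C' ->
    C `<=` C'.
  move=> sS cC' wC' v Cv; have [n [Cn C'n]] := tail_in_meet (wC _ wr) (wC' _ wr).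
  exact: component_closed cC' C'n (linked_sub sS (component_linked cC Cn Cv)).
have s1 : C `<=` C1.
  by apply: (sub S1 C1 (@subsetUl _ _ _) cC1); move: Uw; rewrite UE C1E.
have s2 : C `<=` C2.
  by apply: (sub S2 C2 (@subsetUr _ _ _) cC2); move: U'w; rewrite U'E C2E.
rewrite {}C1E in h1 UE; rewrite {}C2E in h2 U'E.
pose cap (D : set (vertex G)) (d : edge G -> R) e :=
  if `[< exactly_one_end_in D e >] then d e else 2^-1.
have capP D d : (forall e, exactly_one_end_in D e -> 0 < d e < 1) ->
    forall e, 0 < cap D d e < 1.
  move=> hd e; rewrite /cap; case: asboolP => [/hd //|_].
  by rewrite invr_gt0 ltr0n /= invf_lt1 ?ltr1n.
pose eps e := Num.min (cap C1 eps1 e) (cap C2 eps2 e).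
exists (thickening C eps); split=> //.
  right; exists (S1 `|` S2), w, eps; rewrite CE; split=> // e _.
  have /andP[a b] := capP _ _ h1 e; have /andP[c d] := capP _ _ h2 e.
  by rewrite lt_min a c /= gt_min b.
have mono D d : C `<=` D -> (forall e, eps e <= cap D d e) ->
    thickening C eps `<=` thickening D d.
  move=> sD le [v|w'|e t] /=; first exact: sD.
    by move=> w'C r' /w'C[N hN]; exists N => n /hN /sD.
  case=> [[/sD ? /sD ?]|[/sD Ds _ lt]|[_ /sD Dt lt]]; first by constructor 1.
    have [|nD] := pselect (D (tgt e)); first by constructor 1.
    constructor 2; split=> //; apply: (lt_le_trans lt); apply: (le_trans (le e)).
    by rewrite /cap asboolT //; left.
  have [|nD] := pselect (D (src e)); first by constructor 1.
  constructor 3; split=> //; apply: (lt_le_trans lt); apply: (le_trans (le e)).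
  by rewrite /cap asboolT //; right.
rewrite UE U'E => q Cq; split.
  by apply: mono Cq => // e; rewrite /eps ge_min lexx.
by apply: mono Cq => // e; rewrite /eps ge_min lexx orbT.
Qed.

HB.instance Definition _ :=
  @isBaseTopological.Build (graph_point R G) (set (graph_point R G)) basic_open id
    basic_open_cover (fun U U' p => @basic_open_join U U' p).

(* Borel sets for the topology that Omega(G) inherits as a subspace of |G|. *)
Definition borel_end_set (Psi : set (graph_end G)) : Prop :=
  <<s [set (End R) @^-1` U | U in (@open (graph_point R G))] >> Psi.

(* |G| \ (Omega(G) \ Psi) *)
Definition space_with_ends (Psi : set (graph_end G)) : set (graph_point R G) :=
  ~` (End R @` (~` Psi)).

End Space.

(** * Topological cycles *)

Definition homeomorphic (X Y : topologicalType) (A : set X) (B : set Y) :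
    Prop :=
  exists (f : X -> Y) (g : Y -> X),
    [/\ set_fun A B f, set_fun B A g,
        {in A, cancel f g}, {in B, cancel g f} &
        {within A, continuous f} /\ {within B, continuous g}].

Definition unit_circle (R : realType) : set (R * R)%type :=
  [set p | p.1 ^+ 2 + p.2 ^+ 2 = 1].

Section Circuits.
Variables (R : realType) (G : graph).

Definition topological_cycle (X A : set (graph_point R G)) : Prop :=
  A `<=` X /\ homeomorphic A (@unit_circle R).

Definition edge_set (A : set (graph_point R G)) : set (edge G) :=
  [set e | exists t, A (Inner e t)].

Definition cycle_edge_sets (Psi : set (graph_end G)) : set (set (edge G)) :=
  [set edge_set A | A in topological_cycle (@space_with_ends R G Psi)].

Definition bonds_avoiding (Psi : set (graph_end G)) : set (set (edge G)) :=
  [set F | bond F /\ forall w, Psi w -> ~ in_edge_closure w F].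

End Circuits.

Arguments cycle_edge_sets R {G}.

(** * Infinite matroids *)

Definition maximal_in (E : Type) (F : set (set E)) (B : set E) : Prop :=
  F B /\ forall B', F B' -> B `<=` B' -> B' = B.

(* The independence axioms (I1), (I2), (I3), (IM) of Bruhn, Diestel, Kriesell,
   Pendavingh and Wollan. *)
Record matroid (E : Type) := Matroid {
  indep : set (set E);
  indep0 : indep set0;
  indepS : forall I J, indep J -> I `<=` J -> indep I;
  indep_aug : forall I I', indep I -> ~ maximal_in indep I ->
    maximal_in indep I' -> exists x, [/\ I' x, ~ I x & indep (x |` I)];
  indep_max : forall I X, indep I -> I `<=` X ->
    exists B, maximal_in [set J | [/\ indep J, I `<=` J & J `<=` X]] B
}.

Definition matroid_base (E : Type) (M : matroid E) : set (set E) :=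
  maximal_in (indep M).

(* The independent sets of the dual matroid, whose bases are the complements of
   the bases of M. *)
Definition dual_indep (E : Type) (M : matroid E) : set (set E) :=
  [set J | exists2 B, matroid_base M B & J `<=` ~` B].

Definition minimal_dependent (E : Type) (F : set (set E)) : set (set E) :=
  [set C | ~ F C /\ forall C', ~ F C' -> C' `<=` C -> C' = C].

Definition circuits (E : Type) (M : matroid E) : set (set E) :=
  minimal_dependent (indep M).

Definition cocircuits (E : Type) (M : matroid E) : set (set E) :=
  minimal_dependent (dual_indep M).

(* Main.v *)
Require Import Defs.
From mathcomp Require Import all_boot all_order all_algebra.
From mathcomp Require Import finmap all_classical all_reals all_analysis.
From mathcomp Require Import ring lra.

Set Implicit Arguments.
Unset Strict Implicit.
Unset Printing Implicit Defensive.

Local Open Scope classical_set_scope.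

(* Call a vertex bipartition [f] good if it is constant near every end of Psi.
   Since the ends of Psi are undominated, the cuts of good bipartitions are
   exactly the cuts without end of Psi in their closure, and good bipartitions
   extend continuously to |G| minus the other ends.  Declare an edge set
   independent if each of its edges is separated by a good bipartition that
   separates no other edge of the set; exchange is then a symmetric difference of
   bipartitions, and the cocircuits are the required bonds.

   The axiom (IM) rests on a compactness property: if every good bipartition
   that respects P identifies [x] and [y], then so do those respecting some
   compact Q inside P.  Here G is exhausted by regions with finite-boundary
   components, and P is tested in a game between a connector, who proposes ways
   around through smaller and smaller components, and a separator, who picks one
   of them; the connector wins an infinite play if it converges to an end of Psi.
   The game is Borel, hence determined (Martin's unravelling): a winning strategy
   of the connector yields Q and one of the separator a good bipartition.

   Finally, a circle has a minimal dependent edge set because removing one point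
   does not disconnect it while removing two does, and conversely the good
   bipartitions separating exactly two edges of a circuit, one of them fixed,
   form a chain whose weighted sum winds the circuit around a circle. *)

(** Spanning is not finitary, so a union of a chain of independent sets may be dependent and Zorn's
    lemma alone gives no bases. What is available is that a good bipartition separates only finitely
    many edges of a compact set, and that a compact set touches only finitely many components of a
    region, each with a finite boundary. A chain is therefore harmless once its trace on each
    component stabilises. A base is the limit of nested pairs of an independent set inside a
    spanning one; the n-th pair agrees off a region and induces the same connections on the
    boundaries of its components.

    Independence is phrased through cuts, so the cocircuits come almost for free and the topology is
    confined to the circuits. There the link is parity: no good cut meets a circuit in exactly one
    edge. For circles this follows from connectedness; for abstract circuits it produces the linear
    order that parametrizes the circle.

    That the ends are undominated enters in one form: around an end there are components whose
    boundary also stays in a given neighbourhood, or avoids a given finite set. That Psi is Borel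
    enters only through the payoff set of the game. *)

(** * Borel determinacy *)

(* Composition at a universe of its own: [ssrfun.comp] would force the universe
   of games below that of sets. *)
Definition move_comp (C A B : Type) (f : A -> B) (g : C -> A) : C -> B := fun x => f (g x).
Arguments move_comp {C A B} f g x /.
Local Notation "f \o g" := (move_comp f g) : function_scope.

Lemma dep_choice (T : nat -> Type) (Q : forall i, T i -> Prop)
    (S : forall i, T i -> T i.+1 -> Prop) :
  (exists a, Q 0 a) -> (forall i a, Q i a -> exists a', S i a a' /\ Q i.+1 a') ->
  exists f : forall i, T i, forall i, Q i (f i) /\ S i (f i) (f i.+1).
Proof.
move=> /cid[a0 Q0] step.
pose nxt i (a : {a | Q i a}) : {a | Q i.+1 a} :=
  let: exist b h := cid (step i _ (svalP a)) in exist _ b h.2.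
pose f := fix f i : {a | Q i a} := if i is j.+1 then nxt j (f j) else exist _ a0 Q0.
exists (fun i => sval (f i)) => i; split; first exact: svalP.
by rewrite /= /nxt; case: (cid _) => b [].
Qed.

Lemma take_mkseq (T : Type) (x : nat -> T) m n :
  m <= n -> take m (mkseq x n) = mkseq x m.
Proof.
by move=> mn; rewrite /mkseq -map_take take_iota (minn_idPl mn).
Qed.

Lemma mkseq_eq (T : Type) (x y : nat -> T) n :
  mkseq x n = mkseq y n <-> forall i, i < n -> x i = y i.
Proof.
split=> [E i lt|E].
  by rewrite -(nth_mkseq (x 0) x lt) E nth_mkseq.
apply: (@eq_from_nth _ (x 0)); rewrite !size_mkseq // => i lt.
by rewrite !nth_mkseq // E.
Qed.

(** * Games and coverings *)

Record game := Game {
  mv : Type;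
  tr : seq mv -> Prop;
  tr_nil : tr [::];
  tr_rcons : forall p a, tr (rcons p a) -> tr p;
  tr_ext : forall p, tr p -> exists a, tr (rcons p a) }.

Definition play (G : game) (x : nat -> mv G) : Prop := forall n, tr (mkseq x n).

Section Strategies.
Variable G : game.
Implicit Types (b : bool) (s : seq (mv G) -> mv G) (p q u : seq (mv G)).

(* Player [b] moves at the positions whose length has parity [b]. *)
Definition legal b s : Prop :=
  forall p, tr p -> odd (size p) = b -> tr (rcons p (s p)).

Definition follows b s (x : nat -> mv G) : Prop :=
  play x /\ forall n, odd n = b -> x n = s (mkseq x n).

Definition agree b n s1 s2 : Prop :=
  forall p, tr p -> odd (size p) = b -> size p < n -> s1 p = s2 p.

Definition some_mv : mv G := sval (cid (tr_ext (@tr_nil G))).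

Definition child p : mv G :=
  if pselect (tr p) is left h then sval (cid (tr_ext h)) else some_mv.

Lemma childP p : tr p -> tr (rcons p (child p)).
Proof. by move=> h; rewrite /child; case: pselect => // h'; case: (cid _). Qed.

(** Replaces illegal moves and keeps legal ones, so strategies can be defined by formulas whose
    legality is known only on some positions. *)
Definition guard p a : mv G := if `[< tr (rcons p a) >] then a else child p.

Lemma guardP p a : tr p -> tr (rcons p (guard p a)).
Proof. by move=> h; rewrite /guard; case: asboolP => // _; exact: childP. Qed.

Lemma guardE p a : tr (rcons p a) -> guard p a = a.
Proof. by move=> h; rewrite /guard asboolT. Qed.

Lemma tr_take n p : tr p -> tr (take n p).
Proof.
elim/last_ind: p => [|p a IH] // h.
case: (leqP (size (rcons p a)) n) => [le|]; first by rewrite take_oversize.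
by rewrite size_rcons ltnS => le; rewrite -cats1 takel_cat //; apply/IH/(tr_rcons h).
Qed.

Lemma follows_agree b s1 s2 x :
  (forall n, agree b n s1 s2) -> follows b s1 x -> follows b s2 x.
Proof.
move=> h [px fx]; split=> // n on; rewrite fx // (h n.+1) ?size_mkseq //.
Qed.

End Strategies.

(* [cpi] acts move by move; [cphi] carries strategies down, using only the
   moves of the given strategy at positions of at most the same length; up to
   length [K] nothing changes. *)
Record covering (K : nat) (G' G : game) := Covering {
  cpi : mv G' -> mv G;
  cphi : bool -> (seq (mv G') -> mv G') -> seq (mv G) -> mv G;
  c_tr : forall p, tr p -> tr (map cpi p);
  c_lift : forall p, tr p -> size p <= K -> exists2 p', tr p' & map cpi p' = p;
  c_inj : forall p q, tr p -> tr q -> size p <= K ->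
    map cpi p = map cpi q -> p = q;
  c_legal : forall b s, legal b s -> legal b (cphi b s);
  c_agree : forall b n s1 s2, legal b s1 -> legal b s2 -> agree b n s1 s2 ->
    agree b n (cphi b s1) (cphi b s2);
  c_id : forall b s p, legal b s -> tr p -> odd (size p) = b -> size p < K ->
    cphi b s (map cpi p) = cpi (s p);
  c_follows : forall b s x, legal b s -> follows b (cphi b s) x ->
    exists2 x', follows b s x' & forall n, cpi (x' n) = x n }.

Definition covering_le K K' G' G (le : K' <= K) (c : covering K G' G) :
  covering K' G' G.
Proof.
refine (@Covering K' G' G (cpi c) (cphi c) (@c_tr _ _ _ c) _ _
  (@c_legal _ _ _ c) (@c_agree _ _ _ c) _ (@c_follows _ _ _ c)).
- by move=> p tp sp; apply: c_lift => //; exact: leq_trans le.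
- by move=> p q tp tq sp; apply: c_inj => //; exact: leq_trans le.
- by move=> b s p ls tp op sp; apply: c_id => //; exact: leq_trans le.
Defined.

Definition covering_comp K G2 G1 G0 (c : covering K G2 G1) (d : covering K G1 G0) :
  covering K G2 G0.
Proof.
refine (@Covering K G2 G0 (cpi d \o cpi c) (fun b s => cphi d b (cphi c b s))
  _ _ _ _ _ _ _).
- by move=> p tp; rewrite map_comp; apply/c_tr/c_tr.
- move=> p tp sp; have [p1 tp1 E1] := c_lift d tp sp.
  have [|p2 tp2 E2] := c_lift c tp1; first by rewrite -(size_map (cpi d)) E1.
  by exists p2; rewrite // map_comp E2.
- move=> p q tp tq sp; rewrite (map_comp _ _ p) (map_comp _ _ q) => E.
  apply: (c_inj (c := c)) => //; apply: (c_inj (c := d)) => //;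
    by [exact: c_tr | rewrite size_map].
- by move=> b s ls; apply/c_legal/c_legal.
- move=> b n s1 s2 l1 l2 ag; apply: c_agree; try exact: c_legal.
  exact: c_agree.
- move=> b s p ls tp op sp; rewrite map_comp c_id ?size_map ?c_id //.
    exact: c_legal.
  exact: c_tr.
- move=> b s x ls fx; have [x1 f1 E1] := c_follows (c_legal c ls) fx.
  have [x2 f2 E2] := c_follows ls f1; exists x2 => // n.
  by rewrite /= E2.
Defined.

(** * Inverse limits *)

Section Limit.
Variables (K : nat) (G : nat -> game) (c : forall i, covering (K + i) (G i.+1) (G i)).

Let M := forall i, mv (G i).
Let pr (p : seq M) i := map (fun a : M => a i) p.
Let T (p : seq M) := (forall i, tr (pr p i)) /\
  forall i, map (cpi (c i)) (pr p i.+1) = pr p i.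

Let pr_rcons p a i : pr (rcons p a) i = rcons (pr p i) (a i).
Proof. exact: map_rcons. Qed.

Let T_rcons p a : T p -> (forall i, tr (rcons (pr p i) (a i))) ->
  (forall i, cpi (c i) (a i.+1) = a i) -> T (rcons p a).
Proof.
move=> [Tp Ep] h1 h2; split=> i; rewrite !pr_rcons ?map_rcons //.
by rewrite Ep h2.
Qed.

Let T_prev p a : T (rcons p a) -> T p.
Proof.
move=> [Tp Ep]; split=> i; first by have := Tp i; rewrite pr_rcons => /tr_rcons.
by have := Ep i; rewrite !pr_rcons map_rcons => /rcons_inj[].
Qed.

Let T_last p a i : T (rcons p a) -> cpi (c i) (a i.+1) = a i.
Proof. by move=> [_ /(_ i)]; rewrite !pr_rcons map_rcons => /rcons_inj[]. Qed.

Let T_nil : T [::].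
Proof. by split=> // i; exact: tr_nil. Qed.

Let lift1 p i a : T p -> size p < K + i -> tr (rcons (pr p i) a) ->
  exists2 a', cpi (c i) a' = a & tr (rcons (pr p i.+1) a').
Proof.
move=> [Tp Ep] sp ta; have [|p' tp'] := c_lift (c i) ta.
  by rewrite size_rcons size_map.
elim/last_ind: p' tp' => [|p' a' _] tp'; first by case: (pr p i).
rewrite map_rcons => /rcons_inj[E <-]; exists a' => //.
suff <- : p' = pr p i.+1 by [].
apply: (c_inj (c := c i)) => //; first exact: tr_rcons tp'.
  by rewrite -(size_map (cpi (c i))) E size_map ltnW.
by rewrite E Ep.
Qed.

(** Below level [i] the thread is forced by projection. Above it, the bound on the length of [p]
    allows [lift1] at every further level. *)
Let thread p i a : T p -> size p < K + i -> tr (rcons (pr p i) a) ->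
  exists2 t : M, t i = a & T (rcons p t).
Proof.
move=> Tp sp ta.
(* [reach m l b]: the move [b] at level [l] is a legal projection from [m] levels higher, where the
   top move is [a] if that level is [i]; hence the transport along [i = l]. *)
pose reach := fix reach m l : mv (G l) -> Prop :=
  if m is m'.+1 then fun b => tr (rcons (pr p l) b) /\
    exists2 b', cpi (c l) b' = b & reach m' l.+1 b'
  else fun b => tr (rcons (pr p l) b) /\
    forall e : i = l, b = eq_rect i (fun l => mv (G l)) a l e.
have reach_tr m l b : reach m l b -> tr (rcons (pr p l) b) by case: m => [|m] [].
have reach_ex m l : l + m = i -> exists b, reach m l b.
  elim: m l => [|m IH] l.
    rewrite addn0 => ->; exists a; split=> // e.
    by rewrite (Prop_irrelevance e erefl).
  rewrite addnS -addSn => /IH[b rb]; exists (cpi (c l) b); split; last by exists b.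
  by have /c_tr := reach_tr _ _ _ rb; move=> /(_ _ _ (c l)); rewrite map_rcons Tp.2.
have [||f fP] := @dep_choice (fun l => mv (G l)) (fun l b => reach (i - l) l b)
    (fun l b b' => cpi (c l) b' = b).
- by rewrite subn0; exact: reach_ex.
- move=> l b; case E : (i - l) => [|m] /= [].
    have il : i <= l by rewrite -subn_eq0 E.
    move=> tb _; have [|b' Eb tb'] := lift1 Tp _ tb.
      by apply: leq_trans sp _; rewrite leq_add2l.
    exists b'; split=> //; rewrite subnS E /=; split=> // e.
    by exfalso; move: il; rewrite {1}e ltnn.
  by move=> tb [b' Eb rb']; exists b'; split=> //; rewrite subnS E.
exists f; last by apply: T_rcons => // l; [exact: reach_tr (fP l).1|exact: (fP l).2].
by have [+ _] := fP i; rewrite subnn => -[_ /(_ erefl)].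
Qed.

Let T_ext p : T p -> exists a, T (rcons p a).
Proof.
move=> Tp; have [a ta] := tr_ext (Tp.1 (size p).+1).
by have [|t _ Tt] := thread Tp _ ta; [rewrite addnS ltnS leq_addl|exists t].
Qed.

Definition limit_game : game := Game T_nil T_prev T_ext.

Let lift i p : tr p -> size p <= K + i -> exists2 p', T p' & pr p' i = p.
Proof.
elim/last_ind: p => [|p a IH]; first by exists [::].
move=> ta; rewrite size_rcons => sp.
have [p' Tp' E] := IH (tr_rcons ta) (ltnW sp).
have [||t Et Tt] := @thread p' i a Tp'; rewrite ?E //.
  by rewrite -(size_map (fun x : M => x i)) -/(pr p' i) E.
by exists (rcons p' t); rewrite // pr_rcons E Et.
Qed.

Let pr_ext p q : (forall i, pr p i = pr q i) -> p = q.
Proof.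
elim: p q => [|a p IH] [|b q] h //; [by have := h 0|by have := h 0|].
rewrite (IH q) => [|i]; last by have [] := h i.
by congr cons; apply: functional_extensionality_dep => i; have [] := h i.
Qed.

Let inj i p q : T p -> T q -> size p <= K + i -> pr p i = pr q i -> p = q.
Proof.
move=> Tp Tq sp E; apply: pr_ext => j.
case: (leqP i j) => [/subnKC <-|/ltnW/subnKC].
  elim: (j - i) => [|m IH]; first by rewrite addn0.
  rewrite addnS; apply: (c_inj (c := c (i + m))); [exact: Tp.1|exact: Tq.1| |].
    by rewrite size_map (leq_trans sp) // leq_add2l leq_addr.
  by rewrite Tp.2 Tq.2 IH.
move: (i - j) => m Em; rewrite -{}Em in E; elim: m j E {sp} => [|m IH] j.
  by rewrite addn0.
by rewrite addnS -addSn => /IH E; rewrite -Tp.2 -Tq.2 E.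
Qed.

Section LimitStrategy.
Variables (b : bool) (s : seq M -> M).

(* The strategy at level [j] dictated by [s] where it is meaningful. *)
Definition level_strat j (p : seq (mv (G j))) : mv (G j) :=
  if pselect (exists p', [/\ T p', pr p' j = p & size p < K + j]) is left e
  then s (sval (cid e)) j else child p.

Definition pull_strat := fix pull_strat m i : seq (mv (G i)) -> mv (G i) :=
  if m is m'.+1 then cphi (c i) b (pull_strat m' i.+1) else @level_strat i.

(** Starting [(size p).+1] levels higher suffices: there [s] is meaningful at all positions as short
    as [p], and starting still higher gives the same answer at [p]. *)
Definition limit_strat i (p : seq (mv (G i))) := @pull_strat (size p).+1 i p.

Hypothesis ls : @legal limit_game b s.

Let tauE j p : T p -> size p < K + j -> level_strat (pr p j) = s p j.
Proof.
move=> Tp sp; rewrite /level_strat; case: pselect => [e|[]]; last first.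
  by exists p; rewrite size_map.
case: (cid e) => q [Tq Eq sq] /=; congr (s _ j).
by apply: (@inj j) => //; rewrite -(size_map (fun x : M => x j)) -/(pr q j) ltnW // Eq.
Qed.

Let tau_legal j : legal b (@level_strat j).
Proof.
move=> p tp op; case: (ltnP (size p) (K + j)) => sp; last first.
  rewrite /level_strat; case: pselect => [[? []]|_]; last exact: childP.
  by rewrite ltnNge sp.
have [p' Tp' Ep'] := lift tp (ltnW sp).
have Es : size p' = size p by rewrite -Ep' size_map.
rewrite -Ep' tauE ?Es // -pr_rcons; apply: (ls (p := p') _ _).1 => //.
by rewrite Es.
Qed.

Lemma pull_legal m i : legal b (@pull_strat m i).
Proof. by elim: m i => [|m IH] i //=; exact: c_legal. Qed.

(** At positions of length below [K + i] the covering changes nothing ([c_id]), which settles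
    [m = 0]. Locality of the coverings ([c_agree]) carries the agreement down the remaining
    levels. *)
Let dn_agree1 m i : agree b (K + i + m) (@pull_strat m i) (@pull_strat m.+1 i).
Proof.
elim: m i => [|m IH] i.
  rewrite addn0 => p tp op sp /=.
  have [p' Tp' Ep'] := lift tp (ltnW sp).
  have Es : size p' = size p by rewrite -Ep' size_map.
  rewrite -Ep' tauE ?Es // -(Tp'.2 i) c_id ?size_map ?Es //; last exact: Tp'.1.
  rewrite tauE ?Es ?addnS ?leqW //.
  by rewrite (@T_last p') //; apply: ls => //; rewrite Es.
have -> : K + i + m.+1 = K + i.+1 + m by rewrite !addnS addSn.
apply: c_agree; [exact: pull_legal| |exact: IH].
exact: (@pull_legal m.+1 i.+1).
Qed.

Let dn_agree m n i : agree b (K + i + m) (@pull_strat m i) (@pull_strat (n + m) i).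
Proof.
elim: n => [|n IH] p tp op sp; first by rewrite add0n.
rewrite IH // addSn; apply: dn_agree1 => //.
by rewrite (leq_trans sp) // leq_add2l leq_addl.
Qed.

Let limit_dn m i : agree b (K + i + m) (@pull_strat m i) (@limit_strat i).
Proof.
move=> p tp op sp; rewrite /limit_strat (dn_agree (size p).+1) //.
by rewrite addnC; apply/esym/dn_agree => //; rewrite addnS ltnS leq_addl.
Qed.

Lemma limit_legal i : legal b (@limit_strat i).
Proof. by move=> p tp op; exact: pull_legal. Qed.

(** This compatibility of consecutive levels is what allows a play at the bottom to be lifted level
    by level. *)
Lemma limit_step i n : agree b n (@limit_strat i) (cphi (c i) b (@limit_strat i.+1)).
Proof.
move=> p tp op _; rewrite -(limit_dn (m := (size p).+1)) //; last first.
  by rewrite addnS ltnS leq_addl.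
rewrite /=; apply: (c_agree _ _ (n := (size p).+1)) => //.
- exact: pull_legal.
- exact: limit_legal.
move=> q tq oq sq; apply: (limit_dn (m := size p)) => //.
by apply: leq_trans sq _; rewrite addnS addSn ltnS leq_addl.
Qed.

Lemma limit_base i p : T p -> odd (size p) = b -> size p < K + i ->
  limit_strat (pr p i) = s p i.
Proof.
move=> Tp op sp; rewrite -(limit_dn (m := 0)) ?addn0 ?size_map //.
  exact: tauE.
exact: Tp.1.
Qed.

End LimitStrategy.

Lemma limit_agree b n (s1 s2 : seq M -> M) i :
  @legal limit_game b s1 -> @legal limit_game b s2 ->
  @agree limit_game b n s1 s2 ->
  agree b n (@limit_strat b s1 i) (@limit_strat b s2 i).
Proof.
move=> l1 l2 ag p tp op sp; rewrite /limit_strat.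
move: (size p).+1 => m; move: i p tp op sp; elim: m => [|m IH] i.
  move=> p tp op sp /=; rewrite /level_strat; case: pselect => // e.
  case: (cid e) => q [Tq Eq sq] /=.
  have Es : size q = size p by rewrite -Eq size_map.
  by rewrite ag ?Es.
apply: c_agree; [exact: (@pull_legal b s1 l1 m i.+1)|
  exact: (@pull_legal b s2 l2 m i.+1)|exact: IH].
Qed.

Definition limit_covering : covering K limit_game (G 0).
Proof.
refine (@Covering K limit_game (G 0) (fun a => a 0)
  (fun b s => @limit_strat b s 0) _ _ _ _ _ _ _).
- by move=> p [Tp _]; exact: Tp.
- by move=> p tp sp; have [|p' ? ?] := @lift 0 p tp; [rewrite addn0|exists p'].
- by move=> p q Tp Tq sp E; apply: (@inj 0) => //; rewrite addn0.
- by move=> b s ls; exact: limit_legal.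
- by move=> b n s1 s2 l1 l2 ag; exact: limit_agree.
- by move=> b s p ls Tp op sp; apply: limit_base; rewrite // addn0.
- move=> b s x ls fx.
  have [||f fP] := @dep_choice (fun i => nat -> mv (G i))
      (fun i y => follows b (@limit_strat b s i) y /\
         (forall e : 0 = i, y = eq_rect 0 (fun i => nat -> mv (G i)) x i e))
      (fun i y y' => forall n, cpi (c i) (y' n) = y n).
  + by exists x; split=> // e; rewrite (Prop_irrelevance e erefl).
  + move=> i y [fy _].
    have /(c_follows (limit_legal ls (i := i.+1)))[y' fy' Ey'] :=
      follows_agree (@limit_step b s ls i) fy.
    by exists y'; split.
  have f0 : f 0 = x by have [[_ /(_ erefl)]] := fP 0.
  exists (fun n i => f i n) => [|n]; last by rewrite f0.
  have prE i n : pr (mkseq (fun n i => f i n) n) i = mkseq (f i) n.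
    by rewrite /pr /mkseq -map_comp.
  have Tn n : T (mkseq (fun n i => f i n) n).
    split=> i; rewrite !prE; first exact: ((fP i).1.1.1 n).
    by rewrite /mkseq -map_comp; apply: eq_map => m /=; rewrite (fP i).2.
  split=> // n on; apply: functional_extensionality_dep => i.
  set p := mkseq _ n.
  have sp : size p = n by rewrite size_mkseq.
  have Ts : T (rcons p (s p)) by apply: ls; rewrite ?sp //; exact: Tn.
  (* On a level with [n < K + j] the strategy is [s] itself ([limit_base]); lower levels follow by
     projecting both sides. *)
  suff E m j : n < K + j + m -> f j n = s p j.
    by apply: (E n.+1); rewrite addnS ltnS leq_addl.
  elim: m j => [|m IH] {}i.
    rewrite addn0 => ni; have [[[_ /(_ _ on) ->] _] _] := fP i.
    rewrite -prE; apply: (limit_base ls); rewrite ?sp //.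
  rewrite addnS -addSn -(addnS K) => /IH E.
  by rewrite -(fP i).2 E (T_last i Ts).
Defined.

End Limit.

(** * Reaching a set of positions *)

Section Force.
Variable G : game.
Implicit Types (p q u : seq (mv G)) (T W : set (seq (mv G))).

Definition ext q p : Prop := take (size q) p = q.

Lemma ext_refl p : ext p p. Proof. exact: take_size. Qed.

Lemma ext_size q p : ext q p -> size q <= size p.
Proof. by move=> <-; rewrite size_take; case: ltnP => // /ltnW. Qed.

Lemma ext_rcons q p a : ext q p -> ext q (rcons p a).
Proof.
by move=> h; rewrite /ext -cats1 takel_cat //; exact: ext_size.
Qed.

Lemma ext_mkseq (x : nat -> mv G) m n : m <= n -> ext (mkseq x m) (mkseq x n).
Proof. by move=> mn; rewrite /ext size_mkseq take_mkseq. Qed.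

Lemma ext_take n p : ext (take n p) p.
Proof.
rewrite /ext size_take; case: ltnP => // h.
by rewrite !take_oversize.
Qed.

Lemma ext_mkseqE q (x : nat -> mv G) n : ext q (mkseq x n) -> q = mkseq x (size q).
Proof.
by move=> h; have le := ext_size h; rewrite size_mkseq in le; rewrite -{1}h take_mkseq.
Qed.

Inductive force T W (b : bool) p : Prop :=
| force_now of W p
| force_own a of odd (size p) = b & T (rcons p a) & force T W b (rcons p a)
| force_opp of odd (size p) = ~~ b &
    forall a, T (rcons p a) -> force T W b (rcons p a).

Lemma force_witness T W b p :
  (forall q, T q -> exists a, T (rcons q a)) -> T p -> force T W b p ->
  exists2 u, ext p u & W u.
Proof.
move=> Te Tp f; elim: f Tp => {}p => [Wp _|a _ Ta _ IH _|_ _ IH Tp].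
- by exists p => //; exact: ext_refl.
- have [u eu Wu] := IH Ta; exists u => //.
  by move: eu; rewrite /ext size_rcons => E; rewrite -(take_takel u (leqnSn (size p))) E
    -cats1 take_size_cat.
- have [a Ta] := Te _ Tp; have [u eu Wu] := IH _ Ta Ta; exists u => //.
  by move: eu; rewrite /ext size_rcons => E; rewrite -(take_takel u (leqnSn (size p))) E
    -cats1 take_size_cat.
Qed.

(** [T] may restrict player [b] only, so every legal move of the opponent stays in [T]. The play has
    to obey [s] only where [s] proposes a move in [T], because [s] will be used through [guard]. *)
Lemma force_strat T W b p :
  (forall q a, T q -> odd (size q) = ~~ b -> tr (rcons q a) -> T (rcons q a)) ->
  T p -> force T W b p -> exists s : seq (mv G) -> mv G,
  forall x, play x -> mkseq x (size p) = p ->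
    (forall n, size p <= n -> odd n = b -> T (mkseq x n) ->
       T (rcons (mkseq x n) (s (mkseq x n))) -> x n = s (mkseq x n)) ->
    exists n, W (mkseq x n).
Proof.
move=> Tc Tp f; elim: f Tp => {}p => [Wp _|a op Ta _ IH Tp|op _ IH Tp].
- by exists (fun=> some_mv G) => x _ E _; exists (size p); rewrite E.
- have [s sP] := IH Ta.
  exists (fun q => if `[< q = p >] then a else s q) => x px E h.
  have xa : x (size p) = a.
    by have := h (size p) (leqnn _) op; rewrite E asboolT // => /(_ Tp Ta).
  apply: sP => //; first by rewrite size_rcons mkseqS E xa.
  rewrite size_rcons => n pn on Tn; have := h n (ltnW pn) on Tn.
  rewrite asboolF // => Ep; have := congr1 size Ep.
  by rewrite size_mkseq => En; rewrite En ltnn in pn.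
- have /choice[s sP] : forall a, exists s : seq (mv G) -> mv G,
      T (rcons p a) -> forall x, play x ->
    mkseq x (size (rcons p a)) = rcons p a ->
    (forall n, size (rcons p a) <= n -> odd n = b -> T (mkseq x n) ->
       T (rcons (mkseq x n) (s (mkseq x n))) -> x n = s (mkseq x n)) ->
    exists n, W (mkseq x n).
    move=> a; have [Ta|nTa] := pselect (T (rcons p a)); last by exists (fun=> a).
    by have [s sP] := IH a Ta Ta; exists s.
  (* The move of the opponent with index [size p] selects the strategy to be followed from there
     on. *)
  exists (fun q => s (nth (some_mv G) q (size p)) q) => x px E h.
  have Ta : T (rcons p (x (size p))).
    by apply: Tc => //; have := px (size p).+1; rewrite mkseqS E.
  apply: (sP (x (size p))) => //; first by rewrite size_rcons mkseqS E.
  rewrite size_rcons => n pn on Tn.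
  by have := h n (ltnW pn) on Tn; rewrite nth_mkseq.
Qed.

Definition force_move T W b p : seq (mv G) -> mv G :=
  if pselect (exists s : seq (mv G) -> mv G,
  forall x, play x -> mkseq x (size p) = p ->
    (forall n, size p <= n -> odd n = b -> T (mkseq x n) ->
       T (rcons (mkseq x n) (s (mkseq x n))) -> x n = s (mkseq x n)) ->
    exists n, W (mkseq x n)) is left e then sval (cid e) else fun=> some_mv G.

Lemma force_moveP T W b p (x : nat -> mv G) :
  (forall q a, T q -> odd (size q) = ~~ b -> tr (rcons q a) -> T (rcons q a)) ->
  T p -> force T W b p -> play x -> mkseq x (size p) = p ->
  (forall n, size p <= n -> odd n = b -> T (mkseq x n) ->
     T (rcons (mkseq x n) (force_move T W b p (mkseq x n))) ->
     x n = force_move T W b p (mkseq x n)) ->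
  exists n, W (mkseq x n).
Proof.
move=> Tc Tp f; rewrite /force_move; case: pselect => [e|[]]; last exact: force_strat.
by case: (cid e) => s sP px E h; exact: sP h.
Qed.

Definition hit_time W p := find (fun n => `[< W (take n p) >]) (iota 0 (size p).+1).
Definition hits W p : Prop := exists2 n, n <= size p & W (take n p).
Definition first_hit W p := take (hit_time W p) p.

Lemma first_hit_mkseq W (x : nat -> mv G) m n :
  m <= n -> W (mkseq x m) -> (forall i, i < m -> ~ W (mkseq x i)) ->
  first_hit W (mkseq x n) = mkseq x m.
Proof.
move=> mn Wm nW; rewrite /first_hit /hit_time size_mkseq.
suff -> : find (fun i => `[< W (take i (mkseq x n)) >]) (iota 0 n.+1) = m.
  by rewrite take_mkseq.
have hm : has (fun i => `[< W (take i (mkseq x n)) >]) (iota 0 n.+1).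
  apply/hasP; exists m; first by rewrite mem_iota /= add0n ltnS.
  by apply/asboolP; rewrite take_mkseq.
have := nth_find 0 hm; move: (hm); rewrite has_find size_iota => lt.
rewrite nth_iota // add0n => /asboolP; rewrite take_mkseq // => Wf.
apply/eqP; rewrite eqn_leq; apply/andP; split; rewrite leqNgt; apply/negP => h.
  have := before_find 0 h; rewrite nth_iota ?add0n; last first.
    by rewrite (ltn_trans h).
  by move/asboolP; apply; rewrite take_mkseq.
exact: nW h Wf.
Qed.

Lemma hits_mkseq W (x : nat -> mv G) n :
  hits W (mkseq x n) <-> exists2 m, m <= n & W (mkseq x m).
Proof.
by rewrite /hits size_mkseq; split=> -[m mn Wm]; exists m => //;
  move: Wm; rewrite take_mkseq.
Qed.

Lemma first_time W (x : nat -> mv G) n : W (mkseq x n) ->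
  exists2 m, m <= n & W (mkseq x m) /\ forall i, i < m -> ~ W (mkseq x i).
Proof.
move=> Wn; have e : exists i, `[< W (mkseq x i) >] by exists n; apply/asboolP.
case: (ex_minnP e) => m /asboolP Wm mP; exists m; first exact/mP/asboolP.
by split=> // i im /asboolP /mP; rewrite leqNgt im.
Qed.

End Force.

(** * Unravelling a closed set *)

Section Closed.
Variables (G : game) (K : nat) (TA : set (seq (mv G))).
Hypothesis Keven : ~~ odd K.
Hypothesis TA_prefix : forall n p, TA p -> TA (take n p).

Let A := mv G.
Let pos := seq A.
Let d : A := some_mv G.

(* In the covering game the move with index [K] carries a quasi-strategy of the
   player [false], the move with index [K.+1] carries the tree to which the rest
   of the play is confined, and the other moves carry [set0]. *)
Let mark (X Y : set pos) i : set pos :=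
  if i == K then X else if i == K.+1 then Y else set0.
Let lft X Y (p : pos) := zip p (mkseq (mark X Y) (size p)).

Let lft_rcons X Y p a : lft X Y (rcons p a) = rcons (lft X Y p) (a, mark X Y (size p)).
Proof. by rewrite /lft size_rcons mkseqS zip_rcons // size_mkseq. Qed.

Let lft_take n X Y p : n <= size p -> take n (lft X Y p) = lft X Y (take n p).
Proof.
move=> np; rewrite /lft size_takel // -(take_mkseq _ np).
elim: p n (mkseq _ _) {np} => [|a p IH] [|n] [|b t] //=; by [rewrite IH|case: take].
Qed.

Let lft_fst X Y p : map fst (lft X Y p) = p.
Proof. by rewrite -/(unzip1 _) unzip1_zip // size_mkseq. Qed.

Let size_lft X Y p : size (lft X Y p) = size p.
Proof. by rewrite size_zip size_mkseq minnn. Qed.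

Let lft_inj X Y X' Y' p p' : lft X Y p = lft X' Y' p' -> [/\ p = p',
  K < size p -> X = X' & K.+1 < size p -> Y = Y'].
Proof.
move=> E; have Ep : p = p' by rewrite -(lft_fst X Y p) E lft_fst.
rewrite -{}Ep in E *; split=> // lt.
  have := congr1 (fun q => (nth (d, set0) q K).2) E.
  by rewrite !nth_zip ?size_mkseq //= !nth_mkseq // /mark eqxx.
have := congr1 (fun q => (nth (d, set0) q K.+1).2) E.
by rewrite !nth_zip ?size_mkseq //= !nth_mkseq // /mark eqxx eqn_leq ltnn.
Qed.

Let lft_eq1 X Y X' Y' p : size p <= K -> lft X Y p = lft X' Y' p.
Proof.
move=> le; rewrite /lft; congr zip; apply/mkseq_eq => i ip.
have iK := leq_trans ip le; rewrite /mark; case: eqP => [E|_].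
  by rewrite E ltnn in iK.
by case: eqP => // E; rewrite E ltnNge leqnSn in iK.
Qed.

Let lft_eq2 X Y Y' p : size p <= K.+1 -> lft X Y p = lft X Y' p.
Proof.
move=> le; rewrite /lft; congr zip; apply/mkseq_eq => i ip.
have iK := leq_trans ip le; rewrite /mark; case: eqP => // _.
by case: eqP => // E; rewrite E ltnn in iK.
Qed.

Let quasi (q0 : pos) (X : set pos) : Prop :=
  [/\ X q0, X `<=` [set q | tr q /\ ext q0 q],
      forall q, X q -> ~~ odd (size q) -> exists a, X (rcons q a) &
      forall q a, X q -> odd (size q) -> tr (rcons q a) -> X (rcons q a)].

Let cone (u : pos) : set pos := [set q | tr q /\ (ext q u \/ ext u q)].

(** The two replies in Martin's auxiliary game. With [opt1] an exit [u] from [TA] inside [X] is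
    named and the play must pass through it; with [opt2] player [true] commits to a quasi-strategy
    of its own, inside [X], that never leaves [TA]. Either way membership in the closed set is
    decided at once. *)
Let opt1 X (q1 : pos) Y u := [/\ ext q1 u, X u, ~ TA u & Y = cone u].
Let opt2 X (q1 : pos) Y := [/\ Y q1, Y `<=` X `&` TA,
      forall q, Y q -> odd (size q) -> exists a, Y (rcons q a) &
      forall q a, Y q -> ~~ odd (size q) -> X (rcons q a) -> Y (rcons q a)].
Let opt X q1 Y := (exists u, opt1 X q1 Y u) \/ opt2 X q1 Y.

Let T X Y p := [/\ tr p, K < size p -> quasi (take K.+1 p) X &
  K.+1 < size p -> opt X (take K.+2 p) Y /\
    forall n, K.+1 < n -> n <= size p -> Y (take n p)].

Let tr' (p' : seq (A * set pos)) := exists X Y p, p' = lft X Y p /\ T X Y p.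

Let take_rconsl (n : nat) (p : pos) a : n <= size p -> take n (rcons p a) = take n p.
Proof. by move=> le; rewrite -cats1 takel_cat. Qed.

Let T_prev X Y p a : T X Y (rcons p a) -> T X Y p.
Proof.
rewrite /T size_rcons => -[ta h1 h2]; split; first exact: tr_rcons ta.
  by move=> lt; have := h1 (ltnW lt); rewrite take_rconsl.
move=> lt; have [] := h2 (ltnW lt); rewrite take_rconsl // => ? h; split=> // n n1 n2.
by have := h n n1 (leqW n2); rewrite take_rconsl.
Qed.

Let tr'_rcons p' a' : tr' (rcons p' a') -> tr' p'.
Proof.
move=> [X [Y [p [E Tp]]]]; elim/last_ind: p E Tp => [|p a _].
  by move=> /(congr1 size); rewrite size_rcons.
by rewrite lft_rcons => /rcons_inj[-> _] /T_prev Tp; exists X, Y, p.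
Qed.

Let tr'_nil : tr' [::].
Proof. by exists set0, set0, [::]; split=> //; split=> //; exact: tr_nil. Qed.

Let T_rcons X Y p a : T X Y p -> tr (rcons p a) -> size p != K -> size p != K.+1 ->
  (K.+1 < size p -> Y (rcons p a)) -> T X Y (rcons p a).
Proof.
move=> [tp h1 h2] ta n1 n2 h; split=> //; rewrite size_rcons ltnS leq_eqVlt.
  by rewrite eq_sym (negPf n1) /= => lt; rewrite take_rconsl //; exact: h1.
rewrite eq_sym (negPf n2) /= => lt; have [ o Yn] := h2 lt.
rewrite take_rconsl //; split=> // n n3; rewrite leq_eqVlt => /predU1P[->|].
  by rewrite take_oversize ?size_rcons //; exact: h.
by rewrite ltnS => n4; rewrite take_rconsl //; exact: Yn.
Qed.

Let quasi_ext q0 X : quasi q0 X -> forall q, X q -> exists a, X (rcons q a).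
Proof.
move=> [X0 Xs Xe Xo] q Xq; case: (boolP (odd (size q))) => oq; last exact: Xe.
have [tq _] := Xs _ Xq; have [a ta] := tr_ext tq; exists a; exact: Xo.
Qed.

Let opt_ext X q0 q1 Y q : quasi q0 X -> opt X q1 Y -> Y q ->
  exists2 a, tr (rcons q a) & Y (rcons q a).
Proof.
move=> qX [[u [_ Xu _ ->]]|[_ Ys Yo Ye]] Yq.
  have [_ Xs _ _] := qX; have [tu _] := Xs _ Xu.
  case: Yq => tq [eq|eq]; last first.
    have [a ta] := tr_ext tq; exists a => //; split=> //; right; exact: ext_rcons.
  case: (ltnP (size q) (size u)) => [lt|ge]; last first.
    have [a ta] := tr_ext tq; exists a => //; split=> //; right.
    by apply: ext_rcons; rewrite -eq take_oversize //; exact: ext_refl.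
  have E : rcons q (nth d u (size q)) = take (size q).+1 u.
    by rewrite (take_nth d) // eq.
  exists (nth d u (size q)); rewrite E; first exact: tr_take.
  by split; [exact: tr_take|left; exact: ext_take].
have [_ Xs Xe _] := qX; have [Xq _] := Ys _ Yq.
have [a Ya] : exists a, Y (rcons q a).
  case: (boolP (odd (size q))) => oq; first exact: Yo.
  by have [a Xa] := Xe _ Xq oq; exists a; exact: Ye.
by exists a => //; have [/Xs[]] := Ys _ Ya.
Qed.

(** Some reply is always available. If after some move player [false] cannot force an exit from [TA]
    inside [X], the positions with this property form a reply of the second kind. Otherwise an exit
    is forced, in particular one exists, and it can be named. *)
Let opt_exists X p : quasi p X -> size p = K.+1 -> exists a Y,
  [/\ tr (rcons p a), opt X (rcons p a) Y & Y (rcons p a)].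
Proof.
move=> qX sp; have [Xp Xs Xe Xo] := qX.
have op : odd (size p) by rewrite sp /= Keven.
pose W : set pos := [set u | X u /\ ~ TA u].
have [[a [ta nf]]|nf] := pselect (exists a, tr (rcons p a) /\ ~ force X W false (rcons p a)).
  exists a, [set q | X q /\ ~ force X W false q]; split=> //.
    right; split.
    - by split=> //; exact: Xo.
    - move=> q [Xq nq]; split=> //; apply: contrapT => nT.
      by apply: nq; exact: force_now.
    - move=> q [Xq nq] oq; apply: contrapT => h; apply: nq.
      apply: force_opp; rewrite ?oq // => b Xb; apply: contrapT => nb.
      by apply: h; exists b.
    - move=> q b [Xq nq] oq Xb; split=> // fb; apply: nq.
      by apply: (force_own (a := b)) => //; exact: negbTE.
  by split=> //; exact: Xo.
have [tp _] := Xs _ Xp; have [a ta] := tr_ext tp.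
have fa : force X W false (rcons p a).
  by apply: contrapT => h; apply: nf; exists a.
have [u eu [Xu nu]] := force_witness (quasi_ext qX) (Xo _ _ Xp op ta) fa.
by exists a, (cone u); split=> //; [left; exists u|split=> //; left].
Qed.

Let tr'_ext p' : tr' p' -> exists a', tr' (rcons p' a').
Proof.
move=> [X [Y [p [-> Tp]]]]; have [tp h1 h2] := Tp.
case: (ltngtP (size p) K) => [lt|gt|eK].
- have [a ta] := tr_ext tp; exists (a, mark X Y (size p)).
  exists X, Y, (rcons p a); rewrite lft_rcons; split=> //.
  apply: T_rcons => //; first by rewrite neq_ltn lt.
    by rewrite neq_ltn leqW.
  by rewrite ltnNge (leq_trans (ltnW lt)).
- case: (ltngtP (size p) K.+1) => [|gt1|eK1].
  + by rewrite ltnS leqNgt gt.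
  + have [ o Yn] := h2 gt1.
    have [|a ta Ya] := opt_ext (h1 gt) o (q := p).
      by have := Yn _ gt1 (leqnn _); rewrite take_size.
    exists (a, mark X Y (size p)), X, Y, (rcons p a); rewrite lft_rcons; split=> //.
    by apply: T_rcons => //; rewrite neq_ltn ?gt ?gt1 orbT.
  + have qX : quasi p X by have := h1 gt; rewrite -eK1 take_size.
    have [a [Y' [ta o Ya]]] := opt_exists qX eK1.
    exists (a, mark X Y' (size p)), X, Y', (rcons p a); rewrite lft_rcons.
    split; first by rewrite (lft_eq2 X Y Y') ?eK1.
    split; rewrite ?size_rcons ?eK1 // => _.
      by rewrite take_rconsl ?eK1 // -eK1 take_size.
    rewrite take_oversize ?size_rcons ?eK1 //; split=> // n n1 n2.
    by rewrite take_oversize // size_rcons eK1.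
- have [a ta] := tr_ext tp.
  pose X' := [set q | tr q /\ ext (rcons p a) q].
  exists (a, X'), X', Y, (rcons p a).
  rewrite lft_rcons (lft_eq1 X Y X' Y) ?eK // /mark eqxx; split=> //.
  split; rewrite ?size_rcons ?eK ?ltnn // => _.
  rewrite take_oversize ?size_rcons ?eK //; split=> //.
  + by split=> //; exact: ext_refl.
  + move=> q [tq eq] _; have [b tb] := tr_ext tq; exists b; split=> //.
    exact: ext_rcons.
  + by move=> q b [tq eq] _ tb; split=> //; exact: ext_rcons.
Qed.

Definition closed_game : game := Game tr'_nil tr'_rcons tr'_ext.

Let tr'_fst p' : tr' p' -> tr (map fst p').
Proof. by move=> [X [Y [p [-> [tp _ _]]]]]; rewrite lft_fst. Qed.

Lemma closed_game_clopen (x' : nat -> mv closed_game) : play x' ->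
  exists n, forall y' : nat -> mv closed_game, play y' ->
    mkseq y' n = mkseq x' n ->
    ((forall m, TA (mkseq (fst \o x') m)) <-> (forall m, TA (mkseq (fst \o y') m))).
Proof.
have key (y' : nat -> mv closed_game) X Y p :
    mkseq y' K.+2 = lft X Y p -> play y' -> opt X p Y ->
    forall m, K.+1 < m -> Y (mkseq (fst \o y') m).
  move=> E py o m Km; have [X1 [Y1 [p1 [E1 [tp1 h1 h2]]]]] := py m.
  have := congr1 (take K.+2) E1; rewrite take_mkseq // E.
  have sp1 : size p1 = m by rewrite -(size_lft X1 Y1) -E1 size_mkseq.
  rewrite lft_take ?sp1 //.
  move=> /lft_inj[_ _ EY]; have EY1 : Y = Y1.
    by apply: EY; rewrite -(size_lft X Y) -E size_mkseq.
  have [|_ /(_ m Km)] := h2; first by rewrite sp1.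
  rewrite sp1 => /(_ (leqnn _)); rewrite -{1}sp1 take_size EY1.
  by rewrite -(lft_fst X1 Y1 p1) -E1 /mkseq -map_comp.
move=> px; exists K.+2 => y' py Ey.
have [X [Y [p [E [tp _ h]]]]] := px K.+2.
have sp : size p = K.+2 by rewrite -(size_lft X Y) -E size_mkseq.
have [|o _] := h; first by rewrite sp.
rewrite -{1}sp take_size in o.
have kx := key _ _ _ _ E px o.
have ky := key _ _ _ _ (etrans Ey E) py o.
have no u (z : nat -> A) : ~ TA u -> (forall m, K.+1 < m -> cone u (mkseq z m)) ->
    ~ forall m, TA (mkseq z m).
  move=> nu cz h'; apply: nu.
  have [] := cz (K.+2 + size u) _; first by rewrite addSn ltnS leq_addr.
  move=> _ [e|e]; last by rewrite (ext_mkseqE e).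
  have := ext_size e; rewrite size_mkseq => le.
  by have := leq_trans (leq_addl K.+1.+1 (size u)) le; move: le;
    rewrite addSn ltnNge leq_addl.
case: o => [[u [_ _ nu EY]]|[_ Ys _ _]].
  by split=> h'; exfalso; move: h'; apply: (no u) => // m Km; rewrite -EY; [exact: kx|exact: ky].
by split=> _ m; rewrite -(take_mkseq _ (leq_addr K.+2 m));
  apply: TA_prefix; apply: (Ys _ _).2; [apply: ky|apply: kx]; rewrite ltn_addl.
Qed.

(** Outside the tree a fixed value is returned, so strategies that agree on legal positions give
    literally equal answers. *)
Let ask (sg : seq (A * set pos) -> A * set pos) p' : A * set pos :=
  if `[< tr' p' >] then sg p' else (d, set0).

(** Player [false] obtains [X] from [sg], but the reply of [true] has to be invented. While no exit
    can be forced, the invented reply is the quasi-strategy of all such positions. As soon as an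
    exit can be forced it is forced, without consulting [sg]; after that the invented reply is that
    exit, and [sg] is consulted again. *)
Let phi0 sg (p : pos) : A :=
  guard p (if size p <= K then (ask sg (lft set0 set0 p)).1 else
    let X := (ask sg (lft set0 set0 (take K p))).2 in
    let q1 := take K.+2 p in
    let W : set pos := [set u | [/\ ext q1 u, X u & ~ TA u]] in
    let R : set pos := [set q | [/\ ext q1 q, X q & force X W false q]] in
    if `[< hits W p >] then (ask sg (lft X (cone (first_hit W p)) p)).1
    else if `[< hits R p >] then force_move X W false (first_hit R p) p
    else (ask sg (lft X [set q | [/\ ext q1 q, X q & ~ force X W false q]] p)).1).

Let answer (ak : seq (A * set pos) -> A * set pos) q0 u X :=
  [/\ quasi q0 X, K.+1 < size u, ext q0 u, X u /\ ~ TA u &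
      ak (lft X set0 q0) = (nth d u K.+1, cone u)].

Let pick_answer ak q0 u : set pos :=
  if pselect (exists X, answer ak q0 u X) is left e then sval (cid e) else set0.

(** Here the quasi-strategy [X] of [false] has to be invented. [W] consists of the exits that [sg]
    would name against some [X]. If [W] can be forced, it is, and a fitting [X] is chosen afterwards
    by [pick_answer]; otherwise [X] is the set of positions from which [W] cannot be forced. *)
Let phi1 sg (p : pos) : A :=
  guard p (if size p <= K then (ask sg (lft set0 set0 p)).1 else
    let q0 := take K.+1 p in
    let W : set pos := [set u | exists X, answer (ask sg) q0 u X] in
    let R : set pos := [set q | [/\ ext q0 q, tr q & force (@tr G) W true q]] in
    if `[< hits W p >] then
      let u := first_hit W p in
      (ask sg (lft (pick_answer (ask sg) q0 u) (cone u) p)).1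
    else if `[< hits R p >] then force_move (@tr G) W true (first_hit R p) p
    else let X := [set q | [/\ ext q0 q, tr q & ~ force (@tr G) W true q]] in
      (ask sg (lft X (ask sg (lft X set0 q0)).2 p)).1).

Let phi (b : bool) := if b then phi1 else phi0.

Let askE sg p' : tr' p' -> ask sg p' = sg p'.
Proof. by move=> h; rewrite /ask asboolT. Qed.

Let ask_agree b n (s1 s2 : seq (mv closed_game) -> mv closed_game) p' :
  agree b n s1 s2 -> odd (size p') = b -> size p' < n -> ask s1 p' = ask s2 p'.
Proof.
move=> ag op lt; rewrite /ask; case: asboolP => // tp'; exact: ag.
Qed.

Let phi_agree b n (s1 s2 : seq (mv closed_game) -> mv closed_game) :
  agree b n s1 s2 -> agree b n (phi b s1) (phi b s2).
Proof.
move=> ag p tp op sp.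
have ask_p X Y : ask s1 (lft X Y p) = ask s2 (lft X Y p).
  by apply: (ask_agree ag); rewrite size_lft.
case: b op ag => op ag; rewrite /= /phi0 /phi1; congr guard.
  rewrite ask_p; case: leqP => // Kp.
  have sK : size (take K.+1 p) = K.+1 by rewrite size_takel.
  have ask_q X : ask s1 (lft X set0 (take K.+1 p)) = ask s2 (lft X set0 (take K.+1 p)).
    by apply: (ask_agree ag); rewrite size_lft sK //= ?Keven // (leq_ltn_trans Kp).
  have EA : answer (ask s1) (take K.+1 p) = answer (ask s2) (take K.+1 p).
    by apply/funext => u; apply/funext => X; rewrite /answer ask_q.
  by rewrite /pick_answer EA ask_p ask_q ask_p.
rewrite ask_p; case: leqP => // Kp.
rewrite (ask_agree ag (p' := lft set0 set0 (take K p))).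
- by rewrite !ask_p.
- by rewrite size_lft size_takel ?(ltnW Kp) //; exact: negbTE.
- by rewrite size_lft size_takel ?(ltnW Kp) // (ltn_trans Kp).
Qed.

Let phi_legal b sg : legal b (phi b sg).
Proof. by move=> p tp _; case: b; exact: guardP. Qed.

Let low_tr' X Y p : tr p -> size p <= K -> tr' (lft X Y p).
Proof.
move=> tp sp; exists X, Y, p; split=> //; split=> // lt.
  by rewrite ltnNge sp in lt.
by rewrite ltnNge leqW in lt.
Qed.

Let legal_mv b (sg : seq (mv closed_game) -> mv closed_game) X Y p :
  @legal closed_game b sg -> tr' (lft X Y p) -> odd (size p) = b ->
  exists X' Y', [/\ (sg (lft X Y p)).2 = mark X' Y' (size p),
    lft X Y p = lft X' Y' p & T X' Y' (rcons p (sg (lft X Y p)).1)].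
Proof.
move=> lg tp op; have := lg (lft X Y p) tp; rewrite size_lft => /(_ op).
move=> [X' [Y' [q [E Tq]]]]; elim/last_ind: q E Tq => [|q a _].
  by move=> /(congr1 size); rewrite size_rcons.
rewrite lft_rcons => /rcons_inj[E Ea] Tq; exists X', Y'.
have Eq : q = p by rewrite -(lft_fst X' Y' q) -E lft_fst.
by rewrite Ea /=; rewrite Eq in Tq E *.
Qed.

Let low_phi b sg p : @legal closed_game b sg -> tr p -> odd (size p) = b -> size p <= K ->
  phi b sg p = (sg (lft set0 set0 p)).1.
Proof.
move=> lg tp op sp; have tp' := low_tr' set0 set0 tp sp.
have [X [Y [_ _ [ta _ _]]]] := legal_mv lg tp' op.
by case: b op lg => op lg; rewrite /= /phi0 /phi1 sp askE // guardE.
Qed.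

Let follows_lft b sg (x : nat -> A) X Y :
  @legal closed_game b sg -> (forall n, T X Y (mkseq x n)) ->
  (forall n, odd n = b -> sg (lft X Y (mkseq x n)) = (x n, mark X Y n)) ->
  exists2 x', @follows closed_game b sg x' & forall n, (x' n).1 = x n.
Proof.
move=> lg Tx h; exists (fun n => (x n, mark X Y n)) => //.
have E n : mkseq (fun n => (x n, mark X Y n)) n = lft X Y (mkseq x n).
  by elim: n => [|n IH] //; rewrite !mkseqS lft_rcons IH size_mkseq.
split=> [n|n on]; rewrite E; last by rewrite h.
by exists X, Y, (mkseq x n).
Qed.

(* Only the first component of an answer has to be checked: the second one is
   dictated by the rules, except at the indices [K] and [K.+1]. *)
Let answer_mark b sg X Y p : @legal closed_game b sg -> tr' (lft X Y p) -> odd (size p) = b ->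
  size p != K -> size p != K.+1 -> (sg (lft X Y p)).2 = set0.
Proof.
move=> lg tp op n1 n2; have [X' [Y' [-> _ _]]] := legal_mv lg tp op.
by rewrite /mark (negPf n1) (negPf n2).
Qed.

Let T_mkseq X Y (x : nat -> A) n : play x -> quasi (mkseq x K.+1) X ->
  opt X (mkseq x K.+2) Y -> (forall m, K.+1 < m -> m <= n -> Y (mkseq x m)) ->
  T X Y (mkseq x n).
Proof.
move=> px qX oY Ym; split; [exact: px| |]; rewrite size_mkseq => lt.
  by rewrite take_mkseq.
rewrite take_mkseq //; split=> // m m1 m2; rewrite take_mkseq //; exact: Ym.
Qed.

Let mkseq_rcons (x : nat -> A) n a : rcons (mkseq x n) a = mkseq x n.+1 -> a = x n.
Proof. by rewrite mkseqS => /rcons_inj[]. Qed.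

Let cone_step (x : nat -> A) m n a : n < m ->
  cone (mkseq x m) (rcons (mkseq x n) a) -> a = x n.
Proof.
move=> nm [_ [e|e]]; apply: mkseq_rcons.
  by rewrite (ext_mkseqE e) size_rcons size_mkseq.
have := ext_size e; rewrite size_rcons !size_mkseq => mn.
have Em : m = n.+1 by apply/eqP; rewrite eqn_leq mn.
by rewrite -Em -e take_oversize // size_rcons !size_mkseq Em.
Qed.

Let cone_mkseq (x : nat -> A) m n : play x -> cone (mkseq x m) (mkseq x n).
Proof.
move=> px; split=> //; case: (leqP m n) => [mn|/ltnW mn]; [right|left];
exact: ext_mkseq.
Qed.

(** Common to both players: a play through an exit lifts to one confined to its cone. Between the
    index [K.+1] and the exit the confinement leaves [sg] no choice ([cone_step]), whatever was
    played downstairs; after the exit [sg] is copied. *)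
Let follows_cone b sg (x : nat -> A) X m :
  @legal closed_game b sg -> play x -> follows b (phi b sg) x -> quasi (mkseq x K.+1) X ->
  ext (mkseq x K.+2) (mkseq x m) -> X (mkseq x m) -> ~ TA (mkseq x m) ->
  (odd K = b -> (sg (lft set0 set0 (mkseq x K))).2 = X) ->
  (odd K.+1 = b -> sg (lft X set0 (mkseq x K.+1)) = (x K.+1, cone (mkseq x m))) ->
  (forall n, odd n = b -> K.+1 < n -> m <= n ->
     phi b sg (mkseq x n) =
     guard (mkseq x n) (ask sg (lft X (cone (mkseq x m)) (mkseq x n))).1) ->
  exists2 x', @follows closed_game b sg x' & forall n, (x' n).1 = x n.
Proof.
move=> lg px [_ fx] qX e Xu nu hK hK1 hn.
set Y := cone (mkseq x m).
have oY : opt X (mkseq x K.+2) Y by left; exists (mkseq x m).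
have Tn n : T X Y (mkseq x n) by apply: T_mkseq => // i _ _; exact: cone_mkseq.
apply: (follows_lft (X := X) (Y := Y)) => // n on.
have tp' : tr' (lft X Y (mkseq x n)) by exists X, Y, (mkseq x n).
have on' : odd (size (mkseq x n)) = b by rewrite size_mkseq.
case: (ltngtP n K) => [lt|gt|E].
- have E : lft X Y (mkseq x n) = lft set0 set0 (mkseq x n).
    by apply: lft_eq1; rewrite size_mkseq ltnW.
  rewrite [LHS]surjective_pairing (answer_mark lg tp') ?size_mkseq //.
  + rewrite E -(low_phi lg) ?size_mkseq // ?(ltnW lt) // -fx // /mark.
    by rewrite ltn_eqF // ltn_eqF // leqW.
  + by rewrite ltn_eqF.
  + by rewrite ltn_eqF // leqW.
- case: (ltngtP n K.+1) => [|gt1|E]; first by rewrite ltnS leqNgt gt.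
    rewrite [LHS]surjective_pairing (answer_mark lg tp') ?size_mkseq ?gtn_eqF //.
    rewrite /mark !gtn_eqF //; congr (_, _).
    have [X' [Y' [_ E Ta]]] := legal_mv lg tp' on'.
    have [_ _ EY] := lft_inj E; rewrite size_mkseq in EY.
    have [ta _] := Ta; rewrite size_rcons size_mkseq => h2.
    case: (leqP m n) => [mn|nm]; first by rewrite fx // hn // askE // guardE.
    apply: (cone_step nm).
    have [_ /(_ n.+1 (leqW gt1) (leqnn _))] := h2 (leqW gt1).
    by rewrite take_oversize ?size_rcons ?size_mkseq // -(EY gt1).
  rewrite E (lft_eq2 X Y set0) ?size_mkseq // hK1 ?E -?E //.
  by rewrite /mark E eqxx eqn_leq ltnn.
- rewrite -E in hK; have EE : lft X Y (mkseq x n) = lft set0 set0 (mkseq x n).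
    by apply: lft_eq1; rewrite size_mkseq E.
  rewrite [LHS]surjective_pairing EE hK // -(low_phi lg) ?size_mkseq ?E // -E //.
  by rewrite -fx // /mark E eqxx.
Qed.

Let phi0_follows sg x : @legal closed_game false sg -> follows false (phi false sg) x ->
  exists2 x', @follows closed_game false sg x' & forall n, (x' n).1 = x n.
Proof.
move=> lg fx'; have [px fx] := fx'.
have tK' : tr' (lft set0 set0 (mkseq x K)) by apply: low_tr'; rewrite ?size_mkseq.
have oK : odd K = false by exact: negbTE.
have oK' : odd (size (mkseq x K)) = false by rewrite size_mkseq.
set X := (sg (lft set0 set0 (mkseq x K))).2.
have xK : x K = (sg (lft set0 set0 (mkseq x K))).1.
  by rewrite fx // (low_phi lg) ?size_mkseq.
have qX : quasi (mkseq x K.+1) X.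
  have [X' [Y' [EX _ [_]]]] := legal_mv lg tK' oK'.
  rewrite size_rcons size_mkseq -xK -mkseqS take_mkseq // => /(_ (ltnSn _)) + _.
  by rewrite /X EX /mark size_mkseq eqxx.
have [X0 Xs Xe Xo] := qX.
have XK : X (mkseq x K.+2).
  by rewrite mkseqS; apply: Xo; rewrite ?size_mkseq -?mkseqS //= oK.
set q1 := mkseq x K.+2 in XK.
pose W : set pos := [set u | [/\ ext q1 u, X u & ~ TA u]].
pose R : set pos := [set q | [/\ ext q1 q, X q & force X W false q]].
pose Y : set pos := [set q | [/\ ext q1 q, X q & ~ force X W false q]].
have phiE n : odd n = false -> K.+1 < n -> phi false sg (mkseq x n) =
   guard (mkseq x n)
    (if `[< hits W (mkseq x n) >] then
       (ask sg (lft X (cone (first_hit W (mkseq x n))) (mkseq x n))).1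
     else if `[< hits R (mkseq x n) >] then
       force_move X W false (first_hit R (mkseq x n)) (mkseq x n)
     else (ask sg (lft X Y (mkseq x n))).1).
  move=> on Kn; rewrite /= /phi0 size_mkseq leqNgt (ltnW Kn) /=.
  by rewrite !take_mkseq ?(ltnW (ltnW Kn)) // askE.
have [[n Wn]|nW] := pselect (exists n, W (mkseq x n)).
  have [m mn [[eu Xu nu] mP]] := first_time Wn.
  apply: (follows_cone lg px fx' qX eu Xu nu) => //; first by rewrite /= oK.
  move=> i oi Ki mi; rewrite phiE // asboolT; last by apply/hits_mkseq; exists m.
  by rewrite (@first_hit_mkseq _ W x m).
have nhW n : `[< hits W (mkseq x n) >] = false.
  by apply/asboolP => /hits_mkseq[m _ Wm]; apply: nW; exists m.
have nR n : ~ R (mkseq x n).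
  move=> Rn; have [m mn [[em Xm fm] mP]] := first_time Rn.
  apply: nW; apply: (@force_moveP G X W false (mkseq x m) x) => //.
    by rewrite size_mkseq.
  rewrite size_mkseq => i mi oi Xi Xa; have Ki : K.+1 < i.
    by apply: leq_trans mi; have := ext_size em; rewrite !size_mkseq.
  rewrite fx // phiE // nhW asboolT; last by apply/hits_mkseq; exists m.
  by rewrite (@first_hit_mkseq _ R x m) // guardE //; have [] := Xs _ Xa.
have nhR n : `[< hits R (mkseq x n) >] = false.
  by apply/asboolP => /hits_mkseq[m _ Rm]; apply: (nR m).
have oY : opt X q1 Y.
  right; split.
  - by split=> //; [exact: ext_refl|move=> f; apply: (nR K.+2); split=> //; exact: ext_refl].
  - move=> q [eq Xq nf]; split=> //; apply: contrapT => nT.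
    by apply: nf; exact: force_now.
  - move=> q [eq Xq nf] oq; apply: contrapT => h; apply: nf.
    apply: force_opp => // a Xa; apply: contrapT => na.
    by apply: h; exists a; split=> //; exact: ext_rcons.
  - move=> q a [eq Xq nf] oq Xa; split=> //; first exact: ext_rcons.
    by move=> fa; apply: nf; apply: (force_own (a := a)) => //; exact: negbTE.
have sgE n : odd n = false -> K.+1 < n ->
    (forall m, K.+1 < m -> m <= n -> Y (mkseq x m)) ->
    (sg (lft X Y (mkseq x n))).1 = x n /\ Y (mkseq x n.+1).
  move=> on Kn Ym; have Tn := T_mkseq px qX oY Ym.
  have tn' : tr' (lft X Y (mkseq x n)) by exists X, Y, (mkseq x n).
  have on' : odd (size (mkseq x n)) = false by rewrite size_mkseq.
  have [X' [Y' [_ /lft_inj[_ _]]]] := legal_mv lg tn' on'.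
  rewrite size_mkseq => /(_ Kn) <- [ta _]; rewrite size_rcons size_mkseq => h2.
  have Ex : (sg (lft X Y (mkseq x n))).1 = x n.
    by rewrite fx // phiE // nhW nhR askE // guardE.
  split=> //; have [_ /(_ n.+1 (leqW Kn) (leqnn _))] := h2 (leqW Kn).
  by rewrite Ex -mkseqS take_mkseq.
have Yn n : K.+1 < n -> Y (mkseq x n).
  elim/ltn_ind: n => n IH; rewrite leq_eqVlt => /predU1P[<-|].
    split=> //; first exact: ext_refl.
    by move=> f; apply: (nR K.+2); split=> //; exact: ext_refl.
  case: n IH => // n IH; rewrite ltnS => Kn.
  case: (boolP (odd n)) => [on|/negbTE on]; last first.
    by apply: (sgE n on Kn _).2 => m m1 m2; exact: IH.
  have [en Xn _] := IH n (ltnSn _) Kn; split; rewrite ?mkseqS; first exact: ext_rcons.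
    by apply: Xo; rewrite ?size_mkseq // -mkseqS.
  rewrite -mkseqS => f; apply: (nR n.+1); split=> //.
    by rewrite mkseqS; exact: ext_rcons.
  by rewrite mkseqS; apply: Xo; rewrite ?size_mkseq // -mkseqS.
apply: (follows_lft (X := X) (Y := Y)) => // [n|n on].
  by apply: T_mkseq => // m m1 _; exact: Yn.
have tp' : tr' (lft X Y (mkseq x n)).
  by exists X, Y, (mkseq x n); split=> //; apply: T_mkseq => // m m1 _; exact: Yn.
have on' : odd (size (mkseq x n)) = false by rewrite size_mkseq.
case: (leqP n K) => nK.
  have E : lft X Y (mkseq x n) = lft set0 set0 (mkseq x n).
    by apply: lft_eq1; rewrite size_mkseq.
  have E1 : (sg (lft X Y (mkseq x n))).1 = x n.
    by rewrite E -(low_phi lg) ?size_mkseq // -fx.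
  rewrite [LHS]surjective_pairing E1; congr (_, _).
  case: (ltngtP n K) nK => // [lt _|En _].
    rewrite (answer_mark lg tp') ?size_mkseq // /mark ?ltn_eqF //; exact: leqW.
  by rewrite E En /mark eqxx.
have Kn : K.+1 < n.
  by rewrite ltn_neqAle nK andbT; apply/eqP => E; rewrite -E /= oK in on.
rewrite [LHS]surjective_pairing (answer_mark lg tp') ?size_mkseq ?gtn_eqF //.
rewrite /mark !gtn_eqF // (sgE n on Kn _).1 // => m m1 _; exact: Yn.
Qed.

Let phi1_follows sg x : @legal closed_game true sg -> follows true (phi true sg) x ->
  exists2 x', @follows closed_game true sg x' & forall n, (x' n).1 = x n.
Proof.
move=> lg fx'; have [px fx] := fx'.
have oK : odd K = false by exact: negbTE.
set q0 := mkseq x K.+1.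
have sq0 : size q0 = K.+1 by rewrite size_mkseq.
pose W : set pos := [set u | exists X, answer (ask sg) q0 u X].
pose R : set pos := [set q | [/\ ext q0 q, tr q & force (@tr G) W true q]].
pose X : set pos := [set q | [/\ ext q0 q, tr q & ~ force (@tr G) W true q]].
pose Y := (ask sg (lft X set0 q0)).2.
have phiE n : K < n -> phi true sg (mkseq x n) =
   guard (mkseq x n)
    (if `[< hits W (mkseq x n) >] then
       (ask sg (lft (pick_answer (ask sg) q0 (first_hit W (mkseq x n)))
         (cone (first_hit W (mkseq x n))) (mkseq x n))).1
     else if `[< hits R (mkseq x n) >] then
       force_move (@tr G) W true (first_hit R (mkseq x n)) (mkseq x n)
     else (ask sg (lft X Y (mkseq x n))).1).
  by move=> Kn; rewrite /= /phi1 size_mkseq leqNgt Kn /= take_mkseq.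
have [[n Wn]|nW] := pselect (exists n, W (mkseq x n)).
  have [m mn [Wm mP]] := first_time Wn.
  pose Z := pick_answer (ask sg) q0 (mkseq x m).
  have : answer (ask sg) q0 (mkseq x m) Z.
    by rewrite /Z /pick_answer; case: pselect => [e|[]] //; case: (cid e).
  move=> [qZ]; rewrite size_mkseq => Km eu [Zu nu] aE.
  apply: (follows_cone lg px fx' qZ _ Zu nu) => //.
  - exact: ext_mkseq.
  - by rewrite oK.
  - move=> _; rewrite askE in aE; first by rewrite aE nth_mkseq.
    exists Z, set0, q0; split=> //; split; rewrite ?sq0 ?ltnn //; first exact: px.
    by rewrite take_oversize ?sq0.
  - move=> i oi Ki mi; rewrite phiE ?(ltnW Ki) // asboolT; last first.
      by apply/hits_mkseq; exists m.
    by rewrite (@first_hit_mkseq _ W x m).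
have nhW n : `[< hits W (mkseq x n) >] = false.
  by apply/asboolP => /hits_mkseq[m _ Wm]; apply: nW; exists m.
have nR n : ~ R (mkseq x n).
  move=> Rn; have [m mn [[em Xm fm] mP]] := first_time Rn.
  apply: nW; apply: (@force_moveP G (@tr G) W true (mkseq x m) x) => //.
    by rewrite size_mkseq.
  rewrite size_mkseq => i mi oi Xi Xa; have Ki : K < i.
    by apply: leq_trans mi; have := ext_size em; rewrite !size_mkseq.
  rewrite fx // phiE // nhW asboolT; last by apply/hits_mkseq; exists m.
  by rewrite (@first_hit_mkseq _ R x m) // guardE.
have nhR n : `[< hits R (mkseq x n) >] = false.
  by apply/asboolP => /hits_mkseq[m _ Rm]; apply: (nR m).
have Xn n : K < n -> X (mkseq x n).
  move=> Kn; have e : ext q0 (mkseq x n) by exact: ext_mkseq.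
  by split=> // f; apply: (nR n).
have qX : quasi q0 X.
  split; first exact: Xn.
  - by move=> q [].
  - move=> q [eq tq nf] oq; apply: contrapT => h; apply: nf.
    apply: force_opp; first exact: negbTE.
    move=> a ta; apply: contrapT => na; apply: h; exists a; split=> //.
    exact: ext_rcons.
  - move=> q a [eq tq nf] oq ta; split=> //; first exact: ext_rcons.
    by move=> fa; apply: nf; apply: (force_own (a := a)).
have tq0 : tr' (lft X set0 q0).
  exists X, set0, q0; split=> //; split; rewrite ?sq0 ?ltnn //; first exact: px.
  by rewrite take_oversize ?sq0.
have oq0 : odd (size q0) = true by rewrite sq0 /= oK.
have YE : Y = (sg (lft X set0 q0)).2 by rewrite /Y askE.
have xK : (sg (lft X set0 q0)).1 = x K.+1.
  rewrite fx /= ?oK // -/(phi true) phiE // nhW nhR.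
  rewrite (lft_eq2 X Y set0) ?size_mkseq // askE // guardE //.
  by have [X' [Y' [_ _ []]]] := legal_mv lg tq0 oq0.
have [oY YK] : opt X (mkseq x K.+2) Y /\ Y (mkseq x K.+2).
  have [X' [Y' [EY /lft_inj[_ + _] [_ _]]]] := legal_mv lg tq0 oq0.
  rewrite sq0 => /(_ (ltnSn _)) <-; rewrite xK -mkseqS size_mkseq.
  move=> /(_ (ltnSn _))[]; rewrite !take_mkseq // => o /(_ K.+2 (ltnSn _) (leqnn _)).
  rewrite take_mkseq //; have EYY : Y' = Y by rewrite YE EY /mark sq0 eqxx eqn_leq ltnn.
  by rewrite EYY in o *.
(* Against this [X] no exit is named: it would lie in [W], yet [W] cannot be forced from any
   position of [X]. *)
have {}oY : opt2 X (mkseq x K.+2) Y.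
  case: oY => // -[u [eu Xu nu EY]]; exfalso; have [e0 tu nf] := Xu.
  have Ku : K.+1 < size u by have := ext_size eu; rewrite size_mkseq.
  apply: nf; apply: force_now; exists X; split=> //.
  rewrite askE // [LHS]surjective_pairing xK -YE EY; congr (_, _).
  move: eu; rewrite /ext size_mkseq => eu.
  have : nth d (take K.+2 u) K.+1 = x K.+1 by rewrite eu nth_mkseq.
  by rewrite nth_take.
have sgE n : odd n = true -> K.+1 < n ->
    (forall m, K.+1 < m -> m <= n -> Y (mkseq x m)) ->
    (sg (lft X Y (mkseq x n))).1 = x n /\ Y (mkseq x n.+1).
  move=> on Kn Ym; have Tn := T_mkseq px qX (or_intror oY) Ym.
  have tn' : tr' (lft X Y (mkseq x n)) by exists X, Y, (mkseq x n).
  have on' : odd (size (mkseq x n)) = true by rewrite size_mkseq.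
  have [X' [Y' [_ /lft_inj[_ _]]]] := legal_mv lg tn' on'.
  rewrite size_mkseq => /(_ Kn) <- [ta _]; rewrite size_rcons size_mkseq => h2.
  have Ex : (sg (lft X Y (mkseq x n))).1 = x n.
    by rewrite fx // phiE ?(ltnW Kn) // nhW nhR askE // guardE.
  split=> //; have [_ /(_ n.+1 (leqW Kn) (leqnn _))] := h2 (leqW Kn).
  by rewrite Ex -mkseqS take_mkseq.
have Yn n : K.+1 < n -> Y (mkseq x n).
  elim/ltn_ind: n => n IH; rewrite leq_eqVlt => /predU1P[<-|] //.
  case: n IH => // n IH; rewrite ltnS => Kn.
  case: (boolP (odd n)) => [on|on].
    by apply: (sgE n on Kn _).2 => m m1 m2; exact: IH.
  have [_ _ _ Ye] := oY; rewrite mkseqS; apply: Ye; rewrite ?size_mkseq //.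
    exact: IH.
  by rewrite -mkseqS; apply: Xn; rewrite (ltn_trans _ (leqW Kn)).
apply: (follows_lft (X := X) (Y := Y)) => // [n|n on].
  by apply: T_mkseq => //; [right|move=> m m1 _; exact: Yn].
have tp' : tr' (lft X Y (mkseq x n)).
  exists X, Y, (mkseq x n); split=> //.
  by apply: T_mkseq => //; [right|move=> m m1 _; exact: Yn].
have on' : odd (size (mkseq x n)) = true by rewrite size_mkseq.
case: (leqP n K) => nK.
  have lt : n < K.
    by rewrite ltn_neqAle nK andbT; apply/eqP => E; rewrite E oK in on.
  have E : lft X Y (mkseq x n) = lft set0 set0 (mkseq x n).
    by apply: lft_eq1; rewrite size_mkseq.
  rewrite [LHS]surjective_pairing (answer_mark lg tp') ?size_mkseq ?ltn_eqF //.
    by rewrite E -(low_phi lg) ?size_mkseq // -fx // /mark !ltn_eqF // leqW.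
case: (ltngtP n K.+1) => [|Kn|En]; first by rewrite ltnS leqNgt nK.
  rewrite [LHS]surjective_pairing (answer_mark lg tp') ?size_mkseq ?gtn_eqF //.
  rewrite /mark !gtn_eqF // (sgE n on Kn _).1 // => m m1 _; exact: Yn.
rewrite En (lft_eq2 X Y set0) ?size_mkseq //.
by rewrite [LHS]surjective_pairing xK -YE /mark eqxx eqn_leq ltnn.
Qed.

Definition closed_covering : covering K closed_game G.
Proof.
refine (@Covering K closed_game G fst phi tr'_fst _ _ _ _ _ _).
- move=> p tp sp; exists (lft set0 set0 p); last exact: lft_fst.
  exact: low_tr'.
- move=> _ _ [X [Y [p [-> _]]]] [X' [Y' [p' [-> _]]]].
  by rewrite size_lft !lft_fst => sp <-; exact: lft_eq1.
- by move=> b s _; exact: phi_legal.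
- by move=> b n s1 s2 _ _; exact: phi_agree.
- move=> b s p' ls tp'; have [X [Y [p [E [tp _ _]]]]] := tp'.
  rewrite E size_lft lft_fst => op sp; rewrite (low_phi ls) ?(ltnW sp) //.
  by rewrite (lft_eq1 X Y set0 set0) // ltnW.
- by case=> s x ls fx; [exact: phi1_follows|exact: phi0_follows].
Defined.

End Closed.

(** * Determinacy *)

Definition unravels (G : game) (B : set (nat -> mv G)) : Prop := forall K,
  exists (G' : game) (c : covering K G' G), forall x', play x' -> exists n,
  forall y', play y' -> mkseq y' n = mkseq x' n ->
  (B (cpi c \o x') <-> B (cpi c \o y')).

Lemma unravels_open G (B : set (nat -> mv G)) :
  (forall x, B x -> exists n, forall y, mkseq y n = mkseq x n -> B y) ->
  unravels B.
Proof.
(* Rounded up to an even number, because the move with index [K] must belong to player [false]. *)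
move=> Bo K0; pose K := K0 + odd K0.
have Ke : ~~ odd K by rewrite /K oddD oddb addbb.
pose TA : set (seq (mv G)) := [set p | exists2 y, ~ B y & p = mkseq y (size p)].
have TAp n p : TA p -> TA (take n p).
  move=> [y nB E]; exists y => //; rewrite E size_take size_mkseq.
  case: ltnP => lt; first by rewrite take_mkseq // ltnW.
  by rewrite take_oversize // size_mkseq.
have TAB (x : nat -> mv G) : (forall m, TA (mkseq x m)) <-> ~ B x.
  split=> [h Bx|nB m]; last by exists x; rewrite ?size_mkseq.
  have [n nP] := Bo _ Bx; have [y nBy E] := h n; apply/nBy/nP.
  by rewrite E size_mkseq.
exists (closed_game TA Ke); exists (covering_le (leq_addr (odd K0) K0) (closed_covering TA Ke)).
move=> x' px; have [n nP] := closed_game_clopen TAp px; exists n => y' py E.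
have := nP y' py E; rewrite /= !TAB => -[h1 h2].
by split=> h; apply: contrapT => nh; [apply: (h2 nh)|apply: (h1 nh)].
Qed.

(* Quantifying over all games that map to the space of plays makes the property
   stable under countable unions: the sets are unravelled one after the other. *)
Definition unravelable (A : Type) (B : set (nat -> A)) : Prop :=
  forall (G : game) (r : mv G -> A), unravels [set x | B (r \o x)].

Section Unravelable.
Variable A : Type.
Implicit Types B : set (nat -> A).

Lemma unravelable_open B :
  (forall x, B x -> exists n, forall y, mkseq y n = mkseq x n -> B y) ->
  unravelable B.
Proof.
move=> Bo G r; apply: unravels_open => x /Bo[n nP]; exists n => y E; apply: nP.
by apply/mkseq_eq => i lt /=; move/mkseq_eq: E => ->.
Qed.

Lemma unravelable_setC B : unravelable B -> unravelable (~` B).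
Proof.
move=> uB G r K; have [G' [c cP]] := uB G r K; exists G', c => x' px.
have [n nP] := cP _ px; exists n => y' py E; have [h1 h2] := nP _ py E.
by split=> h h'; apply: h; [exact: h2|exact: h1].
Qed.

(** Unravelling [B i] with the bound [K + i] freezes ever longer positions, so the inverse limit
    exists. There every [B i] is clopen, the union is open, and one further unravelling finishes. *)
Lemma unravelable_bigcup (B : nat -> set (nat -> A)) :
  (forall i, unravelable (B i)) -> unravelable (\bigcup_i B i).
Proof.
move=> uB G r K.
pose st := {G : game & mv G -> A}.
pose ok i (s s' : st) (c : covering (K + i) (projT1 s') (projT1 s)) :=
  projT2 s' = projT2 s \o cpi c /\ forall x', play x' -> exists n,
    forall y', play y' -> mkseq y' n = mkseq x' n ->
    (B i (projT2 s' \o x') <-> B i (projT2 s' \o y')).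
have [||s sP] := @dep_choice (fun=> st)
    (fun i s => forall e : 0 = i, s = existT _ G r)
    (fun i s s' => exists c, @ok i s s' c).
- by exists (existT _ G r).
- move=> i [Gi ri] _; have [G' [c cP]] := uB i Gi ri (K + i).
  by exists (existT _ G' (ri \o cpi c)); split=> //; exists c.
have s0 : s 0 = existT _ G r by have [/(_ erefl)] := sP 0.
have cs i : {c | @ok i (s i) (s i.+1) c} by apply: cid; exact: (sP i).2.
pose c i := sval (cs i); pose L := limit_game c.
pose rl : mv L -> A := fun a => projT2 (s 0) (a 0).
have rlE i (x : nat -> mv L) n : play x -> rl (x n) = projT2 (s i) (x n i).
  move=> px; elim: i => // i ->; have [-> _] := svalP (cs i).
  have [_ /(_ i)] := px n.+1.
  by rewrite mkseqS !map_rcons => /rcons_inj[_ <-].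
have clop i (x : nat -> mv L) : play x -> exists n, forall y : nat -> mv L, play y ->
    mkseq y n = mkseq x n -> (B i (rl \o x) <-> B i (rl \o y)).
  move=> px; have [_ h] := svalP (cs i).
  have prP (z : nat -> mv L) : play z -> play (fun n => z n i.+1).
    by move=> pz n; have [/(_ i.+1)] := pz n; rewrite /mkseq -map_comp.
  have prE (z : nat -> mv L) : play z -> rl \o z = projT2 (s i.+1) \o (fun n => z n i.+1).
    by move=> pz; apply/funext => n; exact: rlE.
  have [n nP] := h _ (prP _ px); exists n => y py E; rewrite !prE //.
  apply: nP; first exact: prP.
  by apply/mkseq_eq => j jn; move/mkseq_eq: E => ->.
suff : exists (G' : game) (c' : covering K G' (projT1 (s 0))),
    forall x', play x' -> exists n, forall y', play y' -> mkseq y' n = mkseq x' n ->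
    ((\bigcup_i B i) (projT2 (s 0) \o (cpi c' \o x')) <->
     (\bigcup_i B i) (projT2 (s 0) \o (cpi c' \o y'))) by rewrite s0.
(* [unravels_open] asks for openness among all sequences of moves. [O] has it, and coincides with
   the union on plays. *)
pose O : set (nat -> mv L) := [set x | exists n, forall y : nat -> mv L, play y ->
  mkseq y n = mkseq x n -> exists i, B i (rl \o y)].
have Oo : unravels O.
  apply: unravels_open => x [n nP]; exists n => y E; exists n => z pz Ez.
  by apply: nP => //; rewrite Ez.
have OE (x : nat -> mv L) : play x -> (O x <-> (\bigcup_i B i) (rl \o x)).
  move=> px; split=> [[n /(_ x px erefl)[i Bi]]|[i _ Bi]]; first by exists i.
  have [n nP] := clop i x px; exists n => y py E; exists i.
  by have [h _] := nP y py E; exact: h.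
have [G' [c' c'P]] := Oo K; exists G', (covering_comp c' (limit_covering c)) => x' px.
have pz (z : nat -> mv G') : play z -> play (cpi c' \o z).
  by move=> pz n; rewrite /mkseq map_comp; apply: c_tr; exact: pz.
have [n nP] := c'P x' px; exists n => y' py E.
by have := nP y' py E; rewrite !OE; try exact: pz.
Qed.

(** In the covering game finite positions decide the payoff, so the argument of Gale and Stewart
    applies: either [false] forces a deciding position, or [true] can stay forever where that is
    impossible. [cphi] and [c_follows] bring the strategy and its plays back to the sequences over
    [A]. *)
Lemma unravelable_determined (a0 : A) B : unravelable B ->
  (exists s : seq A -> A, forall x, (forall n, ~~ odd n -> x n = s (mkseq x n)) -> B x) \/
  (exists s : seq A -> A, forall x, (forall n, odd n -> x n = s (mkseq x n)) -> ~ B x).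
Proof.
move=> uB.
have te (p : seq A) : True -> exists a : A, True by exists a0.
pose G := @Game A (fun=> True) I (fun _ _ _ => I) te.
have [G' [c cP]] := uB G id 0.
pose W : set (seq (mv G')) := [set p | forall x', play x' ->
  mkseq x' (size p) = p -> B (cpi c \o x')].
have Wopen x' : play x' -> B (cpi c \o x') -> exists n, W (mkseq x' n).
  move=> px Bx; have [n nP] := cP x' px; exists n => y' py; rewrite size_mkseq => E.
  exact: (nP y' py E).1.
have [f|nf] := pselect (force (@tr G') W false [::]).
  left; pose s p := guard p (force_move (@tr G') W false [::] p).
  have ls : legal false s by move=> p tp _; exact: guardP.
  exists (cphi c false s) => x fx.
  have [|x' [px fx'] E] := @c_follows _ _ _ c false s x ls.
    by split=> // n /negbT; exact: fx.
  suff : B (cpi c \o x') by have -> : cpi c \o x' = x by apply/funext => n; exact: E.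
  have [||||n Wn] := @force_moveP G' (@tr G') W false [::] x' _ _ f px => //.
  - exact: tr_nil.
  - by move=> n _ on tn ta; rewrite fx' // /s guardE.
  - by apply: Wn => //; rewrite size_mkseq.
right; pose s p := if pselect (exists2 a, tr (rcons p a) & ~ force (@tr G') W false (rcons p a))
  is left e then s2val (cid2 e) else child p.
have ls : legal true s.
  move=> p tp _; rewrite /s; case: pselect => [e|_]; last exact: childP.
  by case: (cid2 e).
exists (cphi c true s) => x fx Bx.
have [|x' [px fx'] E] := @c_follows _ _ _ c true s x ls; first by split.
have Ex : cpi c \o x' = x by apply/funext => n; exact: E.
have [|n Wn] := Wopen x' px; first by rewrite Ex.
suff : ~ force (@tr G') W false (mkseq x' n) by apply; exact: force_now.
elim: n {Wn} => [|n IH] //; case: (boolP (odd n)) => on; last first.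
  move=> f; apply: IH; apply: (force_own (a := x' n)); rewrite -?mkseqS //.
  by rewrite size_mkseq; exact: negbTE.
rewrite mkseqS fx' // /s; case: pselect => [e|ne _]; first by case: (cid2 e).
apply: IH; apply: force_opp; rewrite ?size_mkseq // => a ta.
by apply: contrapT => na; apply: ne; exists a.
Qed.

End Unravelable.

(** * Regions around the ends *)

Definition card_set (T : choiceType) (X : set T) : nat := #|` fset_set X|%fset.

Lemma card_sub (T : choiceType) (X Y : set T) : finite_set Y -> X `<=` Y -> card_set X <= card_set Y.
Proof.
move=> fY XY; have fX := sub_finite_set XY fY.
by rewrite /card_set fsubset_leq_card // -fset_set_sub.
Qed.

Lemma card_lt (T : choiceType) (X Y : set T) v : finite_set Y -> X `<=` Y -> Y v -> ~ X v ->
  card_set X < card_set Y.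
Proof.
move=> fY XY Yv nXv; have fX := sub_finite_set XY fY.
apply: fproper_ltn_card; rewrite fproperE; apply/andP; split.
  by rewrite -fset_set_sub.
by apply/negP; rewrite -fset_set_sub // => /(_ _ Yv).
Qed.

Lemma card_modular (T : choiceType) (X Y X' Y' : set T) : finite_set X -> finite_set Y ->
  X' `|` Y' `<=` X `|` Y -> X' `&` Y' `<=` X `&` Y ->
  card_set X' + card_set Y' <= card_set X + card_set Y.
Proof.
move=> fX fY hU hI; have fU : finite_set (X `|` Y) by rewrite finite_setU.
have fU' := sub_finite_set hU fU.
have [fX' fY'] : finite_set X' /\ finite_set Y' by move: fU'; rewrite finite_setU.
rewrite /card_set -cardfsUI -[leqRHS]cardfsUI -!fset_setU // -!fset_setI //.
by apply: leq_add; apply: card_sub => //; apply: finite_setIl.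
Qed.

Section Graph.
Variable G : graph.
Let V := vertex G.
Implicit Types (u v x y z b : V) (S U X Y Z C D : set V) (w : graph_end G).

Definition nb X : set V := [set v | ~ X v /\ exists2 u, X u & adj u v].

Lemma adjC u v : adj u v -> adj v u.
Proof. by case=> e [[? ?]|[? ?]]; exists e; [right|left]. Qed.

Lemma nb_sub X u v : X u -> adj u v -> (X `|` nb X) v.
Proof.
move=> Xu uv; have [Xv|nXv] := pselect (X v); first by left.
by right; split=> //; exists u.
Qed.

Lemma cl_sub X Y : X `<=` Y -> X `|` nb X `<=` Y `|` nb Y.
Proof.
move=> XY v [/XY|[_ [u Xu uv]]]; first by left.
exact: nb_sub (XY _ Xu) uv.
Qed.

Lemma linked_stay S X u v : X u -> nb X `<=` S -> linked S u v -> X v.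
Proof.
move=> Xu nS; elim=> // {}v x _ Xv vx nSx.
by have [//|/nS] := nb_sub Xv vx.
Qed.

Lemma component_nb S C : component S C -> nb C `<=` S.
Proof.
move=> cC v [nCv [u Cu uv]]; apply: contrapT => nSv; apply: nCv.
case: cC Cu => a nSa -> au; exact: linkedS au uv nSv.
Qed.

Lemma component_notin S C v : component S C -> C v -> ~ S v.
Proof. by case=> u _ -> /linked_notinr. Qed.

Lemma component_ex S C : component S C -> exists v, C v.
Proof. by case=> u nSu ->; exists u; exact: linked0. Qed.

Lemma component_of S u : ~ S u -> component S (linked S u).
Proof. by move=> nSu; exists u. Qed.

Lemma component_sub S C v : component S C -> C v -> C = linked S v.
Proof.
move=> cC Cv; apply: (component_eq cC (component_of (component_notin cC Cv)) Cv).
exact/linked0/(component_notin cC Cv).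
Qed.

Lemma component_within S C u v : component S C -> C u -> C v -> linked (~` C) u v.
Proof.
move=> cC Cu /(component_linked cC Cu); elim=> [_|{}v x ux IH vx nx].
  by apply: linked0; apply.
have Cx := Defs.component_closed cC Cu (linkedS ux vx nx).
by apply: linkedS IH vx _; apply.
Qed.

(** * Where ends live *)

Lemma lives_sub w X Y : X `<=` Y -> lives_in w X -> lives_in w Y.
Proof. by move=> XY wX r wr; have [N NP] := wX r wr; exists N => n /NP /XY. Qed.

Lemma lives_setI w X Y : lives_in w X -> lives_in w Y -> lives_in w (X `&` Y).
Proof.
move=> wX wY r wr; have [N NP] := wX r wr; have [M MP] := wY r wr.
by exists (maxn N M) => n; rewrite geq_max => /andP[/NP ? /MP].
Qed.

Lemma lives_ex w X : lives_in w X -> exists v, X v.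
Proof.
have [r wr] := end_nonempty w; move=> /(_ r wr)[N NP].
by exists (r N); exact: NP.
Qed.

Lemma end_comp_component S w : finite_set S -> component S (end_component S w).
Proof. by move=> fS; have [C [cC _ ->]] := end_componentP w fS. Qed.

Lemma end_comp_lives S w : finite_set S -> lives_in w (end_component S w).
Proof. by move=> fS; have [C [_ wC ->]] := end_componentP w fS. Qed.

Arguments end_comp_lives [S] w _.

Lemma end_comp_sub S w X : finite_set S -> nb X `<=` S -> lives_in w X ->
  end_component S w `<=` X.
Proof.
move=> fS nS wX v Cv.
have [u [Cu Xu]] := lives_ex (lives_setI (end_comp_lives w fS) wX).
exact: linked_stay Xu nS (component_linked (end_comp_component w fS) Cu Cv).
Qed.

Lemma lives_dich w X : finite_set (nb X) ->
  lives_in w X \/ lives_in w (~` (X `|` nb X)).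
Proof.
move=> fX; have cC := end_comp_component w fX; have wC := end_comp_lives w fX.
have [u Cu] := component_ex cC.
have [Xu|nXu] := pselect (X u); [left|right]; apply: lives_sub wC => v Cv.
  exact: linked_stay Xu (fun _ h => h) (component_linked cC Cu Cv).
move=> [Xv|]; last exact: component_notin cC Cv.
by apply: nXu; apply: linked_stay Xv (fun _ h => h) (component_linked cC Cv Cu).
Qed.

(** As [linked] walks avoid their parameter, components of the complement of [U] are those of the
    subgraph induced by [U]. A tail of one ray stays in a single one of them, and its finite
    boundary forces the whole end to live there. *)
Lemma lives_component w U : lives_in w U ->
  (forall Y, component (~` U) Y -> finite_set (nb Y)) ->
  exists2 Y, component (~` U) Y & lives_in w Y.
Proof.
move=> wU fU; have [r wr] := end_nonempty w; have [N NP] := wU r wr.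
have cY : component (~` U) (linked (~` U) (r N)).
  by apply: component_of; apply; exact: NP.
exists (linked (~` U) (r N)) => //.
have rY n : N <= n -> linked (~` U) (r N) (r n).
  elim: n => [|n IH]; first by rewrite leqn0 => /eqP E; rewrite E in NP *; apply: linked0 => /(_ (NP _ _))[].
  rewrite leq_eqVlt => /predU1P[<-|]; first by apply: linked0 => /(_ (NP _ (leqnn _))).
  rewrite ltnS => Nn; apply: linkedS (IH Nn) (ray_adj r n) _ => /(_ (NP _ _)).
  by apply; exact: leqW.
have [//|wn] := lives_dich w (fU _ cY).
have [M MP] := wn r wr; exfalso; apply: (MP (maxn N M)); first exact: leq_maxr.
by left; apply: rY; exact: leq_maxl.
Qed.

(** * Undominated ends *)

Lemma linked_is_path S u v : linked S u v ->
  exists p, [/\ is_path u p, last u p = v & forall x, x \in p -> ~ S x].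
Proof.
move=> uv; have [p [pp lp np]] : exists p, [/\ path (fun x y => `[< adj x y >]) u p,
    last u p = v & forall x, x \in p -> ~ S x].
  elim: uv => [nu|{}v x _ [p [pp lp np]] vx nx]; first by exists [::].
  exists (rcons p x); rewrite rcons_path pp lp last_rcons /=; split=> //.
    by apply/asboolP.
  by move=> y; rewrite mem_rcons inE => /predU1P[->|/np].
case/shortenP: pp lp np => p' pp' up' sp' lp np; exists p'; split=> //.
by move=> x /sp'; exact: np.
Qed.

(** If no finite set separates [v] from the end, paths from [v] to a ray can be chosen one after the
    other, each avoiding all earlier vertices except [v]; they show that [v] dominates the end. *)
Lemma undominated_separated w v : ~ dominates v w ->
  exists S, [/\ finite_set S, ~ S v & ~ end_component S w v].
Proof.
move=> nd; apply: contrapT => h; apply: nd.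
have [r wr] := end_nonempty w; exists r => //.
pose ok (s : seq V) p := [/\ is_path v p, p != [::], exists n, last v p = r n &
  forall x, x \in p -> x \in s -> x = v].
have step (s : seq V) : exists p, ok s p.
  pose S : set V := [set x | x \in s /\ x <> v].
  have fS : finite_set S by apply: sub_finite_set (finite_seq s) => x [].
  have Cv : end_component S w v.
    by apply: contrapT => nC; apply: h; exists S; split=> // -[].
  have [N NP] := end_comp_lives w fS r wr.
  (* A target other than [v] makes the path nontrivial, which is why the chosen paths are pairwise
     distinct. *)
  have [n Nn rn] : exists2 n, N <= n & r n <> v.
    have [E|nE] := pselect (r N = v); last by exists N.
    by exists N.+1; rewrite ?leqW // -E => /ray_inj /esym /n_Sn.
  have [p [pp lp np]] := linked_is_path
    (component_linked (end_comp_component w fS) Cv (NP n Nn)).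
  exists p; split=> //; [|by exists n|].
    by apply: contra_notN rn => /eqP E; rewrite -lp E.
  by move=> x xp xs; apply: contrapT => xv; apply: (np x xp).
have [f fP] := choice step.
pose F := fix F n : seq V := if n is m.+1 then F m ++ (v :: f (F m)) else [::].
have FS m n : m < n -> forall x, x \in v :: f (F m) -> x \in F n.
  elim: n => // n IH; rewrite ltnS leq_eqVlt => /predU1P[->|/IH h'] x xm.
    by rewrite /= mem_cat xm orbT.
  by rewrite /= mem_cat h'.
have disj m n x : m < n -> x \in v :: f (F m) -> x \in v :: f (F n) -> x = v.
  move=> mn xm; rewrite inE => /predU1P[//|xn].
  have [_ _ _] := fP (F n); apply => //; exact: FS mn _ xm.
have inj m n : m < n -> f (F m) <> f (F n).
  move=> mn E; have [[_ up] ne _ _] := fP (F n); case Ef : (f (F n)) ne up => [|x p] // _.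
  have xv : x = v by apply: (disj m n x mn); rewrite ?E Ef !inE eqxx orbT.
  by rewrite xv /= inE eqxx.
exists [set f (F n) | n in setT]; split.
- move=> fin; apply: infinite_nat.
  have : finite_set ((fun n => f (F n)) @^-1` [set f (F n) | n in setT]).
    apply: finite_preimage => // m n _ _ E; apply/eqP.
    case: ltngtP => // mn; exfalso; [exact: (inj m n mn)|exact: (inj n m mn)].
  by apply: sub_finite_set => n _; exists n.
- by move=> _ [n _ <-]; have [? _ ? _] := fP (F n).
- move=> _ _ [m _ <-] [n _ <-] ne x xm xn.
  case: (ltngtP m n) => mn; [exact: disj mn xm xn|exact: disj mn xn xm|].
  by rewrite mn in ne.
Qed.

(** A set [T] separating [v] from the end does not contain [v], so [v] is not in the neighbourhood
    of the component either, as that lies in [T]. The finitely many vertices are treated in turn. *)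
Lemma undominated_avoid w X : undominated w -> finite_set X ->
  exists2 S, finite_set S &
    (end_component S w `|` nb (end_component S w)) `&` X `<=` set0.
Proof.
move=> uw /finite_seqP[s ->]; elim: s => [|v s [S fS SP]].
  by exists set0 => // v [].
have [T [fT nTv nCv]] := undominated_separated (uw v).
have fU : finite_set (S `|` T) by rewrite finite_setU.
have cU := end_comp_component w fU; have wU := end_comp_lives w fU.
have sub S' : finite_set S' -> S' `<=` S `|` T ->
    end_component (S `|` T) w `<=` end_component S' w.
  move=> fS' sS; apply: end_comp_sub => //; last exact: end_comp_lives.
  by apply: subset_trans sS; apply: component_nb; exact: end_comp_component.
exists (S `|` T) => // x [cx /= xs]; move: xs cx; rewrite /mkset inE => /predU1P[->|xs] cx.
  case: cx => [/(sub T fT (@subsetUr _ _ _))//|[_ [y Cy yv]]].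
  have [//|] := nb_sub (sub T fT (@subsetUr _ _ _) _ Cy) yv.
  by move=> /(component_nb (end_comp_component w fT)).
by apply: (SP x); split=> //; apply: cl_sub cx; exact: sub.
Qed.

(** * Disjoint regions around the ends in Psi *)

Lemma nbU X Y : nb (X `|` Y) `<=` nb X `|` nb Y.
Proof.
move=> v [nv [u [Xu|Yu] uv]]; [left|right]; split; try (by exists u).
  by move=> h; apply: nv; left.
by move=> h; apply: nv; right.
Qed.

Lemma nbI X Y : nb (X `&` Y) `<=` nb X `|` nb Y.
Proof.
move=> v [nv [u [Xu Yu] uv]].
have [Xv|nX] := nb_sub Xu uv; last by left.
have [Yv|nY] := nb_sub Yu uv; last by right.
by case: nv.
Qed.

Lemma nbD X Y v : nb (X `\` (Y `|` nb Y)) v -> ~ Y v /\ (nb X `|` nb Y) v.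
Proof.
move=> [nv [u [Xu nYu] uv]]; have nYv : ~ Y v.
  by move=> Yv; apply: nYu; apply: nb_sub Yv (adjC uv).
split=> //; have [Xv|nX] := nb_sub Xu uv; last by left.
by right; apply: contrapT => nn; apply: nv; split=> // -[].
Qed.

(** Submodularity of the vertex boundary, for uncrossing two sets that share the end in question. *)
Lemma nbUI X Y : finite_set (nb X) -> finite_set (nb Y) ->
  card_set (nb (X `|` Y)) + card_set (nb (X `&` Y)) <=
  card_set (nb X) + card_set (nb Y).
Proof.
move=> fX fY; apply: card_modular => // [v [/nbU|/nbI]//|v].
move=> [[nv _] [_ [u [Xu Yu] uv]]]; split; split; try (by exists u).
  by move=> h; apply: nv; left.
by move=> h; apply: nv; right.
Qed.

(** The companion inequality, for uncrossing two sets that surround different ends; removing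
    closures keeps the new boundaries inside the old ones. *)
Lemma nbDD X Y : finite_set (nb X) -> finite_set (nb Y) ->
  card_set (nb (X `\` (Y `|` nb Y))) + card_set (nb (Y `\` (X `|` nb X))) <=
  card_set (nb X) + card_set (nb Y).
Proof.
move=> fX fY; apply: card_modular => // [v [/nbD[]//|/nbD[_ []]]|v]; [by right|by left|].
move=> [XY YX]; have [nY _] := nbD XY; have [nX _] := nbD YX.
by move: XY YX => [_ [u [Xu _] uv]] [_ [u' [Yu' _] uv']]; split; split=> //;
  [exists u|exists u'].
Qed.

(** * Uncrossing: pairwise disjoint regions with finite boundaries around the ends *)

Section Cover.
Variables (Psi : set (graph_end G)) (D : set V).

Definition small_around w Z : Prop :=
  [/\ finite_set (nb Z), Z `|` nb Z `<=` D & lives_in w Z].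

Definition tight Y w : Prop :=
  forall Z, small_around w Z -> card_set (nb Y) <= card_set (nb Z).

Definition tight_family k U : Prop := forall Y, component (~` U) Y ->
  [/\ finite_set (nb Y), card_set (nb Y) <= k, Y `|` nb Y `<=` D &
      exists w, [/\ Psi w, lives_in w Y & tight Y w]].

(** A component of the union is an increasing union of components at the stages. More than [k] of
    its boundary vertices would already be boundary vertices at a single stage, so the boundary has
    at most [k] elements and is contained in that of one stage, whose end then serves. *)
Lemma tight_family_chain k (F : set (set V)) : F !=set0 -> total_on F subset ->
  (forall U, F U -> tight_family k U) -> tight_family k (\bigcup_(U in F) U).
Proof.
move=> [U0 FU0] tot hF Y cY; have [v0 Yv0] := component_ex cY.
have YE := component_sub cY Yv0.
have [U1 FU1 U1v] : exists2 U, F U & U v0.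
  by have /contrapT[U ? ?] := component_notin cY Yv0; exists U.
pose W U := linked (~` U) v0.
have WS U U' : U `<=` U' -> W U `<=` W U'.
  by move=> h z; apply: linked_sub; exact: subsetC.
have WY U : F U -> W U `<=` Y.
  move=> FU z; rewrite YE; apply: linked_sub; apply: subsetC.
  by move=> ? ?; exists U.
have YW z : Y z -> exists U, [/\ F U, U v0 & W U z].
  rewrite YE; elim=> [nv|{}z x _ [U [FU Uv Wz]] zx nx].
    by exists U1; split=> //; apply: linked0; apply.
  have /contrapT[U' FU' U'x] := nx.
  have [UU'|U'U] := tot U U' FU FU'.
    exists U'; split=> //; first exact: UU'.
    by apply: linkedS zx _; [exact: WS Wz|apply].
  by exists U; split=> //; apply: linkedS Wz zx _; apply; exact: U'U.
have nbW (s : seq V) : {subset s <= nb Y} -> exists U, [/\ F U, U v0 & {subset s <= nb (W U)}].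
  elim: s => [|x s IH] h; first by exists U1.
  have [|U [FU Uv sU]] := IH; first by move=> z zs; apply: h; rewrite inE zs orbT.
  have : x \in nb Y by apply: h; rewrite inE eqxx.
  rewrite inE => -[nx [y Yy yx]]; have [U' [FU' U'v Wy]] := YW _ Yy.
  have mono U'' z : F U'' -> ~ Y z -> forall U3, U3 `<=` U'' -> nb (W U3) z -> nb (W U'') z.
    move=> FU'' nz U3 s3 [_ [a Wa az]]; split; first by move/(WY _ FU'').
    by exists a => //; exact: WS Wa.
  have sub U'' : F U'' -> U `<=` U'' -> U' `<=` U'' -> {subset x :: s <= nb (W U'')}.
    move=> FU'' h1 h2 z; rewrite inE => /predU1P[->|zs]; rewrite inE.
      split; first by move/(WY _ FU'').
      by exists y => //; exact: WS Wy.
    have /sU := zs; rewrite inE; apply: mono => //.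
    have /h : z \in x :: s by rewrite inE zs orbT.
    by rewrite inE => -[].
  have [UU'|U'U] := tot U U' FU FU'.
    by exists U'; split=> //; apply: sub.
  by exists U; split=> //; apply: sub.
have cW U : F U -> U v0 -> component (~` U) (W U).
  by move=> _ Uv; apply: component_of; apply.
have fin : finite_set (nb Y).
  apply: contrapT => /(infinite_set_fset k.+1)[B BY kB].
  have [|U [FU Uv sU]] := nbW B; first by move=> z zB; rewrite inE; exact: BY.
  have [fW le _ _] := hF U FU _ (cW U FU Uv).
  have leB : (#|` B| <= card_set (nb (W U)))%fset.
    rewrite -[B]set_fsetK; apply: card_sub => // z zB.
    by have := sU z zB; rewrite inE.
  by have := leq_trans kB (leq_trans leB le); rewrite ltnn.
have /finite_seqP[s sE] := fin.
have [|U [FU Uv sU]] := nbW s.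
  by move=> z zs; rewrite inE sE.
have [fW le Wd [w [Pw wW tW]]] := hF U FU _ (cW U FU Uv).
have nbs : nb Y `<=` nb (W U).
  by move=> z; rewrite {1}sE => /= /sU; rewrite inE.
have leY := card_sub fW nbs.
split=> //; first exact: leq_trans leY le.
- move=> z [Yz|nz]; last by apply: Wd; right; exact: nbs.
  have [U' [FU' U'v Wz]] := YW _ Yz.
  by have [_ _ + _] := hF U' FU' _ (cW U' FU' U'v); apply; left.
- exists w; split=> //; first exact: lives_sub (WY _ FU) wW.
  by move=> Z /tW; exact: leq_trans.
Qed.

Definition maximal_family k U : Prop := tight_family k U /\
  forall B, U `<=` B -> tight_family k B -> B `<=` U.

Lemma maximal_family_ex k U0 : tight_family k U0 ->
  exists2 U, U0 `<=` U & maximal_family k U.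
Proof.
move=> t0.
have [F FP tot|A [tA mA]] := @Zorn_bigcup _ [set U | tight_family k (U0 `|` U)].
  rewrite /mkset; have -> : U0 `|` \bigcup_(X in F) X =
      \bigcup_(X in U0 |` [set U0 `|` X | X in F]) X.
    apply/seteqP; split=> [v [Uv|[X FX Xv]]|v [X [->|[X' FX' <-]]]].
    - by exists U0 => //; left.
    - by exists (U0 `|` X); [right; exists X|right].
    - by left.
    - by move=> [?|?]; [left|right; exists X'].
  apply: tight_family_chain; first by exists U0; left.
    move=> _ _ [->|[X FX <-]] [->|[X' FX' <-]].
    - by left.
    - by left; exact: subsetUl.
    - by right; exact: subsetUl.
    - by have [h|h] := tot X X' FX FX'; [left|right]; exact: setUS.
  by move=> U [->//|[X FX <-]]; exact: FP.
exists (U0 `|` A); first exact: subsetUl.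
split=> // B sB tB v Bv; apply: contrapT => nv; apply: (mA (A `|` B)).
  split; first exact: subsetUl.
  by move=> /(_ v (or_intror Bv)) Av; apply: nv; right.
rewrite /= setUA; have -> : U0 `|` A `|` B = B; last by [].
by apply/seteqP; split=> [x [/sB|]//|x Bx]; right.
Qed.

(** Take a neighbourhood of the end with the least boundary and, among these, one whose boundary
    meets [U] least. Uncrossing makes its boundary disjoint from [U]; its component at the end can
    then be added to [U], so by maximality it was there already. *)
Lemma maximal_family_cover k U w Z0 : maximal_family k U -> Psi w ->
  small_around w Z0 -> card_set (nb Z0) <= k ->
  exists2 Y, component (~` U) Y & lives_in w Y.
Proof.
move=> [tU mU] Pw ok0 le0; apply: contrapT => nY.
have {}nY Y : component (~` U) Y -> ~ lives_in w Y.
  by move=> cY wY; apply: nY; exists Y.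
have [m mk [[Z1 ok1 E1] mP]] : exists2 m, m <= k &
    (exists2 Z, small_around w Z & card_set (nb Z) = m) /\
    forall Z, small_around w Z -> m <= card_set (nb Z).
  have e : exists n, `[< exists2 Z, small_around w Z & card_set (nb Z) = n >].
    by exists (card_set (nb Z0)); apply/asboolP; exists Z0.
  case: (ex_minnP e) => m /asboolP[Z okZ EZ] mP; exists m.
    by apply: leq_trans le0; apply: mP; apply/asboolP; exists Z0.
  split; first by exists Z.
  by move=> Z' okZ'; apply: mP; apply/asboolP; exists Z'.
have [n [[Z [okZ leZ EZ]] nP]] : exists n, (exists Z, [/\ small_around w Z,
    card_set (nb Z) <= m & card_set (nb Z `&` U) = n]) /\
    forall Z, small_around w Z -> card_set (nb Z) <= m -> n <= card_set (nb Z `&` U).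
  have e : exists n, `[< exists Z, [/\ small_around w Z,
    card_set (nb Z) <= m & card_set (nb Z `&` U) = n] >].
    by exists (card_set (nb Z1 `&` U)); apply/asboolP; exists Z1; rewrite E1.
  case: (ex_minnP e) => n /asboolP h nP; exists n; split=> // Z okZ leZ.
  by apply: nP; apply/asboolP; exists Z.
have [fZ dZ wZ] := okZ.
have improve Z' v : small_around w Z' -> card_set (nb Z') <= card_set (nb Z) ->
    nb Z' `&` U `<=` nb Z `&` U -> nb Z v -> U v -> ~ nb Z' v -> False.
  move=> ok' le' sub nv Uv nv'; have := nP Z' ok' (leq_trans le' leZ).
  rewrite -EZ leqNgt (card_lt (v := v)) //; first exact: finite_setIl.
  by move=> [].
(* Let [Y] be the component of [U] at a common vertex, tight for [wY]. If [wY] lives in [Z], then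
   the union of [Z] and [Y] beats [Z]; if not, [Z] without the closure of [Y] does. Tightness of [Y]
   bounds the boundary of the set left over by the uncrossing. *)
have nZU : nb Z `&` U `<=` set0.
  move=> v [nv Uv]; have cY : component (~` U) (linked (~` U) v).
    by apply: component_of; apply.
  set Y := linked (~` U) v in cY.
  have Yv : Y v by apply: linked0; apply.
  have [fY _ dY [wY [PwY lY tY]]] := tU _ cY.
  have nYU x : nb Y x -> ~ U x by move=> /(component_nb cY).
  have [lZ|nlZ] := lives_dich wY fZ.
    apply: (improve (Z `|` Y) v) => //.
    - split; last by apply: lives_sub wZ; exact: subsetUl.
        by apply: sub_finite_set (@nbU Z Y) _; rewrite finite_setU.
      by move=> x [[Zx|Yx]|/nbU[nx|nx]]; [apply: dZ; left|apply: dY; left|apply: dZ; right|apply: dY; right].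
    - rewrite -(leq_add2r (card_set (nb Y))); apply: leq_trans (nbUI fZ fY).
      rewrite leq_add2l; apply: tY; split.
      + by apply: sub_finite_set (@nbI Z Y) _; rewrite finite_setU.
      + by apply: subset_trans dY; apply: cl_sub => x [].
      + exact: lives_setI.
    - by move=> x [/nbU[nx|/nYU//] Ux].
    - by move=> [+ _]; apply; right.
  have nlY : lives_in w (~` (Y `|` nb Y)) by have [/(nY _ cY)|] := lives_dich w fY.
  apply: (improve (Z `\` (Y `|` nb Y)) v) => //.
  - split; last exact: lives_setI.
      by apply: (@sub_finite_set _ _ (nb Z `|` nb Y)); [move=> x /nbD[]|rewrite finite_setU].
    by apply: subset_trans dZ; apply: cl_sub => x [].
  - rewrite -(leq_add2r (card_set (nb Y))); apply: leq_trans (nbDD fZ fY).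
    rewrite leq_add2l; apply: tY; split.
    + by apply: (@sub_finite_set _ _ (nb Y `|` nb Z)); [move=> x /nbD[]|rewrite finite_setU].
    + by apply: subset_trans dY; apply: cl_sub => x [].
    + exact: lives_setI.
  - by move=> x [/nbD[_ [nx|/nYU//]] Ux].
  - by move=> /nbD[].
pose C := end_component (nb Z) w.
have cC : component (nb Z) C := end_comp_component w fZ.
have wC : lives_in w C := end_comp_lives w fZ.
have CZ : C `<=` Z by apply: end_comp_sub.
have nC : nb C `<=` nb Z := component_nb cC.
have nCU x : nb C x -> ~ U x by move=> /nC nx Ux; apply: (nZU x).
(* The boundary of [C] avoids [U], so [C] is itself a component after it is added, tight for [w] by
   the minimality of [m]; components disjoint from [C] are unchanged. *)
have sub : U `|` C `<=` U.
  apply: mU; first exact: subsetUl.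
  have stay u : C u -> linked (~` (U `|` C)) u = C.
    move=> Cu; apply/seteqP; split=> x ux.
      by apply: linked_stay Cu _ ux => y ny [/(nCU _ ny)//|]; have [] := ny.
    apply: (@linked_sub _ (~` C)); last exact: component_within cC Cu ux.
    by apply: subsetC; exact: subsetUr.
  move=> Y cY; have [[u [Yu Cu]]|nYC] := pselect (exists u, Y u /\ C u).
    rewrite (component_sub cY Yu) (stay u Cu); split.
    - exact: sub_finite_set nC fZ.
    - exact: leq_trans (card_sub fZ nC) (leq_trans leZ mk).
    - by move=> x [/CZ|/nC] h; apply: dZ; [left|right].
    - exists w; split=> // Z' okZ'; apply: leq_trans (card_sub fZ nC) _.
      exact: leq_trans leZ (mP _ okZ').
  apply: tU; have [v Yv] := component_ex cY.
  have Uv x : Y x -> U x.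
    move=> Yx; have /contrapT[//|Cx] := component_notin cY Yx.
    by exfalso; apply: nYC; exists x.
  exists v; first by apply; exact: Uv.
  rewrite (component_sub cY Yv); apply/seteqP; split=> x; last first.
    by apply: linked_sub; apply: subsetC; exact: subsetUl.
  move=> vx; have : Y x by rewrite (component_sub cY Yv).
  elim: vx => [_ _|{}x y vx IH xy ny Yy]; first by apply: linked0; apply; exact: Uv.
  have Yx : Y x by rewrite (component_sub cY Yv).
  by apply: linkedS (IH Yx) xy _; apply; exact: Uv.
have [||Y cY wY] := @lives_component w U; last exact: nY wY.
- by apply: lives_sub wC => x Cx; apply: sub; right.
- by move=> Y /tU[].
Qed.

Lemma transversal U : exists B, [/\ B `<=` U,
  forall v, U v -> exists2 b, B b & linked (~` U) b v &
  forall b b', B b -> B b' -> linked (~` U) b b' -> b = b'].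
Proof.
pose f v := xget v (linked (~` U) v).
have fP v : U v -> linked (~` U) v (f v).
  by move=> Uv; apply: (xgetPex v); exists v; apply: linked0; apply.
have fE u v : linked (~` U) u v -> f u = f v.
  move=> uv; rewrite /f; have -> : linked (~` U) u = linked (~` U) v.
    apply/seteqP; split=> x h; [apply: linked_trans h; exact: linked_sym|].
    exact: linked_trans h.
  have vv : linked (~` U) v v by apply: linked0; exact: linked_notinr uv.
  by rewrite /xget; case: pselect => // -[]; exists v; apply/asboolP.
exists [set f v | v in U]; split.
- by move=> _ [v Uv <-]; apply: contrapT; exact: linked_notinr (fP v Uv).
- move=> v Uv; exists (f v); first by exists v.
  exact: linked_sym (fP v Uv).
- move=> _ _ [v Uv <-] [v' Uv' <-] h; apply: fE.
  exact: linked_trans (fP v Uv) (linked_trans h (linked_sym (fP v' Uv'))).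
Qed.

Lemma linked_chain (F : nat -> set V) u v : (forall n, F n `<=` F n.+1) ->
  linked (~` (\bigcup_n F n)) u v ->
  exists n, forall m, n <= m -> linked (~` F m) u v.
Proof.
move=> FS; have mono m n x : m <= n -> F m x -> F n x.
  by move=> /subnK <-; elim: (n - m) => // i IH /IH; exact: FS.
elim=> [/contrapT[n _ Fn]|{}v x _ [n nP] vx /contrapT[n' _ Fn']].
  by exists n => m nm; apply: linked0; apply; exact: mono Fn.
exists (maxn n n') => m; rewrite geq_max => /andP[h1 h2].
by apply: linkedS (nP m h1) vx _; apply; exact: mono Fn'.
Qed.

Hypothesis small_ex : forall w, Psi w -> exists Z, small_around w Z.

(** Maximal families for growing bounds cover all ends, but the components of their union may have
    infinite boundary. Cutting each of them into shells between consecutive stages repairs this. *)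
Lemma disjoint_cover : exists U, [/\ U `|` nb U `<=` D,
  forall Y, component (~` U) Y -> finite_set (nb Y) &
  forall w, Psi w -> exists2 Y, component (~` U) Y & lives_in w Y].
Proof.
have tS k U : tight_family k U -> tight_family k.+1 U.
  by move=> t Y /t[? ? ? ?]; split=> //; exact: leqW.
have [||F FP] := @dep_choice (fun=> set V) (fun k U => maximal_family k U)
    (fun _ U U' => U `<=` U').
- have [|U _ mU] := @maximal_family_ex 0 set0; last by exists U.
  by move=> Y cY; have [v /(component_notin cY)] := component_ex cY; case.
- by move=> k U [/tS/maximal_family_ex[U' UU' mU'] _]; exists U'.
have FS n : F n `<=` F n.+1 by have [] := FP n.
have tF n : tight_family n (F n) by have [[]] := FP n.
have [B [BU Bex Buniq]] := transversal (\bigcup_n F n).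
pose K m b := linked (~` F m) b.
have KF m b v : K m b v -> F m b /\ F m v.
  by move=> h; split; apply: contrapT; [exact: linked_notinl h|exact: linked_notinr h].
have Kc m b : F m b -> component (~` F m) (K m b) by move=> Fb; apply: component_of; apply.
have KS m b : K m b `<=` K m.+1 b by move=> v; apply: linked_sub; apply: subsetC; exact: FS.
have Kmono m n b : m <= n -> K m b `<=` K n b.
  by move=> /subnK <- v; elim: (n - m) => // i IH /IH; exact: KS.
have Kfin m b : finite_set (nb (K m b)).
  have [Fb|nFb] := pselect (F m b); first by have [] := tF m _ (Kc m b Fb).
  rewrite (_ : nb _ = set0) //; apply/seteqP; split=> // v [_ [u /KF[]]//].
have KD m b : F m b -> K m b `|` nb (K m b) `<=` D.
  by move=> Fb; have [] := tF m _ (Kc m b Fb).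
pose prev m b : set V := if m is j.+1 then K j b `|` nb (K j b) else set0.
(* Shells: the stage [m] without the closure of the stage before. Different shells are not adjacent,
   and the boundary of a piece lies in the boundaries of two consecutive stages. *)
pose U : set V := [set v | exists b m, [/\ B b, K m b v & ~ prev m b v]].
have prevS j m b : j < m -> K j b `|` nb (K j b) `<=` prev m b.
  by case: m => // m jm; apply: cl_sub; exact: Kmono.
have stay v b m : B b -> K m b v -> ~ prev m b v ->
    linked (~` U) v `<=` K m b `\` prev m b.
  move=> Bb Kv nv x; elim=> [|{}x y _ [Kx nx] xy]; first by split.
  move=> /contrapT[b' [m' [Bb' Ky ny]]].
  have Eb : b' = b.
    apply: Buniq => //.
    have up i c z : K i c z -> linked (~` (\bigcup_n F n)) c z.
      by apply: linked_sub; apply: subsetC => ? ?; exists i.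
    apply: linked_trans (up _ _ _ Ky) _; apply: linked_sym.
    apply: linkedS (up _ _ _ Kx) xy _; apply; have [_ ?] := KF _ _ _ Ky; by exists m'.
  rewrite {}Eb in Ky ny; case: (ltngtP m' m) => mm.
  - exfalso; apply: nx; apply: (prevS _ _ _ mm); exact: nb_sub Ky (adjC xy).
  - exfalso; apply: ny; apply: (prevS _ _ _ mm); exact: nb_sub Kx xy.
  - by rewrite -mm.
have fU Y : component (~` U) Y -> finite_set (nb Y).
  move=> cY; have [v Yv] := component_ex cY.
  have /contrapT[b [m [Bb Kv nv]]] := component_notin cY Yv.
  pose P : set V := if m is j.+1 then nb (K j b) else set0.
  have fP : finite_set P by rewrite /P; case: (m) => // j; exact: Kfin.
  apply: (@sub_finite_set _ _ (nb (K m b) `|` P)); last by rewrite finite_setU.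
  have YE := component_sub cY Yv.
  move=> x [nYx [y Yy yx]].
  have [Ky ny] : (K m b `\` prev m b) y by apply: stay Bb Kv nv _ _; rewrite -YE.
  have [Kx|nKx] := nb_sub Ky yx; last by left.
  have px : prev m b x.
    apply: contrapT => nx; apply: nYx; rewrite YE in Yy *.
    by apply: linkedS Yy yx _; apply; exists b, m.
  right; rewrite /P; move: px ny; rewrite /prev; case: (m) => // j [Kx'|//] ny.
  by exfalso; apply: ny; exact: nb_sub Kx' (adjC yx).
exists U; split=> //.
- move=> x [[b [m [Bb Kx _]]]|[_ [y [b [m [Bb Ky _]]] yx]]]; apply: (KD m b).
  + by have [] := KF _ _ _ Kx.
  + by left.
  + by have [] := KF _ _ _ Ky.
  + exact: nb_sub Ky yx.
- move=> w Pw; have [Z okZ] := small_ex Pw.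
  have [Y cY wY] := maximal_family_cover (FP (card_set (nb Z))).1 Pw okZ (leqnn _).
  have [y Yy] := component_ex cY; move: cY Yy; set k := card_set _ => cY Yy.
  have Fy : F k y by apply: contrapT; exact: component_notin cY Yy.
  have [|b Bb by_] := Bex y; first by exists k.
  have [n nP] := linked_chain FS by_.
  have YK : Y `<=` K (maxn n k) b.
    move=> z Yz; have by' := nP (maxn n k) (leq_maxl _ _); apply: linked_trans by' _.
    apply: linked_sub (component_linked cY Yy Yz); apply: subsetC => x.
    have : k <= maxn n k by exact: leq_maxr.
    by move=> /subnK <-; elim: (_ - _) => // i IH /IH; exact: FS.
  (* At the first stage that captures the end, the end lives off the closure of the preceding stage,
     hence in the shell. *)
  have e : exists m, `[< lives_in w (K m b) >].
    by exists (maxn n k); apply/asboolP; exact: lives_sub YK wY.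
  case: (ex_minnP e) => m /asboolP wK mP; apply: lives_component => //.
  apply: (@lives_sub _ (K m b `\` prev m b)); first by move=> z [Kz nz]; exists b, m.
  rewrite setDE; apply: lives_setI => //; rewrite /prev.
  case: m wK mP => [|j] wK mP; first by rewrite setC0; apply: lives_sub wK.
  have [h|//] := lives_dich w (Kfin j b).
  by have /asboolP/mP := h; rewrite ltnn.
Qed.

End Cover.

(** * A decreasing sequence of regions that exhausts the graph *)

Section Regions.
Variable Psi : set (graph_end G).
Hypothesis Psi_undominated : forall w, Psi w -> undominated w.

(** The finite boundary of [Y] is avoided by a smaller component together with its neighbours, so
    even the edges leaving the smaller component stay in [Y]. *)
Lemma small_in_component U w Y : Psi w -> component (~` U) Y -> finite_set (nb Y) ->
  lives_in w Y -> exists2 S, finite_set S &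
    end_component S w `|` nb (end_component S w) `<=` Y.
Proof.
move=> Pw cY fY wY; have [S fS SP] := undominated_avoid (Psi_undominated Pw) fY.
have fU : finite_set (S `|` nb Y) by rewrite finite_setU.
exists (S `|` nb Y) => //.
have sS : end_component (S `|` nb Y) w `<=` end_component S w.
  apply: end_comp_sub => //; last exact: end_comp_lives.
  by move=> x /(component_nb (end_comp_component w fS)); left.
have sY : end_component (S `|` nb Y) w `<=` Y.
  by apply: end_comp_sub => //; exact: subsetUr.
move=> x cx; have [//|nx] := cl_sub sY cx.
by exfalso; apply: (SP x); split=> //; exact: cl_sub cx.
Qed.

(** Each new region has its closure in the previous one, so a neighbour of a vertex outside the n-th
    region is outside the next one. Starting with one vertex removed from every component of the
    graph, each vertex is therefore left out after finitely many steps. *)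
Lemma regions : exists U : nat -> set V, [/\
  forall n Y, component (~` U n) Y -> finite_set (nb Y),
  forall n w, Psi w -> exists2 Y, component (~` U n) Y & lives_in w Y,
  forall n, U n.+1 `|` nb (U n.+1) `<=` U n &
  forall v, exists n, ~ U n v].
Proof.
have [B [_ Bex Buniq]] := transversal setT.
have lT u v S : linked S u v -> linked (~` setT) u v.
  by apply: linked_sub => x; case.
pose good U := (forall Y, component (~` U) Y -> finite_set (nb Y)) /\
  forall w, Psi w -> exists2 Y, component (~` U) Y & lives_in w Y.
have g0 : good (~` B).
  have fB Y : component (~` ~` B) Y -> finite_set (nb Y).
    move=> cY; have [v Yv] := component_ex cY; have [b Bb bv] := Bex v I.
    apply: (@sub_finite_set _ _ [set b]) => // x nx.
    have : B x by apply: contrapT; exact: (component_nb cY nx).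
    case: nx => _ [y Yy yx] Bx; apply: Buniq => //; apply: linked_sym.
    apply: linked_trans bv _; apply: linkedS yx _; last by case.
    exact: lT (component_linked cY Yv Yy).
  split=> // w Pw; apply: lives_component => // r _.
  have [b Bb br] := Bex (r 0%N) I.
  have rb n : linked (~` setT) b (r n).
    by elim: n => // n IH; apply: linkedS IH (ray_adj r n) _; case.
  have [N NP] := ray_avoids r (finite_set1 b); exists N => n /NP nb Bn.
  by apply: nb; apply/esym; apply: Buniq (rb n).
have [||U UP] := @dep_choice (fun=> set V)
    (fun n U => good U /\ (n = 0 -> U = ~` B)) (fun _ U U' => U' `|` nb U' `<=` U).
- by exists (~` B).
- move=> n U [[fU cU] _].
  have [w Pw|U' [sU' fU' cU']] := @disjoint_cover Psi U; last by exists U'.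
  have [Y cY wY] := cU w Pw.
  have [S fS sS] := small_in_component Pw cY (fU _ cY) wY.
  exists (end_component S w); split; last exact: end_comp_lives.
    apply: (sub_finite_set _ fS).
    by apply: component_nb; exact: end_comp_component.
  move=> x /sS /(component_notin cY); exact: contrapT.
exists U; split.
- by move=> n; have [[[]]] := UP n.
- by move=> n; have [[[]]] := UP n.
- by move=> n; have [_] := UP n.
- move=> v; have [b Bb] := Bex v I; elim=> [_|{}v x _ [n nv] vx _].
    by exists 0 => U0; have [[_ /(_ erefl) E] _] := UP 0; rewrite E in U0; exact: U0 Bb.
  exists n.+1 => Ux; apply: nv; have [_] := UP n; apply; exact: nb_sub Ux (adjC vx).
Qed.

End Regions.

End Graph.

Arguments end_comp_lives [G S] w _.

Lemma linked_chain_mono (T : Type) (F : nat -> set T) : (forall n, F n.+1 `<=` F n) ->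
  forall m n, m <= n -> F n `<=` F m.
Proof. by move=> FS m n /subnK <-; elim: (n - m) => // i IH v /FS /IH. Qed.

Section Spaces.
Variables (G : graph) (Psi : set (graph_end G)).
Let V := vertex G.
Let E := edge G.
Hypothesis Psi_undominated : forall w, Psi w -> undominated w.
Implicit Types (f g h : V -> bool) (P Q I J : set E) (x y v s t : V) (X Y U S : set V)
  (w : graph_end G) (e : E).

(** * Vertex bipartitions that are continuous at the ends in Psi *)

Definition good f : Prop := forall w, Psi w -> exists2 S, finite_set S &
  forall x y, end_component S w x -> end_component S w y -> f x = f y.

Definition sep f e : Prop := f (src e) <> f (tgt e).

Definition Gd P f : Prop := good f /\ forall e, P e -> ~ sep f e.

Definition eqv P x y : Prop := forall f, Gd P f -> f x = f y.

Definition span P : set E := [set e | eqv P (src e) (tgt e)].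

Definition touch X : set E := [set e | X (src e) \/ X (tgt e)].

Lemma end_comp_mono S S' w : finite_set S' -> S `<=` S' ->
  end_component S' w `<=` end_component S w.
Proof.
move=> fS' sS; have fS := sub_finite_set sS fS'.
apply: end_comp_sub => //; last exact: end_comp_lives.
by apply: subset_trans sS; apply: component_nb; exact: end_comp_component.
Qed.

Lemma good_op (op : bool -> bool -> bool) f g :
  good f -> good g -> good (fun v => op (f v) (g v)).
Proof.
move=> gf gg w Pw; have [S fS SP] := gf w Pw; have [T fT TP] := gg w Pw.
have fU : finite_set (S `|` T) by rewrite finite_setU.
exists (S `|` T) => // x y Cx Cy; congr op; [apply: SP|apply: TP];
  apply: (end_comp_mono fU) => //; by [exact: subsetUl|exact: subsetUr].
Qed.

Lemma good_cst b : good (fun=> b).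
Proof. by move=> w _; exists set0. Qed.

Lemma notsep f e : ~ sep f e <-> f (src e) = f (tgt e).
Proof. by rewrite /sep; split=> [/contrapT //|h]; apply. Qed.

Lemma Gd_op P (op : bool -> bool -> bool) f g :
  Gd P f -> Gd P g -> Gd P (fun v => op (f v) (g v)).
Proof.
move=> [gf Pf] [gg Pg]; split; first exact: good_op.
by move=> e Pe; apply/notsep; congr op; apply/notsep; [exact: Pf|exact: Pg].
Qed.

Lemma Gd_cst P b : Gd P (fun=> b).
Proof. by split; [exact: good_cst|move=> e _ []]. Qed.

Lemma Gd_neg P f : Gd P f -> Gd P (fun v => ~~ f v).
Proof. by move=> h; apply: (@Gd_op P (fun a b => ~~ b) _ _ h h). Qed.

Lemma Gd_sub P Q f : P `<=` Q -> Gd Q f -> Gd P f.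
Proof. by move=> PQ [gf Qf]; split=> // e /PQ; exact: Qf. Qed.

Lemma Gd_has P (T : Type) (l : seq T) (F : T -> V -> bool) :
  (forall a, Gd P (F a)) -> Gd P (fun v => has (F^~ v) l).
Proof.
move=> h; elim: l => [|a l IH] /=; first exact: Gd_cst.
exact: (@Gd_op P orb).
Qed.

Lemma Gd_all P (T : Type) (l : seq T) (F : T -> V -> bool) :
  (forall a, Gd P (F a)) -> Gd P (fun v => all (F^~ v) l).
Proof.
move=> h; elim: l => [|a l IH] /=; first exact: Gd_cst.
exact: (@Gd_op P andb).
Qed.

Lemma eqv_sub P Q x y : P `<=` Q -> eqv P x y -> eqv Q x y.
Proof. by move=> PQ h f /(Gd_sub PQ) /h. Qed.

Lemma neqv_Gd P x y : ~ eqv P x y -> exists2 f, Gd P f & f x <> f y.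
Proof.
by move=> /existsNP[f] /not_implyP[gf ne]; exists f.
Qed.

Lemma sep_Gd P x y : ~ eqv P x y -> exists f, [/\ Gd P f, f x & ~~ f y].
Proof.
move=> /neqv_Gd[f gf]; case Fx : (f x); case Fy : (f y) => // _.
  by exists f; rewrite Fx Fy.
by exists (fun v => ~~ f v); rewrite Fx Fy; split=> //; exact: Gd_neg.
Qed.

Lemma sub_span P : P `<=` span P.
Proof. by move=> e Pe f [_ /(_ e Pe)/notsep]. Qed.

Lemma span_mono P Q : P `<=` Q -> span P `<=` span Q.
Proof. by move=> PQ e; exact: eqv_sub. Qed.

(* If [f] separates [e] but not [x y], and [g] separates [x y] but not [e], the
   symmetric difference of the two contradicts one of the hypotheses. *)
Lemma exchange P e x y : eqv (e |` P) x y -> ~ eqv P x y ->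
  forall f, Gd P f -> f x = f y -> ~ sep f e.
Proof.
move=> h /neqv_Gd[g gg gxy] f gf fxy fe.
have ge : sep g e.
  move=> ge; apply: gxy; apply: h; split; first exact: gg.1.
  by move=> e' [->|/gg.2//]; apply.
apply: gxy; have : Gd (e |` P) (fun v => f v (+) g v).
  have [gfg Pfg] := Gd_op addb gf gg; split=> // e' [->|/Pfg//]; apply/notsep.
  move: fe ge; rewrite /sep /=.
  by case: (f (src e)); case: (f (tgt e)); case: (g (src e)); case: (g (tgt e)).
by move=> /h; rewrite /= fxy; case: (f y); case: (g x); case: (g y).
Qed.

(** A disjunctive normal form: for a true vertex [s] and a false vertex [t] some [F (s, t)]
    separates them, and the required function is the disjunction over [s] of the conjunctions over
    [t]. It is good because [B] is finite. *)
Lemma boundary_ext P (B : set V) f : finite_set B ->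
  (forall s t, B s -> B t -> eqv P s t -> f s = f t) ->
  exists2 g, Gd P g & forall v, B v -> g v = f v.
Proof.
move=> /finite_seqP[l ->] h.
have /choice[F FP] : forall st : V * V, exists g, Gd P g /\
    (st.1 \in l -> st.2 \in l -> f st.1 -> ~~ f st.2 -> g st.1 /\ ~~ g st.2).
  move=> [s t]; have [st|/sep_Gd[g [gg gs gt]]] := pselect (eqv P s t); last by exists g.
  exists (fun=> true); split; first exact: Gd_cst.
  by move=> /= sl tl; rewrite (h s t) // => ->.
exists (fun v => has (fun s => f s && all (fun t => f t || F (s, t) v) l) l).
  apply: (@Gd_has P _ l (fun s v => f s && all (fun t => f t || F (s, t) v) l)) => s.
  apply: (@Gd_op P andb); first exact: Gd_cst.
  apply: (@Gd_all P _ l (fun t v => f t || F (s, t) v)) => t.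
  by apply: (@Gd_op P orb); [exact: Gd_cst|exact: (FP _).1].
move=> v /= vl; case fv : (f v).
  apply/hasP; exists v; rewrite ?fv //=; apply/allP => t tl.
  case ft : (f t) => //=; have [_ /(_ vl tl)] := FP (v, t).
  by rewrite /= fv ft => /(_ isT isT)[].
apply/hasPn => s sl; case fs : (f s) => //=; apply/allPn; exists v => //.
rewrite fv /=; have [_ /(_ sl vl)] := FP (s, v).
by rewrite /= fs fv => /(_ isT isT)[].
Qed.

Lemma touch_cl Y e : touch Y e -> (Y `|` nb Y) (src e) /\ (Y `|` nb Y) (tgt e).
Proof.
have a : adj (src e) (tgt e) by exists e; left.
move=> [Ys|Yt]; split; by [left|exact: nb_sub Ys a|exact: nb_sub Yt (adjC a)].
Qed.

Definition covers U : Prop :=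
  (forall Y, component (~` U) Y -> finite_set (nb Y)) /\
  forall w, Psi w -> exists2 Y, component (~` U) Y & lives_in w Y.

Lemma nb_notin U Y v : component (~` U) Y -> nb Y v -> ~ U v.
Proof. by move=> cY /(component_nb cY). Qed.

Lemma in_component U v : U v ->
  component (~` U) (linked (~` U) v) /\ linked (~` U) v v.
Proof. by move=> Uv; split; [apply: component_of|apply: linked0]; apply. Qed.

Lemma touch_component U e : touch U e ->
  exists2 Y, component (~` U) Y & touch Y e.
Proof.
case=> /in_component[cY Ye]; first by exists (linked (~` U) (src e)); [|left].
by exists (linked (~` U) (tgt e)); [|right].
Qed.

(** Gluing along finite boundaries. No edge joins two different components of [U], so the extensions
    that [boundary_ext] provides on them do not interfere. *)
Lemma extend U P f : covers U ->
  (forall e, P e -> ~ touch U e -> ~ sep f e) ->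
  (forall Y s t, component (~` U) Y -> nb Y s -> nb Y t ->
     eqv (P `&` touch Y) s t -> f s = f t) ->
  exists2 h, Gd P h & forall v, ~ U v -> h v = f v.
Proof.
move=> [fU cU] hP hY.
have /choice[g gP] : forall Y, exists g, component (~` U) Y ->
    Gd (P `&` touch Y) g /\ forall v, nb Y v -> g v = f v.
  move=> Y; have [cY|nY] := pselect (component (~` U) Y); last by exists f.
  have [|g gg gE] := @boundary_ext (P `&` touch Y) (nb Y) f (fU Y cY).
    by move=> s t; exact: hY.
  by exists g.
pose h v := if `[< U v >] then g (linked (~` U) v) v else f v.
have hE Y v : component (~` U) Y -> (Y `|` nb Y) v -> h v = g Y v.
  move=> cY [Yv|nv]; rewrite /h.
    rewrite asboolT; last by apply: contrapT; exact: component_notin cY Yv.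
    by rewrite -(component_sub cY Yv).
  by rewrite asboolF; [rewrite (gP Y cY).2|exact: nb_notin cY nv].
exists h => [|v nv]; last by rewrite /h asboolF.
split=> [w Pw|e Pe].
  have [Y cY wY] := cU w Pw; have [[gg _] _] := gP Y cY.
  have [S fS SP] := gg w Pw; have fT : finite_set (S `|` nb Y).
    by rewrite finite_setU; split=> //; exact: fU.
  have TY : end_component (S `|` nb Y) w `<=` Y.
    by apply: end_comp_sub => //; exact: subsetUr.
  exists (S `|` nb Y) => // x y Cx Cy.
  rewrite !(hE Y) //; try (by left; exact: TY).
  by apply: SP; apply: (end_comp_mono fT) => //; exact: subsetUl.
have [te|te] := pselect (touch U e); last first.
  have [ns nt] : ~ U (src e) /\ ~ U (tgt e).
    by split=> ?; apply: te; [left|right].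
  by rewrite /sep /h !asboolF //; exact: hP.
have [Y cY tY] := touch_component te.
have [cs ct] := touch_cl tY; apply/notsep; rewrite !(hE Y) //; apply/notsep.
exact: (gP Y cY).1.2.
Qed.

(** * Compact edge sets *)

Definition fin_covered (UU : set (set V)) Q : Prop :=
  exists W : set (set V), [/\ W `<=` UU, finite_set W &
    finite_set [set e | Q e /\ ~ exists2 X, W X & X (src e) /\ X (tgt e)]].

(** Compactness of [Q] near the ends in terms of vertex sets: given a neighbourhood of each end of
    Psi, finitely many of these sets contain both endvertices of all but finitely many edges of
    [Q]. *)
Definition compact_edges Q : Prop := forall UU : set (set V),
  (forall w, Psi w -> exists2 X, UU X & exists2 S, finite_set S & end_component S w `<=` X) ->
  fin_covered UU Q.

Lemma fin_covered_sub UU Q Q' : Q' `<=` Q -> fin_covered UU Q -> fin_covered UU Q'.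
Proof.
move=> sQ [W [WU fW fQ]]; exists W; split=> //.
by apply: sub_finite_set fQ => e [/sQ].
Qed.

Lemma fin_coveredU UU Q Q' : fin_covered UU Q -> fin_covered UU Q' ->
  fin_covered UU (Q `|` Q').
Proof.
move=> [W [WU fW fQ]] [W' [WU' fW' fQ']].
exists (W `|` W'); split; [by move=> X [/WU|/WU']|by rewrite finite_setU|].
have : finite_set ([set e | Q e /\ ~ exists2 X, W X & X (src e) /\ X (tgt e)] `|`
  [set e | Q' e /\ ~ exists2 X, W' X & X (src e) /\ X (tgt e)]) by rewrite finite_setU.
apply: sub_finite_set => e [[Qe|Qe] ne]; [left|right]; split=> // -[X WX Xe].
  by apply: ne; exists X => //; left.
by apply: ne; exists X => //; right.
Qed.

Lemma fin_covered_finite UU Q : finite_set Q -> fin_covered UU Q.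
Proof.
move=> fQ; exists set0; split=> //.
by apply: sub_finite_set fQ => e [].
Qed.

Lemma compactU Q Q' : compact_edges Q -> compact_edges Q' -> compact_edges (Q `|` Q').
Proof. by move=> cQ cQ' UU h; apply: fin_coveredU; [exact: cQ|exact: cQ']. Qed.

Lemma compact_finite Q : finite_set Q -> compact_edges Q.
Proof. by move=> fQ UU _; exact: fin_covered_finite. Qed.

(** The sets on which [f] is constant form a cover, and a separated edge lies in none of them. *)
Lemma compact_sep Q f : compact_edges Q -> good f -> finite_set [set e | Q e /\ sep f e].
Proof.
move=> cQ gf.
have [w /gf[S fS SP]|W [WU fW fQ]] :=
    cQ [set X | forall x y, X x -> X y -> f x = f y].
  by exists (end_component S w) => //; exists S.
apply: sub_finite_set fQ => e [Qe se]; split=> // -[X /WU XP [Xs Xt]].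
by apply: se; exact: XP.
Qed.

Lemma compact_regions Q U : compact_edges Q -> covers U ->
  exists2 W : set (set V), finite_set W & [/\ W `<=` component (~` U),
    finite_set [set e | Q e /\ ~ touch U e] &
    forall e, Q e -> touch U e -> exists2 Y, W Y & touch Y e].
Proof.
move=> cQ [fU cU]; have [w Pw|W [WU fW fQ]] := cQ (component (~` U)).
  have [Y cY wY] := cU w Pw; exists Y => //; exists (nb Y); first exact: fU.
  by apply: end_comp_sub => //; exact: fU.
set F := [set e | Q e /\ ~ _] in fQ.
(* The finitely many edges missed by [W] may touch further components; these are added. *)
pose W' := [set linked (~` U) (src e) | e in F] `|` [set linked (~` U) (tgt e) | e in F].
exists (W `|` (W' `&` component (~` U))).
  rewrite finite_setU; split=> //; apply: finite_setIl.
  by rewrite finite_setU; split; exact: finite_image.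
split=> [X [/WU|[]]//||e Qe te].
  apply: sub_finite_set fQ => e [Qe ne]; split=> // -[X /WU cX [Xs _]].
  by apply: ne; left; apply: contrapT; exact: component_notin cX Xs.
have [Fe|nFe] := pselect (F e).
  case: te => /in_component[cY Ye].
    exists (linked (~` U) (src e)); last by left.
    by right; split=> //; left; exists e.
  exists (linked (~` U) (tgt e)); last by right.
  by right; split=> //; right; exists e.
have /contrapT[X WX [Xs _]] : ~ ~ exists2 X, W X & X (src e) /\ X (tgt e).
  by move=> ne; apply: nFe.
by exists X; [left|left].
Qed.

End Spaces.

(** * The connectivity game *)

Lemma play_extend (A : Type) (f : seq A -> A) (p : seq A) :
  exists x : nat -> A, mkseq x (size p) = p /\
    forall i, size p <= i -> x i = f (mkseq x i).
Proof.
pose q := fix q k := if k is j.+1 then rcons (q j) (f (q j)) else p.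
have sq k : size (q k) = (size p + k)%N.
  by elim: k => [|k IH]; rewrite ?addn0 //= size_rcons IH addnS.
have d : A by exact: (f [::]).
have qE k j : k <= j -> take (size p + k) (q j) = q k.
  move=> /subnK <-; elim: (j - k) => [|i IH]; first by rewrite add0n take_oversize // sq.
  by rewrite addSn /= -cats1 takel_cat // sq leq_add2l leq_addl.
pose x i := nth d (q i.+1) i.
have xE k : mkseq x (size p + k) = q k.
  apply: (@eq_from_nth _ d); rewrite size_mkseq ?sq // => i ik.
  rewrite nth_mkseq // /x; have [ki|ik'] := leqP k i.+1.
    by rewrite -(qE _ _ ki) nth_take.
  by rewrite -(qE _ _ (ltnW ik')) nth_take // addnS ltnS leq_addl.
exists x; split; first by rewrite -{1}(addn0 (size p)) xE.
move=> i pi; have [k Ek] : exists k, i = (size p + k)%N.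
  by exists (i - size p)%N; rewrite subnKC.
rewrite Ek xE; have := congr1 (fun s => nth d s i) (xE k.+1).
rewrite nth_mkseq Ek ?addnS // => -> /=.
by rewrite nth_rcons sq ltnn eqxx.
Qed.

Fixpoint Inl (T : Type) (a : T) (l : seq T) : Prop :=
  if l is b :: l' then b = a \/ Inl a l' else False.

Section Game.
Variables (G : graph) (Psi : set (graph_end G)) (P : set (edge G)).
Let V := vertex G.
Let E := edge G.
Hypothesis Psi_undominated : forall w, Psi w -> undominated w.
Variable U : nat -> set V.
Hypothesis Ucov : forall n, covers Psi (U n).
Hypothesis Ucl : forall n, U n.+1 `|` nb (U n.+1) `<=` U n.
Hypothesis Uleave : forall v, exists n, ~ U n v.
Variables x0 y0 : V.
Hypotheses (Ux : ~ U 0 x0) (Uy : ~ U 0 y0).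
Implicit Types (C Y S : set V) (u v s t : V) (w : graph_end G) (e : E).

Let US n : U n.+1 `<=` U n.
Proof. by move=> v Uv; apply: Ucl; left. Qed.

Let Umono m n : m <= n -> U n `<=` U m.
Proof. exact: linked_chain_mono. Qed.

Inductive conn (B : set E) (J : V -> V -> Prop) s : V -> Prop :=
| conn0 : conn B J s s
| connE e : conn B J s (src e) -> B e -> conn B J s (tgt e)
| connE' e : conn B J s (tgt e) -> B e -> conn B J s (src e)
| connJ u v : conn B J s u -> J u v -> conn B J s v
| connJ' u v : conn B J s v -> J u v -> conn B J s u.

Lemma conn_mono (B B' : set E) (J J' : V -> V -> Prop) s t :
  B `<=` B' -> (forall u v, J u v -> J' u v) -> conn B J s t -> conn B' J' s t.
Proof.
move=> sB sJ; elim=> [|e _ h Be|e _ h Be|u v _ h Juv|u v _ h Juv].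
- exact: conn0.
- by apply: connE h _; exact: sB.
- by apply: connE' h _; exact: sB.
- by apply: connJ h _; exact: sJ.
- by apply: connJ' h _; exact: sJ.
Qed.

(* [(C, (s, t))] claims that [s] and [t], which lie on the boundary of [C], are
   joined through [C]. *)
Definition jump := (set V * (V * V))%type.

Definition via (J : jump -> Prop) : V -> V -> Prop := fun u v => exists C, J (C, (u, v)).

Lemma conn_finite B (J : jump -> Prop) s t : conn B (via J) s t ->
  exists (B' : seq E) (L : seq jump), [/\ forall e, e \in B' -> B e,
    forall j, Inl j L -> J j & conn [set` B'] (via (fun j => Inl j L)) s t].
Proof.
elim=> [|e _ [B' [L [hB hL h]]] Be|e _ [B' [L [hB hL h]]] Be
  |u v _ [B' [L [hB hL h]]] [C JC]|u v _ [B' [L [hB hL h]]] [C JC]].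
- by exists [::], [::]; split=> //; exact: conn0.
- exists (e :: B'), L; split=> //; first by move=> e'; rewrite inE => /predU1P[->|/hB].
  apply: connE; last by rewrite /= inE eqxx.
  by apply: conn_mono h => // e' /= h'; rewrite inE h' orbT.
- exists (e :: B'), L; split=> //; first by move=> e'; rewrite inE => /predU1P[->|/hB].
  apply: connE'; last by rewrite /= inE eqxx.
  by apply: conn_mono h => // e' /= h'; rewrite inE h' orbT.
- exists B', ((C, (u, v)) :: L); split=> // [j [<-|/hL]//|].
  apply: (connJ (u := u)); last by exists C; left.
  by apply: conn_mono h => // a b [C' h']; exists C'; right.
- exists B', ((C, (u, v)) :: L); split=> // [j [<-|/hL]//|].
  apply: (connJ' (v := v)); last by exists C; left.
  by apply: conn_mono h => // a b [C' h']; exists C'; right.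
Qed.

(** The edges that the connector may use at stage [n]. Edges touching the region [U n] are left to
    later rounds, inside the jumps. *)
Definition base n C : set E := [set e | [/\ P e, touch C e & ~ touch (U n) e]].

Definition jump_ok n C (j : jump) : Prop :=
  [/\ component (~` U n) j.1, j.1 `<=` C, nb j.1 j.2.1 & nb j.1 j.2.2].

Definition list_ok n (c : jump) (L : seq jump) : Prop :=
  (forall j, Inl j L -> jump_ok n c.1 j) /\
  conn (base n c.1) (via (fun j => Inl j L)) c.2.1 c.2.2.

Definition start : jump := (setT, (x0, y0)).
(** Both players use one type of moves: of a move with even index only the list proposed by the
    connector counts, of one with odd index only the jump picked by the separator. The ignored jump
    of the connector is usually [start]. *)
Definition move := (seq jump * jump)%type.

Implicit Type X : nat -> move.

Definition cur X n : jump := if n is m.+1 then (X m.*2.+1).2 else start.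
Definition okC X n := list_ok n (cur X n) (X n.*2).1.
Definition okS X n := Inl (X n.*2.+1).2 (X n.*2).1.
Definition nofault X := forall n, okC X n /\ okS X n.
Definition converges X w := forall n, lives_in w (cur X n).1.

(** In the first alternative the separator is the first to break the rules: in each round the
    connector moves first. *)
Definition wins (B : set (graph_end G)) : set (nat -> move) :=
  [set X | (exists n, [/\ forall m, m <= n -> okC X m, forall m, m < n -> okS X m & ~ okS X n])
    \/ (nofault X /\ exists2 w, B w & converges X w)].

Lemma cur_agree X X' n m : mkseq X n = mkseq X' n -> m.*2 <= n -> cur X m = cur X' m.
Proof.
move=> /mkseq_eq h; case: m => // m; rewrite doubleS => lt.
by rewrite /= h // ltnW.
Qed.

Lemma okC_agree X X' n m : mkseq X n = mkseq X' n -> m.*2 < n -> okC X m = okC X' m.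
Proof.
move=> h lt; rewrite /okC (cur_agree h (ltnW lt)).
by move/mkseq_eq: h => ->.
Qed.

Lemma okS_agree X X' n m : mkseq X n = mkseq X' n -> m.*2.+1 < n -> okS X m = okS X' m.
Proof. by move=> /mkseq_eq h lt; rewrite /okS !h // ltnW. Qed.

Lemma nofault_comp X n : nofault X ->
  [/\ component (~` U n) (cur X n.+1).1, (cur X n.+1).1 `<=` (cur X n).1,
      nb (cur X n.+1).1 (cur X n.+1).2.1 & nb (cur X n.+1).1 (cur X n.+1).2.2].
Proof. by move=> /(_ n)[[h _] okS]; exact: h. Qed.

Lemma nofault_leave X v : nofault X -> exists n, ~ (cur X n).1 v.
Proof.
move=> nf; have [n nU] := Uleave v; exists n.+1 => h.
by have [cC _ _ _] := nofault_comp n nf; apply: nU; apply: contrapT; exact: component_notin cC h.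
Qed.

Lemma nofault_mono X m n : nofault X -> m <= n -> (cur X n).1 `<=` (cur X m).1.
Proof.
by move=> nf; apply: (linked_chain_mono (F := fun n => (cur X n).1)) => i;
  have [] := nofault_comp i nf.
Qed.

Lemma nofault_cl X n : nofault X ->
  (cur X n.+1).1 `|` nb (cur X n.+1).1 `<=` (cur X n).1.
Proof.
move=> nf; have [cC sC _ _] := nofault_comp n nf.
case: n cC sC => [|n] cC sC; first by [].
have [cC' _ _ _] := nofault_comp n nf.
move=> v [/sC//|nv]; case: (nv) => nCv [u Cu uv].
have Uu : U n.+1 u by apply: contrapT; exact: component_notin cC Cu.
have Uv : U n v by apply: Ucl; exact: nb_sub Uu uv.
have := sC _ Cu => C'u; rewrite (component_sub cC' C'u).
by apply: linkedS (linked0 (component_notin cC' C'u)) uv _; apply.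
Qed.

Lemma nofault_finite X S : nofault X -> finite_set S ->
  exists n, (cur X n).1 `&` S `<=` set0.
Proof.
move=> nf /finite_seqP[l ->]; elim: l => [|v l [n nP]]; first by exists 0 => ? [].
have [m mP] := nofault_leave v nf; exists (maxn n m) => u [Cu].
rewrite /= inE => /predU1P[Eu|ul].
  by apply: mP; rewrite -Eu; apply: nofault_mono Cu => //; exact: leq_maxr.
by apply: (nP u); split=> //; apply: nofault_mono Cu => //; exact: leq_maxl.
Qed.

Lemma nofault_connected X n u v : nofault X -> (cur X n.+1).1 u -> (cur X n.+1).1 v ->
  linked (~` (cur X n.+1).1) u v.
Proof.
by move=> nf Cu Cv; have [cC _ _ _] := nofault_comp n nf; exact: component_within cC Cu Cv.
Qed.

Lemma rays_equiv X (r r' : ray G) : nofault X ->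
  (forall n, tail_in r (cur X n).1) -> (forall n, tail_in r' (cur X n).1) -> ray_equiv r r'.
Proof.
move=> nf h h' S fS; have [n nP] := nofault_finite nf fS.
have dis u : (cur X n.+1).1 u -> ~ S u.
  by move=> Cu Su; apply: (nP u); split=> //; apply: nofault_mono Cu.
have [v Cv] : exists v, (cur X n.+1).1 v by have [N /(_ N (leqnn _)) ?] := h n.+1; exists (r N).
have sub u : (cur X n.+1).1 u -> linked S v u.
  move=> Cu; apply: linked_sub (nofault_connected nf Cv Cu).
  by move=> a Sa /dis; apply.
exists (linked S v); split; first exact: component_of (dis _ Cv).
  by have [N NP] := h n.+1; exists N => i /NP /sub.
by have [N NP] := h' n.+1; exists N => i /NP /sub.
Qed.

(** The components of a faultless play are connected and leave every finite set, so any two rays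
    with tails in all of them are equivalent. *)
Lemma converges_unique X w w' : nofault X -> converges X w -> converges X w' -> w = w'.
Proof.
move=> nf cw cw'.
have eqE : end_rays w = end_rays w'.
  have [r rE] := end_raysP w; have [r' r'E] := end_raysP w'.
  have wr : end_rays w r by rewrite rE; exact: ray_equiv_refl.
  have w'r' : end_rays w' r' by rewrite r'E; exact: ray_equiv_refl.
  apply/seteqP; split=> a ha.
    rewrite r'E; apply: (rays_equiv nf) => n; [exact: cw' w'r'|exact: cw ha].
  rewrite rE; apply: (rays_equiv nf) => n; [exact: cw wr|exact: cw' ha].
case: w w' eqE {cw cw'} => [s sP] [s' s'P] /= Es; case: s' / Es in s'P *.
by rewrite (Prop_irrelevance sP s'P).
Qed.

(* Inside the layer [C_n \ C_{n+1}] walk towards [C_{n+1}] along a shortest path;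
   the layers are disjoint, so the resulting walk is a ray. *)
Lemma converges_ex X : nofault X -> exists w, converges X w.
Proof.
move=> nf; pose C n := (cur X n.+1).1.
have Cc n : component (~` U n) (C n) by have [] := nofault_comp n nf.
have CS n : C n.+1 `<=` C n by exact: nofault_mono.
have Cm m n : m <= n -> C n `<=` C m by exact: linked_chain_mono.
have layer v : C 0 v -> exists n, C n v /\ ~ C n.+1 v.
  move=> C0v; have e : exists n, `[< ~ C n v >].
    by have [n nP] := nofault_leave v nf; exists n; apply/asboolP => Cv; apply: nP; exact: nofault_mono Cv.
  case: (ex_minnP e) => -[/asboolP//|m] /asboolP nC mP; exists m; split=> //.
  by apply: contrapT => h; have /asboolP/mP := h; rewrite ltnn.
pose reach n := fix reach k v := if k is k'.+1 then
  exists u, [/\ adj v u, C n u & reach k' u] else C n.+1 v.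
have reachP n v : C n v -> exists k, reach n k v.
  move=> Cv; have [z Cz] := component_ex (Cc n.+1).
  have := component_within (Cc n) (CS _ _ Cz) Cv; move=> {Cv}.
  elim=> [_|{}v a zv [k rk] va _]; first by exists 0.
  by exists k.+1, v; split=> //; [exact: adjC|apply: contrapT; exact: linked_notinr zv].
pose m v n k := [/\ C n v, ~ C n.+1 v, reach n k v & forall k', reach n k' v -> k <= k'].
have mP v : C 0 v -> exists n k, m v n k.
  move=> /layer[n [Cv nCv]]; have [k rk] := reachP n v Cv.
  have e : exists k, `[< reach n k v >] by exists k; apply/asboolP.
  case: (ex_minnP e) => k' /asboolP rk' k'P; exists n, k'; split=> // i ri.
  by apply: k'P; apply/asboolP.
have m_fun v n k n' k' : m v n k -> m v n' k' -> n = n' /\ k = k'.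
  move=> [Cv nC rk mk] [Cv' nC' rk' mk']; have En : n = n'.
    apply/eqP; case: ltngtP => // lt; exfalso; [apply: nC|apply: nC'];
      by [exact: Cm Cv'|exact: Cm Cv].
  rewrite -{}En in Cv' nC' rk' mk' *; split=> //.
  by apply/eqP; rewrite eqn_leq mk // mk'.
have step v n k : m v n k -> exists u n' k', [/\ adj v u, m u n' k' &
    n < n' \/ (n = n' /\ k' < k)].
  move=> [Cv nC rk mk]; case: k rk mk => [//|k] /= [u [vu Cu ru]] mk.
  have [n' [k' mu]] := mP u (Cm 0 n (leq0n _) _ Cu); exists u, n', k'; split=> //.
  have [Cn' nCn' rk' mk'] := mu; case: (ltngtP n n') => [|lt|En]; [by left| |].
    by exfalso; apply: nCn'; exact: Cm Cu.
  by right; split=> //; rewrite ltnS mk' // -En.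
have [v0 Cv0] := component_ex (Cc 0).
have [||r rP] := @dep_choice (fun=> V) (fun _ v => C 0 v) (fun _ v u => adj v u /\
    forall n k n' k', m v n k -> m u n' k' -> n < n' \/ (n = n' /\ k' < k)).
- by exists v0.
- move=> _ v /mP[n [k mv]]; have [u [n' [k' [vu mu h]]]] := step v n k mv.
  exists u; split; last by have [Cu _ _ _] := mu; exact: Cm Cu.
  split=> // n1 k1 n2 k2 m1 m2.
  by have [<- <-] := m_fun _ _ _ _ _ mv m1; have [<- <-] := m_fun _ _ _ _ _ mu m2.
have prog i d : forall n k n' k', m (r i) n k -> m (r (i + d.+1)%N) n' k' ->
    n < n' \/ (n = n' /\ k' < k).
  elim: d => [|d IH] n k n' k' m1 m2.
    by have [_ [_ h]] := rP i; apply: h m1 _; rewrite addn1 in m2.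
  have [n3 [k3 m3]] := mP _ (rP (i + d.+1)%N).1.
  have [_ [_ h]] := rP (i + d.+1)%N; rewrite addnS in m2.
  have := h _ _ _ _ m3 m2; have := IH _ _ _ _ m1 m3.
  move=> [l1|[E1 l1]] [l2|[E2 l2]].
  - by left; exact: ltn_trans l1 l2.
  - by left; rewrite -E2.
  - by left; rewrite E1.
  - by right; split; [rewrite E1|exact: ltn_trans l2 l1].
have rinj : injective r.
  suff lt i j : i < j -> r i <> r j.
    by move=> i j Er; apply/eqP; case: ltngtP => // /lt; rewrite Er.
  move=> ij Er; have [n [k mi]] := mP _ (rP i).1.
  have Ej : j = (i + (j - i.+1).+1)%N by rewrite addnS -addSn subnKC.
  have := prog i (j - i.+1)%N _ _ n k mi; rewrite -Ej -Er => /(_ mi).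
  by case=> [|[_]]; rewrite ltnn.
pose R := Ray (fun i => (rP i).2.1) rinj.
have tl n : tail_in R (C n).
  have in_tail i : C n (r i) -> tail_in R (C n).
    move=> Cri; exists i => j ij; have [n1 [k1 m1]] := mP _ (rP i).1.
    have [n2 [k2 m2]] := mP _ (rP j).1.
    move: ij; rewrite leq_eqVlt => /predU1P[<-//|ij].
    have Ej : j = (i + (j - i.+1).+1)%N by rewrite addnS -addSn subnKC.
    have n12 : n1 <= n2.
      rewrite Ej in m2; by have [/ltnW|[->]] := prog i _ _ _ _ _ m1 m2.
    have nn1 : n <= n1.
      by rewrite leqNgt; apply/negP => lt; have [_ h _ _] := m1; apply: h; exact: Cm Cri.
    by have [C2 _ _ _] := m2; apply: Cm C2; exact: leq_trans n12.
  suff [i Ci] : exists i, C n (r i) by exact: in_tail Ci.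
  elim: n {in_tail} => [|n [i Ci]]; first by exists 0; exact: (rP 0).1.
  have [n1 [k1 m1]] := mP _ (rP i).1.
  elim/ltn_ind: k1 i n1 Ci m1 => k IH i n1 Ci m1.
  have [Cn1|nCn1] := pselect (C n.+1 (r i)); first by exists i.
  have [n2 [k2 m2]] := mP _ (rP i.+1).1; have [_ [_ h]] := rP i.
  have En1 : n1 = n.
    apply/eqP; have [C1 nC1 _ _] := m1; case: ltngtP => // lt; exfalso.
      by apply: nC1; exact: Cm Ci.
    by apply: nCn1; exact: Cm C1.
  have [lt|[En lt]] := h _ _ _ _ m1 m2.
    by exists i.+1; have [C2 _ _ _] := m2; apply: Cm C2; rewrite -En1.
  by apply: (IH k2 lt i.+1 n2) => //; have [C2 _ _ _] := m2; rewrite -En1 En.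
exists (GraphEnd (ex_intro _ R erefl)) => -[|n].
  by move=> r' _; exists 0.
have [//|wn] := lives_dich (GraphEnd (ex_intro _ R erefl)) ((Ucov n).1 _ (Cc n)).
have [N NP] := wn R (@ray_equiv_refl _ R); have [M MP] := tl n.
exfalso; apply: (NP (maxn N M)); first exact: leq_maxl.
by left; apply: MP; exact: leq_maxr.
Qed.

Lemma converges_small X w S : nofault X -> converges X w -> finite_set S ->
  exists n, (cur X n).1 `<=` end_component S w.
Proof.
move=> nf cw fS; have [n nP] := nofault_finite nf fS.
exists n.+1 => v Cv.
have [u [Cu Su]] := lives_ex (lives_setI (cw n.+1) (end_comp_lives w fS)).
apply: Defs.component_closed (end_comp_component w fS) Su _.
apply: linked_sub (nofault_connected nf Cu Cv) => z Sz Cz.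
by apply: (nP z); split=> //; apply: nofault_mono Cz.
Qed.

(** * The winning condition is unravelable *)

Section Borel.
Variable R : realType.

Let open_faults (k : nat -> nat) (Q : nat -> (nat -> move) -> Prop) :
  (forall n X X', mkseq X (k n) = mkseq X' (k n) -> Q n X -> Q n X') ->
  unravelable [set X | exists n, Q n X].
Proof.
move=> h; apply: unravelable_open => X [n Qn]; exists (k n) => Y E'; exists n.
exact: h Qn.
Qed.

Let unravelableU (A B : set (nat -> move)) : unravelable A -> unravelable B ->
  unravelable (A `|` B).
Proof.
move=> uA uB.
have -> : A `|` B = \bigcup_i (if i is 0 then A else B).
  apply/seteqP; split=> [X [h|h]|X [[|i] _ h]]; by [exists 0|exists 1|left|right].
by apply: unravelable_bigcup => -[|i].
Qed.

Let unravelableI (A B : set (nat -> move)) : unravelable A -> unravelable B ->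
  unravelable (A `&` B).
Proof.
move=> uA uB; rewrite -[A `&` B]setCK setCI; apply: unravelable_setC.
by apply: unravelableU; exact: unravelable_setC.
Qed.

Let unravelable_nofault : unravelable nofault.
Proof.
rewrite -[nofault]setCK; apply: unravelable_setC.
have -> : ~` nofault = [set X | exists n, ~ (okC X n /\ okS X n)].
  apply/seteqP; split=> X; last by move=> [n h] nf; apply: h.
  move=> nf; apply: contrapT => ne; apply: nf => n; apply: contrapT => h.
  by apply: ne; exists n.
apply: (open_faults (k := fun n => n.*2.+2)) => n X X' h.
by rewrite (okC_agree h (leqnSn _)) (okS_agree h (leqnn _)).
Qed.

Let Om (B : set (graph_end G)) : set (nat -> move) :=
  [set X | nofault X /\ exists2 w, B w & converges X w].

(** Induction over the sigma-algebra. Complements are harmless because a faultless play converges to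
    exactly one end, and convergence into an open set is visible at a finite stage
    ([converges_small]). *)
Lemma wins_unravelable (B : set (graph_end G)) : borel_end_set R B ->
  unravelable (wins B).
Proof.
move=> bB; suff uO : unravelable (Om B).
  apply: (@unravelableU [set X | _] (Om B)) => //.
  apply: (open_faults (k := fun n => n.*2.+2)) => n X X' h [h1 h2 h3]; split.
  - move=> m mn; rewrite -(okC_agree h); first exact: h1.
    by rewrite ltnS leqW // leq_double.
  - move=> m mn; rewrite -(okS_agree h); first exact: h2.
    by rewrite !ltnS leq_double ltnW.
  - by rewrite -(okS_agree h).
move: B bB; apply: smallest_sub; first split.
- rewrite /mkset (_ : Om set0 = set0); first by apply: unravelable_open.
  by apply/seteqP; split=> // X [_ []].
- move=> B uB; rewrite /mkset setTD.
  have -> : Om (~` B) = nofault `&` ~` Om B.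
    apply/seteqP; split=> [X [nf [w nBw cw]]|X [nf nO]].
      split=> // -[_ [w' Bw' cw']].
      by rewrite -(converges_unique nf cw cw') in Bw'.
    split=> //; have [w cw] := converges_ex nf; exists w => // Bw.
    by apply: nO; split=> //; exists w.
  by apply: unravelableI => //; exact: unravelable_setC.
- move=> B uB; rewrite /mkset.
  have -> : Om (\bigcup_k B k) = \bigcup_k Om (B k).
    apply/seteqP; split=> [X [nf [w [k _ Bw] cw]]|X [k _ [nf [w Bw cw]]]].
      by exists k => //; split=> //; exists w.
    by split=> //; exists w => //; exists k.
  exact: unravelable_bigcup.
- move=> _ [Z oZ <-]; rewrite /mkset.
  have -> : Om (End R @^-1` Z) = nofault `&`
      [set X | exists n, forall w, lives_in w (cur X n).1 -> Z (End R w)].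
    apply/seteqP; split=> [X [nf [w Zw cw]]|X [nf [n nP]]]; last first.
      split=> //; have [w cw] := converges_ex nf; exists w => //; exact: nP.
    split=> //.
    have [D' sD' ZE] : exists2 D', D' `<=` @basic_open R G & \bigcup_(i in D') i = Z := oZ.
    move: Zw; rewrite /= -ZE => -[W D'W Ww].
    have [[nW _]|[S [w0 [eps [fS _ WE]]]]] := sD' _ D'W; first by case: (nW w).
    have [n nP] := converges_small nf cw fS.
    exists n => w' lw'; exists W => //; rewrite WE /=.
    have -> : end_component S w0 = end_component S w.
      move: Ww; rewrite WE /= => lw.
      have [v [Sv S0v]] := lives_ex (lives_setI (end_comp_lives w fS) lw).
      by apply: (component_eq (end_comp_component w0 fS) (end_comp_component w fS) S0v).
    exact: lives_sub lw'.
  apply: unravelableI => //.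
  apply: (open_faults (k := fun n => n.*2)) => n X X' h.
  by rewrite (cur_agree h).
Qed.

End Borel.

Lemma conn_const B J s t (f : V -> bool) : (forall e, B e -> ~ sep f e) ->
  (forall u v, J u v -> f u = f v) -> conn B J s t -> f s = f t.
Proof.
move=> hB hJ; elim=> // [e _ -> /hB/notsep//|e _ -> /hB/notsep//|u v _ -> /hJ//|u v _ -> /hJ//].
Qed.

(** * A winning strategy of the connector yields a compact connecting edge set *)

Section Connector.
Variable s : seq move -> move.
Hypothesis s_wins : forall X, (forall n, ~~ odd n -> X n = s (mkseq X n)) -> wins Psi X.

Let ext p (j : jump) := rcons (rcons p (s p)) ([::], j).

Inductive nodeC : seq move -> nat -> jump -> Prop :=
| nodeC0 : nodeC [::] 0 start
| nodeCS p n c j : nodeC p n c -> Inl j (s p).1 -> nodeC (ext p j) n.+1 j.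

Let mkseq2 X n : mkseq X n.+1.*2 = rcons (rcons (mkseq X n.*2) (X n.*2)) (X n.*2.+1).
Proof. by rewrite doubleS !mkseqS. Qed.

Lemma nodeC_play p n c X : nodeC p n c -> mkseq X n.*2 = p ->
  [/\ cur X n = c, forall m, m < n -> okS X m &
      forall i, i < n.*2 -> ~~ odd i -> X i = s (mkseq X i)].
Proof.
move=> np; elim: np X => [|{}p {}n {}c j np IH jL] X //.
rewrite mkseq2 => /rcons_inj[/rcons_inj[E1 E2] E3].
have [Ec hS hs] := IH _ E1; split.
- by rewrite /= E3.
- move=> m; rewrite ltnS leq_eqVlt => /predU1P[->|/hS//].
  by rewrite /okS E2 E3.
- move=> i; rewrite doubleS ltnS leq_eqVlt => /predU1P[->|].
    by rewrite /= odd_double.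
  by rewrite ltnS leq_eqVlt => /predU1P[->|/hs//]; rewrite E1 E2.
Qed.

Lemma nodeC_size p n c : nodeC p n c -> size p = n.*2.
Proof. by elim=> // {}p {}n {}c j _ IH _; rewrite !size_rcons IH doubleS. Qed.

(** After an illegal proposal the play could be continued by [s], and the separator would not be the
    first offender; [s] would lose this play. *)
Lemma nodeC_ok p n c : nodeC p n c -> list_ok n c (s p).1.
Proof.
move=> np; have [X [Ep hX]] := play_extend s p; rewrite (nodeC_size np) in Ep hX.
have [Ec hS hs] := nodeC_play np Ep.
have fX i : ~~ odd i -> X i = s (mkseq X i).
  by move=> oi; case: (ltnP i n.*2) => [/hs/(_ oi)|/hX].
suff : okC X n by rewrite /okC Ec hX // Ep.
have [[k [hC _ nS]]|[nf _]] := s_wins fX; last exact: (nf n).1.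
by apply: hC; rewrite leqNgt; apply/negP => /hS.
Qed.

(** A Konig-type principle: a property that always passes to some child holds along a whole play
    that follows [s]; having no faults, this play must converge to an end of Psi. *)
Lemma branchC (Q : seq move -> nat -> jump -> Prop) : Q [::] 0 start ->
  (forall p n c, nodeC p n c -> Q p n c ->
     exists2 j, Inl j (s p).1 & Q (ext p j) n.+1 j) ->
  exists X w, [/\ nofault X, Psi w, converges X w &
    forall n, exists2 p, nodeC p n (cur X n) & Q p n (cur X n)].
Proof.
move=> Q0 QS.
have [||F FP] := @dep_choice (fun=> (seq move * jump)%type)
    (fun i pc => nodeC pc.1 i pc.2 /\ Q pc.1 i pc.2)
    (fun i pc pc' => Inl pc'.2 (s pc.1).1 /\ pc'.1 = ext pc.1 pc'.2).
- by exists ([::], start); split=> //; exact: nodeC0.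
- move=> i [p c] [np Qp]; have [j jL Qj] := QS _ _ _ np Qp.
  exists (ext p j, j); split=> //; split=> //; exact: (nodeCS np jL).
have F0 : (F 0).1 = [::].
  by have := nodeC_size (FP 0).1.1; case: (F 0).1.
pose X i : move := if odd i then ([::], (F i./2.+1).2) else s (F i./2).1.
have Xe n : X n.*2 = s (F n).1 by rewrite /X odd_double doubleK.
have Xo n : X n.*2.+1 = ([::], (F n.+1).2) by rewrite /X /= odd_double uphalf_double.
have XF n : mkseq X n.*2 = (F n).1.
  elim: n => [|n IH]; first by rewrite F0.
  by rewrite mkseq2 IH Xe Xo; have [_ [_ ->]] := FP n.
have cF n : cur X n = (F n).2 by have [] := nodeC_play (FP n).1.1 (XF n).
have nf : nofault X.
  move=> n; split; first by rewrite /okC cF Xe; exact: nodeC_ok (FP n).1.1.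
  by rewrite /okS Xe Xo /=; have [_ []] := FP n.
have [|[k [_ _ nS]]|[_ [w Pw cw]]] := s_wins (X := X).
- move=> n /negbTE on; have En : n = n./2.*2 by rewrite -{1}(odd_double_half n) on.
  by rewrite En Xe XF.
- by have [] := nf k.
- by exists X, w; split=> // n; exists (F n).1; rewrite cF; have [[]] := FP n.
Qed.

Inductive belowC p n c : seq move -> nat -> jump -> Prop :=
| belowC0 : belowC p n c p n c
| belowCS q m d j : belowC p n c q m d -> Inl j (s q).1 ->
    belowC p n c (ext q j) m.+1 j.

Lemma belowC_node p n c q m d : nodeC p n c -> belowC p n c q m d ->
  nodeC q m d /\ d.1 `<=` c.1.
Proof.
move=> np; elim=> [|{}q {}m {}d j _ [nq sd] jL]; first by split.
split; first exact: (nodeCS nq jL).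
by have [/(_ j jL)[_ sj _ _] _] := nodeC_ok nq; exact: subset_trans sd.
Qed.

Lemma belowC_root q m d : nodeC q m d -> belowC [::] 0 start q m d.
Proof. by elim=> [|p n c j _ IH jL]; [exact: belowC0|exact: (belowCS IH jL)]. Qed.

Lemma belowC_left p n c q m d : belowC p n c q m d ->
  [/\ p = q, n = m & c = d] \/
  exists2 j, Inl j (s p).1 & belowC (ext p j) n.+1 j q m d.
Proof.
elim=> [|{}q {}m {}d j _ IH jL]; first by left.
right; case: IH => [[Ep En _]|[j' j'L IH]].
  by exists j; rewrite Ep // En; exact: belowC0.
by exists j' => //; exact: (belowCS IH jL).
Qed.

(** [Q] collects, over all nodes of the strategy, finitely many base edges that realise the proposed
    connection there. *)
Lemma connector_compact : exists Q,
  [/\ Q `<=` P, compact_edges Psi Q & eqv Psi Q x0 y0].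
Proof.
have /choice[es esP] : forall a : seq move * nat * jump, exists l : seq E,
    nodeC a.1.1 a.1.2 a.2 -> (forall e, e \in l -> base a.1.2 a.2.1 e) /\
    conn [set` l] (via (fun j => Inl j (s a.1.1).1)) a.2.2.1 a.2.2.2.
  move=> [[p n] c] /=; have [np|nn] := pselect (nodeC p n c); last by exists [::].
  have [_ /conn_finite[B' [L [hB hL h]]]] := nodeC_ok np.
  exists B' => _; split=> //; apply: conn_mono h => // u v [C CL].
  by exists C; exact: hL.
pose Q : set E := [set e | exists p n c, nodeC p n c /\ e \in es (p, n, c)].
exists Q; split.
- by move=> e [p [n [c [np ec]]]]; have [/(_ e ec)[]] := esP (p, n, c) np.
(* A node has finitely many children and finitely many edges of its own, so a failure of finite
   coverage passes to a child. Along the resulting branch the components shrink to an end of Psi,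
   and a single member of the cover contains all edges below a late node. *)
- move=> UU hU; apply: contrapT => nfc.
  pose below p n c : set E := [set e |
    exists q m d, belowC p n c q m d /\ e \in es (q, m, d)].
  have [||X [w [nf Pw cw hX]]] := @branchC (fun p n c => ~ fin_covered UU (below p n c)).
  + apply: contra_not nfc; apply: fin_covered_sub => e [p [n [c [np ec]]]].
    by exists p, n, c; split=> //; exact: belowC_root.
  + move=> p n c np nb_; apply: contrapT => nj; apply: nb_.
    have : fin_covered UU ([set` es (p, n, c)] `|`
        [set e | exists2 j, Inl j (s p).1 & below (ext p j) n.+1 j e]).
      apply: fin_coveredU; first by apply: fin_covered_finite; exact: finite_seq.
      have {nj} : forall j, Inl j (s p).1 -> fin_covered UU (below (ext p j) n.+1 j).
        by move=> j jL; apply: contrapT => nf; apply: nj; exists j.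
      elim: (s p).1 => [|j L IH] h.
        by apply: fin_covered_finite; rewrite (_ : [set e | _] = set0) //;
          apply/seteqP; split=> // e [].
      apply: (@fin_covered_sub _ _ (below (ext p j) n.+1 j `|`
          [set e | exists2 j, Inl j L & below (ext p j) n.+1 j e])).
        by move=> e [j' [<-|jL] be]; [left|right; exists j'].
      apply: fin_coveredU; first by apply: h; left.
      by apply: IH => j' jL; apply: h; right.
    apply: fin_covered_sub => e [q [m [d [bq ed]]]].
    have [[E1 E2 E3]|[j jL bj]] := belowC_left bq; first by left; rewrite /= E1 E2 E3.
    by right; exists j => //; exists q, m, d.
  have [X1 UX1 [S fS SX1]] := hU w Pw; have [n nP] := converges_small nf cw fS.
  have [p np nfc'] := hX n.+1; apply: nfc'; exists [set X1]; split=> //.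
    by move=> _ ->.
  rewrite (_ : [set e | _] = set0) //; apply/seteqP; split=> // e [[q [m [d [bq ed]]]]].
  apply; exists X1 => //; have [nq sd] := belowC_node np bq.
  have [/(_ e ed)[_ te _] _] := esP (q, m, d) nq.
  have te' : touch (cur X n.+1).1 e by case: te => /sd; [left|right].
  have [c1 c2] := touch_cl te'.
  by split; apply/SX1/nP/(nofault_cl nf).
(* A function that separates the two vertices of a node and no edge of [Q] separates the two
   vertices of some proposed jump. Following these jumps leads to an end near which the function is
   constant. *)
- move=> f gf; apply: contrapT => ne.
  have [|X [w [nf Pw cw hX]]] := @branchC (fun p n c => f c.2.1 <> f c.2.2) ne.
    move=> p n c np nf; apply: contrapT => nj; apply: nf.
    have [hB] := esP (p, n, c) np; apply: conn_const.
      by move=> e ec; apply: gf.2; exists p, n, c.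
    move=> u v [C CL]; apply: contrapT => nuv; apply: nj.
    by exists (C, (u, v)).
  have [S fS SP] := gf.1 w Pw; have [n nP] := converges_small nf cw fS.
  have [p _] := hX n.+1; apply; have [_ _ n1 n2] := nofault_comp n nf.
  by apply: SP; apply: nP; apply: (nofault_cl nf); right.
Qed.

End Connector.

(** * A winning strategy of the separator yields a separating bipartition *)

Section Separator.
Variable sg : seq move -> move.
Hypothesis sg_wins : forall X, (forall n, odd n -> X n = sg (mkseq X n)) -> ~ wins Psi X.

Let ask (p : seq move) (L : seq jump) : seq move := rcons p (L, start).
Let rep p L : jump := (sg (ask p L)).2.
Let exS p L := rcons (ask p L) (sg (ask p L)).

Inductive nodeS : seq move -> nat -> jump -> Prop :=
| nodeS0 : nodeS [::] 0 start
| nodeSS p n c L : nodeS p n c -> list_ok n c L -> nodeS (exS p L) n.+1 (rep p L).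

Let mkseq2 X n : mkseq X n.+1.*2 = rcons (rcons (mkseq X n.*2) (X n.*2)) (X n.*2.+1).
Proof. by rewrite doubleS !mkseqS. Qed.

Lemma nodeS_play p n c X : nodeS p n c -> mkseq X n.*2 = p ->
  [/\ cur X n = c, forall m, m < n -> okC X m &
      forall i, i < n.*2 -> odd i -> X i = sg (mkseq X i)].
Proof.
move=> np; elim: np X => [|{}p {}n {}c L np IH okL] X //.
rewrite mkseq2 => /rcons_inj[/rcons_inj[E1 E2] E3].
have [Ec hC hs] := IH _ E1; split.
- by rewrite /= E3.
- move=> m; rewrite ltnS leq_eqVlt => /predU1P[->|/hC//].
  by rewrite /okC Ec E2.
- move=> i; rewrite doubleS ltnS leq_eqVlt => /predU1P[->|].
    by rewrite E3 mkseqS E1 E2.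
  by rewrite ltnS leq_eqVlt => /predU1P[->|/hs//]; rewrite odd_double.
Qed.

Lemma nodeS_size p n c : nodeS p n c -> size p = n.*2.
Proof. by elim=> // {}p {}n {}c j _ IH _; rewrite !size_rcons IH doubleS. Qed.

Lemma nodeS_reply p n c L : nodeS p n c -> list_ok n c L -> Inl (rep p L) L.
Proof.
move=> np okL; have [X [Ep hX]] := play_extend sg (ask p L).
rewrite size_rcons (nodeS_size np) in Ep hX; move: Ep; rewrite mkseqS => /rcons_inj[Ep EL].
have [Ec hC hs] := nodeS_play np Ep.
have fX i : odd i -> X i = sg (mkseq X i).
  move=> oi; case: (ltngtP i n.*2) => [/hs/(_ oi)//|/hX//|Ei].
  by rewrite Ei odd_double in oi.
have ES : X n.*2.+1 = sg (ask p L) by rewrite fX /= ?odd_double // mkseqS Ep EL.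
apply: contrapT => nI; apply: (sg_wins fX); left.
have e : exists k, `[< ~ okS X k >] by exists n; apply/asboolP; rewrite /okS ES EL.
case: (ex_minnP e) => k /asboolP nk kP; exists k; split=> //.
  move=> m mk; have mn : m <= n.
    apply: leq_trans mk _; apply: kP; apply/asboolP; by rewrite /okS ES EL.
  move: mn; rewrite leq_eqVlt => /predU1P[->|/hC//]; by rewrite /okC Ec EL.
move=> m mk; apply: contrapT => nm; have /asboolP/kP := nm.
by rewrite leqNgt mk.
Qed.

Lemma branchS (Q : seq move -> nat -> jump -> Prop) : Q [::] 0 start ->
  (forall p n c, nodeS p n c -> Q p n c ->
     exists2 L, list_ok n c L & Q (exS p L) n.+1 (rep p L)) ->
  exists X, [/\ nofault X, forall w, converges X w -> ~ Psi w &
    forall n, exists2 p, nodeS p n (cur X n) & Q p n (cur X n)].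
Proof.
move=> Q0 QS.
have [||F FP] := @dep_choice (fun=> (seq move * jump)%type)
    (fun i pc => nodeS pc.1 i pc.2 /\ Q pc.1 i pc.2)
    (fun i pc pc' => exists L, list_ok i pc.2 L /\ pc' = (exS pc.1 L, rep pc.1 L)).
- by exists ([::], start); split=> //; exact: nodeS0.
- move=> i [p c] [np Qp]; have [L okL QL] := QS _ _ _ np Qp.
  exists (exS p L, rep p L); split; first by exists L.
  by split=> //; exact: (nodeSS np okL).
have /choice[L LP] := fun i => (FP i).2.
have F0 : (F 0).1 = [::].
  by have := nodeS_size (FP 0).1.1; case: (F 0).1.
pose X i : move := if odd i then sg (ask (F i./2).1 (L i./2)) else (L i./2, start).
have Xe n : X n.*2 = (L n, start) by rewrite /X odd_double doubleK.
have Xo n : X n.*2.+1 = sg (ask (F n).1 (L n)) by rewrite /X /= odd_double uphalf_double.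
have XF n : mkseq X n.*2 = (F n).1.
  elim: n => [|n IH]; first by rewrite F0.
  by rewrite mkseq2 IH Xe Xo; have [_ ->] := LP n.
have cF n : cur X n = (F n).2 by have [] := nodeS_play (FP n).1.1 (XF n).
have nf : nofault X.
  move=> n; split; first by rewrite /okC cF Xe; have [] := LP n.
  rewrite /okS Xe Xo /=; apply: (nodeS_reply (n := n) (c := (F n).2)).
    by have [[]] := FP n.
  by have [] := LP n.
exists X; split=> //; last by move=> n; exists (F n).1; rewrite cF; have [[]] := FP n.
move=> w cw Pw; apply: (sg_wins (X := X)); last by right; split=> //; exists w.
move=> n on; have En : n = n./2.*2.+1 by rewrite -{1}(odd_double_half n) on.
by rewrite En Xo mkseqS XF Xe.
Qed.

(** Idle jumps are those that the separator never picks from a legal list at this node. Whatever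
    they and the base edges connect to the first vertex is thereby conceded, and [fp] is the
    conceded set. *)
Let idle p n c (j : jump) := jump_ok n c.1 j /\ forall L, list_ok n c L -> rep p L <> j.
Let fp p n (c : jump) v := conn (base n c.1) (via (idle p n c)) c.2.1 v.

(** Otherwise finitely many idle jumps would form a legal list, and the reply to it would be one of
    them. *)
Let fp_t p n c : nodeS p n c -> ~ fp p n c c.2.2.
Proof.
move=> np /conn_finite[B' [L [hB hL h]]].
have okL : list_ok n c L.
  split; first by move=> j /hL[].
  exact: conn_mono h.
by have /hL[_ /(_ L okL)] := nodeS_reply np okL.
Qed.

(** A position in which the separator has picked [j]. It is meaningful when [j] leads from a
    conceded vertex to an unconceded one, since such a jump cannot be idle. *)
Let nxt p n c j : seq move :=
  if pselect (exists L, list_ok n c L /\ rep p L = j) is left e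
  then exS p (sval (cid e)) else [::].

Let nxtP p n c j : jump_ok n c.1 j -> fp p n c j.2.1 -> ~ fp p n c j.2.2 ->
  exists L, [/\ list_ok n c L, rep p L = j & nxt p n c j = exS p L].
Proof.
move=> okj f1 f2; rewrite /nxt; case: pselect => [e|[]].
  by case: (cid e) => L [okL rL]; exists L.
apply: contrapT => nL; apply: f2; apply: connJ f1 _; exists j.1.
rewrite -!surjective_pairing; split=> // L okL rL; apply: nL; by exists L.
Qed.

(** The side of the first vertex. Inside a component it is the same disjunction of conjunctions over
    boundary pairs as in [boundary_ext], with the separations supplied by the next nodes of the
    strategy. The recursion at [v] ends when [v] is outside the current region. *)
Inductive sepv : seq move -> nat -> jump -> V -> Prop :=
| sepv0 p n c v : ~ U n v -> fp p n c v -> sepv p n c v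
| sepvS p n c v C a : component (~` U n) C -> C v -> nb C a -> fp p n c a ->
    (forall b, nb C b -> ~ fp p n c b ->
       sepv (nxt p n c (C, (a, b))) n.+1 (C, (a, b)) v) ->
    sepv p n c v.

Let sepv0E p n c v : ~ U n v -> (sepv p n c v <-> fp p n c v).
Proof.
move=> nv; split=> [h|]; last exact: sepv0.
case: h nv => // {}p {}n {}c {}v C a cC Cv _ _ _ []; apply: contrapT.
exact: component_notin cC Cv.
Qed.

Let sepvSE p n c v C : component (~` U n) C -> C v -> (sepv p n c v <->
  exists a, [/\ nb C a, fp p n c a & forall b, nb C b -> ~ fp p n c b ->
       sepv (nxt p n c (C, (a, b))) n.+1 (C, (a, b)) v]).
Proof.
move=> cC Cv; split=> [h|[a [na fa h]]]; last exact: sepvS h.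
case: h cC Cv => {}p {}n {}c {}v.
  by move=> nv _ cC Cv; exfalso; apply: (component_notin cC Cv).
move=> C' a cC' C'v na fa h cC Cv.
by rewrite (component_eq cC cC' Cv C'v); exists a.
Qed.

Let nodeS_nb p n c v : nodeS p n c -> nb c.1 v -> ~ U n v.
Proof.
case=> [|{}p m {}c L np okL] //; first by case=> [[]].
have [/(_ _ (nodeS_reply np okL))[cC _ _ _] _] := okL.
by move=> /(component_nb cC) nv /US.
Qed.

(* The formula for the points of [C] also holds on its boundary. *)
Let sepv_cl p n c v C : nodeS p n c -> component (~` U n) C -> C `<=` c.1 ->
  (C `|` nb C) v -> (sepv p n c v <->
  exists a, [/\ nb C a, fp p n c a & forall b, nb C b -> ~ fp p n c b ->
       sepv (nxt p n c (C, (a, b))) n.+1 (C, (a, b)) v]).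
Proof.
move=> np cC sC [Cv|nv]; first exact: sepvSE.
have node a b : nb C a -> nb C b -> fp p n c a -> ~ fp p n c b ->
    nodeS (nxt p n c (C, (a, b))) n.+1 (C, (a, b)).
  move=> na nb_ fa fb; have [|L [okL rL ->]] := @nxtP p n c (C, (a, b)) _ fa fb.
    by split.
  by rewrite -rL; exact: (nodeSS np okL).
rewrite sepv0E; last exact: nb_notin cC nv.
have nU1 u : nb C u -> ~ U n.+1 u by move=> nu /US; exact: nb_notin cC nu.
split=> [fv|[a [na fa h]]].
  exists v; split=> // b nb_ fb; apply: sepv0; first exact: nU1.
  exact: conn0.
apply: contrapT => fv; have := h v nv fv; rewrite sepv0E; last exact: nU1.
exact: (fp_t (node a v na nv fa fv)).
Qed.

Let sub_cur p n c C v : nodeS p n c -> component (~` U n) C -> C v -> c.1 v -> C `<=` c.1.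
Proof.
case=> [|{}p m {}c L np okL] // cC Cv cv.
have [/(_ _ (nodeS_reply np okL))[cC' _ _ _] _] := okL.
move=> u Cu; apply: Defs.component_closed cC' cv _.
apply: linked_sub (component_linked cC Cv Cu); apply: subsetC; exact: US.
Qed.

Let child p n c C a b : nodeS p n c -> component (~` U n) C -> C `<=` c.1 ->
  nb C a -> nb C b -> fp p n c a -> ~ fp p n c b ->
  exists L, [/\ list_ok n c L, rep p L = (C, (a, b)) & nxt p n c (C, (a, b)) = exS p L].
Proof. by move=> np cC sC na nb_ fa fb; apply: nxtP. Qed.

(** Induction on the number of stages until the edge lies off the region. Off the region it is a
    base edge, so both endvertices are conceded or neither is; within a component, [sepv_cl] reduces
    both endvertices to the same children. *)
Let sepv_edge k p n c e : nodeS p n c -> P e -> touch c.1 e -> ~ touch (U (n + k)) e ->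
  (sepv p n c (src e) <-> sepv p n c (tgt e)).
Proof.
elim: k p n c => [|k IH] p n c np Pe te.
  rewrite addn0 => nt; have [ns nt'] : ~ U n (src e) /\ ~ U n (tgt e).
    by split=> h; apply: nt; [left|right].
  have be : base n c.1 e by [].
  by rewrite !sepv0E //; split=> h; [exact: connE h be|exact: connE' h be].
move=> nt; have [tU|ntU] := pselect (touch (U n) e); last first.
  have [ns nt'] : ~ U n (src e) /\ ~ U n (tgt e).
    by split=> h; apply: ntU; [left|right].
  have be : base n c.1 e by [].
  by rewrite !sepv0E //; split=> h; [exact: connE h be|exact: connE' h be].
have [C cC tC] := touch_component tU; have [c1 c2] := touch_cl tC.
have sC : C `<=` c.1.
  have [d1 d2] := touch_cl te.
  case: tC => Ce; apply: (sub_cur np cC Ce).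
    by case: d1 => // /(nodeS_nb np) h; exfalso; apply: h; apply: contrapT; exact: component_notin cC Ce.
  by case: d2 => // /(nodeS_nb np) h; exfalso; apply: h; apply: contrapT; exact: component_notin cC Ce.
rewrite (sepv_cl np cC sC c1) (sepv_cl np cC sC c2).
have key a b : nb C a -> nb C b -> fp p n c a -> ~ fp p n c b ->
    (sepv (nxt p n c (C, (a, b))) n.+1 (C, (a, b)) (src e) <->
     sepv (nxt p n c (C, (a, b))) n.+1 (C, (a, b)) (tgt e)).
  move=> na nb_ fa fb; have [L [okL rL ->]] := child np cC sC na nb_ fa fb.
  apply: IH; rewrite // ?addSnnS //; rewrite -rL; exact: (nodeSS np okL).
by split=> -[a [na fa h]]; exists a; split=> // b nb_ fb; apply/key => //; exact: h.
Qed.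

(** Constancy near [w]. One implication suffices, because [u] and [v] can be interchanged. *)
Let evc w (phi : V -> Prop) := exists2 S, finite_set S &
  forall u v, end_component S w u -> end_component S w v -> phi u -> phi v.

Let evc_op w (phi psi chi : V -> Prop) : evc w phi -> evc w psi ->
  (forall u v, (phi u <-> phi v) -> (psi u <-> psi v) -> chi u -> chi v) -> evc w chi.
Proof.
move=> [S fS SP] [T fT TP] h; have fU : finite_set (S `|` T) by rewrite finite_setU.
exists (S `|` T) => // u v Cu Cv.
have [SU TU] : end_component (S `|` T) w `<=` end_component S w /\
    end_component (S `|` T) w `<=` end_component T w.
  by split; apply: end_comp_mono.
by apply: h; split; by [apply: SP; exact: SU|apply: TP; exact: TU].
Qed.

Let evc_cst w (b : Prop) : evc w (fun=> b). Proof. by exists set0. Qed.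

Let evc_ex w (l : seq V) (phi : V -> V -> Prop) :
  (forall a, a \in l -> evc w (phi a)) -> evc w (fun v => exists2 a, a \in l & phi a v).
Proof.
elim: l => [|a l IH] h.
  by apply: (evc_op (evc_cst w True) (evc_cst w True)) => u v _ _ [].
have ha : evc w (phi a) by apply: h; rewrite inE eqxx.
apply: (evc_op ha (IH _)); first by move=> b bl; apply: h; rewrite inE bl orbT.
move=> u v h1 h2 [b]; rewrite inE => /predU1P[->|bl] hb.
  by exists a; rewrite ?inE ?eqxx //; apply/h1.
have /h2[b' b'l hb'] : exists2 a, a \in l & phi a u by exists b.
by exists b'; rewrite // inE b'l orbT.
Qed.

Let evc_all w (l : seq V) (phi : V -> V -> Prop) :
  (forall a, a \in l -> evc w (phi a)) -> evc w (fun v => forall a, a \in l -> phi a v).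
Proof.
elim: l => [|a l IH] h; first by apply: (evc_op (evc_cst w True) (evc_cst w True)).
have ha : evc w (phi a) by apply: h; rewrite inE eqxx.
apply: (evc_op ha (IH _)); first by move=> b bl; apply: h; rewrite inE bl orbT.
move=> u v h1 h2 hu b; rewrite inE => /predU1P[->|bl].
  by apply/h1; apply: hu; rewrite inE eqxx.
by move: b bl; apply/h2 => b bl; apply: hu; rewrite inE bl orbT.
Qed.

(** Around [w] the value at a node is a finite Boolean combination of values at children, as the
    boundary is finite. Hence a failure of constancy passes to a child around [w], and the resulting
    branch converges to [w], although the separator wins. *)
Let sepv_good w : Psi w -> evc w (sepv [::] 0 start).
Proof.
move=> Pw; apply: contrapT => ne.
have [||X [nf cw hX]] := @branchS (fun p n c => lives_in w c.1 /\ ~ evc w (sepv p n c)).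
- by split=> // r _; exists 0.
- move=> p n c np [lc nc]; apply: contrapT => nL; apply: nc.
  have [C cC wC] := (Ucov n).2 w Pw.
  have fC := (Ucov n).1 C cC.
  have [v [Cv cv]] := lives_ex (lives_setI wC lc).
  have sC := sub_cur np cC Cv cv.
  have /finite_seqP[l lE] := fC.
  have nbl a : nb C a <-> a \in l by rewrite lE.
  have key : evc w (fun v => exists2 a, a \in l & fp p n c a /\
      forall b, b \in l -> ~ fp p n c b ->
        sepv (nxt p n c (C, (a, b))) n.+1 (C, (a, b)) v).
    apply: evc_ex => a al; have [fa|nfa] := pselect (fp p n c a); last first.
      by apply: (evc_op (evc_cst w True) (evc_cst w True)) => u v' _ _ [].
    apply: (evc_op (evc_cst w True) (evc_all (phi := fun b v => ~ fp p n c b ->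
        sepv (nxt p n c (C, (a, b))) n.+1 (C, (a, b)) v) (l := l) (w := w) _)).
      move=> b bl; have [fb|nfb] := pselect (fp p n c b).
        by apply: (evc_op (evc_cst w True) (evc_cst w True)).
      apply: (@evc_op _ _ _ _ (evc_cst w True) (_ : evc w (sepv (nxt p n c (C, (a, b))) n.+1 (C, (a, b))))).
        apply: contrapT => ns; apply: nL.
        have [L [okL rL EL]] := child np cC sC ((nbl a).2 al) ((nbl b).2 bl) fa nfb.
        by exists L => //; rewrite -EL rL.
      by move=> u v' _ h h' _; apply/h; exact: h'.
    by move=> u v' _ h [_ h']; split=> //; apply/h.
  have [S fS SP] := key; have fT : finite_set (S `|` nb C) by rewrite finite_setU.
  have TC : end_component (S `|` nb C) w `<=` C.
    by apply: end_comp_sub => //; exact: subsetUr.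
  exists (S `|` nb C) => // u v' Tu Tv.
  rewrite (sepvSE _ _ cC (TC _ Tu)) (sepvSE _ _ cC (TC _ Tv)) => -[a [na fa h]].
  have sS : end_component (S `|` nb C) w `<=` end_component S w.
    by apply: end_comp_mono => //; exact: subsetUl.
  have [|a' a'l [fa' h']] := SP u v' (sS _ Tu) (sS _ Tv).
    by exists a; [exact/nbl|split=> // b /nbl; exact: h].
  by exists a'; split=> //; [exact/nbl|move=> b /nbl; exact: h'].
- by apply: (cw w) => // n; have [p _ []] := hX n.
Qed.

Lemma separator_Gd : exists2 f, Gd Psi P f & f x0 <> f y0.
Proof.
exists (fun v => `[< sepv [::] 0 start v >]); first split.
- move=> w Pw; have [S fS SP] := sepv_good Pw; exists S => // u v Cu Cv.
  by apply/asboolP/asboolP; exact: SP.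
- move=> e Pe; apply/notsep.
  have [k nt] : exists k, ~ touch (U k) e.
    have [k nk] := Uleave (src e); have [m nm] := Uleave (tgt e); exists (maxn k m).
    by case=> h; [apply: nk|apply: nm]; apply: Umono h; rewrite ?leq_maxl ?leq_maxr.
  have te : touch start.1 e by left.
  have := @sepv_edge k _ _ _ e nodeS0 Pe te; rewrite add0n => /(_ nt) h.
  by apply/asboolP/asboolP => /h.
- rewrite asboolT; last by apply: sepv0 => //; exact: conn0.
  rewrite asboolF //; rewrite sepv0E //; exact: fp_t nodeS0.
Qed.

End Separator.

Lemma eqv_compact (R : realType) : borel_end_set R Psi -> eqv Psi P x0 y0 ->
  exists Q, [/\ Q `<=` P, compact_edges Psi Q & eqv Psi Q x0 y0].
Proof.
move=> bP xy.
have [[s sP]|[s sP]] := unravelable_determined ([::], start) (wins_unravelable bP).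
  exact: connector_compact sP.
by have [f /xy] := separator_Gd sP.
Qed.

End Game.

(** * The matroid and its cocircuits *)

Lemma chain_finite (T : choiceType) (F : set (set T)) (A : set T) :
  total_on F subset -> finite_set A -> A `<=` \bigcup_(X in F) X ->
  A = set0 \/ exists2 X, F X & A `<=` X.
Proof.
move=> tot /finite_seqP[l ->]; elim: l => [|a l IH] h; first by left; apply/seteqP; split.
right; have [X FX Xa] : (\bigcup_(X in F) X) a by apply: h; rewrite /= inE eqxx.
have [|E|[Y FY lY]] := IH; first by move=> b bl; apply: h; rewrite /= inE bl orbT.
  exists X => // b; rewrite /= inE => /predU1P[->//|bl].
  by have : set0 b by rewrite -E.
have [XY|YX] := tot X Y FX FY.
  by exists Y => // b; rewrite /= inE => /predU1P[->|/lY//]; exact: XY.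
by exists X => // b; rewrite /= inE => /predU1P[->//|/lY /YX].
Qed.

Section Bases.
Variables (R : realType) (G : graph) (Psi : set (graph_end G)).
Let V := vertex G.
Let E := edge G.
Hypothesis Psi_borel : borel_end_set R Psi.
Hypothesis Psi_undominated : forall w, Psi w -> undominated w.
Implicit Types (f g h : V -> bool) (P Q I J K X Y Z : set E) (x y v s t : V)
  (C U : set V) (w : graph_end G) (e : E).

Let Gd := Gd Psi.
Let eqv := eqv Psi.
Let span := span Psi.
Let cpt := compact_edges Psi.
Let cov := covers Psi.

Lemma eqv_witness P x y : eqv P x y ->
  exists Q, [/\ Q `<=` P, cpt Q & eqv Q x y].
Proof.
move=> xy; have [U [fU cU Ucl Ul]] := regions Psi_undominated.
have [n nx] := Ul x; have [m my] := Ul y.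
have US k : U k.+1 `<=` U k by move=> v Uv; apply: Ucl; left.
have nU k v : k <= maxn n m -> ~ U k v -> ~ U (maxn n m) v.
  by move=> le nv Uv; apply: nv; exact: (linked_chain_mono US le).
(* The sequence of regions is shifted so that [x] and [y] lie outside the initial one. *)
apply: (@eqv_compact G Psi P (fun i => U (maxn n m + i)%N) _ _ _ x y _ _ R) => //.
- by move=> i; split; [exact: fU|exact: cU].
- move=> i; rewrite addnS; exact: Ucl.
- move=> v; have [k nk] := Ul v; exists k => Uv; apply: nk.
  by apply: (linked_chain_mono US _ Uv); exact: leq_addl.
- by rewrite addn0; apply: (nU n); rewrite ?leq_maxl.
- by rewrite addn0; apply: (nU m); rewrite ?leq_maxr.
Qed.

Definition edge_indep I : Prop := forall e, I e -> ~ span (I `\ e) e.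

Lemma indep_sub I J : I `<=` J -> edge_indep J -> edge_indep I.
Proof.
move=> IJ iJ e Ie h; apply: (iJ e (IJ _ Ie)); apply: span_mono h => e' [/IJ].
by [].
Qed.

Lemma indep_Gd I e : edge_indep I -> I e -> exists2 f, Gd (I `\ e) f & sep f e.
Proof. by move=> iI Ie; apply: neqv_Gd; exact: iI. Qed.

Lemma indep_add J (y : E) : edge_indep J -> ~ span J y -> edge_indep (y |` J).
Proof.
move=> iJ nJ e; have [->|ne] := pselect (e = y).
  by move=> _ h; apply: nJ; apply: eqv_sub h => e' [[//|//]].
move=> [//|Je] h; apply: nJ => f gf.
have h' : eqv (y |` (J `\ e)) (src e) (tgt e).
  by apply: eqv_sub h => e' [[->|Je'] ne']; [left|right].
apply/notsep; apply: (exchange h' (iJ e Je)).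
  by apply: Gd_sub gf => e' [].
by apply/notsep; exact: gf.2.
Qed.

Lemma sep_addP f g e : sep (fun v => f v (+) g v) e <->
  (sep f e /\ ~ sep g e) \/ (~ sep f e /\ sep g e).
Proof.
have tf : true <> false by []. have ft : false <> true by [].
have := erefl true; have := erefl false; rewrite /sep.
by case: (f (src e)); case: (f (tgt e)); case: (g (src e)); case: (g (tgt e)) => /=; tauto.
Qed.

(** A largest set of edges of [K] outside [I] is discarded without changing the span. Unions of
    chains are allowed since a good function separates finitely many edges of [K], and these lie in
    one member of the chain. *)
Lemma indep_compact I K : edge_indep I -> cpt K -> exists J, [/\ I `<=` J,
  J `<=` I `|` K, edge_indep J & forall f, Gd J f -> Gd (I `|` K) f].
Proof.
move=> iI cK.
have [F FP tot|D [[DK Dsp] Dmax]] := @Zorn_bigcup _ [set D | D `<=` K `\` I /\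
    forall f, Gd ((I `|` K) `\` D) f -> Gd (I `|` K) f].
  split=> [e [D /FP[DK _] /DK]//|f gf].
  have fin : finite_set [set e | (\bigcup_(D in F) D) e /\ sep f e].
    apply: sub_finite_set (compact_sep cK gf.1) => e [[D /FP[DK _] De] se].
    by have [] := DK _ De.
  have [e []//|E0|[D FD sD]] := chain_finite tot fin.
    split; first exact: gf.1.
    move=> e IKe se; apply: (gf.2 e) => //; split=> // De.
    by have : set0 e by rewrite -E0.
  apply: (FP D FD).2; split; first exact: gf.1.
  move=> e [IKe nDe] se; apply: (gf.2 e) => //; split=> // De.
  by apply: nDe; apply: sD.
pose J := (I `|` K) `\` D; exists J.
have IJ : I `<=` J by move=> e Ie; split; [left|move=> /DK[]].
have fJ j : J j -> ~ I j -> exists2 f, Gd (J `\ j) f & sep f j.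
  move=> [[//|Kj] nDj] nIj; apply: contrapT => nf; apply: (Dmax (j |` D)).
    split; first by move=> e; right.
    by move=> /(_ j (or_introl erefl)).
  split; first by move=> e [->|/DK//]; split.
  move=> f gf; apply: Dsp; split; first exact: gf.1.
  move=> e [IKe nDe] se; have [Ee|ne] := pselect (e = j).
    rewrite {}Ee in se *; apply: nf; exists f => //; apply: Gd_sub gf => e' [[IKe' nD'] ne'].
    by split=> // -[].
  by apply: (gf.2 e) => //; split=> // -[].
split=> //; first by move=> e [].
move=> e Je; have [Ie|nIe] := pselect (I e); last first.
  by have [f gf sf] := fJ e Je nIe; move=> /(_ f gf).
(* The function witnessing that [e] is not spanned by the rest of [I] may separate finitely many of
   the new edges. Each is repaired by adding, modulo 2, a function that separates that edge and no
   other edge of [J]. *)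
have [f0 gf0 sf0] := indep_Gd iI Ie.
have /finite_seqP[l lE] := compact_sep cK gf0.1.
suff [f gf sf] : exists2 f, Gd (J `\ e) f & sep f e by move=> /(_ f gf).
have : forall j, J j -> ~ I j -> sep f0 j -> j \in l.
  move=> j [[//|Kj] _] _ sj; have : [set e | K e /\ sep f0 e] j by [].
  by rewrite lE.
elim: l {lE} f0 gf0 sf0 => [|j l IH] f gf sf hl.
  exists f => //; split; first exact: gf.1.
  move=> e' [Je' ne'] se'; have [Ie'|nIe'] := pselect (I e').
    by apply: (gf.2 e').
  by have := hl e' Je' nIe' se'.
have [[Jj nIj sj]|nj] := pselect [/\ J j, ~ I j & sep f j]; last first.
  apply: IH gf sf _ => j' Jj' nIj' sj'.
  by have := hl j' Jj' nIj' sj'; rewrite inE => /predU1P[Ej|//]; rewrite Ej in Jj' nIj' sj'; case: nj.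
have [g gg sg] := fJ j Jj nIj.
have ge : ~ sep g e by apply: gg.2; split=> // Ej; rewrite Ej in Ie.
apply: (IH (fun v => f v (+) g v)).
- split; first exact: good_op gf.1 gg.1.
  move=> e' [Ie' ne'] /sep_addP[[se' _]|[_ se']]; first by apply: (gf.2 e').
  by apply: (gg.2 e') => //; split; [exact: IJ|move=> Ej; rewrite Ej in Ie'].
- by apply/sep_addP; left.
- move=> j' Jj' nIj' /sep_addP[[sj' ng]|[nf sj']].
    have := hl j' Jj' nIj' sj'; rewrite inE => /predU1P[Ej|//].
    by rewrite Ej in ng.
  have [Ej|nEj] := pselect (j' = j); last by exfalso; apply: (gg.2 j').
  by rewrite Ej in nf.
Qed.

(** * One region: independent and spanning sets with equal boundary connections *)

Section Step.
Variable U : set V.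
Hypothesis covU : cov U.
Let comp C := component (~` U) C.

Lemma touch_disjoint C C' e : comp C -> comp C' -> touch C e -> touch C' e -> C = C'.
Proof.
move=> cC cC' tC tC'; have [c1 c2] := touch_cl tC.
have inU C'' v : comp C'' -> C'' v -> U v.
  by move=> c h; apply: contrapT; exact: component_notin c h.
case: tC' => C'e; [case: c1 => [Ce|ne]|case: c2 => [Ce|ne]].
- exact: component_eq cC cC' Ce C'e.
- by case: (nb_notin cC ne); exact: inU C'e.
- exact: component_eq cC cC' Ce C'e.
- by case: (nb_notin cC ne); exact: inU C'e.
Qed.

Lemma touch_comp C e : comp C -> touch C e -> touch U e.
Proof.
by move=> cC [h|h]; [left|right]; apply: contrapT; exact: component_notin cC h.
Qed.

Definition rel C J s t : Prop := [/\ nb C s, nb C t & eqv (J `&` touch C) s t].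

(** The order for Zorn's lemma. A trace may grow only together with the relation that it induces on
    the finite boundary, which bounds the number of changes along a chain. *)
Definition step_le J J' : Prop := J `<=` J' /\ forall C, comp C ->
  J `&` touch C = J' `&` touch C \/ exists s t, rel C J' s t /\ ~ rel C J s t.

Lemma rel_mono C J J' s t : J `<=` J' -> rel C J s t -> rel C J' s t.
Proof. by move=> JJ' [? ? h]; split=> //; apply: eqv_sub h => e [/JJ']. Qed.

Lemma step_le_refl J : step_le J J.
Proof. by split=> // C _; left. Qed.

Lemma step_le_trans J J' J'' : step_le J J' -> step_le J' J'' -> step_le J J''.
Proof.
move=> [s1 h1] [s2 h2]; split; first exact: subset_trans s2.
move=> C cC; have [E1|[s [t [r1 n1]]]] := h1 C cC; last first.
  by right; exists s, t; split=> //; exact: rel_mono s2 r1.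
have [E2|[s [t [r1 n1]]]] := h2 C cC; first by left; rewrite E1.
right; exists s, t; split=> // r; apply: n1; case: r => ? ? r; split=> //.
by rewrite -E1.
Qed.

(* Along a chain, the trace on a component changes at most finitely often,
   because the boundary of the component is finite. *)
Lemma step_chain (F : set (set E)) C : F !=set0 ->
  (forall J J', F J -> F J' -> step_le J J' \/ step_le J' J) -> comp C ->
  exists2 J, F J & (\bigcup_(J in F) J) `&` touch C = J `&` touch C.
Proof.
move=> [J0 FJ0] tot cC.
have fB := covU.1 C cC; pose RJ J : set (V * V) := [set p | rel C J p.1 p.2].
have RB J : RJ J `<=` nb C `*` nb C by move=> p [].
have fBB : finite_set (nb C `*` nb C) by exact: finite_setX.
pose N J := (card_set (nb C `*` nb C) - card_set (RJ J))%N.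
have e : exists n, `[< exists2 J, F J & N J = n >].
  by exists (N J0); apply/asboolP; exists J0.
case: (ex_minnP e) => n /asboolP[J FJ En] nP; exists J => //.
apply/seteqP; split=> [e' [[J' FJ' J'e] te]|e' [Je te]]; last by split=> //; exists J.
have [[sJ /(_ C cC)[EJ|[s [t [r nr]]]]]|[sJ _]] := tot J J' FJ FJ'.
- by rewrite EJ.
- exfalso; have : n <= N J' by apply: nP; apply/asboolP; exists J'.
  rewrite -En /N leqNgt ltn_sub2l //.
    apply: (@leq_trans (card_set (RJ J'))); last exact: card_sub.
    apply: (card_lt (v := (s, t))) => //; last by move=> p; exact: rel_mono.
    exact: sub_finite_set (RB J') fBB.
  apply: (card_lt (v := (s, t))) => //; last by move=> p; exact: rel_mono.
  exact: sub_finite_set (RB J') fBB.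
- by split=> //; exact: sJ.
Qed.

(** A maximal element of [step_le] works. An edge off the region can be added without touching any
    trace; a missing boundary connection could be supplied by a compact part of [Y] in one
    component, which would be a legitimate larger element. *)
Lemma step_lower I Y : edge_indep I -> I `<=` Y -> exists J, [/\ I `<=` J, J `<=` Y,
  edge_indep J, forall e, Y e -> ~ touch U e -> span J e &
  forall C s t, comp C -> rel C Y s t -> eqv J s t].
Proof.
move=> iI IY.
pose T := {J : set E | [/\ I `<=` J, J `<=` Y & edge_indep J]}.
have I0 : [/\ I `<=` I, I `<=` Y & edge_indep I] by split.
have [| | |[J [IJ JY iJ]] Jmax] := @ZL_preorder T (exist _ I I0)
    (fun a b => `[< step_le (sval a) (sval b) >]).
- by move=> a; apply/asboolP; exact: step_le_refl.
- by move=> a b c /asboolP h1 /asboolP h2; apply/asboolP; exact: step_le_trans h1 h2.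
- move=> A totA.
  have [[a0 Aa0]|nA] := pselect (exists a, A a); last first.
    by exists (exist _ I I0) => a Aa; exfalso; apply: nA; exists a.
  pose F := [set sval a | a in A]; pose Jo := \bigcup_(J in F) J.
  have F0 : F !=set0 by exists (sval a0); exists a0.
  have totF J J' : F J -> F J' -> step_le J J' \/ step_le J' J.
    move=> [a Aa <-] [b Ab <-].
    by have [/asboolP|/asboolP] := totA a b Aa Ab; [left|right].
  have totS : total_on F subset.
    by move=> J J' FJ FJ'; have [[]|[]] := totF J J' FJ FJ'; [left|right].
  have st C : comp C -> exists2 J, F J & Jo `&` touch C = J `&` touch C.
    by move=> cC; exact: step_chain.
  have IJo : I `<=` Jo by move=> e Ie; exists (sval a0); [exists a0|have [h _ _] := svalP a0; exact: h].
  have JoY : Jo `<=` Y by move=> e [_ [a Aa <-]]; have [_ h _] := svalP a; exact: h.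
  (* A dependence in the union has a compact witness. Off the region it is finite, and it touches
     finitely many components, on each of which the trace is attained; so one member of the chain
     contains all of it. *)
  have iJo : edge_indep Jo.
    move=> e Joe h; have [Q [QJ cQ Qe]] := eqv_witness h.
    have [W fW [Wc fQ tQ]] := compact_regions cQ covU.
    pose small (Z : set E) := exists2 J, F J & Z `<=` J.
    have smallU Z Z' : small Z -> small Z' -> small (Z `|` Z').
      move=> [J FJ ZJ] [J' FJ' ZJ']; have [JJ'|J'J] := totS J J' FJ FJ'.
        by exists J' => // z [/ZJ/JJ'|/ZJ'].
      by exists J => // z [/ZJ|/ZJ'/J'J].
    have sm1 : small (e |` [set e | Q e /\ ~ touch U e]).
      have [||E0|[J FJ sJ]] := @chain_finite _ F (e |` [set e | Q e /\ ~ touch U e]) totS.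
      - by rewrite finite_setU.
      - by move=> e' [->//|[/QJ[]]].
      - by have : set0 e by rewrite -E0; left.
      - by exists J.
    have sm2 : small [set e' | exists2 C, W C & (Jo `&` touch C) e'].
      have /finite_seqP[l lE] := fW.
      have : forall C, C \in l -> comp C by move=> C Cl; apply: Wc; rewrite lE.
      have -> : [set e' | exists2 C, W C & (Jo `&` touch C) e'] =
          [set e' | exists2 C, C \in l & (Jo `&` touch C) e'] by rewrite lE.
      elim: l {lE} => [|C l IH] hl.
        by exists (sval a0); [exists a0|move=> e' []].
      have [|J FJ sJ] := IH; first by move=> C' C'l; apply: hl; rewrite inE C'l orbT.
      have [|J' FJ' EJ'] := st C; first by apply: hl; rewrite inE eqxx.
      have [J3 FJ3 s3] : small (J' `|` J) by apply: smallU; [exists J'|exists J].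
      exists J3 => // e' [C']; rewrite inE => /predU1P[->|C'l] he.
        by apply: s3; left; move: he; rewrite EJ' => -[].
      by apply: s3; right; apply: sJ; exists C'.
    have [J FJ sJ] := smallU _ _ sm1 sm2.
    have [a Aa Ea] := FJ; have [_ _ iJ] := svalP a; rewrite Ea in iJ.
    apply: (iJ e); first by apply: sJ; left; left.
    apply: eqv_sub Qe => e' Qe'; have [Joe' ne'] := QJ _ Qe'; split=> //; apply: sJ.
    have [te|nte] := pselect (touch U e'); last by left; right.
    by right; have [C WC tC] := tQ _ Qe' te; exists C.
  exists (exist _ Jo (And3 IJo JoY iJo)) => a Aa; apply/asboolP; split.
    by move=> e ae; exists (sval a) => //; exists a.
  move=> C cC /=; have [J FJ EJ] := st C cC; have Fa : F (sval a) by exists a.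
  have [[sJ h]|[sJ _]] := totF _ _ Fa FJ.
    rewrite EJ; have [|[s [t [r nr]]]] := h C cC; first by left.
    right; exists s, t; split=> //; case: r => ? ? r; split=> //.
    by rewrite EJ.
  left; apply/seteqP; split=> [e [ae te]|e]; first by split=> //; exists (sval a).
  by rewrite EJ => -[Je te]; split=> //; exact: sJ.
have {}Jmax J' : step_le J J' -> J' `<=` Y -> edge_indep J' -> J' `<=` J.
  move=> le sY iJ'; have IJ' : I `<=` J' by apply: subset_trans le.1.
  have /asboolP[] := Jmax (exist _ J' (And3 IJ' sY iJ')) (introT (asboolP _) le).
  by [].
exists J; split=> //.
  move=> y Yy nty; apply: contrapT => ns; apply: (ns); apply: sub_span.
  apply: (Jmax (y |` J)); last by left.
  - split; first by move=> e; right.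
    move=> C cC; left; apply/seteqP; split=> [e [Je te]|e [[->|Je] te]]; [by split; [right|]| |by []].
    by case: nty; exact: touch_comp te.
  - by move=> e [->|/JY].
  - exact: indep_add iJ ns.
move=> C s t cC [nbs nbt YC]; apply: contrapT => nst.
have [K [KY cK Kst]] := eqv_witness YC.
have [J' [JJ' J'K iJ' J'sp]] := indep_compact iJ cK.
have J'st : eqv J' s t.
  by move=> f /J'sp gf; apply: Kst; apply: Gd_sub gf => e; right.
have [f gf fst] := neqv_Gd nst.
suff : J' `<=` J by move=> h; apply: nst; exact: eqv_sub J'st.
apply: Jmax => //; last by move=> e /J'K[/JY//|/KY[]].
split=> // C' cC'; have [EC|nC] := pselect (C' = C); last first.
  left; apply/seteqP; split=> [e [Je te]|e [J'e te]]; first by split=> //; exact: JJ'.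
  split=> //; have [//|Ke] := J'K e J'e; case: nC; have [_ tC] := KY _ Ke.
  exact: touch_disjoint cC' cC te tC.
rewrite EC; have [|nr] := pselect (exists u v, rel C J' u v /\ ~ rel C J u v).
  by right.
(* If no new boundary connection arose in [C], a function separating [s] and [t] and no edge of [J]
   could be changed inside the region to separate no edge of [J'], although [J'] joins [s] to
   [t]. *)
exfalso; have [| |h gh hf] := @extend G Psi U J' f covU.
- move=> e J'e nte; have [Je|/KY[_ tC]] := J'K e J'e; first exact: gf.2.
  by case: nte; exact: touch_comp tC.
- move=> Z a b cZ na nb' eZ; have [EZ|nZ] := pselect (Z = C).
    rewrite EZ in na nb' eZ; have [_ _ h] : rel C J a b.
      by apply: contrapT => n; apply: nr; exists a, b.
    by apply: h; apply: Gd_sub gf => e [].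
  apply: eZ; split; first exact: gf.1.
  move=> e [J'e tZ]; have [Je|/KY[_ tC]] := J'K e J'e; first exact: gf.2.
  by case: nZ; exact: touch_disjoint cZ cC tZ tC.
apply: fst; rewrite -!hf; [exact: J'st|exact: nb_notin cC nbt|exact: nb_notin cC nbs].
Qed.

(** [Z] is a maximal edge set in [C] that induces no new boundary connection. Adding a further edge
    would create one, and by [exchange] that edge is then spanned by [Z] once the two boundary
    vertices are identified. *)
Lemma step_upper J Y C : comp C -> J `<=` Y -> exists Z, [/\ J `&` touch C `<=` Z,
  Z `<=` Y `&` touch C, forall s t, rel C Z s t -> rel C J s t &
  forall e, Y e -> touch C e -> ~ Z e -> exists s t, rel C Y s t /\
    forall f, Gd Z f -> f s = f t -> ~ sep f e].
Proof.
move=> cC JY; pose P := J `&` touch C.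
have /choice[F FP] : forall p : V * V, exists f, Gd P f /\ (~ eqv P p.1 p.2 -> f p.1 <> f p.2).
  move=> [s t]; have [h|/neqv_Gd[f gf ne]] := pselect (eqv P s t); last by exists f.
  by exists (fun=> true); split=> //; exact: Gd_cst.
have /finite_seqP[l lE] := covU.1 C cC.
pose Y0 := [set e | (Y `&` touch C) e /\ forall s t, nb C s -> nb C t -> ~ sep (F (s, t)) e].
have PY0 : P `<=` Y0.
  move=> e Pe; split; first by split; [exact: JY Pe.1|exact: Pe.2].
  by move=> s t _ _; apply: (FP (s, t)).1.2.
have relY0 s t : nb C s -> nb C t -> eqv Y0 s t -> eqv P s t.
  move=> ns nt h; apply: contrapT => nh; have [gF /(_ nh)] := FP (s, t); apply.
  apply: h; split; first exact: gF.1.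
  by move=> e [_ /(_ s t ns nt)].
have [H HP tot|A [[AY Arel] Amax]] := @Zorn_bigcup _ [set A | A `<=` Y `&` touch C /\
    forall s t, nb C s -> nb C t -> eqv (Y0 `|` A) s t -> eqv P s t].
  split=> [e [A /HP[AY _] /AY]//|s t ns nt h].
  (* Finitely many witnessing functions each separate finitely many edges of the compact [Q], so [Q]
     has finitely many edges outside [Y0], all in one member of the chain. *)
  have [Q [QA cQ Qst]] := eqv_witness h.
  have fin : finite_set [set e | Q e /\ ~ Y0 e].
    have : finite_set (\bigcup_(p in [set` allpairs pair l l]) [set e | Q e /\ sep (F p) e]).
      apply: bigcup_finite => [|p _]; first exact: finite_seq.
      exact: compact_sep cQ (FP p).1.1.
    apply: sub_finite_set => e [Qe nY].
    have YCe : (Y `&` touch C) e.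
      by have [[]//|[A /HP[AY _] /AY]] := QA e Qe.
    have /existsNP[a /existsNP[b /not_implyP[na /not_implyP[nb' /contrapT sab]]]] :
        ~ forall s t, nb C s -> nb C t -> ~ sep (F (s, t)) e by move=> hs; apply: nY.
    exists (a, b) => //=; move: na nb'; rewrite lE => /= al bl.
    by apply/allpairsP; exists (a, b).
  have [e [Qe nYe]|E0|[A HA sA]] := chain_finite tot fin.
  - by have [|] := QA e Qe.
  - apply: relY0 => //; apply: eqv_sub Qst => e Qe; apply: contrapT => nYe.
    by have : set0 e by rewrite -E0.
  - apply: (HP A HA).2 => //; apply: eqv_sub Qst => e Qe.
    by have [|nYe] := pselect (Y0 e); [left|right; exact: sA].
exists (Y0 `|` A); split.
- by move=> e /PY0; left.
- by move=> e [[]|/AY].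
- move=> s t [ns nt h]; split=> //; apply: Arel => //.
  by apply: eqv_sub h => e [].
move=> e Ye te ne; have : ~ [set A | A `<=` Y `&` touch C /\
    forall s t, nb C s -> nb C t -> eqv (Y0 `|` A) s t -> eqv P s t] (e |` A).
  apply: Amax; split; first by move=> e'; right.
  by move=> /(_ e (or_introl erefl)) Ae; apply: ne; right.
move=> nA; apply: contrapT => nex; apply: nA; split; first by move=> e' [->|/AY].
move=> s t ns nt h; apply: contrapT => nP; apply: nex; exists s, t; split.
  split=> //; apply: eqv_sub h => e' [[]//|[->|/AY]//].
apply: exchange; last by move=> h'; apply: nP; exact: Arel.
by apply: eqv_sub h => e' [|[->|]]; [right; left|left|right; right].
Qed.

Lemma step I Y : edge_indep I -> I `<=` Y -> exists I' Y', [/\ I `<=` I', I' `<=` Y',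
  Y' `<=` Y, edge_indep I' & [/\ forall f, Gd Y' f -> Gd Y f,
  forall e, Y' e -> ~ touch U e -> I' e &
  forall C s t, comp C -> rel C Y' s t -> rel C I' s t]].
Proof.
move=> iI IY; have [J [IJ JY iJ Joff Jrel]] := step_lower iI IY.
have /choice[Z ZP] : forall C, exists Z, comp C -> [/\ J `&` touch C `<=` Z,
  Z `<=` Y `&` touch C, forall s t, rel C Z s t -> rel C J s t &
  forall e, Y e -> touch C e -> ~ Z e -> exists s t, rel C Y s t /\
    forall f, Gd Z f -> f s = f t -> ~ sep f e].
  move=> C; have [cC|nC] := pselect (comp C); last by exists set0.
  by have [Z ZP] := step_upper cC JY; exists Z.
pose Y' := [set e | (J e /\ ~ touch U e) \/ exists2 C, comp C & Z C e].
have ZY' C : comp C -> Z C `<=` Y' by move=> cC e Ze; right; exists C.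
have JY' : J `<=` Y'.
  move=> e Je; have [te|] := pselect (touch U e); last by left.
  have [C cC tC] := touch_component te; apply: (ZY' C cC).
  by have [h _ _ _] := ZP C cC; apply: h.
exists J, Y'; split=> //.
  by move=> e [[/JY]//|[C cC Ze]]; have [_ h _ _] := ZP C cC; exact: (h _ Ze).1.
split.
- move=> f gf; split; first exact: gf.1.
  move=> e Ye; have gJ : Gd J f by exact: Gd_sub JY' gf.
  have [te|nt] := pselect (touch U e); last first.
    by apply/notsep; exact: Joff.
  have [C cC tC] := touch_component te; have [Ze|nZ] := pselect (Z C e).
    by apply: gf.2; exact: (ZY' C).
  have [_ _ _ h] := ZP C cC; have [s [t [rst]]] := h e Ye tC nZ; apply.
    by apply: Gd_sub gf; exact: ZY'.
  exact: (Jrel C s t).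
- move=> e [[]//|[C cC Ze]] nt; case: nt; apply: (touch_comp cC).
  by have [_ h _ _] := ZP C cC; exact: (h _ Ze).2.
- move=> C s t cC [ns nt h]; have [_ _ + _] := ZP C cC; apply; split=> //.
  apply: eqv_sub h => e [[[Je nte]|[C' cC' Ze]] tC]; first by case: nte; exact: touch_comp tC.
  have [_ h' _ _] := ZP C' cC'; have E' := touch_disjoint cC' cC (h' _ Ze).2 tC.
  by rewrite -E'; split=> //; rewrite E'.
Qed.

End Step.

(** The steps along the regions squeeze one set [J] between all lower and all upper sets. Both
    independence and spanning concern a single edge at a time, and this edge lies off some
    region. *)
Lemma base_extend I X : edge_indep I -> I `<=` X -> exists J, [/\ I `<=` J, J `<=` X,
  edge_indep J & forall f, Gd J f -> Gd X f].
Proof.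
move=> iI IX; have [U [fU cU Ucl Ul]] := regions Psi_undominated.
have covU n : cov (U n) by split; [exact: fU|exact: cU].
have US k : U k.+1 `<=` U k by move=> v Uv; apply: Ucl; left.
pose Q (n : nat) (p : set E * set E) := [/\ edge_indep p.1, p.1 `<=` p.2, I `<=` p.1,
  p.2 `<=` X & forall f, Gd p.2 f -> Gd X f].
pose S n (p q : set E * set E) := [/\ p.1 `<=` q.1, q.2 `<=` p.2,
  forall e, q.2 e -> ~ touch (U n) e -> q.1 e &
  forall C s t, component (~` U n) C -> rel C q.2 s t -> rel C q.1 s t].
have [||F FP] := @dep_choice (fun=> (set E * set E)%type) Q S.
- by exists (I, X); split.
- move=> n [I1 Y1] [/= i1 s1 II1 YX1 g1].
  have [I2 [Y2 [a b c d [p q r]]]] := step (covU n) i1 s1.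
  exists (I2, Y2); split; split=> //=; [exact: subset_trans a|exact: subset_trans YX1|].
  by move=> f /p /g1.
have sI n : (F n).1 `<=` (F n.+1).1 by have [_ []] := FP n.
have sY n : (F n.+1).2 `<=` (F n).2 by have [_ []] := FP n.
have mI m n : m <= n -> (F m).1 `<=` (F n).1.
  by move=> /subnK <-; elim: (n - m) => // i IH e /IH /sI.
have mY := linked_chain_mono sY.
pose J := \bigcup_n (F n).1.
have JY n : J `<=` (F n).2.
  move=> e [m _ Ie]; have [[_ s _ _ _] _] := FP (maxn m n).
  by apply: (mY n (maxn m n)); rewrite ?leq_maxr //; apply: s; apply: mI Ie; exact: leq_maxl.
have IJ n : (F n).1 `<=` J by move=> e Ie; exists n.
have leave m e : exists2 n, m <= n & ~ touch (U n) e.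
  have [a na] := Ul (src e); have [b nb'] := Ul (tgt e).
  exists (maxn m (maxn a b)); first exact: leq_maxl.
  move=> [h|h]; [apply: na|apply: nb']; apply: (linked_chain_mono US) h;
    by rewrite !leq_max leqnn ?orbT.
exists J; split.
- by move=> e Ie; apply: (IJ 0); have [[_ _ h _ _] _] := FP 0; exact: h.
- by move=> e Je; have [[_ _ _ h _] _] := FP 0; apply: h; exact: JY.
(* The witness for [e] in the lower set after step [n] is changed inside the region only. The
   boundary conditions for [J] hold because [J] lies below the upper set, which makes the same
   connections as the lower one. *)
- move=> e [m _ Ie] h; have [n le nt] := leave m e.
  have [[iN sN _ _ _] _] := FP n.+1; have [_ [_ _ off rl]] := FP n.
  have [|f gf sf] := @indep_Gd (F n.+1).1 e iN; first by apply: mI Ie; exact: leqW.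
  have [| |g gg gE] := @extend G Psi (U n) (J `\ e) f (covU n).
  + move=> e' [Je' ne'] nt'; apply: gf.2; split=> //; apply: off => //; exact: JY.
  + move=> C s t cC ns nt' hst.
    have [|_ _ hI] := rl C s t cC.
      by split=> //; apply: eqv_sub hst => e' [[/JY Je' _] te].
    apply: hI; apply: Gd_sub gf => e' [Ie' te]; split=> // Ee; apply: nt.
    by rewrite -Ee; exact: touch_comp cC te.
  apply: sf; rewrite -!gE; first exact: h.
    by move=> ?; apply: nt; right.
  by move=> ?; apply: nt; left.
- move=> f gf; split; first exact: gf.1.
  move=> e Xe; have [n _ nt] := leave 0 e.
  have [[_ _ _ _ gX] _] := FP n.+1; have [_ [_ _ off rl]] := FP n.
  have [| |g gg gE] := @extend G Psi (U n) (F n.+1).2 f (covU n).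
  + by move=> e' Ye' nt'; apply: gf.2; apply: (IJ n.+1); exact: off.
  + move=> C s t cC ns nt' hst; have [//|_ _ hI] := rl C s t cC.
    by apply: hI; apply: Gd_sub gf => e' [/IJ].
  have := (gX g gg).2 e Xe; rewrite /sep !gE //; move=> ?; apply: nt; by [left|right].
Qed.

Lemma indep_set0 : edge_indep set0. Proof. by []. Qed.

Lemma maximal_span I X : edge_indep I -> I `<=` X ->
  (forall J, edge_indep J -> I `<=` J -> J `<=` X -> J `<=` I) -> X `<=` span I.
Proof.
move=> iI IX max e Xe; apply: contrapT => ns; apply: (ns); apply: sub_span.
apply: (max (e |` I)); [exact: indep_add|by move=> e'; right|by move=> e' [->|/IX]|by left].
Qed.

Lemma span_maximal I J : edge_indep J -> I `<=` J -> J `<=` span I -> J = I.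
Proof.
move=> iJ IJ sJ; apply/seteqP; split=> // e Je; apply: contrapT => nI.
apply: (iJ e Je); apply: span_mono (sJ e Je) => e' Ie'; split; first exact: IJ.
by move=> Ee; apply: nI; rewrite -Ee.
Qed.

Lemma span_trans I J : J `<=` span I -> span J `<=` span I.
Proof.
move=> JI e h f gf; apply: h; split; first exact: gf.1.
by move=> e' Je'; apply/notsep; exact: JI.
Qed.

Lemma maximal_indep_span I : maximal_in edge_indep I -> forall e, span I e.
Proof.
move=> [iI max] e; apply: (@maximal_span I setT) => // J iJ IJ _.
by rewrite (max J iJ IJ).
Qed.

Lemma edge_indep_aug I I' : edge_indep I -> ~ maximal_in edge_indep I ->
  maximal_in edge_indep I' -> exists e, [/\ I' e, ~ I e & edge_indep (e |` I)].
Proof.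
move=> iI nmax maxI'; apply: contrapT => nex; apply: nmax; split=> // J iJ IJ.
apply: span_maximal => // e _; apply: (@span_trans I I'); last exact: maximal_indep_span.
move=> e' I'e'; apply: contrapT => ns; apply: nex; exists e'; split=> //.
  by move=> Ie'; apply: ns; exact: sub_span.
exact: indep_add.
Qed.

Lemma edge_indep_max I X : edge_indep I -> I `<=` X ->
  exists B, maximal_in [set J | [/\ edge_indep J, I `<=` J & J `<=` X]] B.
Proof.
move=> iI IX; have [J [IJ JX iJ sp]] := base_extend iI IX; exists J; split=> // B [iB IB BX] JB.
by apply: span_maximal => // e /BX Xe f /sp gf; apply/notsep; exact: gf.2.
Qed.

Definition end_matroid : matroid E :=
  Matroid indep_set0 (fun I J iJ IJ => indep_sub IJ iJ) edge_indep_aug edge_indep_max.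

(** If [f] is constant on a component at the end, then a smaller component with its neighbours
    inside has no separated edge touching it. Conversely, [f] is constant on a connected component
    that no separated edge touches. *)
Lemma good_edge_closure f :
  good Psi f <-> forall w, Psi w -> ~ in_edge_closure w [set e | sep f e].
Proof.
split=> [gf w Pw cl|h w Pw].
  have [S fS SP] := gf w Pw; have cC := end_comp_component w fS.
  have [|||T fT TC] := @small_in_component _ _ Psi_undominated (~` S) w (end_component S w) Pw.
  - by rewrite setCK.
  - by apply: sub_finite_set fS; exact: component_nb.
  - exact: end_comp_lives.
  have [e se eC] := cl T fT; apply: se.
  have [c1 c2] := @touch_cl G (end_component T w) e eC.
  by apply: SP; exact: TC.
have /existsNP[S /not_implyP[fS nS]] := h w Pw; exists S => // x y Cx Cy.
have cC := end_comp_component w fS.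
elim: (component_within cC Cx Cy) => // u v uu IH uv nv.
have Cu : end_component S w u by apply: contrapT; exact: linked_notinr uu.
rewrite IH; case: uv => e [[Eu Ev]|[Ev Eu]]; apply: contrapT => ne; apply: nS; exists e.
- by rewrite /sep /= Eu Ev.
- by left; rewrite Eu.
- by move=> /= h'; apply: ne; rewrite -Eu -Ev h'.
- by right; rewrite Eu.
Qed.

(** A set is codependent if and only if its complement is not spanning. An edge that a base of the
    complement does not span is separated by a good bipartition whose cut must lie in [K]. *)
Lemma dual_dependent K : ~ dual_indep end_matroid K <->
  exists2 f, good Psi f & (exists e, sep f e) /\ [set e | sep f e] `<=` K.
Proof.
split=> [nK|[f gf [[e se] fK]] [B maxB KB]].
  have [J [_ JK iJ sp]] := base_extend indep_set0 (@sub0set _ (~` K)).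
  have [e ns] : exists e, ~ span J e.
    apply: contrapT => ne; apply: nK; exists J; last by move=> e Ke /JK.
    split=> // B iB JB; apply: span_maximal => // e _; apply: contrapT => ns.
    by apply: ne; exists e.
  have [f gf fe] := neqv_Gd ns; exists f; first exact: gf.1.
  split; first by exists e.
  by move=> e' se'; apply: contrapT => nK'; apply: (sp f gf).2 se'.
apply: se; apply: (maximal_indep_span maxB e); split=> // e' Be' /fK /KB.
by [].
Qed.

Lemma cut_sep F : Defs.cut F <-> exists f, F = [set e | sep f e].
Proof.
split=> [[A ->]|[f ->]].
  exists (fun v => `[< A v >]); apply/seteqP; split=> e; rewrite /= /sep.
    by move=> [[a /asboolF->]|[/asboolF-> a]]; rewrite asboolT.
  by case: asboolP => a; case: asboolP => b // _; [left|right].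
exists [set v | f v]; apply/seteqP; split=> e; rewrite /= /sep.
  by case: (f (src e)); case: (f (tgt e)) => // _; [left|right].
by case: (f (src e)); case: (f (tgt e)) => // -[[]|[]].
Qed.

Lemma end_matroid_cocircuits : cocircuits end_matroid = bonds_avoiding Psi.
Proof.
apply/seteqP; split=> [K [/dual_dependent[f gf [[e se] fK]] min]|K [[cK [e0 Ke0] min] avoid]].
  have EK : [set e | sep f e] = K.
    by apply: min => //; apply/dual_dependent; exists f => //; split=> //; exists e.
  split; last by rewrite -EK; exact/good_edge_closure.
  split; [by apply/cut_sep; exists f|by exists e; rewrite -EK|].
  move=> F' /cut_sep[g EF] [e' F'e'] F'K; apply: min => //; apply/dual_dependent; exists g.
    apply/good_edge_closure => w Pw cl; have := (good_edge_closure f).1 gf w Pw; apply.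
    by move=> S fS; have [a ga ha] := cl S fS; exists a => //; rewrite EK; apply: F'K; rewrite EF.
  by rewrite -EF; split=> //; exists e'; rewrite EF in F'e'.
have /cut_sep[f EK] := cK; split.
  apply/dual_dependent; exists f; first by apply/good_edge_closure; rewrite -EK.
  by rewrite -EK; split=> //; exists e0; rewrite EK in Ke0.
move=> K' /dual_dependent[g gg [[e se] gK]] K'K.
have Eg : [set e | sep g e] = K.
  by apply: min; [apply/cut_sep; exists g|exists e|exact: subset_trans gK K'K].
by apply/seteqP; split=> //; rewrite -Eg.
Qed.

End Bases.

(** * Compactness, continuity and the circle *)

Import Order.TTheory GRing.Theory Num.Theory.
Import numFieldNormedType.Exports.
Local Open Scope ring_scope.

(** Replaces finite subcovers: a property inherited by subsets and finite unions holds on a compact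
    set if it holds locally. The sets with good remainder form a filter, and a cluster point
    contradicts the local hypothesis. *)
Lemma compact_ind (T : topologicalType) (A : set T) (P : set T -> Prop) : compact A ->
  P set0 -> (forall Y Z, P Y -> P Z -> P (Y `|` Z)) -> (forall Y Z, Y `<=` Z -> P Z -> P Y) ->
  (forall a, A a -> exists2 O, nbhs a O & P (A `&` O)) -> P A.
Proof.
move=> cA P0 PU Ps loc; apply: contrapT => nP.
pose F : set_system T := [set Z | P (A `\` Z)].
have FF : ProperFilter F.
  split; first by rewrite /F /= setD0.
  split; rewrite /F /=.
  - by rewrite setDT.
  - move=> Y Z PY PZ; apply: Ps (PU _ _ PY PZ) => a [Aa nYZ].
    by have [Ya|nYa] := pselect (Y a); [right; split=> // Za; apply: nYZ|left].
  - by move=> Y Z YZ; apply: Ps => a [Aa nZ]; split=> // /YZ.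
have [a [Aa cl]] : A `&` cluster F !=set0.
  by apply: cA; rewrite /F /= setDv.
have [W nW PW] := loc a Aa.
have [b [nb' Ob]] : (~` W) `&` W !=set0.
  by apply: cl => //; rewrite /F /=; apply: Ps PW => b [Ab /contrapT].
exact: nb'.
Qed.

Lemma compact_intro (T : topologicalType) (A : set T) :
  (forall P : set T -> Prop, P set0 -> (forall Y Z, P Y -> P Z -> P (Y `|` Z)) ->
     (forall Y Z, Y `<=` Z -> P Z -> P Y) ->
     (forall a, A a -> exists2 O, nbhs a O & P O) -> P A) -> compact A.
Proof.
move=> h F PF FA; apply: contrapT => nc.
have FnA : F (~` A).
  apply: (h (fun Z => F (~` Z))).
  - by rewrite setC0; exact: filterT.
  - by move=> Y Z FY FZ; rewrite setCU; exact: filterI.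
  - by move=> Y Z YZ; apply: filterS; exact: subsetC.
  - move=> a Aa; apply: contrapT => nex; apply: nc; exists a; split=> // Z O FZ nO.
    apply: contrapT => ne; apply: nex; exists O => //; apply: filterS FZ => z Zz Oz.
    by apply: ne; exists z.
have nF : ~ F set0 by case: PF.
by apply: nF; rewrite -(setICr A); exact: filterI.
Qed.

Lemma within_comp (T U W : topologicalType) (A : set T) (B : set U) (f : T -> U) (g : U -> W) :
  {within A, continuous f} -> (forall x, A x -> B (f x)) ->
  {within B, continuous g} -> {within A, continuous (fun x => g (f x))}.
Proof.
move=> cf AB cg; apply/subspace_continuousP => x Ax O nO.
have h1 : nbhs (f x) [set y | B y -> O (g y)].
  exact: ((subspace_continuousP B g).1 cg (f x) (AB x Ax) O nO).
have h2 : nbhs x [set z | A z -> B (f z) -> O (g (f z))].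
  exact: ((subspace_continuousP A f).1 cf x Ax _ h1).
suff : nbhs x [set z | A z -> O (g (f z))] by [].
by apply: filterS h2 => z h Az; apply: h => //; exact: AB.
Qed.

Lemma within_open_pos (R : realType) (T : topologicalType) (A : set T) (h : T -> R) a :
  {within A, continuous h} -> A a -> 0 < h a ->
  exists2 O, nbhs a O & forall b, A b -> O b -> 0 < h b.
Proof.
move=> ch Aa ha.
have n0 : nbhs (h a) [set y : R | 0 < y] by apply: open_nbhs_nbhs; split=> //; exact: open_gt.
have h1 : nbhs a [set y | A y -> 0 < h y].
  exact: ((subspace_continuousP A h).1 ch a Aa _ n0).
by exists [set y | A y -> 0 < h y] => // b Ab /(_ Ab).
Qed.

Lemma within_uniform_limit (R : realType) (T : topologicalType) (A : set T) (h : T -> R) :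
  (forall eps : R, 0 < eps -> exists2 g : T -> R, {within A, continuous g} &
     forall a, A a -> `|h a - g a| <= eps) -> {within A, continuous h}.
Proof.
move=> app; apply/subspace_continuousP => a Aa.
apply/cvgrPdist_lt => eps e0; have e4 : 0 < eps / 4 by rewrite divr_gt0.
have [g cg gh] := app _ e4.
have /cvgrPdist_lt/(_ _ e4) h1 := (subspace_continuousP A g).1 cg a Aa.
have h2 : nbhs a [set b | A b -> `|g a - g b| < eps / 4] by exact: h1.
suff : nbhs a [set b | A b -> `|h a - h b| < eps] by [].
apply: filterS h2 => b hb Ab; have {}hb := hb Ab.
have := gh a Aa; have := gh b Ab; move: hb.
rewrite ltr_norml => /andP[? ?]; rewrite !ler_norml => /andP[? ?] /andP[? ?].
by rewrite ltr_norml; apply/andP; split; lra.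
Qed.

Lemma compact_inverse_continuous (T U : topologicalType) (A : set T) (f : T -> U) (g : U -> T) :
  hausdorff_space U -> compact A -> {within A, continuous f} -> {in A, cancel f g} ->
  {within f @` A, continuous g}.
Proof.
move=> hU cA cf fK; apply/subspace_continuousP => _ [x Ax <-].
have gf z : A z -> g (f z) = z by move=> Az; apply: fK; rewrite inE.
move=> O nO; have : nbhs (g (f x)) O by [].
rewrite gf // nbhsE => -[W [oW Wx] WO].
have cK : compact (A `&` ~` W) by apply: compact_closedI => //; exact: open_closedC.
have clK : closed (f @` (A `&` ~` W)).
  apply: compact_closed => //; apply: continuous_compact cK.
  by apply: continuous_subspaceW cf => z [].
suff : nbhs (f x) [set y | (f @` A) y -> O (g y)] by [].
have n : nbhs (f x) (~` (f @` (A `&` ~` W))).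
  apply: open_nbhs_nbhs; split; first exact: closed_openC.
  by move=> [z [Az nWz] /(congr1 g)]; rewrite !gf // => E; rewrite E in nWz.
apply: filterS n => y ny [z Az Ez]; apply: WO; rewrite -Ez gf //.
by apply: contrapT => nW; apply: ny; exists z.
Qed.

Lemma continuous_pair (T U W : topologicalType) (f : T -> U) (g : T -> W) :
  continuous f -> continuous g -> continuous (fun x => (f x, g x)).
Proof.
move=> cf cg x.
exact: (@cvg_pair T U W (nbhs x) (nbhs (f x)) (nbhs (g x)) _ _ _ f g (cf x) (cg x)).
Qed.

Section CircleParam.
Variable R : realType.
Implicit Types q s x y : R.

(* The square, normalised to modulus 1, of the arc [(1 - q^2) + i q]; it winds
   once around the circle as [q] runs from -1 to 1. *)
Definition arc_re q : R := 1 - q * q.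
Definition arc_sq q : R := arc_re q * arc_re q + q * q.
Definition circ_x q : R := (arc_re q * arc_re q - q * q) / arc_sq q.
Definition circ_y q : R := 2 * (arc_re q * q) / arc_sq q.

Lemma arc_sq_gt0 q : 0 < arc_sq q.
Proof.
rewrite /arc_sq /arc_re; have [->|n] := eqVneq q 0; first by rewrite mulr0 subr0 mulr1 addr0.
by apply: ltr_wpDl; [rewrite -expr2 sqr_ge0|rewrite -expr2 exprn_even_gt0].
Qed.

Lemma arc_sq_neq0 q : arc_sq q != 0. Proof. by rewrite gt_eqF // arc_sq_gt0. Qed.

Lemma circ_xy q : circ_x q ^+ 2 + circ_y q ^+ 2 = 1.
Proof. by have := arc_sq_neq0 q; rewrite /circ_x /circ_y /arc_sq => n; field. Qed.

Lemma circ_xN q : circ_x (- q) = circ_x q.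
Proof. by rewrite /circ_x /arc_sq /arc_re !mulrNN. Qed.

Lemma circ_yN q : circ_y (- q) = - circ_y q.
Proof. by rewrite /circ_y /arc_sq /arc_re !mulrNN !mulrN mulNr. Qed.

Lemma circ_x1 q : q * q = 1 -> circ_x q = -1.
Proof. by move=> h; rewrite /circ_x /arc_sq /arc_re h subrr mulr0 sub0r add0r divr1. Qed.

Lemma circ_y1 q : q * q = 1 -> circ_y q = 0.
Proof. by move=> h; rewrite /circ_y /arc_re h subrr mul0r mulr0 mul0r. Qed.

Lemma circ_y0 : circ_y 0 = 0.
Proof. by rewrite /circ_y mulr0 mulr0 mul0r. Qed.

(** The half-angle formula: the tangent of half the angle is [q / arc_re q]. *)
Lemma circ_slope q : arc_re q * circ_y q = q * (1 + circ_x q).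
Proof. by have := arc_sq_neq0 q; rewrite /circ_x /circ_y /arc_sq => n; field. Qed.

Lemma circ_x_neq q : q * q != 1 -> 1 + circ_x q != 0.
Proof.
move=> n; have p0 : arc_re q != 0 by rewrite subr_eq0 eq_sym.
have -> : 1 + circ_x q = 2 * (arc_re q * arc_re q) / arc_sq q.
  by have := arc_sq_neq0 q; rewrite /circ_x /arc_sq => n'; field.
by rewrite !mulf_neq0 ?invr_eq0 ?arc_sq_neq0 // pnatr_eq0.
Qed.

Lemma circ_inj q s : -1 <= q <= 1 -> -1 <= s <= 1 ->
  circ_x q = circ_x s -> circ_y q = circ_y s -> q = s \/ (q * q = 1 /\ s * s = 1).
Proof.
move=> hq hs ex ey; have [q1|q1] := eqVneq (q * q) 1.
  right; split=> //; apply: contrapT => /eqP /circ_x_neq.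
  by rewrite -ex circ_x1 // subrr eqxx.
have x0 := circ_x_neq q1; left.
have s1 : s * s != 1 by apply: contraNneq x0 => s1; rewrite ex circ_x1 // subrr.
have E : arc_re s * q = arc_re q * s.
  apply: (mulIf x0); rewrite -[LHS]mulrA -circ_slope -[RHS]mulrA ex -circ_slope ey.
  by rewrite mulrCA.
(* Equality of the two half-angle tangents. The second factor vanishes on the square only if both
   parameters have modulus 1, which is excluded here. *)
have : (q - s) * (1 + q * s) = 0 by move: E; rewrite /arc_re => E; lra.
move=> /eqP; rewrite mulf_eq0 subr_eq0 => /orP[/eqP//|/eqP h].
exfalso; case/eqP: q1; case/andP: hq => q1 q2; case/andP: hs => s1' s2.
have qq : 0 <= q * q by rewrite -expr2 sqr_ge0.
have ss : s * s <= 1 by nra.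
have q1' : q * q <= 1 by nra.
have e1 : q * q * (s * s) = 1.
  transitivity ((q * s) * (q * s)); first by ring.
  have e0 : q * s = -1 by lra.
  by rewrite e0 mulrNN mulr1.
have h3 : 0 <= q * q * (1 - s * s) by apply: mulr_ge0; lra.
by lra.
Qed.

Lemma arc_re_continuous : continuous arc_re.
Proof.
move=> x; rewrite /continuous_at /arc_re.
by apply: cvgB; [exact: cvg_cst|apply: cvgM; exact: cvg_id].
Qed.

Lemma arc_sq_continuous : continuous arc_sq.
Proof.
move=> x; rewrite /continuous_at /arc_sq.
by apply: cvgD; apply: cvgM; try exact: cvg_id; exact: arc_re_continuous.
Qed.

Lemma circ_x_continuous : continuous circ_x.
Proof.
move=> x; rewrite /continuous_at /circ_x; apply: cvgM.
  by apply: cvgB; apply: cvgM; try exact: cvg_id; exact: arc_re_continuous.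
by apply: cvgV; [exact: arc_sq_neq0|exact: arc_sq_continuous].
Qed.

Lemma circ_y_continuous : continuous circ_y.
Proof.
move=> x; rewrite /continuous_at /circ_y; apply: cvgM.
  apply: cvgM; [exact: cvg_cst|apply: cvgM; [exact: arc_re_continuous|exact: cvg_id]].
by apply: cvgV; [exact: arc_sq_neq0|exact: arc_sq_continuous].
Qed.

Lemma circ_surj x y : x ^+ 2 + y ^+ 2 = 1 ->
  exists q, [/\ -1 <= q <= 1, circ_x q = x & circ_y q = y].
Proof.
move=> xy; have [x1|x1] := eqVneq (1 + x) 0.
  have Ex : x = -1 by lra.
  have Ey : y = 0 by apply/eqP; rewrite -sqrf_eq0; apply/eqP; move: xy; rewrite Ex; lra.
  by exists 1; split; [lra|rewrite circ_x1 ?mulr1|rewrite circ_y1 ?mulr1].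
pose t := y / (1 + x).
(* The parameter is found from its half-angle tangent [t]; at -1 and 1 the function has the values 1
   and -1. *)
have [|||q qI hq] := @IVT R (fun q => t * arc_re q - q) (-1) 1 0.
- lra.
- apply: continuous_subspaceT => q; apply: cvgB; last exact: cvg_id.
  by apply: cvgM; [exact: cvg_cst|exact: arc_re_continuous].
- rewrite /arc_re mulrNN mulr1 subrr mulr0 !sub0r opprK.
  by rewrite ge_min le_max ler01 lerN10 orbT.
have Eq : q = t * arc_re q by lra.
have q1 : q * q != 1.
  apply/eqP => q1; have p0 : arc_re q = 0 by rewrite /arc_re q1 subrr.
  by move: Eq q1; rewrite p0 mulr0 => ->; rewrite mulr0 => /esym/eqP; rewrite oner_eq0.
have p0 : arc_re q != 0 by rewrite subr_eq0 eq_sym.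
have T : 1 + t * t = 2 / (1 + x).
  have -> : 1 + t * t = ((1 + x) ^+ 2 + y ^+ 2) / (1 + x) ^+ 2 by rewrite /t; field.
  have -> : (1 + x) ^+ 2 + y ^+ 2 = 2 * (1 + x) by rewrite -[y ^+ 2](addKr (x ^+ 2)) xy; ring.
  by field.
have T0 : 1 + t * t != 0 by rewrite T mulf_neq0 // ?invr_eq0 // pnatr_eq0.
have D0 : arc_re q * arc_re q + t * arc_re q * (t * arc_re q) != 0.
  by have := arc_sq_neq0 q; rewrite /arc_sq {3 4}Eq.
exists q; split; first by move: qI; rewrite in_itv.
- rewrite /circ_x /arc_sq {3 4 7 8}Eq.
  have -> : (arc_re q * arc_re q - t * arc_re q * (t * arc_re q)) /
      (arc_re q * arc_re q + t * arc_re q * (t * arc_re q)) = 2 / (1 + t * t) - 1.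
    by field; rewrite T0 D0.
  by rewrite T; field; rewrite ?pnatr_eq0 ?x1.
- rewrite /circ_y /arc_sq {2 5 6}Eq.
  have -> : 2 * (arc_re q * (t * arc_re q)) /
      (arc_re q * arc_re q + t * arc_re q * (t * arc_re q)) = t * (2 / (1 + t * t)).
    by field; rewrite T0 D0.
  by rewrite T /t; field; rewrite ?pnatr_eq0 ?x1.
Qed.

Lemma unit_circle_compact : compact (@unit_circle R).
Proof.
have -> : @unit_circle R = (fun q => (circ_x q, circ_y q)) @` `[-1, 1].
  apply/seteqP; split=> [[x y] h|_ [q _ <-]]; last exact: circ_xy.
  have [q [hq <- <-]] := @circ_surj x y h.
  by exists q => //=; rewrite in_itv.
apply: continuous_compact; last exact: segment_compact.
apply: continuous_subspaceT; apply: continuous_pair; [exact: circ_x_continuous|exact: circ_y_continuous].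
Qed.

(** A circle minus one point is connected, in the form of an intermediate value statement. *)
Lemma circle_sign (h : R * R -> R) (a p p' : R * R) : {within @unit_circle R, continuous h} ->
  unit_circle a -> unit_circle p -> unit_circle p' -> p <> a -> p' <> a ->
  (forall b, unit_circle b -> b <> a -> h b <> 0) -> 0 < h p -> 0 < h p'.
Proof.
move=> ch; case: a => a1 a2 ca cp cp' pa p'a h0.
(* In complex notation, multiplication by minus [a]: the parameters -1 and 1 are sent to [a], and
   the open interval between them covers the rest of the circle. *)
pose g q : R * R := (- a1 * circ_x q + a2 * circ_y q, - a2 * circ_x q - a1 * circ_y q).
have {}ca : a1 ^+ 2 + a2 ^+ 2 = 1 by [].
have gc q : unit_circle (g q).
  rewrite /unit_circle /=.
  transitivity ((a1 ^+ 2 + a2 ^+ 2) * (circ_x q ^+ 2 + circ_y q ^+ 2)); first by ring.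
  by rewrite ca circ_xy mulr1.
have gcont : continuous g.
  apply: continuous_pair => q; [apply: cvgD|apply: cvgB]; apply: cvgM; try exact: cvg_cst;
    by [exact: circ_x_continuous|exact: circ_y_continuous].
have surj b : unit_circle b -> b <> (a1, a2) -> exists2 q, -1 < q < 1 & g q = b.
  case: b => X Y cb nb'; have {}cb : X ^+ 2 + Y ^+ 2 = 1 by [].
  have [|q [hq ex ey]] := @circ_surj (- (a1 * X + a2 * Y)) (a2 * X - a1 * Y).
    transitivity ((a1 ^+ 2 + a2 ^+ 2) * (X ^+ 2 + Y ^+ 2)); first by ring.
    by rewrite ca cb mulr1.
  have Eg : g q = (X, Y).
    rewrite /g ex ey; congr pair.
      by transitivity ((a1 ^+ 2 + a2 ^+ 2) * X); [ring|rewrite ca mul1r].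
    by transitivity ((a1 ^+ 2 + a2 ^+ 2) * Y); [ring|rewrite ca mul1r].
  exists q => //; have q1 : q * q != 1.
    apply/eqP => q1; apply: nb'; rewrite -Eg /g circ_x1 // circ_y1 //.
    by rewrite !mulr0 subr0 addr0 !mulrNN !mulr1.
  case/andP: hq => l r; rewrite !lt_neqAle l r !andbT; apply/andP; split.
    by apply: contraNneq q1 => <-; rewrite mulrNN mulr1.
  by apply: contraNneq q1 => ->; rewrite mulr1.
have hg : continuous (fun q => h (g q)).
  move=> q O nO; have h1 : nbhs (g q) [set y | unit_circle y -> O (h y)].
    exact: ((subspace_continuousP _ h).1 ch (g q) (gc q) O nO).
  have h2 : nbhs q [set z | unit_circle (g z) -> O (h (g z))] by exact: (gcont q _ h1).
  suff : nbhs q [set z | O (h (g z))] by [].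
  by apply: filterS h2 => z hz; exact: hz (gc z).
have hne q : -1 < q < 1 -> h (g q) <> 0.
  move=> hq; apply: h0 => // E.
  have E1 : - a1 * circ_x q + a2 * circ_y q = a1 by case: E.
  have E2 : - a2 * circ_x q - a1 * circ_y q = a2 by case: E.
  have : 1 + circ_x q = 0.
    transitivity ((a1 ^+ 2 + a2 ^+ 2) * (1 + circ_x q)); first by rewrite ca mul1r.
    transitivity (a1 * (a1 - (- a1 * circ_x q + a2 * circ_y q)) +
      a2 * (a2 - (- a2 * circ_x q - a1 * circ_y q))); first by ring.
    by rewrite E1 E2 !subrr !mulr0 addr0.
  apply/eqP; apply: circ_x_neq; case/andP: hq => l r; apply/eqP; nra.
have [q hq Eq] := surj p cp pa; have [q' hq' Eq'] := surj p' cp' p'a.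
rewrite -Eq -Eq' => pos; rewrite ltNge; apply/negP => npos.
have ivt (s1 s2 : R) : -1 < s1 < 1 -> -1 < s2 < 1 -> s1 <= s2 ->
    Num.min (h (g s1)) (h (g s2)) <= 0 <= Num.max (h (g s1)) (h (g s2)) -> False.
  move=> /andP[l1 r1] /andP[l2 r2] le12 hh.
  have [|s sI hs] := @IVT R (fun q => h (g q)) s1 s2 0 le12 _ hh.
    exact: continuous_subspaceT.
  move: sI; rewrite in_itv /= => /andP[ls rs]; apply: (hne s) => //.
  by apply/andP; split; lra.
have [le|/ltW le] := leP q q'.
  by apply: (ivt q q') => //; rewrite ge_min npos orbT le_max (ltW pos).
by apply: (ivt q' q) => //; rewrite ge_min npos le_max (ltW pos) orbT.
Qed.

End CircleParam.

(** * Continuous functions on |G| *)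

Lemma within_compT (T U W : topologicalType) (A : set T) (f : T -> U) (g : U -> W) :
  {within A, continuous f} -> continuous g -> {within A, continuous (fun x => g (f x))}.
Proof.
by move=> cf cg; apply: (@within_comp _ _ _ A setT f g cf) => //; exact: continuous_subspaceT.
Qed.

Section Points.
Variables (R : realType) (G : graph) (Psi : set (graph_end G)).
Let V := vertex G.
Let E := edge G.
Let pt := graph_point R G.
Let X := @space_with_ends R G Psi.
Hypothesis Psi_undominated : forall w, Psi w -> undominated w.
Implicit Types (f g : V -> bool) (p q : pt) (A : set pt) (w : graph_end G) (e : E) (x v : V) (S : set V).

Definition edgewise (a : V -> R) (b : graph_end G -> R) (c : E -> R -> R) (p : pt) : R :=
  match p with
  | Vtx v => a v
  | End w => b w
  | Inner e t => c e (val t)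
  end.

Lemma edgewise_map (a : V -> R) (b : graph_end G -> R) (c : E -> R -> R) e (t : R) : c e 0 = a (src e) -> c e 1 = a (tgt e) -> t \in `[0, 1] ->
  edgewise a b c (edge_map e t) = c e t.
Proof.
move=> c0 c1 /edge_cases[->|->|t01]; rewrite ?edge_map0 ?edge_map1 //=.
by rewrite (edge_map_in _ t01).
Qed.

Lemma basic_is_open (U : set pt) : basic_open U -> open U.
Proof. by move=> bU; exists [set U]; [move=> _ ->|rewrite bigcup_set1]. Qed.

Lemma half_bounds : 0 < (2^-1 : R) < 1.
Proof. by rewrite invr_gt0 ltr0n /= invf_lt1 ?ltr1n. Qed.

Lemma edgewise_continuous A (a : V -> R) (b : graph_end G -> R) (c : E -> R -> R) :
  (forall e, c e 0 = a (src e)) -> (forall e, c e 1 = a (tgt e)) ->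
  (forall e, {within `[0 : R, 1], continuous (c e)}) ->
  (forall w, A (End R w) -> exists2 S, finite_set S & forall p,
     thickening (end_component S w) (fun=> 2^-1) p -> edgewise a b c p = b w) ->
  {within A, continuous (edgewise a b c)}.
Proof.
move=> c0 c1 cc cw; apply/subspace_continuousP => p Ap O nO.
suff : nbhs p [set q | A q -> O (edgewise a b c q)] by [].
suff [W [bW Wp WO]] : exists W, [/\ basic_open W, W p & forall q, W q -> O (edgewise a b c q)].
  by apply: filterS (open_nbhs_nbhs (conj (basic_is_open bW) Wp)) => q Wq _; exact: WO.
have {}nO : nbhs (edgewise a b c p) O by [].
have [ep|np] := pselect (is_end_point p).
  case: p ep Ap nO => // w _ Aw nO; have [S fS SP] := cw w Aw.
  exists (thickening (end_component S w) (fun=> 2^-1)); split.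
  - right; exists S, w, (fun=> 2^-1); split=> // e _; exact: half_bounds.
  - exact: end_comp_lives.
  - by move=> q /SP ->; exact: nbhs_singleton nO.
move: nO; rewrite nbhsE => -[W [oW Wp] WO].
exists [set q | ~ is_end_point q /\ W (edgewise a b c q)]; split=> //; last by move=> q [_ /WO].
left; split=> [w [h _]|e]; first exact: h.
have -> : edge_map e @^-1` [set q | ~ is_end_point q /\ W (edgewise a b c q)] =
    [set t | W (edgewise a b c (edge_map e t))].
  apply/seteqP; split=> t /= => [[]//|h]; split=> //.
  by case Et : (edge_map e t) => [|w|] //=; have := @edge_map_not_end R G e t w.
have : {within `[0 : R, 1], continuous (fun t => edgewise a b c (edge_map e t))}.
  apply: subspace_eq_continuous (cc e) => t; rewrite inE /= => tI.
  exact: esym (edgewise_map b (c0 e) (c1 e) tI).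
by move=> /continuousP /(_ W oW).
Qed.

Lemma edge_map_continuous e : {within `[0 : R, 1], continuous (edge_map e : R -> pt)}.
Proof.
apply/continuousP => O oO.
have [D bD <-] : exists2 D, D `<=` @basic_open R G & \bigcup_(i in D) i = O := oO.
rewrite preimage_bigcup; apply: bigcup_open => U /bD bU.
have [_ /(_ e)] := complex_open_basic bU.
suff -> : edge_map e @^-1` (U `\` (@is_end_point R G)) = edge_map e @^-1` U by [].
apply/seteqP; split=> t /= => [[]//|h]; split=> //.
by case Et : (edge_map e t) => [|w|] //=; have := @edge_map_not_end R G e t w.
Qed.

Definition bval f p : bool :=
  match p with
  | Vtx v => f v
  | End w => `[< exists2 S, finite_set S & forall x, end_component S w x -> f x >]
  | Inner _ _ => false
  end.

Definition lin_ext f : pt -> R :=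
  edgewise (fun v => (f v)%:R) (fun w => (bval f (End R w))%:R)
    (fun e t => (1 - t) * (f (src e))%:R + t * (f (tgt e))%:R).

Definition inner p : Prop := if p is Inner _ _ then True else False.

Lemma ext_bval f p : ~ inner p -> lin_ext f p = (bval f p)%:R.
Proof. by case: p => // e t []. Qed.

Lemma bval_end f w S b : finite_set S -> (forall x, end_component S w x -> f x = b) ->
  bval f (End R w) = b.
Proof.
move=> fS h; case: b h => h /=; first by rewrite asboolT //; exists S => // x /h ->.
rewrite asboolF // => -[T fT TP].
have [u [Su Tu]] := lives_ex (lives_setI (end_comp_lives w fS) (end_comp_lives w fT)).
by have := TP u Tu; rewrite h.
Qed.

Lemma good_bval f w : good Psi f -> Psi w ->
  exists2 S, finite_set S & forall x, end_component S w x -> f x = bval f (End R w).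
Proof.
move=> gf Pw; have [S fS SP] := gf w Pw; exists S => // x Cx.
by apply/esym/(bval_end fS) => y Cy; exact: SP.
Qed.

Lemma space_end w : X (End R w) <-> Psi w.
Proof.
split=> [h|Pw [w' nP [Ew]]]; first by apply: contrapT => nP; apply: h; exists w.
by apply: nP; rewrite Ew.
Qed.

Lemma bval_op (op : bool -> bool -> bool) f g p : good Psi f -> good Psi g -> X p -> ~ inner p ->
  bval (fun v => op (f v) (g v)) p = op (bval f p) (bval g p).
Proof.
move=> gf gg; case: p => [v //|w /space_end Pw _|e t _ []//].
have [S fS SP] := good_bval gf Pw; have [T fT TP] := good_bval gg Pw.
have fU : finite_set (S `|` T) by rewrite finite_setU.
apply: (bval_end fU) => x Cx; congr op; [apply: SP|apply: TP];
  apply: (end_comp_mono fU) Cx; by [exact: subsetUl|exact: subsetUr].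
Qed.

Lemma bval_cst b p : ~ inner p -> bval (fun=> b) p = b.
Proof. by case: p => // [w _|e t []//]; apply: (bval_end (finite_set0 _)). Qed.

(** An edge leaving a component on which [f] is constant may carry other values. A smaller component
    whose neighbours also lie in the first one avoids this, so the extension is constant near the
    end. *)
Lemma ext_continuous A f : A `<=` X -> good Psi f -> {within A, continuous (lin_ext f)}.
Proof.
move=> AX gf; apply: edgewise_continuous => [e|e|e|w Aw].
- by rewrite subr0 mul1r mul0r addr0.
- by rewrite subrr mul0r mul1r add0r.
- apply: continuous_subspaceT => t; apply: cvgD; apply: cvgM; try exact: cvg_cst; last exact: cvg_id.
  by apply: cvgB; [exact: cvg_cst|exact: cvg_id].
have Pw : Psi w by apply/space_end; exact: AX.
have [S fS SP] := good_bval gf Pw; have cC := end_comp_component w fS.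
have [|||T fT TC] := @small_in_component _ _ Psi_undominated (~` S) w (end_component S w) Pw.
- by rewrite setCK.
- by apply: sub_finite_set fS; exact: component_nb.
- exact: end_comp_lives.
have cT := end_comp_component w fT.
exists T => // -[v Cv|w' w'C|e t tC] /=; first by rewrite SP //; apply: TC; left.
  congr (_%:R); congr (nat_of_bool _); apply: (bval_end fT) => x Cx; apply: SP; apply: TC; left.
  by apply: (end_comp_sub fT _ w'C) Cx; exact: component_nb.
have te : touch (end_component T w) e by case: tC => [[]|[]|[]]; by [left|right].
have [c1 c2] := touch_cl te; rewrite !SP; try exact: TC.
by rewrite -mulrDl subrK mul1r.
Qed.

Definition bump e0 (phi : R -> R) : pt -> R :=
  edgewise (fun=> 0) (fun=> 0) (fun e t => if e == e0 then phi t else 0).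

Lemma bump_continuous A e0 phi : {within `[0 : R, 1], continuous phi} -> phi 0 = 0 -> phi 1 = 0 ->
  {within A, continuous (bump e0 phi)}.
Proof.
move=> cphi p0 p1; apply: edgewise_continuous => [e|e|e|w Aw].
- by case: ifP.
- by case: ifP.
- case: eqP => _ //; apply: continuous_subspaceT => t; exact: cvg_cst.
have fS : finite_set [set src e0; tgt e0] by rewrite finite_setU; split; exact: finite_set1.
have nC := component_notin (end_comp_component w fS).
exists [set src e0; tgt e0] => // -[v _|w' _|e t tC] //=.
case: eqP => // Ee; exfalso; rewrite Ee in tC.
by case: tC => [[c1 _]|[c1 _ _]|[_ c1 _]]; apply: (nC _ c1); by [left|right].
Qed.

Lemma bump_inner e0 phi p : bump e0 phi p <> 0 -> exists t, p = Inner e0 t.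
Proof. by case: p => //= e t; case: eqP => // -> _; exists t. Qed.

Lemma bump_at e0 phi t : bump e0 phi (Inner e0 t) = phi (val t).
Proof. by rewrite /= eqxx. Qed.

(* Vanishes only at the vertex [x]; a linear extension would vanish on loops. *)
Definition tent x : pt -> R :=
  edgewise (fun v => (v != x)%:R) (fun=> 1)
    (fun e t => (1 - (src e == x)%:R * (1 - t)) * (1 - (tgt e == x)%:R * t)).

Lemma tent_continuous A x : A `<=` X -> {within A, continuous (tent x)}.
Proof.
move=> AX; apply: edgewise_continuous => [e|e|e|w Aw].
- by rewrite subr0 mulr0 subr0 !mulr1; case: eqP; rewrite ?subrr ?subr0.
- by rewrite subrr mulr0 subr0 mul1r mulr1; case: eqP; rewrite ?subrr ?subr0.
- apply: continuous_subspaceT => t; apply: cvgM; apply: cvgB; try exact: cvg_cst.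
    apply: cvgM; first exact: cvg_cst.
    by apply: cvgB; [exact: cvg_cst|exact: cvg_id].
  by apply: cvgM; [exact: cvg_cst|exact: cvg_id].
have Pw : Psi w by apply/space_end; exact: AX.
have [S fS SP] := undominated_avoid (Psi_undominated Pw) (finite_set1 x).
have nx v : (end_component S w `|` nb (end_component S w)) v -> (v == x) = false.
  by move=> Cv; apply/eqP => Ev; apply: (SP v); split=> //; rewrite Ev.
exists S => // -[v Cv|w' _|e t tC] //=; first by rewrite nx //; left.
have te : touch (end_component S w) e by case: tC => [[]|[]|[]]; by [left|right].
by have [c1 c2] := touch_cl te; rewrite !nx // !mul0r !subr0 mulr1.
Qed.

Lemma tent_gt0 x p : p <> Vtx R x -> 0 < tent x p.
Proof.
case: p => [v h|w _|e [t /= /andP[t0 t1]] _] //=; first by case: eqP => // Ev; case: h; rewrite Ev.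
by apply: mulr_gt0; case: eqP => _; rewrite ?mul1r ?mul0r; lra.
Qed.

Lemma end_eq w w' :
  (forall S, finite_set S -> end_component S w = end_component S w') -> w = w'.
Proof.
have sub u u' : (forall S, finite_set S -> end_component S u = end_component S u') ->
    end_rays u `<=` end_rays u'.
  move=> h r ur; have [r' Er'] := end_raysP u'; rewrite Er' /= => S fS.
  have r'u : end_rays u' r' by rewrite Er'; exact: ray_equiv_refl.
  exists (end_component S u'); split; first exact: end_comp_component.
    exact: (end_comp_lives u' fS).
  by rewrite -h //; exact: (end_comp_lives u fS).
move=> h; have : end_rays w = end_rays w'.
  by apply/seteqP; split; apply: sub => S fS; rewrite h.
case: w {h} => r1 h1; case: w' => r2 h2 /= Er; rewrite Er in h1 *.
by congr GraphEnd; exact: Prop_irrelevance.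
Qed.

(** A vertex is separated from everything else by its singleton, which is good as an undominated end
    avoids it. An end is separated by one of its components, which is good as every end lives in one
    component only. *)
Lemma sep_points p q : X p -> X q -> ~ inner p -> ~ inner q -> p <> q ->
  exists f, [/\ good Psi f, bval f p & ~~ bval f q].
Proof.
move=> + Xq; case: p => [x _ _ nq pq|w /space_end Pw _ nq pq|e t _ []//].
  have av w : Psi w -> exists2 S, finite_set S & forall v, end_component S w v -> (v == x) = false.
    move=> Pw; have [S fS SP] := undominated_avoid (Psi_undominated Pw) (finite_set1 x).
    by exists S => // v Cv; apply/eqP => Ev; apply: (SP v); split; [left|rewrite Ev].
  exists (fun v => v == x); split; last 1 first.
  - case: q Xq nq pq => [y _ _ pq|w /space_end Pw _ _|e t _ []//].
      by apply/eqP => Ey; apply: pq; rewrite Ey.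
    by have [S fS SP] := av w Pw; rewrite (bval_end fS SP).
  - by move=> w /av[S fS SP]; exists S => // a b Ca Cb; rewrite !SP.
  - by rewrite /= eqxx.
suff [S fS h] : exists2 S, finite_set S & match q with Vtx y => ~ end_component S w y
    | End w' => ~ exists x, end_component S w x /\ end_component S w' x | _ => True end.
  have cC := end_comp_component w fS.
  exists (fun v => `[< end_component S w v >]); split.
  - move=> w' _; exists S => // a b Ca Cb.
    have ab := component_linked (end_comp_component w' fS) Ca Cb.
    apply: asbool_equiv_eq; split=> h'; first exact: Defs.component_closed cC h' ab.
    exact: Defs.component_closed cC h' (linked_sym ab).
  - by rewrite (bval_end (b := true) fS) // => a Ca; apply/asboolP.
  - case: q {Xq pq} nq h => [y _ h|w' _ h|e t []//]; first exact/asboolPn.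
    by rewrite (bval_end (b := false) fS) // => a Ca; apply/asboolPn => Cw; apply: h; exists a.
case: q Xq nq pq => [y _ _ _|w' _ _ ne|e t _ []//].
  have [S fS SP] := undominated_avoid (Psi_undominated Pw) (finite_set1 y).
  by exists S => // Cy; apply: (SP y); split=> //; left.
apply: contrapT => nex; apply: ne; congr End; apply: end_eq => S fS.
have /contrapT[x [Cx C'x]] : ~ ~ exists x, end_component S w x /\ end_component S w' x.
  by move=> h; apply: nex; exists S.
exact: component_eq (end_comp_component w fS) (end_comp_component w' fS) Cx C'x.
Qed.

Lemma inner_nbhs A p : A p -> inner p -> exists2 O, nbhs p O & forall q, A q -> O q -> inner q.
Proof.
case: p => // e t Ap _.
have [||O nO OP] := @within_open_pos R _ A (bump e (fun t => t * (1 - t))) (Inner e t) _ Ap.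
- apply: bump_continuous; rewrite ?mul0r ?subrr ?mulr0 //; apply: continuous_subspaceT => s.
  by apply: cvgM; [exact: cvg_id|apply: cvgB; [exact: cvg_cst|exact: cvg_id]].
- by rewrite bump_at; case/andP: (svalP t) => t0 t1; apply: mulr_gt0; rewrite ?subr_gt0.
exists O => // q Aq Oq; have h := OP q Aq Oq.
by have [|s ->] := @bump_inner e (fun t => t * (1 - t)) q; first by apply/eqP; rewrite gt_eqF.
Qed.

(** Two compactness arguments, as in the proof that compact Hausdorff spaces are normal:
    conjunctions make a function true at one positive point and false at all negative ones, then
    disjunctions reach all positive points. Inner points impose no condition and have neighbourhoods
    of inner points. *)
Lemma separate A (h : pt -> R) : compact A -> A `<=` X -> {within A, continuous h} ->
  (forall p, A p -> ~ inner p -> h p <> 0) ->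
  exists2 f, good Psi f & forall p, A p -> ~ inner p -> bval f p = (0 < h p).
Proof.
move=> cA AX ch h0.
have first p : A p -> ~ inner p -> 0 < h p -> exists g, [/\ good Psi g, bval g p &
    forall q, A q -> ~ inner q -> ~~ (0 < h q) -> ~~ bval g q].
  move=> Ap np hp.
  pose P (Z : set pt) := exists g, [/\ good Psi g, bval g p &
    forall q, Z q -> A q -> ~ inner q -> ~~ (0 < h q) -> ~~ bval g q].
  suff [g [gg gp gq]] : P A by exists g; split=> // q Aq; exact: gq.
  have Pv Z : (forall q, Z q -> A q -> ~ inner q -> 0 < h q) -> P Z.
    move=> hZ; exists (fun=> true); split; [exact: good_cst|by rewrite bval_cst|].
    by move=> q Zq Aq nq; rewrite hZ.
  apply: (compact_ind cA).
  - by apply: Pv => q [].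
  - move=> Y Z [g [gg gp gq]] [g' [gg' gp' gq']]; exists (fun v => g v && g' v); split.
    + exact: (good_op andb).
    + by rewrite (bval_op andb) // ?gp ?gp' //; exact: AX.
    + move=> q YZ Aq nq hq; rewrite (bval_op andb) //; last exact: AX.
      by case: YZ => [Yq|Zq]; [rewrite (negPf (gq q Yq Aq nq hq))|rewrite (negPf (gq' q Zq Aq nq hq)) andbF].
  - by move=> Y Z YZ [g [gg gp gq]]; exists g; split=> // q /YZ; exact: gq.
  move=> a Aa; have [ia|na] := pselect (inner a).
    have [W nW WP] := inner_nbhs Aa ia; exists W => //; apply: Pv => q [_ Wq] Aq nq.
    by case: nq; exact: WP.
  have [ha|nha] := boolP (0 < h a).
    have [W nW WP] := within_open_pos ch Aa ha; exists W => //.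
    by apply: Pv => q [_ Wq] Aq _; exact: WP.
  have [||//|//||f [gf fp fa]] := @sep_points p a; [exact: AX|exact: AX| |].
    by move=> Ea; rewrite -Ea hp in nha.
  have cf : {within A, continuous (fun q => 2^-1 - lin_ext f q)}.
    apply: (@within_compT _ _ _ A (lin_ext f) (fun y => 2^-1 - y)); first exact: ext_continuous.
    by move=> y; apply: cvgB; [exact: cvg_cst|exact: cvg_id].
  have [|W nW WP] := within_open_pos cf Aa.
    by rewrite ext_bval // (negPf fa) subr0; case/andP: half_bounds.
  exists W => //; exists f; split=> // q [_ Wq] Aq nq _.
  have := WP q Aq Wq; rewrite ext_bval //; case: (bval f q) => //.
  by move=> /= h1; exfalso; have /andP[_ h2] := half_bounds; lra.
pose P (Z : set pt) := exists g, [/\ good Psi g,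
  forall p, Z p -> A p -> ~ inner p -> 0 < h p -> bval g p &
  forall q, A q -> ~ inner q -> ~~ (0 < h q) -> ~~ bval g q].
suff [g [gg gp gq]] : P A.
  exists g => // p Ap np; case hp : (0 < h p); first by apply: gp.
  by apply/negbTE/gq => //; rewrite hp.
have Pv Z : (forall q, Z q -> A q -> ~ inner q -> ~~ (0 < h q)) -> P Z.
  move=> hZ; exists (fun=> false); split; first exact: good_cst.
    by move=> q Zq Aq nq hq; have := hZ q Zq Aq nq; rewrite hq.
  by move=> q Aq nq _; rewrite bval_cst.
apply: (compact_ind cA).
- by apply: Pv => q [].
- move=> Y Z [g [gg gp gq]] [g' [gg' gp' gq']]; exists (fun v => g v || g' v); split.
  + exact: (good_op orb).
  + move=> p YZ Ap np hp; rewrite (bval_op orb) //; last exact: AX.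
    by case: YZ => [Yp|Zp]; [rewrite gp|rewrite gp' // orbT].
  + move=> q Aq nq hq; rewrite (bval_op orb) //; last exact: AX.
    by rewrite (negPf (gq q Aq nq hq)) (negPf (gq' q Aq nq hq)).
- by move=> Y Z YZ [g [gg gp gq]]; exists g; split=> // q /YZ; exact: gp.
move=> a Aa; have [ia|na] := pselect (inner a).
  have [W nW WP] := inner_nbhs Aa ia; exists W => //; apply: Pv => q [_ Wq] Aq nq.
  by case: nq; exact: WP.
have [ha|nha] := boolP (0 < h a); last first.
  have cN : {within A, continuous (fun q => - h q)}.
    by apply: (@within_compT _ _ _ A h (fun y => - y) ch) => y; apply: cvgN; exact: cvg_id.
  have [|W nW WP] := within_open_pos cN Aa.
    by rewrite oppr_gt0 lt_neqAle leNgt nha andbT; apply/eqP; exact: h0.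
  exists W => //; apply: Pv => q [_ Wq] Aq _.
  by have := WP q Aq Wq; rewrite oppr_gt0 -leNgt => /ltW.
have [g [gg ga gq]] := first a Aa na ha.
have cf : {within A, continuous (fun q => lin_ext g q - 2^-1)}.
  apply: (@within_compT _ _ _ A (lin_ext g) (fun y => y - 2^-1)); first exact: ext_continuous.
  by move=> y; apply: cvgB; [exact: cvg_id|exact: cvg_cst].
have [|W nW WP] := within_open_pos cf Aa.
  by rewrite ext_bval // ga subr_gt0; case/andP: half_bounds.
exists W => //; exists g; split=> // q [_ Wq] Aq nq _.
have := WP q Aq Wq; rewrite ext_bval //; case: (bval g q) => //.
by move=> /= h1; exfalso; have /andP[h2 _] := half_bounds; lra.
Qed.

End Points.

(** * Circles have minimal dependent edge sets *)

(** With [l] the coordinate along the chord, the equation of the circle becomes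
    [l * (l - 1) * D = 0]. *)
Lemma chord_circle (R : realType) (a1 a2 b1 b2 x y : R) : a1 ^+ 2 + a2 ^+ 2 = 1 ->
  b1 ^+ 2 + b2 ^+ 2 = 1 -> x ^+ 2 + y ^+ 2 = 1 -> (a1, a2) <> (b1, b2) ->
  (b1 - a1) * (y - a2) - (b2 - a2) * (x - a1) = 0 -> (x, y) = (a1, a2) \/ (x, y) = (b1, b2).
Proof.
move=> ha hb hx ne h; pose D := (b1 - a1) ^+ 2 + (b2 - a2) ^+ 2.
have D0 : D != 0.
  rewrite /D paddr_eq0 ?sqr_ge0 // !sqrf_eq0 !subr_eq0; apply/negP => /andP[/eqP e1 /eqP e2].
  by apply: ne; rewrite e1 e2.
pose l := ((x - a1) * (b1 - a1) + (y - a2) * (b2 - a2)) / D.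
have lD : l * D = (x - a1) * (b1 - a1) + (y - a2) * (b2 - a2) by rewrite /l mulfVK.
have Ex : x = a1 + l * (b1 - a1).
  apply/eqP; rewrite -subr_eq0; apply/eqP; apply: (mulIf D0); rewrite mul0r.
  transitivity ((x - a1) * D - l * D * (b1 - a1)); first by ring.
  rewrite lD /D; transitivity (- (b2 - a2) * ((b1 - a1) * (y - a2) - (b2 - a2) * (x - a1))).
    by ring.
  by rewrite h mulr0.
have Ey : y = a2 + l * (b2 - a2).
  apply/eqP; rewrite -subr_eq0; apply/eqP; apply: (mulIf D0); rewrite mul0r.
  transitivity ((y - a2) * D - l * D * (b2 - a2)); first by ring.
  rewrite lD /D; transitivity ((b1 - a1) * ((b1 - a1) * (y - a2) - (b2 - a2) * (x - a1))).
    by ring.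
  by rewrite h mulr0.
have ab : 2 * (a1 * (b1 - a1) + a2 * (b2 - a2)) = - D.
  transitivity ((b1 ^+ 2 + b2 ^+ 2) - (a1 ^+ 2 + a2 ^+ 2) - D); first by rewrite /D; ring.
  by rewrite ha hb subrr sub0r.
have : l * (l - 1) * D = 0.
  transitivity ((x ^+ 2 + y ^+ 2) - (a1 ^+ 2 + a2 ^+ 2)); last by rewrite hx ha subrr.
  transitivity (l * (2 * (a1 * (b1 - a1) + a2 * (b2 - a2))) + l ^+ 2 * D).
    by rewrite ab; ring.
  by rewrite Ex Ey /D; ring.
move=> /eqP; rewrite mulf_eq0 (negPf D0) orbF mulf_eq0 subr_eq0 => /orP[/eqP l0|/eqP l1].
  by left; rewrite Ex Ey l0 !mul0r !addr0.
by right; rewrite Ex Ey l1 !mul1r !(addrC a1) !(addrC a2) !subrK.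
Qed.

(* The two points of the circle on the normal of the chord. *)
Lemma chord_sides (R : realType) (a1 a2 b1 b2 : R) : a1 ^+ 2 + a2 ^+ 2 = 1 ->
  b1 ^+ 2 + b2 ^+ 2 = 1 -> (a1, a2) <> (b1, b2) ->
  let h (p : R * R) := (b1 - a1) * (p.2 - a2) - (b2 - a2) * (p.1 - a1) in
  exists p q : R * R, [/\ unit_circle p, unit_circle q, 0 < h p & h q < 0].
Proof.
move=> ha hb ne h; pose D := (b1 - a1) ^+ 2 + (b2 - a2) ^+ 2.
have D0 : 0 < D.
  rewrite lt_neqAle addr_ge0 ?sqr_ge0 // andbT eq_sym.
  rewrite /D paddr_eq0 ?sqr_ge0 // !sqrf_eq0 !subr_eq0; apply/negP => /andP[/eqP e1 /eqP e2].
  by apply: ne; rewrite e1 e2.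
pose r := Num.sqrt D; have r2 : r * r = D by rewrite -expr2 sqr_sqrtr // ltW.
have r0 : 0 < r by rewrite sqrtr_gt0.
have rn0 : r != 0 by rewrite gt_eqF.
pose c := (b1 - a1) * a2 - (b2 - a2) * a1.
have cr : c * c < r * r.
  have E : c * c + (a1 * (b1 - a1) + a2 * (b2 - a2)) ^+ 2 = D * (a1 ^+ 2 + a2 ^+ 2).
    by rewrite /c /D; ring.
  have ab : a1 * (b1 - a1) + a2 * (b2 - a2) = - (D / 2).
    have : 2 * (a1 * (b1 - a1) + a2 * (b2 - a2)) = - D.
      transitivity ((b1 ^+ 2 + b2 ^+ 2) - (a1 ^+ 2 + a2 ^+ 2) - D); first by rewrite /D; ring.
      by rewrite ha hb subrr sub0r.
    by lra.
  move: E; rewrite ha mulr1 ab r2 => <-; rewrite ltrDl sqrrN exprn_gt0 //.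
  by rewrite divr_gt0.
have c1 : c < r by rewrite ltNge; apply/negP => le; nra.
have c2 : - r < c by rewrite ltNge; apply/negP => le; nra.
have circ : (- (b2 - a2) / r) ^+ 2 + ((b1 - a1) / r) ^+ 2 = 1.
  transitivity (D / (r * r)); first by rewrite /D; field.
  by rewrite r2 divff // gt_eqF.
have E1 : (b1 - a1) * ((b1 - a1) / r) - (b2 - a2) * (- (b2 - a2) / r) = r.
  transitivity (D / r); first by rewrite /D; field.
  by rewrite -r2 mulfK.
exists (- (b2 - a2) / r, (b1 - a1) / r), (- (- (b2 - a2) / r), - ((b1 - a1) / r)); split.
- exact: circ.
- by rewrite /unit_circle /= !sqrrN.
- rewrite /h /= !mulrBr; move: E1 c1; rewrite /c; lra.
- rewrite /h /= !mulrBr; move: E1 c2; rewrite /c; lra.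
Qed.

Lemma edge_sign (R : realType) (G : graph) (A : set (graph_point R G))
    (h : graph_point R G -> R) (e : edge G) (s1 s2 : R) : {within A, continuous h} ->
  (forall s : R, s \in `[0, 1] -> A (edge_map e s)) ->
  0 <= s1 -> s1 <= s2 -> s2 <= 1 ->
  (forall s : R, s1 <= s <= s2 -> h (edge_map e s) <> 0) ->
  (0 < h (edge_map e s1)) = (0 < h (edge_map e s2)).
Proof.
move=> ch Ae s10 s12 s21 h0.
have c : {within `[s1, s2], continuous (fun s => h (edge_map e s))}.
  apply: (@continuous_subspaceW _ _ _ `[0 : R, 1]).
    by move=> s /=; rewrite !in_itv /= => /andP[? ?]; apply/andP; split; lra.
  apply: (within_comp (B := A)) ch; first exact: edge_map_continuous.
  by move=> s sI; exact: Ae.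
have ivt : ~ (Num.min (h (edge_map e s1)) (h (edge_map e s2)) <= 0 <=
    Num.max (h (edge_map e s1)) (h (edge_map e s2))).
  by move=> /(IVT s12 c)[s sI hs]; exact: (h0 s).
case: ltP => h1; case: ltP => h2 //; exfalso; apply: ivt.
  by rewrite ge_min h2 orbT le_max (ltW h1).
by rewrite ge_min h1 le_max (ltW h2) orbT.
Qed.

Section CycleEdges.
Variables (R : realType) (G : graph) (Psi : set (graph_end G)).
Let V := vertex G.
Let E := edge G.
Let pt := graph_point R G.
Let X := @space_with_ends R G Psi.
Hypothesis Psi_undominated : forall w, Psi w -> undominated w.
Variable A : set pt.
Hypothesis AX : A `<=` X.
Variables (phi : pt -> R * R) (psi : R * R -> pt).
Hypothesis phiA : forall p, A p -> unit_circle (phi p).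
Hypothesis psiA : forall a, unit_circle a -> A (psi a).
Hypothesis phiK : forall p, A p -> psi (phi p) = p.
Hypothesis psiK : forall a, unit_circle a -> phi (psi a) = a.
Hypothesis phi_cont : {within A, continuous phi}.
Hypothesis psi_cont : {within @unit_circle R, continuous psi}.
Implicit Types (f : V -> bool) (p q : pt) (e : E).

Lemma cycle_compact : compact A.
Proof.
have -> : A = psi @` (@unit_circle R).
  apply/seteqP; split=> [p Ap|_ [a ca <-]]; last exact: psiA.
  by exists (phi p); [exact: phiA|exact: phiK].
by apply: continuous_compact => //; exact: unit_circle_compact.
Qed.

Lemma cycle_third (p q : pt) : exists2 a, unit_circle a & psi a <> p /\ psi a <> q.
Proof.
have c1 : unit_circle (1 : R, 0 : R) by rewrite /unit_circle /= expr1n expr0n addr0.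
have c2 : unit_circle (0 : R, 1 : R) by rewrite /unit_circle /= expr1n expr0n add0r.
have c3 : unit_circle (-1 : R, 0 : R) by rewrite /unit_circle /= sqrrN expr1n expr0n addr0.
have inj a b : unit_circle a -> unit_circle b -> psi a = psi b -> a = b.
  by move=> ca cb /(congr1 phi); rewrite !psiK.
have d12 : (1 : R, 0 : R) <> (0, 1) by move=> [] /eqP; rewrite oner_eq0.
have d13 : (1 : R, 0 : R) <> (-1, 0) by move=> [] /eqP; rewrite -subr_eq0 opprK -mulr2n pnatr_eq0.
have d23 : (0 : R, 1 : R) <> (-1, 0) by move=> [] _ /eqP; rewrite oner_eq0.
apply: contrapT => nex.
have h a : unit_circle a -> psi a = p \/ psi a = q.
  move=> ca; apply: contrapT => n; apply: nex; exists a => //.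
  by split=> e; apply: n; [left|right].
case: (h _ c1) => e1; case: (h _ c2) => e2; case: (h _ c3) => e3;
  first [by apply: d12; apply: inj => //; rewrite e1 e2 |
         by apply: d13; apply: inj => //; rewrite e1 e3 |
         by apply: d23; apply: inj => //; rewrite e2 e3].
Qed.

(** The point [x] may lie off the circle; a third point is then removed instead. *)
Lemma cycle_sign (h : pt -> R) (x p q : pt) : {within A, continuous h} -> A p -> A q ->
  p <> x -> q <> x -> (forall b, A b -> b <> x -> h b <> 0) -> 0 < h p -> 0 < h q.
Proof.
move=> ch Ap Aq px qx h0.
have [a ca [pa qa ax]] : exists2 a, unit_circle a & [/\ p <> psi a, q <> psi a &
    forall b, A b -> b <> psi a -> h b <> 0].
  have [Ax|nAx] := pselect (A x).
    by exists (phi x); [exact: phiA|rewrite phiK].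
  have [a ca [pa qa]] := cycle_third p q; exists a => //; split.
  - by move=> e; apply: pa.
  - by move=> e; apply: qa.
  - by move=> b Ab _; apply: h0 => // e; rewrite e in Ab.
rewrite -(phiK Ap) -(phiK Aq).
apply: (@circle_sign R (fun b => h (psi b)) a) => //; try exact: phiA.
- exact: within_comp psi_cont psiA ch.
- by move=> e; apply: pa; rewrite -e phiK.
- by move=> e; apply: qa; rewrite -e phiK.
- by move=> b cb ba; apply: ax; [exact: psiA|move=> /(congr1 phi); rewrite !psiK].
Qed.

Lemma cycle_sign0 (h : pt -> R) (p q : pt) : {within A, continuous h} -> A p -> A q ->
  (forall b, A b -> h b <> 0) -> 0 < h p -> 0 < h q.
Proof.
move=> ch Ap Aq h0; have [a ca [pa qa]] := cycle_third p q.
by apply: (@cycle_sign h (psi a)) => //; [move=> e; apply: pa|move=> e; apply: qa|move=> b /h0].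
Qed.

(* [gap e l r] is negative exactly on the segment of [e] between [l] and [r]. *)
Definition gap (e : E) (l r : R) (p : pt) : R :=
  1 + bump e (fun s => Num.max (1 - s / l) (1 - (1 - s) / (1 - r)) - 1) p.

Lemma gap_continuous e l r : 0 < l -> l < r -> r < 1 -> {within A, continuous (gap e l r)}.
Proof.
move=> l0 lr r1; rewrite /gap.
apply: (@within_compT _ _ _ A (bump e _) (fun y : R => 1 + y)); last first.
  by move=> y; apply: cvgD; [exact: cvg_cst|exact: cvg_id].
have r1' : 0 < 1 - r by lra.
apply: bump_continuous.
- apply: continuous_subspaceT => s; apply: cvgB; last exact: cvg_cst.
  apply: (@continuous_max R R (fun s => 1 - s / l) (fun s => 1 - (1 - s) / (1 - r)) s).
    by apply: cvgB; [exact: cvg_cst|apply: cvgM; [exact: cvg_id|exact: cvg_cst]].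
  apply: cvgB; [exact: cvg_cst|apply: cvgM; last exact: cvg_cst].
  by apply: cvgB; [exact: cvg_cst|exact: cvg_id].
- rewrite mul0r !subr0 mul1r; apply/eqP; rewrite subr_eq0; apply/eqP/max_idPl.
  by rewrite gerBl invr_ge0 ltW.
- rewrite subrr mul0r subr0 mul1r; apply/eqP; rewrite subr_eq0; apply/eqP/max_idPr.
  by rewrite gerBl invr_ge0 ltW.
Qed.

Lemma gap_inner e l r t : 0 < l -> l < r -> r < 1 ->
  (gap e l r (Inner e t) < 0) = (l < val t < r) /\
  (gap e l r (Inner e t) = 0 <-> val t = l \/ val t = r).
Proof.
move=> l0 lr r1; rewrite /gap bump_at; move: (val t) => s.
have r1' : 0 < 1 - r by lra.
rewrite addrC subrK; set a := 1 - s / l; set b := 1 - _ / _.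
have Ea : a * l = l - s by rewrite /a; field; rewrite gt_eqF.
have Eb : b * (1 - r) = s - r by rewrite /b; field; rewrite gt_eqF.
have al : (a < 0) = (l < s) by rewrite -(pmulr_llt0 a l0) Ea subr_lt0.
have bl : (b < 0) = (s < r) by rewrite -(pmulr_llt0 b r1') Eb subr_lt0.
have a0 : a = 0 <-> s = l.
  split=> [e0|e0]; first by move: Ea; rewrite e0 mul0r; lra.
  by rewrite /a e0 divff ?subrr // gt_eqF.
have b0 : b = 0 <-> s = r.
  split=> [e0|e0]; first by move: Eb; rewrite e0 mul0r; lra.
  by rewrite /b e0 divff ?subrr // gt_eqF.
split; first by rewrite gt_max al bl.
split=> [|[e0|e0]].
- rewrite maxEle; case: ifP => _; [by right; exact/b0|by left; exact/a0].
- rewrite (a0.2 e0); apply/max_idPl; apply: ltW; rewrite bl e0; exact: lr.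
- rewrite (b0.2 e0); apply/max_idPr; apply: ltW; rewrite al e0; exact: lr.
Qed.

Lemma gap_other e l r p : (forall t, p <> Inner e t) -> gap e l r p = 1.
Proof.
move=> np; rewrite /gap; apply/eqP; rewrite -subr_eq0 addrAC subrr add0r.
by apply/eqP; apply: contrapT => /bump_inner[t Et]; apply: (np t).
Qed.

(* If [A] misses one end of the segment [l, r] of [e], then the points of [A]
   other than the other end [x] are all inside or all outside the segment. *)
Lemma gap_cycle e l r x p q : 0 < l -> l < r -> r < 1 -> A p -> A q -> p <> x -> q <> x ->
  (forall t, A (Inner e t) -> Inner e t <> x -> val t <> l /\ val t <> r) ->
  gap e l r p < 0 -> gap e l r q < 0.
Proof.
move=> l0 lr r1 Ap Aq px qx nx gp.
have g0 b : A b -> b <> x -> gap e l r b <> 0.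
  move=> Ab bx; have [[t Et]|ne] := pselect (exists t, b = Inner e t); last first.
    rewrite gap_other; last by move=> t Et; apply: ne; exists t.
    by apply/eqP; rewrite oner_eq0.
  rewrite Et in Ab bx *; have [n1 n2] := nx t Ab bx.
  by move=> /(gap_inner e t l0 lr r1).2[].
rewrite ltNge; apply/negP => gq.
have gq' : 0 < gap e l r q by rewrite lt_neqAle gq andbT eq_sym; apply/eqP; exact: g0.
have := @cycle_sign (gap e l r) x q p (gap_continuous l0 lr r1) Aq Ap qx px g0 gq'.
by rewrite ltNge (ltW gp).
Qed.

Lemma gap_neg e l r p : 0 < l -> l < r -> r < 1 -> gap e l r p < 0 ->
  exists2 t, p = Inner e t & l < val t < r.
Proof.
move=> l0 lr r1 gp; have [[t Et]|ne] := pselect (exists t, p = Inner e t); last first.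
  by move: gp; rewrite gap_other ?ltr10 // => t Et; apply: ne; exists t.
by exists t => //; rewrite -(gap_inner e t l0 lr r1).1 -Et.
Qed.

Lemma inner_eq (e e' : E) (t t' : {t : R | 0 < t < 1}) :
  Inner e t = Inner e' t' :> pt -> e = e' /\ val t = val t'.
Proof. by move=> [-> ->]. Qed.

(** Suppose [s] is missing. For a point [u] of the circle on the edge, cutting at a single further
    point of the edge confines the circle between [s] and that point, hence, moving the cut towards
    [u], between [s] and [u]. Any two points bound each other in this way, so the circle would be a
    single point. *)
Lemma cycle_edge_inner e t s : A (Inner e t) -> A (Inner e s).
Proof.
move=> At; apply: contrapT => nAs.
have nts : val t <> val s.
  by move=> h; apply: nAs; have -> : s = t by apply: val_inj.
have /andP[s0 s1] : 0 < val s < 1 := svalP s.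
have two (u : {t : R | 0 < t < 1}) : A (Inner e u) ->
    (forall p, A p -> p = Inner e u) -> False.
  move=> Au h; have [a ca [n1 _]] := cycle_third (Inner e u) (Inner e u).
  by apply: n1; apply: h; exact: psiA.
have mk (r : R) : 0 < r < 1 -> {r' : {t : R | 0 < t < 1} | val r' = r}.
  by move=> h; exists (exist _ r h).
have [lt|gt|Est] := ltgtP (val s) (val t); last by apply: nts.
- have key (u : {t : R | 0 < t < 1}) q : val s < val u -> A (Inner e u) -> A q ->
      exists2 v, q = Inner e v & val s < val v <= val u.
    move=> su Au Aq; have /andP[u0 u1] : 0 < val u < 1 := svalP u.
    have step (r : R) : val u < r -> r < 1 -> q <> Inner e u ->
        exists2 v, q = Inner e v & val s < val v <= r.
      move=> ur r1 qu; have [|r' Er] := mk r; first by apply/andP; split; lra.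
      have sr : val s < r by lra.
      have [Eq|nq] := pselect (q = Inner e r'); first by exists r' => //; rewrite Er sr lexx.
      suff : gap e (val s) r q < 0.
        by move=> /(gap_neg s0 sr r1)[v Ev /andP[h1 h2]]; exists v => //; rewrite h1 ltW.
      apply: (@gap_cycle e (val s) r (Inner e r') (Inner e u) q) => //.
      + by move=> /inner_eq[_]; rewrite Er; lra.
      + move=> v Av nv; split=> h; last by apply: nv; congr Inner; apply: val_inj; rewrite Er.
        by apply: nAs; have -> : s = v by apply: val_inj.
      + by rewrite (gap_inner e u s0 sr r1).1 su ur.
    have [Eq|nq] := pselect (q = Inner e u); first by exists u => //; rewrite su lexx.
    have [||//|v Ev /andP[h _]] := step ((val u + 1) / 2); try by lra.
    exists v => //; rewrite h andTb leNgt; apply/negP => uv.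
    have /andP[v0 v1] : 0 < val v < 1 := svalP v.
    have [||//|v' Ev' /andP[_ le]] := step ((val u + val v) / 2); try by lra.
    by move: Ev'; rewrite Ev => /inner_eq[_ h']; lra.
  apply: (two t At) => p Ap; have [v Ev /andP[sv le1]] := key t p lt At Ap.
  rewrite Ev in Ap *; have [u /inner_eq[_ Eu] /andP[_ le2]] := key v (Inner e t) sv Ap At.
  by congr Inner; apply: val_inj; lra.
- have key (u : {t : R | 0 < t < 1}) q : val u < val s -> A (Inner e u) -> A q ->
      exists2 v, q = Inner e v & val u <= val v < val s.
    move=> su Au Aq; have /andP[u0 u1] : 0 < val u < 1 := svalP u.
    have step (r : R) : r < val u -> 0 < r -> q <> Inner e u ->
        exists2 v, q = Inner e v & r <= val v < val s.
      move=> ur r1 qu; have [|r' Er] := mk r; first by apply/andP; split; lra.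
      have sr : r < val s by lra.
      have [Eq|nq] := pselect (q = Inner e r'); first by exists r' => //; rewrite Er sr lexx.
      suff : gap e r (val s) q < 0.
        by move=> /(gap_neg r1 sr s1)[v Ev /andP[h1 h2]]; exists v => //; rewrite h2 ltW.
      apply: (@gap_cycle e r (val s) (Inner e r') (Inner e u) q) => //.
      + by move=> /inner_eq[_]; rewrite Er; lra.
      + move=> v Av nv; split=> h; first by apply: nv; congr Inner; apply: val_inj; rewrite Er.
        by apply: nAs; have -> : s = v by apply: val_inj.
      + by rewrite (gap_inner e u r1 sr s1).1 su ur.
    have [Eq|nq] := pselect (q = Inner e u); first by exists u => //; rewrite su lexx.
    have [||//|v Ev /andP[_ h]] := step (val u / 2); try by lra.
    exists v => //; rewrite h andbT leNgt; apply/negP => uv.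
    have /andP[v0 v1] : 0 < val v < 1 := svalP v.
    have [||//|v' Ev' /andP[le _]] := step ((val u + val v) / 2); try by lra.
    by move: Ev'; rewrite Ev => /inner_eq[_ h']; lra.
  apply: (two t At) => p Ap; have [v Ev /andP[le1 sv]] := key t p gt At Ap.
  rewrite Ev in Ap *; have [u /inner_eq[_ Eu] /andP[le2 _]] := key v (Inner e t) sv Ap At.
  by congr Inner; apply: val_inj; lra.
Qed.

(** By compactness [tent] attains its minimum on the circle. If the endvertex were missing, the
    minimum would be positive, but the values tend to 0 along the edge. *)
Lemma cycle_edge_ends e t : A (Inner e t) -> A (Vtx R (src e)) /\ A (Vtx R (tgt e)).
Proof.
move=> At.
have low x (d : {t : R | 0 < t < 1} -> R) :
    (forall s, tent x (Inner e s) <= d s) -> (forall m : R, 0 < m -> exists s, d s < m) ->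
    A (Vtx R x).
  move=> hd ds; apply: contrapT => nx.
  have [||c cA cmin] := @compact_EVT_min pt R (tent x) A _ cycle_compact.
  - by exists (Inner e t).
  - exact: (@tent_continuous R G Psi Psi_undominated A x AX).
  have c0 : 0 < tent x c.
    by apply: tent_gt0 => Ec; apply: nx; rewrite -Ec; rewrite inE in cA.
  have [s sm] := ds _ c0; have As : A (Inner e s) by exact: cycle_edge_inner At.
  have := cmin (Inner e s); rewrite inE => /(_ As); rewrite leNgt.
  by rewrite (le_lt_trans (hd s) sm).
have mk (r : R) : 0 < r < 1 -> {r' : {t : R | 0 < t < 1} | val r' = r}.
  by move=> h; exists (exist _ r h).
have small (m : R) : 0 < m -> {s : {t : R | 0 < t < 1} | val s < m}.
  move=> m0; have [|s Es] := mk (Num.min (m / 2) 2^-1).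
    rewrite lt_min gt_min; have /andP[h1 h2] := half_bounds R; rewrite h1 h2 orbT !andbT.
    by lra.
  exists s; rewrite Es gt_min; apply/orP; left; lra.
split.
- apply: (low _ (fun s => val s)) => [s|m /small[s sm]]; last by exists s.
  have /andP[s0 s1] : 0 < sval s < 1 := svalP s.
  rewrite /= eqxx; move: (sval s) s0 s1 => r ? ?; case: eqP => _ /=; nra.
- apply: (low _ (fun s => 1 - val s)) => [s|m /small[s sm]].
    have /andP[s0 s1] : 0 < sval s < 1 := svalP s.
    rewrite /= eqxx; move: (sval s) s0 s1 => r ? ?; case: eqP => _ /=; nra.
  have /andP[s0 s1] : 0 < val s < 1 := svalP s.
  have [|s' Es'] := mk (1 - val s); first by apply/andP; split; lra.
  by exists s'; rewrite Es'; lra.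
Qed.

Lemma cycle_edge e (s : R) : edge_set A e -> s \in `[0, 1] -> A (edge_map e s).
Proof.
move=> [t At] /edge_cases[->|->|h].
- by rewrite edge_map0; exact: (cycle_edge_ends At).1.
- by rewrite edge_map1; exact: (cycle_edge_ends At).2.
- by rewrite (edge_map_in _ h); exact: cycle_edge_inner At.
Qed.

Lemma edge_ivt (h : pt -> R) e (s1 s2 : R) : {within A, continuous h} -> edge_set A e ->
  0 <= s1 -> s1 <= s2 -> s2 <= 1 ->
  (forall s : R, s1 <= s <= s2 -> h (edge_map e s) <> 0) ->
  (0 < h (edge_map e s1)) = (0 < h (edge_map e s2)).
Proof. by move=> ch Ce; apply: (edge_sign ch) => s; exact: cycle_edge. Qed.

Lemma ext_half f p : (forall e t, p = Inner e t -> ~ sep f e) -> lin_ext f p - 2^-1 <> 0 :> R.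
Proof.
have /andP[b1 b2] := half_bounds R.
have two (b : bool) : b%:R - 2^-1 <> 0 :> R by case: b => /= ?; lra.
case: p => [v _|w _|e t ns] /=; [exact: two|exact: two|].
have /notsep -> := ns e t erefl.
by rewrite -mulrDl subrK mul1r; exact: two.
Qed.

Lemma ext_half_continuous f : good Psi f -> {within A, continuous (fun p => lin_ext f p - 2^-1)}.
Proof.
move=> gf; apply: (@within_compT _ _ _ A (lin_ext f) (fun y => y - 2^-1)).
  exact: (@ext_continuous R G Psi Psi_undominated A f AX gf).
by move=> y; apply: cvgB; [exact: cvg_id|exact: cvg_cst].
Qed.

Lemma half_point : {t : {t : R | 0 < t < 1} | val t = 2^-1}.
Proof. by exists (exist _ 2^-1 (half_bounds R)). Qed.

(** Otherwise the extension of [f] takes the value 1/2 on the circle only at the midpoint of [e],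
    although the endvertices of [e] lie on different sides and removing one point does not
    disconnect the circle. *)
Lemma cycle_even f e : good Psi f -> edge_set A e -> sep f e ->
  exists e', [/\ edge_set A e', e' <> e & sep f e'].
Proof.
move=> gf Ce se; apply: contrapT => nex.
have ns e' : edge_set A e' -> e' <> e -> ~ sep f e'.
  by move=> Ce' ne s'; apply: nex; exists e'.
have [m Em] := half_point; have /andP[b1 b2] := half_bounds R.
have h0 b : A b -> b <> Inner e m -> lin_ext f b - 2^-1 <> 0.
  move=> Ab bm; have [[t Et]|ne] := pselect (exists t, b = Inner e t); last first.
    apply: ext_half => e' t Eb; apply: ns; first by exists t; rewrite -Eb.
    by move=> Ee; apply: ne; exists t; rewrite -Ee.
  rewrite Et /= => h; apply: bm; rewrite Et; congr Inner; apply: val_inj; rewrite Em /=.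
  move: se h; rewrite /sep; move: (val t) => s.
  by case: (f (src e)); case: (f (tgt e)) => //= _; lra.
have [t At] := Ce; have [As Ag] := cycle_edge_ends At.
have sgn a b : A (Vtx R a) -> A (Vtx R b) -> f a -> ~~ f b -> False.
  move=> Aa Ab fa fb.
  have := @cycle_sign (fun p => lin_ext f p - 2^-1) (Inner e m) (Vtx R a) (Vtx R b)
    (ext_half_continuous gf) Aa Ab.
  move=> /(_ _ _ h0); rewrite /= fa (negPf fb) /=.
  have x1 : Vtx R a <> Inner e m by []. have x2 : Vtx R b <> Inner e m by [].
  by move=> /(_ x1 x2); lra.
move: se; rewrite /sep; case fs : (f (src e)); case ft : (f (tgt e)) => // _.
  by apply: (sgn (src e) (tgt e)); rewrite ?fs ?ft.
by apply: (sgn (tgt e) (src e)); rewrite ?fs ?ft.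
Qed.

(** Without edges the circle consists of vertices and ends, and a good bipartition separating two of
    them would disconnect it. *)
Lemma cycle_edge_ex : exists e, edge_set A e.
Proof.
apply: contrapT => nex.
have ni p : A p -> ~ inner p by case: p => [v _ []|w _ []|e t Ap _]; apply: nex; exists e, t.
have [a ca [n1 _]] := cycle_third (psi (1, 0)) (psi (1, 0)).
have c1 : unit_circle (1 : R, 0 : R) by rewrite /unit_circle /= expr1n expr0n addr0.
have A1 := psiA c1; have Aa := psiA ca; have /andP[b1 b2] := half_bounds R.
have [|||||f [gf f1 f2]] := @sep_points R G Psi Psi_undominated (psi a) (psi (1, 0)) => //.
- exact: AX.
- exact: AX.
- exact: ni.
- exact: ni.
have := @cycle_sign0 (fun p => lin_ext f p - 2^-1) (psi a) (psi (1, 0)) (ext_half_continuous gf) Aa A1.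
rewrite !ext_bval ?f1 ?(negPf f2) /=; try exact: ni.
have h0 b : A b -> lin_ext f b - 2^-1 <> 0.
  by move=> Ab; apply: ext_half => e t Eb; exfalso; apply: (ni b Ab); rewrite Eb.
by move=> /(_ h0); lra.
Qed.

(** The chord through the images of the two midpoints cuts the circle into two arcs, and [separate]
    turns the arcs into a good bipartition. It separates no third edge; if it did not separate [e1],
    then by parity it would separate no edge of the circle at all, yet both sides occur. *)
Lemma cycle_pair e0 e1 : edge_set A e0 -> edge_set A e1 -> e0 <> e1 ->
  exists f, [/\ good Psi f, sep f e1 &
    forall e, edge_set A e -> e <> e0 -> e <> e1 -> ~ sep f e].
Proof.
move=> C0 C1 ne; have [m Em] := half_point; have /andP[b1 b2] := half_bounds R.
have A0 : A (Inner e0 m) by have [t At] := C0; exact: cycle_edge_inner At.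
have A1 : A (Inner e1 m) by have [t At] := C1; exact: cycle_edge_inner At.
have ca := phiA A0; have cb := phiA A1.
have nab : phi (Inner e0 m) <> phi (Inner e1 m).
  by move=> /(congr1 psi); rewrite !phiK // => -[].
case Ea : (phi (Inner e0 m)) => [a1 a2] in ca nab *.
case Eb : (phi (Inner e1 m)) => [d1 d2] in cb nab *.
pose l (p : R * R) := (d1 - a1) * (p.2 - a2) - (d2 - a2) * (p.1 - a1).
pose h p := l (phi p).
have ch : {within A, continuous h}.
  apply: (@within_compT _ _ _ A phi l) => // p.
  apply: cvgB; apply: cvgM; try exact: cvg_cst; apply: cvgB; try exact: cvg_cst.
    exact: cvg_snd.
  exact: cvg_fst.
have hz p : A p -> h p = 0 -> p = Inner e0 m \/ p = Inner e1 m.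
  move=> Ap h0; have := phiA Ap; move: h0; rewrite /h /l.
  case Ep : (phi p) => [x y] /= h0 cp.
  have [E0|E1] := chord_circle ca cb cp nab h0.
    by left; rewrite -(phiK Ap) Ep E0 -Ea phiK.
  by right; rewrite -(phiK Ap) Ep E1 -Eb phiK.
have [|f gf fP] := @separate R G Psi Psi_undominated A h cycle_compact AX ch.
  by move=> p Ap np /(hz p Ap)[] Ep; apply: np; rewrite Ep.
have fV v : A (Vtx R v) -> f v = (0 < h (Vtx R v)) by move=> Av; rewrite -fP.
have em e (s : R) t : s \in `[0, 1] -> edge_map e s = Inner t m -> e = t /\ s = 2^-1.
  move=> /edge_cases[->|->|hs]; rewrite ?edge_map0 ?edge_map1 // (edge_map_in _ hs).
  by move=> /inner_eq[-> /= ->].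
have seg e (s1 s2 : R) : edge_set A e -> 0 <= s1 -> s1 <= s2 -> s2 <= 1 ->
    (e <> e0 /\ e <> e1 \/ s2 < 2^-1 \/ 2^-1 < s1) ->
    (0 < h (edge_map e s1)) = (0 < h (edge_map e s2)).
  move=> Ce s10 s12 s21 hs; apply: edge_ivt => // s /andP[l1 l2] h0.
  have sI : s \in `[0, 1] by rewrite in_itv /=; apply/andP; split; lra.
  by case: (hz _ (cycle_edge Ce sI) h0) => /(em _ _ _ sI)[Ee Es];
    case: hs => [[n1 n2]|[hs|hs]];
    by [case: n1|case: n2|move: hs; rewrite -Es ltNge l2|move: hs; rewrite -Es ltNge l1].
have other e : edge_set A e -> e <> e0 -> e <> e1 -> ~ sep f e.
  move=> Ce n0 n1; apply/notsep; have [t At] := Ce; have [As Ag] := cycle_edge_ends At.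
  by rewrite !fV // -edge_map0 -edge_map1; apply: seg => //; left.
exists f; split=> // ns.
have nsep e : edge_set A e -> ~ sep f e.
  move=> Ce; have [->|n0] := pselect (e = e0); last first.
    by have [->|n1] := pselect (e = e1); [exact/notsep|exact: other].
  move=> s0; have [e' [Ce' ne' s']] := cycle_even gf C0 s0.
  have [Ee|n1] := pselect (e' = e1); last exact: (other e').
  by rewrite Ee in s'; apply: s'.
(* Either arc contains a vertex or an end: from an inner point one endvertex of its edge can be
   reached without crossing a midpoint where the chord function vanishes. *)
have side p : A p -> h p <> 0 -> exists r, [/\ A r, ~ inner r & (0 < h r) = (0 < h p)].
  case: p => [v Av _|w Aw _|e t At h0]; [by exists (Vtx R v); split=> [|[]|]|by exists (End R w); split=> [|[]|]|].
  have Ce : edge_set A e by exists t.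
  have [As Ag] := cycle_edge_ends At; have /andP[t0 t1] : 0 < val t < 1 := svalP t.
  have Et : Inner e t = edge_map e (val t).
    by rewrite (edge_map_in _ (svalP t)); congr Inner; apply: val_inj.
  have [lt|gt|Eh] := ltgtP (val t) 2^-1.
  - exists (Vtx R (src e)); split; [by []|by move=> []|]; rewrite Et -edge_map0; apply: seg => //; try exact: ltW.
    by right; left.
  - exists (Vtx R (tgt e)); split; [by []|by move=> []|]; rewrite Et -edge_map1; apply/esym; apply: seg => //; try exact: ltW.
    by right; right.
  - have tm : t = m by apply: val_inj; rewrite Eh Em.
    have [Ee0|n0] := pselect (e = e0).
      by exfalso; apply: h0; rewrite Ee0 tm /h Ea /l /= !subrr !mulr0 subrr.
    have [Ee1|n1] := pselect (e = e1).
      by exfalso; apply: h0; rewrite Ee1 tm /h Eb /l /= mulrC subrr.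
    exists (Vtx R (src e)); split; [by []|by move=> []|]; rewrite Et -edge_map0; apply: seg => //; try exact: ltW.
    by left.
have [p [q [cp cq hp hq]]] := chord_sides ca cb nab.
have lp : 0 < h (psi p) by rewrite /h psiK.
have lq : h (psi q) < 0 by rewrite /h psiK.
have [||r [Ar nr Er]] := side (psi p); [exact: psiA|by apply/eqP; rewrite gt_eqF|].
have [||r' [Ar' nr' Er']] := side (psi q); [exact: psiA|by apply/eqP; rewrite lt_eqF|].
have := @cycle_sign0 (fun p => lin_ext f p - 2^-1) r r' (ext_half_continuous gf) Ar Ar'.
have nq : (0 < h (psi q)) = false by apply/negbTE; rewrite -leNgt ltW.
rewrite !ext_bval // !fP // Er Er' lp nq /=.
have h0 b : A b -> lin_ext f b - 2^-1 <> 0.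
  by move=> Ab; apply: ext_half => e t Eb'; apply: nsep; exists t; rewrite -Eb'.
by move=> /(_ h0); lra.
Qed.

(** Parity shows that no edge of the circle can be witnessed as unspanned by the others. When [e0]
    is omitted, [cycle_pair] gives such a witness for every remaining edge. *)
Lemma cycle_circuit : minimal_dependent (edge_indep Psi) (edge_set A).
Proof.
split=> [ind|C' nind CC'].
  have [e Ce] := cycle_edge_ex; have [f gf sf] := indep_Gd ind Ce.
  have [e' [Ce' ne s']] := cycle_even gf.1 Ce sf.
  by apply: (gf.2 e').
apply/seteqP; split=> // e0 C0; apply: contrapT => nC'; apply: nind => e1 C1 h.
have [|f [gf sf fo]] := @cycle_pair e0 e1 C0 (CC' _ C1).
  by move=> Ee; apply: nC'; rewrite Ee.
apply: sf; apply: h; split=> // e [Ce ne]; apply: fo => //; first exact: CC'.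
by move=> Ee; apply: nC'; rewrite -Ee.
Qed.

End CycleEdges.

(** * Circuits are edge sets of circles *)

Section DyadicSum.
Variable R : realType.
Implicit Types (x y : nat -> R) (N : nat).

Definition psum x N : R := \sum_(i < N) x i / 2 ^+ i.+1.
(** For terms in the unit interval the partial sums increase, so the supremum is the sum of the
    series. *)
Definition tsum x : R := sup (range (psum x)).

Lemma psumS x N : psum x N.+1 = psum x N + x N / 2 ^+ N.+1.
Proof. by rewrite /psum big_ord_recr. Qed.

Lemma pow2_gt0 N : 0 < 2 ^+ N :> R. Proof. by rewrite exprn_gt0. Qed.

Lemma psum_tail x N k : (forall i, 0 <= x i <= 1) ->
  psum x N <= psum x (N + k) <= psum x N + ((2 ^+ N)^-1 - (2 ^+ (N + k))^-1).
Proof.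
move=> x01; elim: k => [|k /andP[h1 h2]]; first by rewrite addn0 subrr addr0 lexx.
rewrite addnS psumS; have /andP[x0 x1] := x01 (N + k)%N.
have i0 : 0 < (2 ^+ (N + k).+1)^-1 :> R by rewrite invr_gt0 pow2_gt0.
have E : (2 ^+ (N + k))^-1 = 2 * (2 ^+ (N + k).+1)^-1 :> R.
  by rewrite exprS invfM mulrA divff ?mul1r // pnatr_eq0.
rewrite E in h2; move: (2 ^+ (N + k).+1)^-1 i0 h2 => z i0 h2.
have a0 : 0 <= x (N + k)%N * z by rewrite mulr_ge0 // ltW.
have a1 : x (N + k)%N * z <= z by rewrite ger_pMl.
by apply/andP; split; lra.
Qed.

Lemma psum_ub x N M : (forall i, 0 <= x i <= 1) -> psum x M <= psum x N + (2 ^+ N)^-1.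
Proof.
move=> x01; have [le|/ltnW le] := leqP N M.
  have /andP[_ h] := psum_tail N (M - N) x01; rewrite subnKC // in h.
  by apply: (le_trans h); rewrite lerD2l gerBl invr_ge0 ltW // pow2_gt0.
have /andP[h _] := psum_tail M (N - M) x01; rewrite subnKC // in h.
by apply: (le_trans h); rewrite lerDl invr_ge0 ltW // pow2_gt0.
Qed.

Lemma psum_le_tsum x N : (forall i, 0 <= x i <= 1) -> psum x N <= tsum x.
Proof.
move=> x01; apply: ub_le_sup; last by exists N.
by exists (psum x 0 + (2 ^+ 0)^-1) => _ [M _ <-]; exact: psum_ub.
Qed.

Lemma tsum_le x (b : R) : (forall N, psum x N <= b) -> tsum x <= b.
Proof. by move=> h; apply: ge_sup; [exists (psum x 0); exists 0|move=> _ [N _ <-]]. Qed.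

Lemma tsum_approx x N : (forall i, 0 <= x i <= 1) -> `|tsum x - psum x N| <= (2 ^+ N)^-1.
Proof.
move=> x01; have h1 := psum_le_tsum N x01.
have h2 : tsum x <= psum x N + (2 ^+ N)^-1 by apply: tsum_le => M; exact: psum_ub.
by rewrite ger0_norm ?subr_ge0 // lerBlDl.
Qed.

Lemma tsum_mono x y : (forall i, 0 <= y i <= 1) -> (forall i, x i <= y i) -> tsum x <= tsum y.
Proof.
move=> y01 xy; apply: tsum_le => N; apply: le_trans (psum_le_tsum N y01).
by apply: ler_sum => i _; rewrite ler_pM2r // invr_gt0 pow2_gt0.
Qed.

Lemma tsum_lt x y j : (forall i, 0 <= x i <= 1) -> (forall i, 0 <= y i <= 1) ->
  (forall i, x i <= y i) -> x j < y j -> tsum x < tsum y.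
Proof.
move=> x01 y01 xy xyj; pose d := (y j - x j) / 2 ^+ j.+1.
have d0 : 0 < d by rewrite divr_gt0 ?subr_gt0 // pow2_gt0.
suff : tsum x <= tsum y - d by lra.
apply: tsum_le => N; rewrite lerBrDr.
pose M := (maxn N j.+1); have jM : (j < M)%N by rewrite leq_maxr.
have /andP[h1 _] := psum_tail N (M - N) x01; rewrite subnKC ?leq_maxl // in h1.
apply: le_trans (psum_le_tsum M y01); apply: (@le_trans _ _ (psum x M + d)).
  by rewrite lerD2r.
rewrite -lerBrDl /psum -sumrB (bigD1 (Ordinal jM)) //=.
rewrite -mulrBl -/d lerDl; apply: sumr_ge0 => i _.
by rewrite subr_ge0 ler_pM2r // invr_gt0 pow2_gt0.
Qed.

Lemma pow2_small (eps : R) : 0 < eps -> exists N, (2 ^+ N)^-1 <= eps.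
Proof.
move=> e0; have e1 : 0 <= eps^-1 by rewrite invr_ge0 ltW.
exists (Num.bound eps^-1); rewrite invf_ple ?posrE ?pow2_gt0 //.
apply: ltW; apply: lt_le_trans (archi_boundP e1) _.
by rewrite -natrX ler_nat ltnW // ltn_expl.
Qed.

End DyadicSum.

Lemma homeomorphic_circle (R : realType) (T : topologicalType) (A : set T) (F : T -> R * R) :
  compact A -> {within A, continuous F} -> (forall p, A p -> unit_circle (F p)) ->
  (forall p q, A p -> A q -> F p = F q -> p = q) ->
  (forall a, unit_circle a -> exists2 p, A p & F p = a) -> homeomorphic A (@unit_circle R).
Proof.
move=> cA cF Fc Finj Fsurj.
have [p0 _ _] : exists2 p, A p & F p = (1, 0).
  by apply: Fsurj; rewrite /unit_circle /= expr1n expr0n addr0.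
pose g a := xget p0 [set p | A p /\ F p = a].
have gP a : unit_circle a -> A (g a) /\ F (g a) = a.
  by move=> /Fsurj[p Ap Ep]; apply: (@xgetPex _ p0 [set p | A p /\ F p = a]); exists p.
have gF : {in A, cancel F g}.
  by move=> p; rewrite inE => Ap; have [Ag Eg] := gP _ (Fc p Ap); exact: Finj.
exists F, g; split=> //.
- by move=> a ca; have [] := gP a ca.
- by move=> a; rewrite inE => ca; have [] := gP a ca.
split=> //; have -> : @unit_circle R = F @` A.
  by apply/seteqP; split=> [a /Fsurj[p Ap <-]|_ [p Ap <-]]; [exists p|exact: Fc].
by apply: compact_inverse_continuous => //; exact: norm_hausdorff.
Qed.

Section Circuit.
Variables (R : realType) (G : graph) (Psi : set (graph_end G)).
Let V := vertex G.
Let E := edge G.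
Let pt := graph_point R G.
Let X := @space_with_ends R G Psi.
Hypothesis Psi_borel : borel_end_set R Psi.
Hypothesis Psi_undominated : forall w, Psi w -> undominated w.
Variable C : set E.
Hypothesis circ : minimal_dependent (edge_indep Psi) C.
Implicit Types (f g : V -> bool) (p q : pt) (e : E) (x y : V) (w : graph_end G).

Lemma circuit_proper_indep C' : C' `<=` C -> C' <> C -> edge_indep Psi C'.
Proof. by move=> s n; apply: contrapT => ni; apply: n; exact: circ.2. Qed.

Lemma circuit_indepD e : C e -> edge_indep Psi (C `\ e).
Proof.
move=> Ce; apply: circuit_proper_indep; first by move=> e' [].
move=> h; suff [_ n] : (C `\ e) e by apply: n.
by rewrite h.
Qed.

(** Let [e1] be spanned by the rest of [C]. Without [e] the circuit is independent, so some [g]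
    separates [e1] and no other edge except possibly [e]; if it separates [e], adding [f] modulo 2
    removes this. Then [e1] is separated alone, a contradiction. *)
Lemma circuit_even f e : good Psi f -> C e -> sep f e ->
  exists e', [/\ C e', e' <> e & sep f e'].
Proof.
move=> gf Ce se; apply: contrapT => nex.
have ns e' : C e' -> e' <> e -> ~ sep f e' by move=> ? ? ?; apply: nex; exists e'.
have /existsNP[e1 /not_implyP[C1 /contrapT sp]] := circ.1.
have [Ee|ne] := pselect (e = e1).
  by rewrite Ee in se ns; apply: se; apply: sp; split=> // e' [Ce' ne']; exact: ns.
have [|g gg sg] := @indep_Gd _ _ (C `\ e) e1 (circuit_indepD Ce).
  by split=> // E1; apply: ne.
have [sge|nge] := pselect (sep g e).
  have : ~ sep (fun v => g v (+) f v) e1.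
    apply/notsep; apply: (sp (fun v => g v (+) f v)); split.
      exact: (good_op addb gg.1 gf).
    move=> e' [Ce' ne'] /sep_addP[[s1 s2]|[s1 s2]]; have [Ee|ne2] := pselect (e' = e).
    - by rewrite Ee in s2.
    - by apply: (gg.2 e').
    - by rewrite Ee in s1.
    - exact: (ns e').
  apply; apply/sep_addP; left; split=> //; apply: ns => // E1; exact: ne.
apply: sg; apply: sp; split; first exact: gg.1.
move=> e' [Ce' ne'] s'; have [Ee|ne2] := pselect (e' = e); first by rewrite Ee in s'.
by apply: (gg.2 e').
Qed.

Definition pairs f e0 e1 : Prop := [/\ good Psi f, sep f e0, sep f e1 &
  forall e, C e -> e <> e0 -> e <> e1 -> ~ sep f e].

Lemma circuit_pair e0 e1 : C e0 -> C e1 -> e1 <> e0 -> exists2 f, pairs f e0 e1 & ~~ f (src e0).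
Proof.
move=> C0 C1 ne; have [|f gf sf] := @indep_Gd _ _ (C `\ e0) e1 (circuit_indepD C0); first by split.
have ns e : C e -> e <> e0 -> e <> e1 -> ~ sep f e by move=> Ce n0 n1; apply: gf.2.
have [e' [Ce' ne' s']] := circuit_even gf.1 C1 sf.
have [E0|n0] := pselect (e' = e0); last by exfalso; exact: (ns e').
rewrite E0 in s'; case fs : (f (src e0)); last by exists f; rewrite ?fs //; split=> //; exact: gf.1.
exists (fun v => ~~ f v); last by rewrite fs.
have sn e : sep (fun v => ~~ f v) e <-> sep f e.
  by rewrite /sep; split=> h h'; apply: h; [rewrite h'|apply: negb_inj].
split; [exact: (good_op (fun a b => ~~ b) gf.1 gf.1)|exact/sn|exact/sn|].
by move=> e Ce n0 n1 /sn; exact: ns.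
Qed.

Definition on_circuit x : Prop := exists2 e, C e & x = src e \/ x = tgt e.

(** If [f] took both values, the edges on its true side would form a proper, hence independent,
    subset. A function separating just one of them, cut down by [f], would separate exactly one edge
    of the circuit. *)
Lemma circuit_const f x y : good Psi f -> (forall e, C e -> ~ sep f e) ->
  on_circuit x -> on_circuit y -> f x = f y.
Proof.
move=> gf ns.
have key a b : C a -> C b -> f (src a) -> f (src b).
  move=> Ca Cb fa; apply: contrapT => nb'.
  have iC : edge_indep Psi [set e | C e /\ f (src e)].
    apply: circuit_proper_indep; first by move=> e [].
    move=> h; suff [_ fb] : [set e | C e /\ f (src e)] b by apply: nb'.
    by rewrite h.
  have [|g gg sg] := @indep_Gd _ _ [set e | C e /\ f (src e)] a iC; first by split.
  have Ef e : C e -> f (tgt e) = f (src e) by move=> /ns/notsep ->.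
  have [|e' [Ce' ne' s']] := @circuit_even (fun v => g v && f v) a (good_op andb gg.1 gf) Ca.
    by rewrite /sep Ef // fa !andbT.
  move: s'; rewrite /sep Ef //; case fe : (f (src e')); last by rewrite !andbF.
  by rewrite !andbT; apply: gg.2.
have src_eq a b : C a -> C b -> f (src a) = f (src b).
  by move=> Ca Cb; apply/idP/idP; exact: key.
have on z : on_circuit z -> exists2 e, C e & f z = f (src e).
  move=> [e Ce [->|->]]; exists e => //; exact/esym/notsep/ns.
by move=> /on[a Ca ->] /on[b Cb ->]; exact: src_eq.
Qed.

Lemma circuit_ex : exists e, C e.
Proof. by have /existsNP[e /not_implyP[Ce _]] := circ.1; exists e. Qed.

(** A compact witness for one edge being spanned, together with that edge, is dependent and so by
    minimality is the whole circuit. *)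
Lemma circuit_compact : compact_edges Psi C.
Proof.
have [e0 C0] := circuit_ex.
have sp : eqv Psi (C `\ e0) (src e0) (tgt e0).
  apply: contrapT => /neqv_Gd[f gf sf]; have [e [Ce ne se]] := circuit_even gf.1 C0 sf.
  by apply: (gf.2 e).
have [Q [QC cQ Qsp]] := eqv_witness Psi_borel Psi_undominated sp.
have <- : e0 |` Q = C.
  apply: circ.2; last by move=> e [->|/QC[]].
  move=> /(_ e0 (or_introl erefl)); apply; apply: eqv_sub Qsp => e Qe.
  by split; [right|have [] := QC e Qe].
by apply: compactU => //; apply: compact_finite; exact: finite_set1.
Qed.

Definition circuit_space : set pt := fun p =>
  match p with
  | Vtx v => on_circuit v
  | End w => Psi w /\ in_edge_closure w C
  | Inner e _ => C e
  end.
Let A := circuit_space.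

Lemma circuit_space_sub : A `<=` X.
Proof. by move=> [v _ [w _ []]//|w [Pw _]|e t _ [w _ []]//]; apply/space_end. Qed.

Lemma circuit_edge_set : edge_set A = C.
Proof.
have /andP[h1 h2] := half_bounds R.
apply/seteqP; split=> [e [t]//|e Ce]; exists (exist _ 2^-1 (half_bounds R)).
exact: Ce.
Qed.

Lemma circuit_edge e (s : R) : C e -> s \in `[0, 1] -> A (edge_map e s).
Proof.
move=> Ce /edge_cases[->|->|h]; rewrite ?edge_map0 ?edge_map1 ?(edge_map_in _ h) //.
  by exists e => //; left.
by exists e => //; right.
Qed.

Definition within_set (Y : set V) : set pt := fun p =>
  match p with
  | Vtx v => Y v
  | End w => lives_in w Y
  | Inner e _ => Y (src e) /\ Y (tgt e)
  end.

(** Derived from [circuit_compact] with the cover by those components that are locally controlled by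
    the property at hand or touch no edge of [C]; the second kind is for ends not in the closure of
    [C]. The finitely many edges left over are compact arcs. *)
Lemma circuit_space_compact : compact A.
Proof.
apply: compact_intro => P P0 PU Ps loc.
have Pfin (I : choiceType) (D : set I) (F : I -> set pt) : finite_set D ->
    (forall i, D i -> P (F i)) -> P (\bigcup_(i in D) F i).
  move=> /finite_seqP[l ->]; elim: l => [|i l IH] h.
    by apply: Ps P0 => p [i].
  apply: Ps (PU _ _ (h i _) (IH _)); first 1 last.
  - by rewrite /= inE eqxx.
  - by move=> j jl; apply: h; rewrite /= inE; apply/orP; right.
  by move=> p [j]; rewrite /= inE => /predU1P[->|jl] Fp; [left|right; exists j].
have Pedge e : C e -> P (edge_map e @` `[0 : R, 1]).
  move=> Ce; have cE : compact (edge_map e @` `[0 : R, 1] : set pt).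
    apply: continuous_compact; [exact: edge_map_continuous|exact: segment_compact].
  apply: (compact_ind cE) => // _ [s sI <-].
  have [W nW PW] := loc _ (circuit_edge Ce sI); exists W => //; apply: Ps PW => p [].
  by [].
pose inside (Y : set V) e := Y (src e) /\ Y (tgt e).
have [w Pw|W [WU fW fF]] := @circuit_compact [set Y | (exists S w, finite_set S /\ Y = end_component S w) /\
    (P (within_set Y) \/ forall e, C e -> ~ touch Y e)].
  have [cl|/existsNP[S /not_implyP[fS nS]]] := pselect (in_edge_closure w C); last first.
    exists (end_component S w); last by exists S.
    split; first by exists S, w.
    by right=> e Ce te; apply: nS; exists e.
  have [W nW PW] : exists2 W, nbhs (End R w) W & P W by apply: loc.
  move: nW; rewrite nbhsE => -[W' [oW' W'w] W'W].
  have [D bD ED] : exists2 D, D `<=` @basic_open R G & \bigcup_(i in D) i = W' := oW'.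
  have [B DB Bw] : (\bigcup_(i in D) i) (End R w) by rewrite ED.
  have BW : B `<=` W by move=> p Bp; apply: W'W; rewrite -ED; exists B.
  have [[/(_ w)//]|[S [w' [eps [fS _ EB]]]]] := bD B DB.
  have wC : lives_in w (end_component S w') by move: Bw; rewrite EB.
  exists (end_component S w'); last first.
    exists S => //; apply: end_comp_sub => //; apply: component_nb; exact: end_comp_component.
  split; first by exists S, w'.
  left; apply: Ps PW => p h; apply: BW; rewrite EB.
  by case: p h => //= e t h; constructor 1.
have /choice[S SP] : forall Y, exists S, W Y -> finite_set S /\ exists w, Y = end_component S w.
  move=> Y; have [WY|nW] := pselect (W Y); last by exists set0.
  by have [[S [w [fS EY]]] _] := WU Y WY; exists S => _; split=> //; exists w.
set F := [set e | C e /\ ~ _] in fF.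
have inW e : C e -> F e \/ exists2 Y, W Y & inside Y e.
  move=> Ce; have [|ne] := pselect (exists2 Y, W Y & inside Y e); first by right.
  by left; split.
have Pin Y e : W Y -> C e -> touch Y e -> P (within_set Y).
  by move=> WY Ce te; have [_ [//|/(_ e Ce)]] := WU Y WY.
pose W1 := [set Y | W Y /\ P (within_set Y)].
apply: (@Ps _ ((\bigcup_(Y in W1) within_set Y) `|` (\bigcup_(e in F) (edge_map e @` `[0 : R, 1])))).
  move=> p Ap; case: p Ap => [v [e Ce ve]|w [Pw cl]|e t Ce].
  - have [Fe|[Y WY [Ys Yt]]] := inW e Ce.
      right; exists e => //; case: ve => ->; [exists 0; rewrite ?edge_map0 //|exists 1; rewrite ?edge_map1 //];
        by rewrite /= in_itv /= ?lexx ler01.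
    left; exists Y; last by case: ve => ->.
    by split=> //; apply: (Pin Y e) => //; left.
  (* This finite set contains the separators of all chosen components and the endvertices of all
     uncovered edges. So an edge of [C] touching the component at [w] lies in a chosen [Y], and [w]
     lives in [Y]. *)
  - have fT : finite_set ((\bigcup_(Y in W) S Y) `|` ([set src e | e in F] `|` [set tgt e | e in F])).
      rewrite !finite_setU; split; last by split; exact: finite_image.
      by apply: bigcup_finite => // Y WY; have [] := SP Y WY.
    have [e Ce te] := cl _ fT; have nT := component_notin (end_comp_component w fT).
    have [Fe|[Y WY iY]] := inW e Ce.
      by exfalso; case: te => /nT; apply; right; [left|right]; exists e.
    have [fS [w' EY]] := SP Y WY.
    left; exists Y; first by split=> //; apply: (Pin Y e) => //; left; case: iY.
    have mono := end_comp_mono fT (S := S Y).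
    have sub : S Y `<=` (\bigcup_(Y in W) S Y) `|` ([set src e | e in F] `|` [set tgt e | e in F]).
      by move=> z Sz; left; exists Y.
    have [u Yu Cu] : exists2 u, Y u & end_component (S Y) w u.
      by case: iY te => Ys Yt [h|h]; [exists (src e)|exists (tgt e)] => //; exact: (mono w sub).
    rewrite /= EY; rewrite EY in Yu.
    rewrite (component_eq (end_comp_component w' fS) (end_comp_component w fS) Yu Cu).
    exact: end_comp_lives.
  - have [Fe|[Y WY [Ys Yt]]] := inW e Ce.
      right; exists e => //; exists (val t); last by rewrite (edge_map_in _ (svalP t)); congr Inner; apply: val_inj.
      by rewrite /= in_itv /=; have /andP[h1 h2] := svalP t; rewrite !ltW.
    left; exists Y => //; split=> //; apply: (Pin Y e) => //; by left.
apply: PU; first by apply: Pfin => [|Y []//]; apply: sub_finite_set fW => Y [].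
by apply: Pfin => // e [Ce _]; exact: Pedge.
Qed.

Lemma bval_attained f p : good Psi f -> A p -> ~ inner p ->
  exists2 x, on_circuit x & bval f p = f x.
Proof.
move=> gf; case: p => [v Av _|w [Pw cl] _|e t _ []//]; first by exists v.
have [S fS SP] := @good_bval R G Psi f w gf Pw; have [e Ce [h|h]] := cl S fS.
  by exists (src e); [exists e => //; left|rewrite SP].
by exists (tgt e); [exists e => //; right|rewrite SP].
Qed.

(** At an end the inequality says that the good function [f v ==> g v] is true there, and a good
    function takes at an end of the circuit a value that it has at some vertex of the circuit. *)
Lemma ext_le f g p : good Psi f -> good Psi g ->
  (forall x, on_circuit x -> f x -> g x) -> A p -> lin_ext f p <= lin_ext g p :> R.
Proof.
move=> gf gg fg Ap; have le x : on_circuit x -> (f x)%:R <= (g x)%:R :> R.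
  by move=> cx; rewrite ler_nat; case: (f x) (fg x cx) => // ->.
have [ip|np] := pselect (inner p).
  case: p ip Ap => // e [t /= /andP[t0 t1]] _ Ce; apply: lerD; apply: ler_wpM2l.
  - by rewrite subr_ge0 ltW.
  - by apply: le; exists e => //; left.
  - exact: ltW.
  - by apply: le; exists e => //; right.
rewrite !ext_bval //.
have gfg : good Psi (fun v => f v ==> g v) by exact: (good_op implb gf gg).
have [x cx] := bval_attained gfg Ap np.
rewrite (@bval_op R G Psi implb) //; last exact: circuit_space_sub.
rewrite ler_nat; case: (bval f p) => //=; case: (bval g p) => //=.
by case fx : (f x) => //=; rewrite fg.
Qed.

Lemma ext01 f p : 0 <= (lin_ext f p : R) <= 1.
Proof.
have b01 (b : bool) : 0 <= (b%:R : R) <= 1 by rewrite ler0n lern1 leq_b1.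
case: p => [v|w|e [t /= /andP[t0 t1]]] /=; [exact: b01|exact: b01|].
by case: (f (src e)); case: (f (tgt e)) => /=; apply/andP; split; nra.
Qed.

Lemma circuit_sequence e0 : C e0 -> exists F : nat -> V -> bool,
  [/\ forall n, good Psi (F n), forall n, F n (src e0) = false,
      forall n, F n = (fun=> false) \/ exists2 e1, C e1 /\ e1 <> e0 & pairs (F n) e0 e1 &
      forall e1, C e1 -> e1 <> e0 -> exists n, pairs (F n) e0 e1].
Proof.
move=> C0; have [U [fU cU Ucl Ul]] := regions Psi_undominated.
have US k : U k.+1 `<=` U k by move=> z Uz; apply: Ucl; left.
have cC : countable C.
  have -> : C = \bigcup_n [set e | C e /\ ~ touch (U n) e].
    apply/seteqP; split=> [e Ce|e [n _ []]//].
    have [a na] := Ul (src e); have [b nb'] := Ul (tgt e).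
    exists (maxn a b) => //; split=> // -[h|h]; [apply: na|apply: nb'];
      by apply: (linked_chain_mono US) h; rewrite ?leq_maxl ?leq_maxr.
  apply: bigcup_countable => [|n _]; first exact: countableP.
  apply: finite_set_countable.
  by have [W _ []] := compact_regions circuit_compact (conj (fU n) (cU n)).
have [k kinj] : exists k : E -> nat, {in C &, injective k} by apply/countable_injP.
have /choice[F FP] : forall n, exists f, [/\ good Psi f, f (src e0) = false,
    f = (fun=> false) \/ (exists2 e1, C e1 /\ e1 <> e0 & pairs f e0 e1) &
    forall e1, C e1 -> e1 <> e0 -> k e1 = n -> pairs f e0 e1].
  move=> n; have [[e1 [C1 ne k1]]|nex] := pselect (exists e1, [/\ C e1, e1 <> e0 & k e1 = n]).
    have [f pf nf] := circuit_pair C0 C1 ne; exists f; split; [by case: pf|exact: negbTE| |].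
      by right; exists e1.
    move=> e2 C2 ne2 k2; have -> // : e2 = e1.
    by apply: kinj; rewrite ?inE // k1 k2.
  exists (fun=> false); split=> //; [exact: good_cst|by left|].
  by move=> e1 C1 ne k1; exfalso; apply: nex; exists e1.
exists F; split=> [n|n|n|e1 C1 ne]; try (by have [] := FP n).
by exists (k e1); have [_ _ _ h] := FP (k e1); exact: h.
Qed.

(** * Circuits with at least two edges *)

Section Theta.
Variables (e0 e1 : E) (C0 : C e0) (C1 : C e1) (ne10 : e1 <> e0).
Variable F : nat -> V -> bool.
Hypothesis Fgood : forall n, good Psi (F n).
Hypothesis F0 : forall n, F n (src e0) = false.
Hypothesis Fkind : forall n,
  F n = (fun=> false) \/ exists2 e, C e /\ e <> e0 & pairs (F n) e0 e.
Hypothesis Fex : forall e, C e -> e <> e0 -> exists n, pairs (F n) e0 e.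

Lemma pairs_tgt n e : pairs (F n) e0 e -> F n (tgt e0).
Proof. by case=> _; rewrite /sep F0; case: (F n (tgt e0)). Qed.

Lemma src_on : on_circuit (src e0). Proof. by exists e0 => //; left. Qed.

Lemma F_zero f x : good Psi f -> (forall e, C e -> ~ sep f e) -> f (src e0) = false ->
  on_circuit x -> f x = false.
Proof. by move=> gf ns f0 cx; rewrite (circuit_const gf ns cx src_on). Qed.

Lemma F_same i j e : pairs (F i) e0 e -> pairs (F j) e0 e ->
  forall x, on_circuit x -> F i x = F j x.
Proof.
move=> [gi i0 i1 io] [gj j0 j1 jo] x cx.
suff : F i x (+) F j x = false by case: (F i x); case: (F j x).
apply: (@F_zero (fun v => F i v (+) F j v)) cx => [|e' Ce'|]; last by rewrite !F0.
  exact: (good_op addb).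
move=> /sep_addP[[s1 s2]|[s1 s2]].
  have [E0|n0] := pselect (e' = e0); first by rewrite E0 in s2.
  have [E1|n1] := pselect (e' = e); first by rewrite E1 in s2.
  exact: (io e').
have [E0|n0] := pselect (e' = e0); first by rewrite E0 in s1.
have [E1|n1] := pselect (e' = e); first by rewrite E1 in s1.
exact: (jo e').
Qed.

(* The symmetric difference of [g] and [F k] separates no edge of the circuit:
   it could separate [b] only, but parity forbids that. *)
Lemma F_absorb g k a b : good Psi g -> g (src e0) = false -> sep g e0 -> sep g a ->
  pairs (F k) e0 a -> (forall e, C e -> e <> e0 -> e <> a -> e <> b -> ~ sep g e) ->
  forall x, on_circuit x -> g x = F k x.
Proof.
move=> gg g0 s0 sa [gk k0 ka ko] go x cx.
have gh : good Psi (fun v => g v (+) F k v) by exact: (good_op addb).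
have nsb e : C e -> e <> b -> ~ sep (fun v => g v (+) F k v) e.
  move=> Ce nb' /sep_addP[[s1 s2]|[s1 s2]].
    have [E0|n0] := pselect (e = e0); first by rewrite E0 in s2.
    have [E1|n1] := pselect (e = a); first by rewrite E1 in s2.
    exact: (go e).
  have [E0|n0] := pselect (e = e0); first by rewrite E0 in s1.
  have [E1|n1] := pselect (e = a); first by rewrite E1 in s1.
  exact: (ko e).
suff : g x (+) F k x = false by case: (g x); case: (F k x).
apply: (@F_zero (fun v => g v (+) F k v)) cx => // [e Ce se|]; last by rewrite g0 F0.
have [e' [Ce' ne' s']] := circuit_even gh Ce se.
have [Eb|nb'] := pselect (e = b); last exact: (nsb e).
by apply: (nsb e') => //; rewrite -Eb.
Qed.

(** The conjunction of the two functions separates [e0], hence by parity also [a] or [b]; by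
    [F_absorb] it then agrees on the circuit with the corresponding function, which is thus the
    smaller one. *)
Lemma F_chain i j : (forall x, on_circuit x -> F i x -> F j x) \/
  (forall x, on_circuit x -> F j x -> F i x).
Proof.
have [Ei|[a [Ca na] pa]] := Fkind i; first by left=> x _; rewrite Ei.
have [Ej|[b [Cb nb'] pb]] := Fkind j; first by right=> x _; rewrite Ej.
have [Eab|nab] := pselect (a = b).
  by rewrite Eab in pa; left=> x cx; rewrite (F_same pa pb cx).
pose g v := F i v && F j v.
have gg : good Psi g by exact: (good_op andb).
have g0 : g (src e0) = false by rewrite /g F0.
have s0 : sep g e0 by rewrite /sep g0 /g (pairs_tgt pa) (pairs_tgt pb).
have go e : C e -> e <> e0 -> e <> a -> e <> b -> ~ sep g e.
  move=> Ce n0 n1 n2; have [_ _ _ /(_ e Ce n0 n1)/notsep ei] := pa.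
  have [_ _ _ /(_ e Ce n0 n2)/notsep ej] := pb.
  by apply/notsep; rewrite /g ei ej.
have [e' [Ce' ne' s']] := circuit_even gg C0 s0.
have [Ea|n1] := pselect (e' = a).
  rewrite Ea in s'; left=> x cx; rewrite -(F_absorb gg g0 s0 s' pa go cx).
  by case/andP.
have [Eb|n2] := pselect (e' = b); last by exfalso; exact: (go e').
rewrite Eb in s'; right=> x cx; rewrite -(@F_absorb g j b a gg g0 s0 s' pb _ x cx).
  by case/andP.
by move=> e Ce ? ? ?; exact: go.
Qed.

Let xx i p : R := lin_ext (F i) p.
Let not0 p := forall t, p <> Inner e0 t.

Lemma xx_le i j : (forall p, A p -> xx i p <= xx j p) \/ (forall p, A p -> xx j p <= xx i p).
Proof. by have [h|h] := F_chain i j; [left|right] => p Ap; exact: ext_le. Qed.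

Lemma xx01 i p : 0 <= xx i p <= 1. Proof. exact: ext01. Qed.

Lemma boolR_frac (b : bool) : ~ (0 < (b%:R : R) < 1).
Proof. by case: b; rewrite ?ltxx ?andbF. Qed.

Lemma xx_frac i p : A p -> not0 p -> 0 < xx i p < 1 ->
  exists2 e, pairs (F i) e0 e & exists t, p = Inner e t.
Proof.
move=> Ap np; rewrite /xx; have [ip|ni] := pselect (inner p); last first.
  by rewrite ext_bval // => /boolR_frac.
case: p ip Ap np => // e t _ Ce np h.
have [se|/notsep ns] := pselect (sep (F i) e); last first.
  by move: h; rewrite /= ns -mulrDl subrK mul1r => /boolR_frac.
have [Ei|[a [Ca na] pa]] := Fkind i; first by move: se; rewrite Ei /sep.
exists e; last by exists t.
have [Ea|ne] := pselect (e = a); first by rewrite Ea.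
by have [_ _ _ /(_ e Ce)] := pa; case=> // Ee; apply: (np t); rewrite Ee.
Qed.

Lemma xx_inner i e t t' : sep (F i) e -> 0 < xx i (Inner e t) < 1 /\
  (xx i (Inner e t) = xx i (Inner e t') -> t = t').
Proof.
rewrite /xx /lin_ext /sep /= => s; have /andP[a b] : 0 < sval t < 1 := svalP t.
suff [h1 h2] : 0 < (1 - sval t) * (F i (src e))%:R + sval t * (F i (tgt e))%:R < 1 /\
    ((1 - sval t) * (F i (src e))%:R + sval t * (F i (tgt e))%:R =
     (1 - sval t') * (F i (src e))%:R + sval t' * (F i (tgt e))%:R -> sval t = sval t').
  by split=> // /h2 h; apply: val_inj.
move: (sval t) (sval t') a b s => r r' a b.
by case: (F i (src e)); case: (F i (tgt e)) => //= _; (split; [apply/andP; split; lra|move=> ?; lra]).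
Qed.

(** A good function separates finitely many edges of the compact circuit. Adding suitable [F n]
    modulo 2 removes them one by one, except [e0], and by parity a function that can separate [e0]
    only is constant on the circuit. *)
Lemma bval_sep p q : A p -> A q -> ~ inner p -> ~ inner q ->
  (forall i, bval (F i) p = bval (F i) q) -> p = q.
Proof.
move=> Ap Aq np nq h; apply: contrapT => ne.
have [||//|//|//|g [gg gp gq]] := @sep_points R G Psi Psi_undominated p q.
- exact: circuit_space_sub.
- exact: circuit_space_sub.
suff E' : bval g p = bval g q by rewrite E' (negPf gq) in gp.
have /finite_seqP[l lE] := compact_sep circuit_compact gg.
have {gp gq} : forall e, C e -> sep g e -> e = e0 \/ e \in l.
  move=> e Ce se; right; have : [set e | C e /\ sep g e] e by [].
  by rewrite lE.
elim: l {lE} g gg => [|a l IH] g gg hl.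
  have [x cx ->] := bval_attained gg Ap np; have [y cy ->] := bval_attained gg Aq nq.
  apply: (circuit_const gg) => // e Ce se; have [Ee|//] := hl e Ce se.
  have [e' [Ce' ne' s']] := circuit_even gg Ce se.
  by apply: ne'; rewrite Ee; have [] := hl e' Ce' s'.
have [[Ca na sa]|nca] := pselect [/\ C a, a <> e0 & sep g a]; last first.
  apply: IH => // e Ce se; have [|] := hl e Ce se; first by left.
  rewrite inE => /predU1P[Eea|]; last by right.
  left; apply: contrapT => n0; apply: nca; rewrite -Eea.
  by split.
have [n pn] := Fex Ca na.
have gh : good Psi (fun v => g v (+) F n v) by exact: (good_op addb).
have [_ p0 p1 po] := pn.
suff : bval (fun v => g v (+) F n v) p = bval (fun v => g v (+) F n v) q.
  rewrite !(@bval_op R G Psi addb) //; try exact: circuit_space_sub.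
  by rewrite h => /addIb.
apply: IH => // e Ce /sep_addP[[s1 s2]|[s1 s2]].
  have [|] := hl e Ce s1; first by left.
  by rewrite inE => /predU1P[Eea|]; [rewrite Eea in s2|right].
left; apply: contrapT => n0; have [Ea|n1] := pselect (e = a); first by rewrite Ea in s1.
exact: (po e).
Qed.

(** The position along the circuit opened at [e0]: a weighted count of the edges already passed.
    Positive weights make it strictly monotone, and their summability makes it continuous. *)
Definition theta p : R := tsum (fun i => xx i p).

Lemma theta_inj p q : A p -> A q -> not0 p -> not0 q -> theta p = theta q -> p = q.
Proof.
move=> Ap Aq np nq Et.
have same i j r s : A r -> not0 r -> 0 < xx i r < 1 -> 0 < xx j r < 1 -> A s -> xx i s = xx j s.
  move=> Ar nr /(xx_frac Ar nr)[a pa [t Et1]] /(xx_frac Ar nr)[b pb [t' Et2]] As.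
  have Eab : a = b by move: Et2; rewrite Et1 => -[].
  rewrite Eab in pa; have h := F_same pa pb.
  by apply/eqP; rewrite eq_le /xx !ext_le // => x cx; rewrite h.
(* Were two coordinates to order [p] and [q] oppositely, comparability of the functions would
   squeeze both coordinates strictly between 0 and 1 at one of the points. Both functions would then
   belong to the same edge and coincide. *)
have cmp : (forall i, xx i p <= xx i q) \/ (forall i, xx i q <= xx i p).
  apply: contrapT => /not_orP[/existsNP[i ni] /existsNP[j nj]].
  move/negP: ni; rewrite -ltNge => ni; move/negP: nj; rewrite -ltNge => nj.
  have [le|le] := xx_le i j.
    have h1 := le p Ap; have h2 := le q Aq.
    have /andP[a1 a2] := xx01 i q; have /andP[a3 a4] := xx01 j q.
    have E1 : xx i q = xx j q.
      apply: (same i j p q) => //; apply/andP; split.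
      - exact: le_lt_trans a1 ni.
      - exact: le_lt_trans h1 (lt_le_trans nj a4).
      - exact: lt_le_trans (le_lt_trans a1 ni) h1.
      - exact: lt_le_trans nj a4.
    by have := lt_trans (lt_le_trans ni h1) nj; rewrite E1 ltxx.
  have h1 := le p Ap; have h2 := le q Aq.
  have /andP[a1 a2] := xx01 i p; have /andP[a3 a4] := xx01 j p.
  have E1 : xx i p = xx j p.
    apply: (same i j q p) => //; apply/andP; split.
    - exact: lt_le_trans (le_lt_trans a3 nj) h2.
    - exact: lt_le_trans ni a2.
    - exact: le_lt_trans a3 nj.
    - exact: le_lt_trans h2 (lt_le_trans ni a2).
  by have := lt_trans (lt_le_trans nj h2) ni; rewrite E1 ltxx.
suff h : forall i, xx i p = xx i q.
  have inn r s : A r -> A s -> not0 r -> not0 s -> (forall i, xx i r = xx i s) -> inner r -> r = s.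
    move=> Ar As nr ns hrs; case: r Ar nr hrs => // e t Ce nr hrs _.
    have ne0 : e <> e0 by move=> Ee; apply: (nr t); rewrite Ee.
    have [n pn] := Fex Ce ne0; have [_ _ se _] := pn.
    have [fr _] := xx_inner t t se; have fs := fr; rewrite hrs in fs.
    have [b pb [t' Es]] := xx_frac As ns fs.
    have Eeb : b = e.
      apply: contrapT => nbe; have [_ _ sb _] := pb; have [_ _ _ po] := pn; apply: (po b) => //.
        by move: As; rewrite Es.
      by move=> Eb; apply: (ns t'); rewrite Es Eb.
    have := hrs n; rewrite Es Eeb => /(xx_inner t t' se).2 ->.
    by [].
  have [ip|ni] := pselect (inner p); first exact: inn.
  have [iq|nqi] := pselect (inner q); first by apply/esym; apply: inn.
  apply: bval_sep => // i; have := h i; rewrite /xx !ext_bval //.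
  by case: (bval (F i) p); case: (bval (F i) q) => //= /eqP; rewrite ?oner_eq0 // eq_sym oner_eq0.
move=> i; apply: contrapT => /eqP ne; have [le|le] := cmp.
  have := @tsum_lt R (fun i => xx i p) (fun i => xx i q) i (xx01^~ p) (xx01^~ q) le.
  by rewrite lt_neqAle ne le => /(_ isT); rewrite -/(theta p) -/(theta q) Et ltxx.
have := @tsum_lt R (fun i => xx i q) (fun i => xx i p) i (xx01^~ q) (xx01^~ p) le.
by rewrite lt_neqAle eq_sym ne le => /(_ isT); rewrite -/(theta p) -/(theta q) Et ltxx.
Qed.

Lemma xx_e0 i (s : R) : s \in `[0, 1] -> xx i (edge_map e0 s) = s * (F i (tgt e0))%:R.
Proof.
move=> sI; rewrite /xx /lin_ext edgewise_map //.
- by rewrite F0 mulr0 add0r.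
- by rewrite subr0 mul1r mul0r addr0.
- by rewrite subrr mul0r mul1r add0r.
Qed.

Lemma theta_e0 (s s' : R) : 0 <= s -> s < s' -> s' <= 1 ->
  theta (edge_map e0 s) < theta (edge_map e0 s').
Proof.
move=> h1 h2 h3; have [n pn] := Fex C1 ne10.
have sI : s \in `[0, 1] by rewrite in_itv /= h1 (le_trans (ltW h2)).
have sI' : s' \in `[0, 1] by rewrite in_itv /= h3 andbT (le_trans h1 (ltW h2)).
apply: (@tsum_lt R _ _ n (xx01^~ _) (xx01^~ _)) => [i|]; rewrite !xx_e0 //.
  by apply: ler_wpM2r; [exact: ler0n|exact: ltW].
by rewrite (pairs_tgt pn) !mulr1.
Qed.

Lemma theta_bounds p : A p -> theta (Vtx R (src e0)) <= theta p <= theta (Vtx R (tgt e0)).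
Proof.
move=> Ap; apply/andP; split; apply: tsum_mono => i; try exact: xx01.
  by rewrite {1}/xx /= F0; have /andP[] := xx01 i p.
have [Ei|[a _ pa]] := Fkind i; last by rewrite {2}/xx /= (pairs_tgt pa); have /andP[] := xx01 i p.
rewrite /xx Ei; have [ip|ni] := pselect (inner p); last by rewrite ext_bval // bval_cst.
by case: p ip {Ap} => // e t _ /=; rewrite !mulr0 addr0.
Qed.

Lemma psum_continuous N : {within A, continuous (fun p => psum (fun i => xx i p) N)}.
Proof.
elim: N => [|N IH].
  have -> : (fun p => psum (fun i => xx i p) 0) = (fun=> 0).
    by apply/funext => p; rewrite /psum big_ord0.
  by apply: continuous_subspaceT; exact: cst_continuous.
have -> : (fun p => psum (fun i => xx i p) N.+1) =
    (fun p => psum (fun i => xx i p) N + xx N p / 2 ^+ N.+1).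
  by apply/funext => p; rewrite psumS.
apply/subspace_continuousP => p Ap; apply: cvgD.
  exact: ((subspace_continuousP _ _).1 IH p Ap).
apply: cvgM; last exact: cvg_cst.
exact: ((subspace_continuousP _ _).1 (ext_continuous Psi_undominated circuit_space_sub (Fgood N)) p Ap).
Qed.

Lemma theta_continuous : {within A, continuous theta}.
Proof.
apply: within_uniform_limit => eps e0'; have [N hN] := pow2_small e0'.
exists (fun p => psum (fun i => xx i p) N); first exact: psum_continuous.
by move=> p Ap; apply: le_trans hN; apply: tsum_approx => i; exact: xx01.
Qed.

Let D := theta (Vtx R (tgt e0)) - theta (Vtx R (src e0)).
Definition ntheta p : R := (theta p - theta (Vtx R (src e0))) / D.

Lemma D_gt0 : 0 < D.
Proof. by rewrite subr_gt0 -edge_map0 -edge_map1; apply: theta_e0. Qed.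

Lemma ntheta_continuous : {within A, continuous ntheta}.
Proof.
have h : {within A, continuous (fun p => (theta p - theta (Vtx R (src e0))) / D)}.
  apply: (within_compT (f := theta) (g := fun y : R => (y - theta (Vtx R (src e0))) / D)).
    exact: theta_continuous.
  by move=> y; apply: cvgM; [apply: cvgB; [exact: cvg_id|exact: cvg_cst]|exact: cvg_cst].
exact: h.
Qed.

Lemma ntheta_src : ntheta (Vtx R (src e0)) = 0. Proof. by rewrite /ntheta subrr mul0r. Qed.

Lemma ntheta_tgt : ntheta (Vtx R (tgt e0)) = 1.
Proof. by rewrite /ntheta -/D divff // gt_eqF // D_gt0. Qed.

Lemma ntheta01 p : A p -> 0 <= ntheta p <= 1.
Proof.
move=> Ap; have /andP[h1 h2] := theta_bounds Ap; have d0 := D_gt0.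
rewrite /ntheta; apply/andP; split; first by apply: divr_ge0; [rewrite subr_ge0|exact: ltW].
by rewrite ler_pdivrMr // mul1r /D lerD2r.
Qed.

Lemma ntheta_lt p q : (ntheta p < ntheta q) = (theta p < theta q).
Proof. by rewrite /ntheta ltr_pM2r ?invr_gt0 ?D_gt0 // ltrD2r. Qed.

Lemma ntheta_inj p q : A p -> A q -> not0 p -> not0 q -> ntheta p = ntheta q -> p = q.
Proof.
move=> Ap Aq np nq h; apply: theta_inj => //; apply/eqP; rewrite eq_le !leNgt.
by rewrite -!ntheta_lt h ltxx.
Qed.

(** If the value [r] were missed off [e0], the sign of [ntheta - r] would give a good bipartition
    that separates [e0] and no other edge of the circuit, against parity. *)
Lemma ntheta_surj (r : R) : 0 <= r <= 1 -> exists p, [/\ A p, not0 p & ntheta p = r].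
Proof.
move=> /andP[r0 r1]; apply: contrapT => nex.
have hr p : A p -> not0 p -> ntheta p - r <> 0.
  by move=> Ap np /eqP; rewrite subr_eq0 => /eqP h; apply: nex; exists p.
have tgt_on : on_circuit (tgt e0) by exists e0 => //; right.
have ch : {within A, continuous (fun p => ntheta p - r)}.
  apply: (within_compT (f := ntheta) (g := fun y : R => y - r) ntheta_continuous) => y.
  by apply: cvgB; [exact: cvg_id|exact: cvg_cst].
have [|f gf fP] := @separate R G Psi Psi_undominated A (fun p => ntheta p - r)
    circuit_space_compact circuit_space_sub ch.
  by move=> p Ap np; apply: hr => // t Ep; apply: np; rewrite Ep.
have fV x : on_circuit x -> f x = (0 < ntheta (Vtx R x) - r).
  by move=> cx; rewrite -fP //; case.
have se : sep f e0.
  rewrite /sep !fV //; last exact: src_on.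
  have n1 : ntheta (Vtx R (tgt e0)) - r <> 0 by apply: hr.
  have p0 : (0 < 0 - r) = false by rewrite sub0r oppr_gt0 ltNge r0.
  have p1 : 0 < 1 - r.
    rewrite lt_neqAle subr_ge0 r1 andbT eq_sym; apply/eqP.
    by move: n1; rewrite ntheta_tgt.
  by rewrite ntheta_src ntheta_tgt p0 p1.
have [e [Ce ne s']] := circuit_even gf C0 se; apply: s'.
rewrite !fV; [|by exists e => //; right|by exists e => //; left].
rewrite -edge_map0 -edge_map1.
apply: (@edge_sign R G A (fun p => ntheta p - r) e 0 1 ch) => // [s|s /andP[s0 s1]].
  exact: circuit_edge.
have sI : s \in `[0, 1] by rewrite in_itv /= s0.
apply: hr; first exact: circuit_edge.
move=> t Et; apply: ne; move: Et; have [->|->|hs] := edge_cases sI.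
- by rewrite edge_map0.
- by rewrite edge_map1.
- by rewrite (edge_map_in _ hs) => -[].
Qed.

(** The circuit off the interior of [e0] covers the parameters from 0 to 1, and [e0] is to cover
    those from -1 to 0. Since [circ_x] is even and [circ_y] odd, it is enough to reverse the second
    coordinate on [e0], and the correction is a bump because [circ_y] vanishes at 0 and 1. *)
Definition turn p : R * R := (circ_x (ntheta p),
  circ_y (ntheta p) - 2 * bump e0 (fun s => circ_y (ntheta (edge_map e0 s))) p).

Definition angle p : R := if `[< inner p /\ ~ not0 p >] then - ntheta p else ntheta p.

Lemma inner_edge_map (e : E) (t : {t : R | 0 < t < 1}) : Inner e t = edge_map e (val t) :> pt.
Proof. by rewrite (edge_map_in _ (svalP t)); congr Inner; apply: val_inj. Qed.

Lemma angle_in t : angle (Inner e0 t) = - ntheta (Inner e0 t).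
Proof. by rewrite /angle asboolT //; split=> // /(_ t). Qed.

Lemma angle_out p : not0 p -> angle p = ntheta p.
Proof. by move=> np; rewrite /angle asboolF // => -[_]. Qed.

Lemma turnE p : turn p = (circ_x (angle p), circ_y (angle p)).
Proof.
have [[t ->]|np] := pselect (exists t, p = Inner e0 t).
  rewrite /turn bump_at -inner_edge_map angle_in circ_xN circ_yN; congr pair.
  by rewrite mulr_natl mulr2n opprD addrA subrr sub0r.
have n0 : not0 p by move=> t Et; apply: np; exists t.
rewrite angle_out // /turn; congr pair; suff -> : bump e0 (fun s => circ_y (ntheta (edge_map e0 s))) p = 0.
  by rewrite mulr0 subr0.
by apply: contrapT => /bump_inner.
Qed.

Lemma turn_continuous : {within A, continuous turn}.
Proof.
apply/subspace_continuousP => p Ap.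
have h1 : {within A, continuous (fun p => circ_x (ntheta p))}.
  by apply: within_compT; [exact: ntheta_continuous|exact: circ_x_continuous].
have h2 : {within A, continuous (fun p => circ_y (ntheta p))}.
  by apply: within_compT; [exact: ntheta_continuous|exact: circ_y_continuous].
have h3 : {within A, continuous (bump e0 (fun s => circ_y (ntheta (edge_map e0 s))))}.
  apply: bump_continuous.
  - apply: (@within_comp _ _ _ _ A _ (fun p => circ_y (ntheta p))) => //.
      exact: edge_map_continuous.
    by move=> s sI; exact: circuit_edge.
  - by rewrite edge_map0 ntheta_src circ_y0.
  - by rewrite edge_map1 ntheta_tgt circ_y1 // mulr1.
have c1 := (subspace_continuousP _ _).1 h1 p Ap.
have c2 := (subspace_continuousP _ _).1 h2 p Ap.
have c3 := (subspace_continuousP _ _).1 h3 p Ap.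
have c4 : (circ_y (ntheta q) - 2 * bump e0 (fun s => circ_y (ntheta (edge_map e0 s))) q)
    @[q --> within A (nbhs p)] -->
    (circ_y (ntheta p) - 2 * bump e0 (fun s => circ_y (ntheta (edge_map e0 s))) p).
  by apply: cvgB; [exact: c2|apply: cvgM; [exact: cvg_cst|exact: c3]].
exact: (@cvg_pair _ _ _ _ (nbhs _) (nbhs _) _ _ _ _ _ c1 c4).
Qed.

Lemma ntheta_in t : 0 < ntheta (Inner e0 t) < 1.
Proof.
have /andP[t0 t1] : 0 < val t < 1 := svalP t; rewrite inner_edge_map.
have h1 := theta_e0 (lexx (0 : R)) t0 (ltW t1); rewrite -ntheta_lt edge_map0 ntheta_src in h1.
have h2 := theta_e0 (ltW t0) t1 (lexx (1 : R)); rewrite -ntheta_lt edge_map1 ntheta_tgt in h2.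
by rewrite h1 h2.
Qed.

Lemma angle_bounds p : A p -> -1 <= angle p <= 1 /\ (angle p * angle p = 1 -> angle p = 1).
Proof.
move=> Ap; have [[t Et]|np] := pselect (exists t, p = Inner e0 t).
  rewrite {p Ap}Et angle_in; have /andP[a b] := ntheta_in t; move: (ntheta _) a b => r a b.
  by split; [apply/andP; split; lra|move=> h; exfalso; nra].
have n0 : not0 p by move=> t Et; apply: np; exists t.
rewrite angle_out //; have /andP[a b] := ntheta01 Ap; move: (ntheta _) a b => r a b.
by split; [apply/andP; split; lra|move=> h; nra].
Qed.

Lemma theta_homeomorphic : homeomorphic A (@unit_circle R).
Proof.
apply: (@homeomorphic_circle R _ A turn) => //.
- exact: circuit_space_compact.
- exact: turn_continuous.
- by move=> p Ap; rewrite turnE; exact: circ_xy.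
- move=> p q Ap Aq; rewrite !turnE => -[ex ey].
  have [bp p1] := angle_bounds Ap; have [bq q1] := angle_bounds Aq.
  have Ea : angle p = angle q.
    by have [//|[/p1 -> /q1 ->]] := circ_inj bp bq ex ey.
  have [[t Ep]|np] := pselect (exists t, p = Inner e0 t);
    have [[t' Eq]|nq] := pselect (exists t, q = Inner e0 t).
  + rewrite Ep Eq !angle_in in Ea *; have {}Ea := oppr_inj Ea.
    congr Inner; apply: val_inj; move: Ea; rewrite !inner_edge_map => Ea.
    have /andP[t0 t1] : 0 < val t < 1 := svalP t; have /andP[t0' t1'] : 0 < val t' < 1 := svalP t'.
    have [lt|lt|//] := ltgtP (val t) (val t').
      by have := theta_e0 (ltW t0) lt (ltW t1'); rewrite -ntheta_lt Ea ltxx.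
    by have := theta_e0 (ltW t0') lt (ltW t1); rewrite -ntheta_lt Ea ltxx.
  + exfalso; have nq0 : not0 q by move=> s Es; apply: nq; exists s.
    rewrite Ep angle_in angle_out // in Ea.
    have /andP[a _] := ntheta_in t; have /andP[b _] := ntheta01 Aq.
    by move: b; rewrite -Ea oppr_ge0 leNgt a.
  + exfalso; have np0 : not0 p by move=> s Es; apply: np; exists s.
    rewrite Eq angle_in angle_out // in Ea.
    have /andP[a _] := ntheta_in t'; have /andP[b _] := ntheta01 Ap.
    by move: b; rewrite Ea oppr_ge0 leNgt a.
  + have np0 : not0 p by move=> s Es; apply: np; exists s.
    have nq0 : not0 q by move=> s Es; apply: nq; exists s.
    by apply: ntheta_inj => //; rewrite !angle_out in Ea.
- move=> [a b] cab; have [r [/andP[r0 r1] ex ey]] := circ_surj (cab : a ^+ 2 + b ^+ 2 = 1).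
  have [rpos|rneg] := leP 0 r.
    have [|p [Ap np Ep]] := @ntheta_surj r; first by rewrite rpos.
    by exists p => //; rewrite turnE angle_out // Ep ex ey.
  have [rm|rm] := eqVneq r (-1).
    exists (Vtx R (tgt e0)); first by exists e0 => //; right.
    rewrite turnE angle_out // ntheta_tgt -ex -ey rm.
    by rewrite !circ_x1 ?circ_y1 ?mulrNN ?mulr1.
  have c : {within `[0 : R, 1], continuous (fun s => ntheta (edge_map e0 s))}.
    apply: (@within_comp _ _ _ _ A _ ntheta); [exact: edge_map_continuous| |exact: ntheta_continuous].
    by move=> s sI; exact: circuit_edge.
  have [|s sI hs] := IVT (v := - r) ler01 c.
    have a1 : 0 <= - r by rewrite oppr_ge0 ltW.
    have a2 : - r <= 1 by rewrite lerNl.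
    by rewrite edge_map0 edge_map1 ntheta_src ntheta_tgt ge_min le_max a1 a2 orbT.
  exists (edge_map e0 s); first exact: circuit_edge.
  have [Es|Es|h] := edge_cases sI.
  + by move: hs; rewrite Es edge_map0 ntheta_src => /eqP; rewrite eq_sym oppr_eq0 lt_eqF.
  + by move: hs; rewrite Es edge_map1 ntheta_tgt => /eqP; rewrite eq_sym eqr_oppLR (negPf rm).
  + by move: hs; rewrite (edge_map_in _ h) turnE angle_in => ->; rewrite opprK ex ey.
Qed.

End Theta.

(** A circuit with one edge is a loop, as parity forbids separating the two endvertices of [e0], and
    it has no end in its closure. *)
Lemma loop_homeomorphic e0 : C e0 -> (forall e, C e -> e = e0) -> homeomorphic A (@unit_circle R).
Proof.
move=> C0 C1.
have Ee : src e0 = tgt e0.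
  apply: contrapT => ne.
  have [||||ne'|f [gf f1 f2]] := @sep_points R G Psi Psi_undominated (Vtx R (src e0)) (Vtx R (tgt e0)).
  - by move=> [w _ []].
  - by move=> [w _ []].
  - by case.
  - by case.
  - by apply: ne; case: ne'.
  have se : sep f e0 by move: f1 f2; rewrite /sep /= => -> /negPf ->.
  by have [e [Ce n _]] := circuit_even gf C0 se; apply: n; exact: C1.
have Av p : A p -> ~ inner p -> p = Vtx R (src e0).
  case: p => [v [e Ce ve] _|w [Pw cl] _|e t _ []//].
    by rewrite (C1 e Ce) in ve; case: ve => ->; rewrite // -Ee.
  exfalso; have fS : finite_set [set src e0; tgt e0] by rewrite finite_setU; split; exact: finite_set1.
  have nC := component_notin (end_comp_component w fS).
  have [e Ce h] := cl _ fS; rewrite (C1 e Ce) in h.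
  by case: h => /nC; apply; by [left|right].
pose q (s : R) := 2 * s - 1.
have qc : continuous q.
  by move=> s; apply: cvgB; [apply: cvgM; [exact: cvg_cst|exact: cvg_id]|exact: cvg_cst].
have q0 : q 0 * q 0 = 1 by rewrite /q mulr0 sub0r mulrNN mulr1.
have q1 : q 1 * q 1 = 1 by rewrite /q; ring.
have cx : continuous (fun s => circ_x (q s) + 1).
  move=> s; apply: cvgD; last exact: cvg_cst.
  exact: (continuous_comp (qc s) (@circ_x_continuous R _)).
have cy : continuous (fun s => circ_y (q s)).
  by move=> s; exact: (continuous_comp (qc s) (@circ_y_continuous R _)).
(* Both endpoints of the loop go to the point with coordinates -1 and 0. The first coordinate is
   shifted by 1 so that it vanishes there and [bump] applies. *)
pose Fl p : R * R := (bump e0 (fun s => circ_x (q s) + 1) p - 1, bump e0 (fun s => circ_y (q s)) p).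
have FI t : Fl (Inner e0 t) = (circ_x (q (val t)), circ_y (q (val t))).
  by rewrite /Fl !bump_at addrK.
have FV : Fl (Vtx R (src e0)) = (-1, 0) by rewrite /Fl /= sub0r.
have qt (t : {t : R | 0 < t < 1}) : -1 <= q (val t) <= 1 /\ q (val t) * q (val t) != 1.
  rewrite /q; have /andP[a b] : 0 < val t < 1 := svalP t; move: (val t) a b => r a b.
  by split; [apply/andP; split; lra|apply/eqP; nra].
apply: (@homeomorphic_circle R _ A Fl).
- exact: circuit_space_compact.
- apply/subspace_continuousP => p Ap.
  have h1 : {within A, continuous (bump e0 (fun s => circ_x (q s) + 1))}.
    apply: bump_continuous; first exact: continuous_subspaceT.
      by rewrite circ_x1 // addNr.
    by rewrite circ_x1 // addNr.
  have h2 : {within A, continuous (bump e0 (fun s => circ_y (q s)))}.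
    by apply: bump_continuous; [exact: continuous_subspaceT|rewrite circ_y1|rewrite circ_y1].
  have c1 := (subspace_continuousP _ _).1 h1 p Ap.
  have c2 := (subspace_continuousP _ _).1 h2 p Ap.
  have c3 : (bump e0 (fun s => circ_x (q s) + 1) z - 1) @[z --> within A (nbhs p)] -->
      (bump e0 (fun s => circ_x (q s) + 1) p - 1).
    by apply: cvgB; [exact: c1|exact: cvg_cst].
  exact: (@cvg_pair _ _ _ _ (nbhs _) (nbhs _) _ _ _ _ _ c3 c2).
- move=> p Ap; have [ip|np] := pselect (inner p).
    by case: p ip Ap => // e t _ Ce; rewrite (C1 e Ce) FI; exact: circ_xy.
  by rewrite (Av p Ap np) FV /unit_circle /= sqrrN expr1n expr0n addr0.
- have sep_iv t : Fl (Inner e0 t) <> Fl (Vtx R (src e0)).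
    rewrite FI FV => -[ex _]; have [_ /circ_x_neq] := qt t.
    by rewrite ex subrr eqxx.
  move=> p r Ap Ar; have [ip|np] := pselect (inner p); have [ir|nr] := pselect (inner r).
  + case: p ip Ap => // e t _ Ce; case: r ir Ar => // e' t' _ Ce'.
    rewrite (C1 e Ce) (C1 e' Ce') !FI => -[ex ey].
    have [b1 n1] := qt t; have [b2 _] := qt t'.
    have [h|[h _]] := circ_inj b1 b2 ex ey; last by rewrite h eqxx in n1.
    congr Inner; apply: val_inj; move: h; rewrite /q; move: (val t) (val t') => x y h; lra.
  + by case: p ip Ap => // e t _ Ce; rewrite (C1 e Ce) (Av r Ar nr) => /sep_iv.
  + by case: r ir Ar => // e t _ Ce; rewrite (C1 e Ce) (Av p Ap np) => /esym/sep_iv.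
  + by rewrite (Av p Ap np) (Av r Ar nr).
- move=> [a b] cab; have [r [/andP[r0 r1] ex ey]] := circ_surj (cab : a ^+ 2 + b ^+ 2 = 1).
  have [h1|h1] := eqVneq (r * r) 1.
    exists (Vtx R (src e0)); first by exists e0 => //; left.
    by rewrite FV -ex -ey circ_x1 // circ_y1.
  have h : 0 < (r + 1) / 2 < 1.
    have n1 : r <> 1 by move=> E1; rewrite E1 mulr1 eqxx in h1.
    have n2 : r <> -1 by move=> E1; rewrite E1 mulrNN mulr1 eqxx in h1.
    have l1 : r < 1 by rewrite lt_neqAle r1 andbT; apply/eqP.
    have l2 : -1 < r by rewrite lt_neqAle r0 andbT eq_sym; apply/eqP.
    by apply/andP; split; lra.
  exists (Inner e0 (exist (fun t : R => 0 < t < 1) _ h)); first exact: C0.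
  rewrite FI /q /=; have -> : 2 * ((r + 1) / 2) - 1 = r by field.
  by rewrite ex ey.
Qed.

Lemma circuit_cycle : topological_cycle X A.
Proof.
split; first exact: circuit_space_sub.
have [e0 C0] := circuit_ex.
have [[e1 [C1 ne]]|nex] := pselect (exists e1, C e1 /\ e1 <> e0).
  have [F [Fg F0 Fk Fe]] := circuit_sequence C0.
  exact: (theta_homeomorphic C0 C1 ne Fg F0 Fk Fe).
by apply: (loop_homeomorphic C0) => e Ce; apply: contrapT => n; apply: nex; exists e.
Qed.

End Circuit.

Theorem theorem1p3 (R : realType) (G : graph) (Psi : set (graph_end G))
    (Psi_borel : borel_end_set R Psi)
    (Psi_undominated : forall w : graph_end G, Psi w -> undominated w) :
  exists M : matroid (edge G),
    circuits M = cycle_edge_sets R Psi /\ cocircuits M = bonds_avoiding Psi.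
Proof.
exists (end_matroid Psi_borel Psi_undominated); split; last exact: end_matroid_cocircuits.
apply/seteqP; split=> [C cC|_ [A [AX [phi [psi [fA gA fK gK [cf cg]]]]] <-]].
  exists (@circuit_space R G Psi C); last exact: circuit_edge_set.
  exact: (circuit_cycle Psi_borel Psi_undominated cC).
apply: (@cycle_circuit R G Psi Psi_undominated A AX phi psi) => //.
- by move=> p Ap; apply: fK; rewrite inE.
- by move=> a ca; apply: gK; rewrite inE.
Qed.
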